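(* Let $\delta>0$ be fixed and sufficiently small, let $\chi$ be the characteristic function of $\{|\operatorname{Re} z|<1\}$, and let $$h_0(z)=\frac{1}{\sqrt{2\pi|\phi_\lambda''(1)|}}\,\frac{2}{1-z^2}.$$ Then, as $n\to\infty$ with $\lambda=\lambda(n)$, the Taylor polynomials of $f$ satisfy $$T_{2n-2}(\lambda z)=T_{2n-1}(\lambda z)=\begin{cases} f(\lambda z)\left[\chi(z)-\dfrac{e^{n\phi_\lambda(z)}}{\sqrt n}\,h_0(z)\bigl(1+\mathcal E(z)\bigr)\right], & z\in\mathbb C\setminus B_\delta,\\[3mm] f(\lambda z)\left[\dfrac12\operatorname{erfc}\bigl(i\sqrt n\,w(z)\bigr)-\dfrac{e^{n\phi_\lambda(z)}}{\sqrt n}\,\mathcal E(z)\right], & z\in B_\delta,\end{cases}$$ where the residual error function $\mathcal E$ (depending on $n$) is bounded, analytic in $\mathbb C\setminus\bigl((\partial\mathcal S_1\setminus B_\delta)\cup\partial B_\delta\bigr)$, and satisfies, uniformly in $z$ in each set, $$\mathcal E(z)=\begin{cases}\mathcal O(n^{-1}), & z\in \mathbb C\setminus B_\delta,\\ h_0(z)+\dfrac{1}{2i\sqrt\pi\,w(z)}+\mathcal O(n^{-1}), & z\in B_\delta.\end{cases}$$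
   Context: $\xi(z)=\tfrac12\pi^{-z/2}\Gamma(z/2)z(z-1)\zeta(z)$ is Riemann's xi function (entire, with $\xi(z)=\xi(1-z)$), and $f(z)=\xi(1/2+z)$, an even entire function. $T_m(z)$ denotes the degree-$m$ Taylor (Maclaurin) polynomial of $f$ at $0$, and $T_m(\lambda z)$ is its value at the point $\lambda z$. Scaling: for all sufficiently large $n$, $\lambda=\lambda(n)$ is the unique $\lambda>1/2$ with $2-\frac{\lambda}{n}\frac{f'(\lambda)}{f(\lambda)}=0$. Phase: $\phi_\lambda(z)=2\log z+\frac1n\log\frac{f(\lambda)}{f(\lambda z)}$, so that $e^{n\phi_\lambda(z)}=\frac{z^{2n}f(\lambda)}{f(\lambda z)}$; the branch is chosen so that $\phi_\lambda$ is real on $(1,\infty)$ and $\phi_\lambda(z)=\phi_\lambda(-z)$; in particular $\phi_\lambda(\pm1)=0$, and the choice of $\lambda$ gives $\phi_\lambda'(\pm 1)=0$. At zeros of $f(\lambda z)$ the product $f(\lambda z)e^{n\phi_\lambda(z)}$ is understood as $z^{2n}f(\lambda)$. $\mathcal S_1=\{z:|\operatorname{Re}z|<1\}$. Local map: near $z=1$, $w=w(z)$ is the conformal map defined by $w^2=\phi_\lambda(z)$ and $w(z)=-i\sqrt{-\phi_\lambda''(1)/2}\,(z-1)[1+\mathcal O(z-1)]$; near $z=-1$ it is defined by $w(z)=w(-z)$. For small $\delta>0$, $B_{\pm1,\delta}$ is the neighborhood of $\pm1$ mapped conformally by $w$ onto $\{|w|<\delta\}$, and $B_\delta=B_{1,\delta}\cup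 B_{-1,\delta}$. $\operatorname{erfc}(s)=\frac{2}{\sqrt\pi}\int_s^\infty e^{-t^2}\,dt$ is the complementary error function. *)

(* Defs.v *)
From Stdlib Require Export Reals Arith.Factorial.
From Coquelicot Require Export Coquelicot.

Open Scope C_scope.

(** * Complex analysis *)

(* Meant for open [D], where pointwise complex differentiability is analyticity. *)
Definition holomorphic_on (D : C -> Prop) (g : C -> C) : Prop :=
  forall z, D z -> @ex_derive C_AbsRing C_NormedModule g z.

Definition entire (g : C -> C) : Prop := holomorphic_on (fun _ => True) g.

Definition C_derive_n (g : C -> C) (k : nat) : C -> C := Nat.iter k C_derive g.

Definition boundary (A : C -> Prop) (z : C) : Prop :=
  ~ locally z A /\ ~ locally z (fun y => ~ A y).

Definition Cexp (z : C) : C :=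
  (exp (Re z) * cos (Im z), exp (Re z) * sin (Im z))%R.

(* x ^ s for real x > 0 *)
Definition RCpow (x : R) (s : C) : C := Cexp (s * RtoC (ln x)).

(* The path of integration is the horizontal ray t |-> s + t, t >= 0. *)
Definition Cerfc (s : C) : C :=
  RtoC (2 / sqrt PI) *
  RInt_gen (V := C_R_CompleteNormedModule)
    (fun t : R => Cexp (- ((s + RtoC t) * (s + RtoC t))))
    (at_point 0%R) (Rbar_locally p_infty).

Definition taylor_poly (g : C -> C) (m : nat) (z : C) : C :=
  sum_n (G := C_AbelianMonoid)
    (fun k => C_derive_n g k (RtoC 0) / RtoC (INR (fact k)) * Cpow z k) m.

(** * Riemann's xi function *)

(* The three predicates below each determine a unique function away from the
   excluded points, by the identity theorem. *)

Definition Gamma_pole (s : C) : Prop := exists k : nat, s = - RtoC (INR k).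

Definition is_Gamma (G : C -> C) : Prop :=
  holomorphic_on (fun s => ~ Gamma_pole s) G /\
  forall s, (0 < Re s)%R ->
    is_RInt_gen (V := C_R_NormedModule)
      (fun t : R => RCpow t (s - RtoC 1) * RtoC (exp (- t)))
      (at_right 0%R) (Rbar_locally p_infty) (G s).

Definition is_zeta (Z : C -> C) : Prop :=
  holomorphic_on (fun s => s <> RtoC 1) Z /\
  forall s, (1 < Re s)%R ->
    @is_series C_AbsRing C_NormedModule
      (fun k : nat => RCpow (INR (S k)) (- s)) (Z s).

(* The excluded points are removable singularities of the right-hand side;
   there xi is given by continuity. *)
Definition is_xi (Gamma zeta xi : C -> C) : Prop :=
  entire xi /\
  forall z, z <> RtoC 1 -> ~ Gamma_pole (z / RtoC 2) ->
    xi z = RtoC (1 / 2) * RCpow PI (- z / RtoC 2) * Gamma (z / RtoC 2)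
           * z * (z - RtoC 1) * zeta z.

(** * Scaling, phase and local map *)

Definition is_scaling (f : C -> C) (n : nat) (lam : R) : Prop :=
  (1 / 2 < lam)%R /\
  RtoC 2 - RtoC (lam / INR n) * (C_derive f (RtoC lam) / f (RtoC lam)) = RtoC 0.

(* A branch of 2 log z + (1/n) log (f(lam) / f(lam z)).  For f(z) = xi(1/2+z) all
   zeros lie in |Re z| <= 1/2, so a branch analytic for |Re z| > 1/(2 lam) exists
   and the reality and parity conditions determine it there.  In the remaining
   strip the logarithm is multivalued: any pointwise choice is allowed, and it
   only enters through exp (n phi), which does not depend on it. *)
Definition is_phase (f : C -> C) (n : nat) (lam : R) (phi : C -> C) : Prop :=
  (forall z, z <> RtoC 0 -> f (RtoC lam * z) <> RtoC 0 ->
     exists a b : C,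
       Cexp a = z /\ Cexp b = f (RtoC lam) / f (RtoC lam * z) /\
       phi z = RtoC 2 * a + RtoC (1 / INR n) * b) /\
  holomorphic_on (fun z => (1 / (2 * lam) < Rabs (Re z))%R) phi /\
  (forall x : R, (1 < x)%R -> Im (phi (RtoC x)) = 0%R) /\
  (forall z, phi (- z) = phi z).

Definition ddphi1 (phi : C -> C) : C := C_derive_n phi 2 (RtoC 1).

(* The product f(lam z) exp (n phi(z)); it is z^(2n) f(lam) at the zeros of
   f(lam z), and also at z = 0, where phi has a logarithmic singularity. *)
Definition f_exp_phase (f : C -> C) (n : nat) (lam : R) (phi : C -> C) (z : C) : C :=
  if Ceq_dec z (RtoC 0) then Cpow z (2 * n) * f (RtoC lam)
  else if Ceq_dec (f (RtoC lam * z)) (RtoC 0) then Cpow z (2 * n) * f (RtoC lam)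
  else f (RtoC lam * z) * Cexp (RtoC (INR n) * phi z).

(* [B1] is the neighbourhood of 1 that [w] maps conformally onto |w| < delta.
   The second derivative of phi at 1 is real (phi is real on (1,oo)), hence the
   real square root of its real part.  The last clause transports w to -B1. *)
Definition is_local_map (phi : C -> C) (delta : R) (B1 : C -> Prop) (w : C -> C)
  : Prop :=
  open B1 /\ B1 (RtoC 1) /\
  holomorphic_on B1 w /\
  (forall z, B1 z -> w z * w z = phi z) /\
  (exists K eps : R, (0 < eps)%R /\
     forall z, B1 z -> (Cmod (z - RtoC 1) < eps)%R ->
       exists r : C, (Cmod r <= K * Cmod (z - RtoC 1))%R /\
         w z = - Ci * RtoC (sqrt (- Re (ddphi1 phi) / 2))
               * (z - RtoC 1) * (RtoC 1 + r)) /\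
  (forall z, B1 z -> (Cmod (w z) < delta)%R) /\
  (forall z z', B1 z -> B1 z' -> w z = w z' -> z = z') /\
  (forall u, (Cmod u < delta)%R -> exists z, B1 z /\ w z = u) /\
  (forall z, B1 z -> w (- z) = w z).

Definition sym_nbhd (B1 : C -> Prop) (z : C) : Prop := B1 z \/ B1 (- z).

Definition S1 (z : C) : Prop := (Rabs (Re z) < 1)%R.

Definition chi (z : C) : C := if Rlt_dec (Rabs (Re z)) 1 then RtoC 1 else RtoC 0.

Definition h0 (phi : C -> C) (z : C) : C :=
  RtoC (1 / sqrt (2 * PI * Cmod (ddphi1 phi))) * (RtoC 2 / (RtoC 1 - z * z)).

(* Main.v *)
(* With Q(s) = f(lam s) / (f(lam) s^(2n)) = exp(-n phi(s)), the residue theorem turns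
   the principal value of Q(s) (1/(s-z) + 1/(s+z)) along Re s = 1 into the remainder
   (f - T)(lam z) / (f(lam) z^(2n)) when |Re z| < 1 and into -T(lam z) / (f(lam) z^(2n))
   when Re z > 1, up to the factor 2 pi.  The saddle of phi at 1 lies on this line, and
   (1-z^2)/2 (1/(s-z) + 1/(s+z)) = s - (s^2-1)/2 (1/(s-z) + 1/(s+z)) there, so that
   Laplace's method gives the leading Gaussian integral with an error O(n^(-3/2)), uniformly
   in z away from +-1.  Near 1 the error function matches the jump of this approximation
   across the line, up to O(1/n) on an annulus; the difference of the two is holomorphic
   once the common pole at 1 is removed, and Cauchy's formula carries the bound inside.

   Evenness of f follows from the parity of phi.  The bounds on phi near 1, uniform in n,
   come from the Borel-Caratheodory inequality: |Q| is controlled on vertical lines by its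
   value on the real axis, because |xi(s)| <= xi(Re s) times a polynomial factor, and on the
   real axis by the log-convexity of pi^(-s/2) Gamma(s/2) zeta(s). *)

Require Import Defs.
From Stdlib Require Import Reals Lra Lia Psatz List Classical ClassicalEpsilon Ranalysis5.
From Coquelicot Require Import Coquelicot.
Open Scope R_scope.

(** * Complex differentiability *)

(** The obstacle is uniformity: [lam] and [phi] both change with n, so no estimate at the saddle may
    carry a constant depending on them. [Qgood] records exactly what Laplace's method consumes, with
    the single absolute constant [Cphi]; the radius [rloc], and with it the admissible [delta], is
    computed from [Cphi] alone. The error function is not extracted from an expansion. It is defined
    by solving the two displayed formulas for it: [ein] in the strip, [eout] outside it, [Ein] near
    1. The representation is then exact algebra, and all analysis goes into bounding these three
    functions. Reflecting the line Re s = 1 to Re s = -1 requires polynomial growth of f in the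
    strip, hence linear growth of zeta for Re s >= 1/2; this is why zeta is continued by hand to the
    left of 1. Non-vanishing of f(lam z) in the half-plane where [phi] is analytic is read off from
    the existence of the branch. Near 1 two different curves matter: the Taylor polynomial changes
    its representation on Re z = 1, while erfc changes its asymptotics where Re(i sqrt(n) w) = 0.
    Between them [Q] is exponentially small, so the mismatch is harmless. *)

Lemma Cmod_le_Re_Im (z : C) : Cmod z <= Rabs (Re z) + Rabs (Im z).
Proof.
  unfold Cmod. apply Rsqr_incr_0_var.
  - rewrite Rsqr_sqrt. 2: nra.
    unfold Rsqr, Re, Im.
    assert (H := Rabs_pos (fst z)). assert (H' := Rabs_pos (snd z)).
    rewrite <- (pow2_abs (fst z)), <- (pow2_abs (snd z)). nra.
  - assert (H := Rabs_pos (Re z)). assert (H' := Rabs_pos (Im z)). lra.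
Qed.

Lemma Im_le_Cmod (z : C) : Rabs (Im z) <= Cmod z.
Proof. eapply Rle_trans; [|apply Rmax_Cmod]. apply Rmax_r. Qed.

Lemma Re_le_Cmod (z : C) : Rabs (Re z) <= Cmod z.
Proof. eapply Rle_trans; [|apply Rmax_Cmod]. apply Rmax_l. Qed.

Lemma Cmod_rev (x y : C) : Cmod x - Cmod y <= Cmod (x - y).
Proof.
  assert (H := Cmod_triangle (x - y) y). replace (x - y + y)%C with x in H by ring. lra.
Qed.

Lemma Cmod_minus_sym (x y : C) : Cmod (x - y) = Cmod (y - x).
Proof. rewrite <- Cmod_opp. f_equal. ring. Qed.

Lemma Cmod_minus_le (x y : C) : Cmod (x - y) <= Cmod x + Cmod y.
Proof. unfold Cminus. rewrite <- (Cmod_opp y). apply Cmod_triangle. Qed.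

(** C carries two uniform structures, the product one and the one of its absolute value. Explicit
    [Cmod] radii avoid switching between them; [cder_is_derive] makes the link with [is_derive]
    once. *)
Definition cder (h : C -> C) (z l : C) : Prop :=
  forall eps : R, 0 < eps -> exists d, 0 < d /\
    forall y, Cmod (y - z) < d -> Cmod (h y - h z - (y - z) * l) <= eps * Cmod (y - z).

Definition ccont (h : C -> C) (z : C) : Prop :=
  forall eps : R, 0 < eps -> exists d, 0 < d /\
    forall y, Cmod (y - z) < d -> Cmod (h y - h z) < eps.

Definition hol (h : C -> C) (z : C) : Prop := exists l, cder h z l.

Definition near (z : C) (P : C -> Prop) : Prop :=
  exists d, 0 < d /\ forall y, Cmod (y - z) < d -> P y.

(** Balls of the product structure are squares, which accounts for the halved radius in one
    direction. *)
Lemma locally_near (z : C) (P : C -> Prop) : locally z P <-> near z P.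
Proof.
  split.
  - intros [e He]. exists e. split; [apply cond_pos|]. intros y Hy. apply He.
    apply C_NormedModule_mixin_compat1. exact Hy.
  - intros [d [Hd HP]].
    assert (Hd2 : 0 < d / 2) by lra.
    exists (mkposreal _ Hd2). intros y Hy. apply HP.
    destruct Hy as [H1 H2]. eapply Rle_lt_trans; [apply Cmod_le_Re_Im|].
    change (Rabs (fst y - fst z) < d / 2) in H1.
    change (Rabs (snd y - snd z) < d / 2) in H2.
    replace (Re (y - z)) with (fst y - fst z) by reflexivity.
    replace (Im (y - z)) with (snd y - snd z) by reflexivity. lra.
Qed.

Lemma near_and z P Q : near z P -> near z Q -> near z (fun y => P y /\ Q y).
Proof.
  intros [d [Hd HP]] [e [He HQ]]. exists (Rmin d e).
  split; [now apply Rmin_pos|]. intros y Hy.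
  assert (H1 := Rmin_l d e). assert (H2 := Rmin_r d e).
  split; [apply HP|apply HQ]; lra.
Qed.

Lemma locally_abs_near (z : C) (P : C -> Prop) :
  @locally (AbsRing_NormedModule C_AbsRing) z P <-> near z P.
Proof.
  split.
  - intros [e He]. exists e. split; [apply cond_pos|]. intros y Hy. apply He. exact Hy.
  - intros [d [Hd HP]]. exists (mkposreal d Hd). intros y Hy. apply HP. exact Hy.
Qed.

Lemma cder_is_derive h z l :
  cder h z l <-> @is_derive C_AbsRing C_NormedModule h z l.
Proof.
  split.
  - intros H. split.
    + apply (is_linear_scal_l (K:=C_AbsRing) (V:=C_NormedModule)).
    + intros x Hx.
      apply (is_filter_lim_locally_unique (K:=C_AbsRing) (V:=AbsRing_NormedModule C_AbsRing)) in Hx.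
      subst x.
      intros eps. apply (proj2 (locally_abs_near z _)).
      destruct (H eps (cond_pos eps)) as [d [Hd HH]].
      exists d. split; [exact Hd|]. intros y Hy. exact (HH y Hy).
  - intros [_ H] eps He.
    assert (Hz : is_filter_lim (@locally (AbsRing_NormedModule C_AbsRing) z) z).
    { intros P HP. exact HP. }
    specialize (H z Hz (mkposreal eps He)).
    apply (proj1 (locally_abs_near z _)) in H.
    destruct H as [d [Hd HH]]. exists d. split; [exact Hd|].
    intros y Hy. exact (HH y Hy).
Qed.

Lemma near_mono z (P Q : C -> Prop) : (forall y, P y -> Q y) -> near z P -> near z Q.
Proof. intros H [d [Hd HP]]. exists d. split; auto. Qed.

Lemma near_self z P : near z P -> P z.
Proof. intros [d [Hd HP]]. apply HP. replace (z - z)%C with (RtoC 0) by ring. now rewrite Cmod_0. Qed.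

Lemma near_near z P : near z P -> near z (fun y => near y P).
Proof.
  intros [d [Hd HP]]. exists (d / 2). split; [lra|]. intros y Hy.
  exists (d / 2). split; [lra|]. intros x Hx. apply HP.
  replace (x - z)%C with ((x - y) + (y - z))%C by ring.
  eapply Rle_lt_trans; [apply Cmod_triangle|lra].
Qed.

Lemma near_ball z c r : Cmod (z - c) < r -> near z (fun y => Cmod (y - c) < r).
Proof.
  intros H. exists (r - Cmod (z - c)). split; [lra|]. intros y Hy.
  replace (y - c)%C with ((y - z) + (z - c))%C by ring.
  eapply Rle_lt_trans; [apply Cmod_triangle|lra].
Qed.

Lemma near_annulus z c r : r < Cmod (z - c) -> near z (fun y => r < Cmod (y - c)).
Proof.
  intros H. exists (Cmod (z - c) - r). split; [lra|]. intros y Hy.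
  assert (H' := Cmod_triangle (z - y) (y - c)).
  replace (z - y + (y - c))%C with (z - c)%C in H' by ring.
  rewrite (Cmod_minus_sym z y) in H'. lra.
Qed.

Lemma near_Re_gt z r : r < Re z -> near z (fun y => r < Re y).
Proof.
  intros H. exists (Re z - r). split; [lra|]. intros y Hy.
  assert (H' := Re_le_Cmod (y - z)). change (Re (y - z)) with (Re y - Re z) in H'.
  apply Rabs_le_between in H'. lra.
Qed.

Lemma near_true z (P : C -> Prop) : (forall y, P y) -> near z P.
Proof. intros H. exists 1. split; [lra|auto]. Qed.

Lemma near_neq z c : z <> c -> near z (fun y => y <> c).
Proof.
  intros H. assert (H0 : 0 < Cmod (z - c)).
  { apply Cmod_gt_0. intro E. apply H. replace z with ((z - c) + c)%C by ring. rewrite E. ring. }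
  apply near_annulus in H0. revert H0. apply near_mono. intros y Hy E. subst y.
  replace (c - c)%C with (RtoC 0) in Hy by ring. rewrite Cmod_0 in Hy. lra.
Qed.

Lemma Cmod_sub_gt0 (x y : C) : x <> y -> 0 < Cmod (x - y).
Proof.
  intros H. apply Cmod_gt_0. intro E. apply H.
  replace x with ((x - y) + y)%C by ring. rewrite E. ring.
Qed.

Lemma Csub_neq0 (x y : C) : x <> y -> (x - y)%C <> RtoC 0.
Proof. intros H E. apply H. replace x with ((x - y) + y)%C by ring. rewrite E. ring. Qed.

Lemma Cmod_self (z : C) : Cmod (z - z) = 0.
Proof. replace (z - z)%C with (RtoC 0) by ring. apply Cmod_0. Qed.

Lemma ccont_near_bound h z : ccont h z -> near z (fun y => Cmod (h y) <= Cmod (h z) + 1).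
Proof.
  intros H. destruct (H 1 Rlt_0_1) as [d [Hd HH]]. exists d. split; [exact Hd|].
  intros y Hy. specialize (HH y Hy). assert (H' := Cmod_rev (h y) (h z)). lra.
Qed.

Lemma ccont_const c z : ccont (fun _ => c) z.
Proof. intros e He. exists 1. split; [lra|]. intros. rewrite Cmod_self. exact He. Qed.

Lemma ccont_id z : ccont (fun y => y) z.
Proof. intros e He. exists e. auto. Qed.

Lemma ccont_plus f g z : ccont f z -> ccont g z -> ccont (fun y => f y + g y)%C z.
Proof.
  intros Hf Hg e He. assert (He2 : 0 < e / 2) by lra.
  destruct (near_and z _ _ (Hf _ He2) (Hg _ He2)) as [d [Hd H]].
  exists d. split; [exact Hd|]. intros y Hy. destruct (H y Hy) as [H1 H2].
  replace (f y + g y - (f z + g z))%C with ((f y - f z) + (g y - g z))%C by ring.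
  eapply Rle_lt_trans; [apply Cmod_triangle|lra].
Qed.

Lemma ccont_mult f g z : ccont f z -> ccont g z -> ccont (fun y => f y * g y)%C z.
Proof.
  intros Hf Hg e He.
  set (A := Cmod (f z) + Cmod (g z) + 2).
  assert (HA : 0 < A) by (assert (H1 := Cmod_ge_0 (f z)); assert (H2 := Cmod_ge_0 (g z)); unfold A; lra).
  assert (He2 : 0 < e / A) by (apply Rdiv_lt_0_compat; lra).
  destruct (near_and z _ _ (ccont_near_bound g z Hg) (near_and z _ _ (Hf _ He2) (Hg _ He2))) as [d [Hd H]].
  exists d. split; [exact Hd|]. intros y Hy. destruct (H y Hy) as [H0 [H1 H2]].
  replace (f y * g y - (f z * g z))%C with ((f y - f z) * g y + f z * (g y - g z))%C by ring.
  eapply Rle_lt_trans; [apply Cmod_triangle|]. rewrite !Cmod_mult.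

  assert (P3 := Cmod_ge_0 (f z)). assert (P4 := Cmod_ge_0 (g y)).
  apply Rle_lt_trans with (e / A * (Cmod (g z) + 1) + Cmod (f z) * (e / A)).
  - nra.
  - replace (e / A * (Cmod (g z) + 1) + Cmod (f z) * (e / A)) with (e - e / A).
    lra. unfold A. field. unfold A in HA. lra.
Qed.

Lemma ccont_ext_near f g z : near z (fun y => f y = g y) -> ccont f z -> ccont g z.
Proof.
  intros H Hf e He. assert (E := near_self _ _ H).
  destruct (near_and z _ _ H (Hf e He)) as [d [Hd HH]]. exists d. split; [exact Hd|].
  intros y Hy. destruct (HH y Hy) as [H1 H2]. now rewrite <- H1, <- E.
Qed.

Lemma ccont_ext f g z : (forall y, f y = g y) -> ccont f z -> ccont g z.
Proof. intros H. apply ccont_ext_near. now apply near_true. Qed.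

Lemma ccont_opp f z : ccont f z -> ccont (fun y => - f y)%C z.
Proof.
  intros H. apply ccont_ext with (fun y => RtoC (-1) * f y)%C.
  intros y. ring. apply ccont_mult; [apply ccont_const|exact H].
Qed.

Lemma ccont_minus f g z : ccont f z -> ccont g z -> ccont (fun y => f y - g y)%C z.
Proof. intros Hf Hg. apply ccont_plus; [exact Hf|now apply ccont_opp]. Qed.

Lemma ccont_near_neq h z c : ccont h z -> h z <> c -> near z (fun y => h y <> c).
Proof.
  intros H Hz. destruct (H _ (Cmod_sub_gt0 _ _ Hz)) as [d [Hd HH]].
  exists d. split; [exact Hd|]. intros y Hy E. specialize (HH y Hy).
  rewrite E, (Cmod_minus_sym c) in HH. lra.
Qed.

Lemma ccont_near_lower h z : ccont h z -> h z <> RtoC 0 ->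
  near z (fun y => Cmod (h z) / 2 < Cmod (h y)).
Proof.
  intros H Hz. apply Cmod_gt_0 in Hz. destruct (H (Cmod (h z) / 2) ltac:(lra)) as [d [Hd HH]].
  exists d. split; [exact Hd|]. intros y Hy. specialize (HH y Hy).
  assert (H' := Cmod_rev (h z) (h y)). rewrite Cmod_minus_sym in H'. lra.
Qed.

Lemma Cmod_neq0 (z : C) : 0 < Cmod z -> z <> RtoC 0.
Proof. apply Cmod_gt_0. Qed.

Lemma ccont_inv h z : h z <> RtoC 0 -> ccont h z -> ccont (fun y => / h y)%C z.
Proof.
  intros Hz H e He. assert (Hm : 0 < Cmod (h z)) by now apply Cmod_gt_0.
  set (m := Cmod (h z)) in *.
  assert (He2 : 0 < e * (m * m / 2)) by (apply Rmult_lt_0_compat; nra).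
  destruct (near_and z _ _ (ccont_near_lower h z H Hz) (H _ He2)) as [d [Hd HH]].
  exists d. split; [exact Hd|]. intros y Hy. destruct (HH y Hy) as [H1 H2].
  fold m in H1. assert (Hy0 : h y <> RtoC 0) by (apply Cmod_neq0; lra).
  replace (/ h y - / h z)%C with (- (h y - h z) / (h y * h z))%C by (field; auto).
  rewrite Cmod_div by (apply Cmult_neq_0; auto). rewrite Cmod_opp, Cmod_mult. fold m.
  apply Rmult_lt_reg_r with (Cmod (h y) * m). nra.
  unfold Rdiv. rewrite Rmult_assoc, Rinv_l by nra. nra.
Qed.

Lemma ccont_div f g z : g z <> RtoC 0 -> ccont f z -> ccont g z -> ccont (fun y => f y / g y)%C z.
Proof. intros. apply ccont_mult; [|apply ccont_inv]; auto. Qed.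

Lemma ccont_comp f g z : ccont f (g z) -> ccont g z -> ccont (fun y => f (g y)) z.
Proof.
  intros Hf Hg e He. destruct (Hf e He) as [d [Hd H1]]. destruct (Hg d Hd) as [d' [Hd' H2]].
  exists d'. split; auto.
Qed.

Lemma ccont_pow h z n : ccont h z -> ccont (fun y => Cpow (h y) n) z.
Proof.
  intros H. induction n; simpl; [apply ccont_const|now apply ccont_mult].
Qed.

(** Caratheodory's form of the derivative: [h] has derivative [l] at [z] exactly when this quotient
    is continuous at [z]. The product, inverse and chain rules thereby become algebra with
    continuous functions. *)
Definition slope (h : C -> C) (z l y : C) : C :=
  if Ceq_dec y z then l else ((h y - h z) / (y - z))%C.

Lemma slope_eq h z l y : (h y = h z + (y - z) * slope h z l y)%C.
Proof.
  unfold slope. destruct (Ceq_dec y z) as [->|H]; [ring|].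
  field. now apply Csub_neq0.
Qed.

Lemma cder_slope h z l : cder h z l -> ccont (slope h z l) z.
Proof.
  intros H e He. destruct (H (e / 2) ltac:(lra)) as [d [Hd HH]].
  exists d. split; [exact Hd|]. intros y Hy.
  replace (slope h z l z) with l by (unfold slope; destruct (Ceq_dec z z); congruence).
  unfold slope. destruct (Ceq_dec y z) as [->|Hn]; [rewrite Cmod_self; lra|].
  specialize (HH y Hy). assert (P := Cmod_sub_gt0 _ _ Hn).
  replace ((h y - h z) / (y - z) - l)%C with ((h y - h z - (y - z) * l) / (y - z))%C
    by (field; now apply Csub_neq0).
  rewrite Cmod_div by now apply Csub_neq0.
  apply Rmult_lt_reg_r with (Cmod (y - z)); [exact P|].
  unfold Rdiv. rewrite Rmult_assoc, Rinv_l by lra. nra.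
Qed.

Lemma slope_cder h z q : ccont q z -> near z (fun y => h y = h z + (y - z) * q y)%C ->
  cder h z (q z).
Proof.
  intros H E e He. destruct (near_and _ _ _ (H e He) E) as [d [Hd HH]].
  exists d. split; [exact Hd|]. intros y Hy. destruct (HH y Hy) as [H1 H2].
  rewrite H2. replace (h z + (y - z) * q y - h z - (y - z) * q z)%C
    with ((y - z) * (q y - q z))%C by ring.
  rewrite Cmod_mult. assert (P := Cmod_ge_0 (y - z)). nra.
Qed.

Lemma cder_ccont h z l : cder h z l -> ccont h z.
Proof.
  intros H. apply cder_slope in H.
  apply ccont_ext with (fun y => h z + (y - z) * slope h z l y)%C.
  intros y. symmetry. apply slope_eq.
  apply ccont_plus; [apply ccont_const|]. apply ccont_mult; [|exact H].
  apply ccont_minus; [apply ccont_id|apply ccont_const].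
Qed.

Lemma cder_unique h z l l' : cder h z l -> cder h z l' -> l = l'.
Proof.
  intros H H'. apply cder_is_derive in H, H'. apply is_C_derive_unique in H, H'. congruence.
Qed.

Lemma cder_C_derive h z l : cder h z l -> C_derive h z = l.
Proof. intros H. now apply is_C_derive_unique, cder_is_derive. Qed.

Lemma cder_ext_near f g z l : near z (fun y => f y = g y) -> cder f z l -> cder g z l.
Proof.
  intros H Hf e He. assert (E := near_self _ _ H).
  destruct (near_and z _ _ H (Hf e He)) as [d [Hd HH]]. exists d. split; [exact Hd|].
  intros y Hy. destruct (HH y Hy) as [H1 H2]. now rewrite <- H1, <- E.
Qed.

Lemma cder_ext f g z l : (forall y, f y = g y) -> cder f z l -> cder g z l.
Proof. intros H. apply cder_ext_near. now apply near_true. Qed.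

Lemma slope_self h z l : slope h z l z = l.
Proof. unfold slope. destruct (Ceq_dec z z); congruence. Qed.

Lemma cder_eq h z l l' : cder h z l -> l = l' -> cder h z l'.
Proof. now intros H <-. Qed.

Lemma cder_const c z : cder (fun _ => c) z 0.
Proof.
  apply (slope_cder _ _ (fun _ => RtoC 0)); [apply ccont_const|]. apply near_true. intros. ring.
Qed.

Lemma cder_id z : cder (fun y => y) z 1.
Proof.
  apply (slope_cder _ _ (fun _ => RtoC 1)); [apply ccont_const|]. apply near_true. intros. ring.
Qed.

Lemma cder_plus f g z a b : cder f z a -> cder g z b -> cder (fun y => f y + g y)%C z (a + b)%C.
Proof.
  intros Hf Hg. assert (Sf := cder_slope _ _ _ Hf). assert (Sg := cder_slope _ _ _ Hg).
  eapply cder_eq.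
  apply (slope_cder _ _ (fun y => slope f z a y + slope g z b y)%C).
  - now apply ccont_plus.
  - apply near_true. intros y. rewrite (slope_eq f z a y) at 1. rewrite (slope_eq g z b y) at 1. ring.
  - simpl. now rewrite !slope_self.
Qed.

Lemma cder_mult f g z a b : cder f z a -> cder g z b ->
  cder (fun y => f y * g y)%C z (a * g z + f z * b)%C.
Proof.
  intros Hf Hg. assert (Sf := cder_slope _ _ _ Hf). assert (Sg := cder_slope _ _ _ Hg).
  eapply cder_eq.
  apply (slope_cder _ _ (fun y => slope f z a y * g y + f z * slope g z b y)%C).
  - apply ccont_plus; apply ccont_mult; auto using ccont_const. eapply cder_ccont; eauto.
  - apply near_true. intros y. rewrite (slope_eq f z a y) at 1. rewrite (slope_eq g z b y) at 1 2. ring.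
  - simpl. now rewrite !slope_self.
Qed.

Lemma cder_inv h z l : h z <> RtoC 0 -> cder h z l -> cder (fun y => / h y)%C z (- l / (h z * h z))%C.
Proof.
  intros Hz H. assert (Sf := cder_slope _ _ _ H). assert (Hc := cder_ccont _ _ _ H).
  eapply cder_eq.
  apply (slope_cder _ _ (fun y => - slope h z l y / (h y * h z))%C).
  - apply ccont_div. now apply Cmult_neq_0. now apply ccont_opp.
    apply ccont_mult; auto using ccont_const.
  - generalize (ccont_near_neq _ _ _ Hc Hz). apply near_mono. intros y Hy.
    assert (E := slope_eq h z l y).
    assert (E' : ((y - z) * slope h z l y = h y - h z)%C) by (rewrite E; ring).
    replace ((y - z) * (- slope h z l y / (h y * h z)))%C with
      (- ((y - z) * slope h z l y) / (h y * h z))%C by (field; auto).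
    rewrite E'. field. auto.
  - simpl. now rewrite !slope_self.
Qed.

Lemma cder_comp f g z a b : cder f (g z) a -> cder g z b -> cder (fun y => f (g y)) z (a * b)%C.
Proof.
  intros Hf Hg. assert (Sf := cder_slope _ _ _ Hf). assert (Sg := cder_slope _ _ _ Hg).
  eapply cder_eq.
  apply (slope_cder _ _ (fun y => slope f (g z) a (g y) * slope g z b y)%C).
  - apply ccont_mult; auto. apply ccont_comp; auto. eapply cder_ccont; eauto.
  - apply near_true. intros y. rewrite (slope_eq f (g z) a (g y)) at 1.
    replace (g y - g z)%C with ((y - z) * slope g z b y)%C by (rewrite (slope_eq g z b y); ring). ring.
  - simpl. now rewrite !slope_self.
Qed.

Lemma cder_scal c f z a : cder f z a -> cder (fun y => c * f y)%C z (c * a)%C.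
Proof.
  intros H. eapply cder_eq. apply cder_mult; [apply cder_const|exact H]. simpl. ring.
Qed.

Lemma cder_opp f z a : cder f z a -> cder (fun y => - f y)%C z (- a)%C.
Proof.
  intros H. eapply cder_eq. apply (cder_ext (fun y => RtoC (-1) * f y)%C). intros; ring.
  apply cder_scal; eauto. ring.
Qed.

Lemma cder_minus f g z a b : cder f z a -> cder g z b -> cder (fun y => f y - g y)%C z (a - b)%C.
Proof. intros. apply cder_plus; [assumption|now apply cder_opp]. Qed.

Lemma hol_ccont h z : hol h z -> ccont h z.
Proof. intros [l H]. eapply cder_ccont; eauto. Qed.
Lemma hol_ex_derive h z : hol h z <-> @ex_derive C_AbsRing C_NormedModule h z.
Proof. split; intros [l H]; exists l; now apply cder_is_derive. Qed.
Lemma hol_cder h z : hol h z -> cder h z (C_derive h z).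
Proof. intros [l H]. now rewrite (cder_C_derive _ _ _ H). Qed.
Lemma hol_const c z : hol (fun _ => c) z.
Proof. eexists. apply cder_const. Qed.
Lemma hol_id z : hol (fun y => y) z.
Proof. eexists. apply cder_id. Qed.
Lemma hol_plus f g z : hol f z -> hol g z -> hol (fun y => f y + g y)%C z.
Proof. intros [a Ha] [b Hb]. eexists. apply cder_plus; eauto. Qed.
Lemma hol_opp f z : hol f z -> hol (fun y => - f y)%C z.
Proof. intros [a Ha]. eexists. apply cder_opp; eauto. Qed.
Lemma hol_minus f g z : hol f z -> hol g z -> hol (fun y => f y - g y)%C z.
Proof. intros [a Ha] [b Hb]. eexists. apply cder_minus; eauto. Qed.
Lemma hol_mult f g z : hol f z -> hol g z -> hol (fun y => f y * g y)%C z.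
Proof. intros [a Ha] [b Hb]. eexists. apply cder_mult; eauto. Qed.
Lemma hol_inv f z : f z <> RtoC 0 -> hol f z -> hol (fun y => / f y)%C z.
Proof. intros H [a Ha]. eexists. apply cder_inv; eauto. Qed.
Lemma hol_div f g z : g z <> RtoC 0 -> hol f z -> hol g z -> hol (fun y => f y / g y)%C z.
Proof. intros. apply hol_mult; [|apply hol_inv]; auto. Qed.
Lemma hol_comp f g z : hol f (g z) -> hol g z -> hol (fun y => f (g y)) z.
Proof. intros [a Ha] [b Hb]. eexists. apply cder_comp; eauto. Qed.
Lemma hol_pow f z n : hol f z -> hol (fun y => Cpow (f y) n) z.
Proof. intros H. induction n; simpl; [apply hol_const|now apply hol_mult]. Qed.
Lemma hol_ext_near f g z : near z (fun y => f y = g y) -> hol f z -> hol g z.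
Proof. intros H [a Ha]. exists a. eapply cder_ext_near; eauto. Qed.
Lemma hol_ext f g z : (forall y, f y = g y) -> hol f z -> hol g z.
Proof. intros H. apply hol_ext_near. now apply near_true. Qed.
Lemma hol_scal c f z : hol f z -> hol (fun y => c * f y)%C z.
Proof. apply hol_mult, hol_const. Qed.

Create HintDb holo.
#[export] Hint Resolve ccont_const ccont_id ccont_plus ccont_minus ccont_mult ccont_opp ccont_pow
  hol_const hol_id hol_plus hol_minus hol_mult hol_opp hol_pow : holo.

(** * Line integrals and Cauchy's theorem *)

Definition CI (k : R -> C) (a b : R) : C := RInt (V := C_R_CompleteNormedModule) k a b.

Definition rcont (k : R -> C) (t : R) : Prop :=
  forall eps : R, 0 < eps -> exists d, 0 < d /\
    forall u, Rabs (u - t) < d -> Cmod (k u - k t) < eps.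

Definition rder (k : R -> C) (t : R) (l : C) : Prop :=
  forall eps : R, 0 < eps -> exists d, 0 < d /\
    forall u, Rabs (u - t) < d -> Cmod (k u - k t - RtoC (u - t) * l) <= eps * Rabs (u - t).

Lemma rcont_continuous k t : rcont k t -> continuous (U := C_R_CompleteNormedModule) k t.
Proof.
  intros H P HP. change (locally (k t) P) in HP. apply (proj1 (locally_near (k t) P)) in HP.
  destruct HP as [e [He HP]]. destruct (H e He) as [d [Hd HH]].
  exists (mkposreal d Hd). intros u Hu. apply HP. apply HH. exact Hu.
Qed.

Lemma norm_CR (z : C) : @norm R_AbsRing C_R_NormedModule z = Cmod z.
Proof. symmetry. apply Cmod_norm. Qed.

Lemma rder_is_derive k t l : rder k t l -> is_derive (V := C_R_NormedModule) k t l.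
Proof.
  intros H. split. apply (is_linear_scal_l (K:=R_AbsRing) (V:=C_R_NormedModule)).
  intros x Hx.
  apply (is_filter_lim_locally_unique (K:=R_AbsRing) (V:=R_NormedModule)) in Hx. subst x.
  intros eps. destruct (H eps (cond_pos eps)) as [d [Hd HH]].
  exists (mkposreal d Hd). intros u Hu. specialize (HH u Hu). rewrite norm_CR.
  eapply Rle_trans; [|exact HH]. right. f_equal.
  change (k u - k t - (scal (u - t)%R l : C_R_NormedModule) = k u - k t - RtoC (u - t) * l)%C.
  f_equal. f_equal. unfold scal; simpl. unfold prod_scal, scal; simpl. unfold mult; simpl.
  unfold Cmult. simpl. f_equal; ring.
Qed.

Lemma ex_CI k a b : a <= b -> (forall t, a <= t <= b -> rcont k t) ->
  ex_RInt (V := C_R_CompleteNormedModule) k a b.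
Proof.
  intros Hab H. apply ex_RInt_continuous. intros z Hz.
  rewrite Rmin_left, Rmax_right in Hz by lra. now apply rcont_continuous, H.
Qed.

Lemma is_CI k a b : a <= b -> (forall t, a <= t <= b -> rcont k t) ->
  is_RInt (V := C_R_NormedModule) k a b (CI k a b).
Proof.
  intros Hab H. apply (RInt_correct (V := C_R_CompleteNormedModule)). now apply ex_CI.
Qed.

Lemma CI_unique k a b l : is_RInt (V := C_R_NormedModule) k a b l -> CI k a b = l.
Proof. apply (is_RInt_unique (V := C_R_CompleteNormedModule)). Qed.

Lemma CI_ext f g a b : a <= b -> (forall t, a < t < b -> f t = g t) -> CI f a b = CI g a b.
Proof.
  intros Hab H. unfold CI. apply (RInt_ext (V := C_R_CompleteNormedModule)). intros t Ht. rewrite Rmin_left, Rmax_right in Ht by lra. now apply H.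
Qed.

Lemma CI_plus f g a b : a <= b -> (forall t, a <= t <= b -> rcont f t) ->
  (forall t, a <= t <= b -> rcont g t) ->
  CI (fun t => f t + g t)%C a b = (CI f a b + CI g a b)%C.
Proof.
  intros Hab Hf Hg. apply CI_unique.
  apply (is_RInt_plus (V := C_R_NormedModule)); now apply is_CI.
Qed.

Lemma CI_scal c f a b : a <= b -> (forall t, a <= t <= b -> rcont f t) ->
  CI (fun t => c * f t)%C a b = (c * CI f a b)%C.
Proof.
  intros Hab Hf. apply CI_unique. assert (H := is_CI f a b Hab Hf).
  assert (H1 := is_RInt_fct_extend_fst (U:=R_NormedModule) (V:=R_NormedModule) _ _ _ _ H).
  assert (H2 := is_RInt_fct_extend_snd (U:=R_NormedModule) (V:=R_NormedModule) _ _ _ _ H).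
  apply (is_RInt_fct_extend_pair (U:=R_NormedModule) (V:=R_NormedModule)); simpl.
  - apply (is_RInt_minus (V:=R_NormedModule)); apply (is_RInt_scal (V:=R_NormedModule)); assumption.
  - apply (is_RInt_plus (V:=R_NormedModule)); apply (is_RInt_scal (V:=R_NormedModule)); assumption.
Qed.

Lemma rcont_const c t : rcont (fun _ => c) t.
Proof. intros e He. exists 1. split; [lra|]. intros. now rewrite Cmod_self. Qed.

Lemma rcont_comp h p t : ccont h (p t) -> rcont p t -> rcont (fun u => h (p u)) t.
Proof.
  intros Hf Hg e He. destruct (Hf e He) as [d [Hd H1]]. destruct (Hg d Hd) as [d' [Hd' H2]].
  exists d'. split; auto.
Qed.

Lemma rcont_plus f g t : rcont f t -> rcont g t -> rcont (fun u => f u + g u)%C t.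
Proof.
  intros Hf Hg e He. destruct (Hf (e/2) ltac:(lra)) as [d [Hd H1]].
  destruct (Hg (e/2) ltac:(lra)) as [d' [Hd' H2]]. exists (Rmin d d').
  split; [now apply Rmin_pos|]. intros u Hu.
  assert (M1 := Rmin_l d d'). assert (M2 := Rmin_r d d').
  specialize (H1 u ltac:(lra)). specialize (H2 u ltac:(lra)).
  replace (f u + g u - (f t + g t))%C with ((f u - f t) + (g u - g t))%C by ring.
  eapply Rle_lt_trans; [apply Cmod_triangle|lra].
Qed.

Lemma rcont_scal c f t : rcont f t -> rcont (fun u => c * f u)%C t.
Proof.
  intros H. apply (rcont_comp (fun z => c * z)%C f); auto with holo.
Qed.

Lemma rcont_ext f g t : (forall u, f u = g u) -> rcont f t -> rcont g t.
Proof. intros E H e He. destruct (H e He) as [d [Hd HH]]. exists d. split; auto.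
  intros u Hu. rewrite <- !E. auto. Qed.

Lemma CI_minus f g a b : a <= b -> (forall t, a <= t <= b -> rcont f t) ->
  (forall t, a <= t <= b -> rcont g t) ->
  CI (fun t => f t - g t)%C a b = (CI f a b - CI g a b)%C.
Proof.
  intros Hab Hf Hg. apply CI_unique.
  apply (is_RInt_minus (V := C_R_NormedModule)); now apply is_CI.
Qed.

Lemma CI_Chasles f a b c : a <= b <= c -> (forall t, a <= t <= c -> rcont f t) ->
  CI f a c = (CI f a b + CI f b c)%C.
Proof.
  intros Hab Hf. symmetry.
  apply (RInt_Chasles (V := C_R_CompleteNormedModule)); apply ex_CI; try lra; intros; apply Hf; lra.
Qed.

Lemma CI_const c a b : CI (fun _ => c) a b = (RtoC (b - a) * c)%C.
Proof.
  unfold CI. rewrite RInt_const. unfold scal; simpl. unfold prod_scal, scal; simpl.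
  unfold mult; simpl. unfold Cmult; simpl. f_equal; ring.
Qed.

Lemma CI_norm f g a b : a <= b -> (forall t, a <= t <= b -> rcont f t) ->
  ex_RInt g a b -> (forall t, a <= t <= b -> Cmod (f t) <= g t) -> Cmod (CI f a b) <= RInt g a b.
Proof.
  intros Hab Hf Hg H. rewrite <- norm_CR.
  apply (norm_RInt_le (V := C_R_NormedModule) f g a b).
  - exact Hab.
  - intros x Hx. rewrite norm_CR. auto.
  - now apply is_CI.
  - now apply (RInt_correct (V := R_CompleteNormedModule)).
Qed.

Lemma CI_bound f M a b : a <= b -> (forall t, a <= t <= b -> rcont f t) ->
  (forall t, a <= t <= b -> Cmod (f t) <= M) -> Cmod (CI f a b) <= M * (b - a).
Proof.
  intros Hab Hf H. eapply Rle_trans. apply (CI_norm f (fun _ => M)); auto.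
  apply ex_RInt_const. rewrite RInt_const. unfold scal; simpl. unfold mult; simpl. lra.
Qed.

Lemma CI_ftc k dk a b : a <= b -> (forall t, a <= t <= b -> rder k t (dk t)) ->
  (forall t, a <= t <= b -> rcont dk t) -> CI dk a b = (k b - k a)%C.
Proof.
  intros Hab Hk Hd. apply CI_unique.
  apply (is_RInt_derive (V := C_R_CompleteNormedModule)).
  - intros x Hx. rewrite Rmin_left, Rmax_right in Hx by lra. apply rder_is_derive. auto.
  - intros x Hx. rewrite Rmin_left, Rmax_right in Hx by lra. apply rcont_continuous. auto.
Qed.

Lemma Cmod_RtoC_mult r z : Cmod (RtoC r * z) = Rabs r * Cmod z.
Proof. rewrite Cmod_mult, Cmod_R. reflexivity. Qed.

Lemma rcont_line (z v : C) t : rcont (fun u => z + RtoC u * v)%C t.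
Proof.
  intros e He. assert (Hv := Cmod_ge_0 v).
  exists (e / (Cmod v + 1)). split; [apply Rdiv_lt_0_compat; lra|].
  intros u Hu. replace (z + u * v - (z + t * v))%C with (RtoC (u - t) * v)%C
    by (rewrite RtoC_minus; ring).
  rewrite Cmod_RtoC_mult. apply Rle_lt_trans with (Rabs (u - t) * (Cmod v + 1)).
  - assert (P := Rabs_pos (u - t)). nra.
  - apply Rmult_lt_reg_r with (/ (Cmod v + 1)). apply Rinv_0_lt_compat; lra.
    rewrite Rmult_assoc, Rinv_r by lra. unfold Rdiv in Hu. lra.
Qed.

Lemma rder_line h z v t l : cder h (z + RtoC t * v)%C l ->
  rder (fun u => h (z + RtoC u * v)%C) t (v * l)%C.
Proof.
  intros H e He. assert (Hv := Cmod_ge_0 v).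
  assert (He2 : 0 < e / (Cmod v + 1)) by (apply Rdiv_lt_0_compat; lra).
  destruct (H _ He2) as [d [Hd HH]].
  destruct (rcont_line z v t d Hd) as [d' [Hd' H2]].
  exists d'. split; [exact Hd'|]. intros u Hu. specialize (HH _ (H2 u Hu)).
  replace (z + u * v - (z + t * v))%C with (RtoC (u - t) * v)%C in HH
    by (rewrite RtoC_minus; ring).
  replace (RtoC (u - t) * (v * l))%C with (RtoC (u - t) * v * l)%C by ring.
  eapply Rle_trans; [exact HH|]. rewrite Cmod_RtoC_mult.
  assert (P := Rabs_pos (u - t)).
  replace (e * Rabs (u - t)) with (e / (Cmod v + 1) * (Rabs (u - t) * (Cmod v + 1))) by (field; lra).
  apply Rmult_le_compat_l; [lra|]. apply Rmult_le_compat_l; lra.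
Qed.

Lemma CI_segment h dh z v a b : a <= b ->
  (forall t, a <= t <= b -> cder h (z + RtoC t * v)%C (dh (z + RtoC t * v)%C)) ->
  (forall t, a <= t <= b -> ccont dh (z + RtoC t * v)%C) ->
  (v * CI (fun t => dh (z + RtoC t * v)%C) a b = h (z + RtoC b * v)%C - h (z + RtoC a * v)%C)%C.
Proof.
  intros Hab H Hc. rewrite <- CI_scal; auto.
  - apply (CI_ftc (fun u => h (z + RtoC u * v)%C)); auto.
    + intros t Ht. apply rder_line. auto.
    + intros t Ht. apply rcont_scal. apply (rcont_comp dh). auto. apply rcont_line.
  - intros t Ht. apply (rcont_comp dh). auto. apply rcont_line.
Qed.

Definition hseg (h : C -> C) (a b y : R) : C := CI (fun t => h (t, y)) a b.
Definition vseg (h : C -> C) (x a b : R) : C := CI (fun t => h (x, t)) a b.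

(* Counterclockwise boundary integral over the rectangle [a,b] x [c,d]. *)
Definition Rect (h : C -> C) (a b c d : R) : C :=
  (hseg h a b c + Ci * vseg h b c d - hseg h a b d - Ci * vseg h a c d)%C.

Lemma pairE (x y : R) : (x, y) = (RtoC x + RtoC y * Ci)%C.
Proof. unfold RtoC, Ci, Cplus, Cmult; simpl. f_equal; ring. Qed.

Lemma rcont_h h y t : ccont h (t, y) -> rcont (fun u => h (u, y)) t.
Proof.
  intros H. apply (rcont_comp h (fun u => (u, y))). exact H.
  apply rcont_ext with (fun u => RtoC y * Ci + RtoC u * RtoC 1)%C.
  - intros u. rewrite (pairE u y). ring.
  - apply rcont_line.
Qed.

Lemma rcont_v h x t : ccont h (x, t) -> rcont (fun u => h (x, u)) t.
Proof.
  intros H. apply (rcont_comp h (fun u => (x, u))). exact H.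
  apply rcont_ext with (fun u => RtoC x + RtoC u * Ci)%C.
  - intros u. now rewrite (pairE x u).
  - apply rcont_line.
Qed.

Definition inR (a b c d : R) (z : C) : Prop := a <= Re z <= b /\ c <= Im z <= d.

Definition onR (a b c d : R) (z : C) : Prop :=
  inR a b c d z /\ (Re z = a \/ Re z = b \/ Im z = c \/ Im z = d).

Ltac onr := unfold onR, inR, Re, Im; simpl; lra.

Lemma Rect_sides h a b c d : a <= b -> c <= d -> (forall z, onR a b c d z -> ccont h z) ->
  (forall t, a <= t <= b -> rcont (fun u => h (u, c)) t) /\
  (forall t, a <= t <= b -> rcont (fun u => h (u, d)) t) /\
  (forall t, c <= t <= d -> rcont (fun u => h (a, u)) t) /\
  (forall t, c <= t <= d -> rcont (fun u => h (b, u)) t).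
Proof.
  intros Hab Hcd H. repeat split; intros t Ht; (apply rcont_h || apply rcont_v); apply H; onr.
Qed.

Lemma Rect_ext f g a b c d : a <= b -> c <= d -> (forall z, onR a b c d z -> f z = g z) ->
  Rect f a b c d = Rect g a b c d.
Proof.
  intros Hab Hcd H. unfold Rect, hseg, vseg.
  rewrite (CI_ext (fun t => f (t, c)) (fun t => g (t, c))), (CI_ext (fun t => f (t, d)) (fun t => g (t, d))),
    (CI_ext (fun t => f (a, t)) (fun t => g (a, t))), (CI_ext (fun t => f (b, t)) (fun t => g (b, t)));
    auto; intros t Ht; apply H; onr.
Qed.

Lemma Rect_minus f g a b c d : a <= b -> c <= d -> (forall z, onR a b c d z -> ccont f z) ->
  (forall z, onR a b c d z -> ccont g z) ->
  Rect (fun z => f z - g z)%C a b c d = (Rect f a b c d - Rect g a b c d)%C.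
Proof.
  intros Hab Hcd Hf Hg. destruct (Rect_sides f a b c d) as [F1 [F2 [F3 F4]]]; auto.
  destruct (Rect_sides g a b c d) as [G1 [G2 [G3 G4]]]; auto.
  unfold Rect, hseg, vseg. rewrite !CI_minus; auto. ring.
Qed.

Lemma Rect_scal k f a b c d : a <= b -> c <= d -> (forall z, onR a b c d z -> ccont f z) ->
  Rect (fun z => k * f z)%C a b c d = (k * Rect f a b c d)%C.
Proof.
  intros Hab Hcd Hf. destruct (Rect_sides f a b c d) as [F1 [F2 [F3 F4]]]; auto.
  unfold Rect, hseg, vseg. rewrite !CI_scal; auto. ring.
Qed.

Lemma Rect_bound f M a b c d : a <= b -> c <= d -> (forall z, onR a b c d z -> ccont f z) ->
  (forall z, onR a b c d z -> Cmod (f z) <= M) ->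
  Cmod (Rect f a b c d) <= 2 * M * ((b - a) + (d - c)).
Proof.
  intros Hab Hcd Hf HM. destruct (Rect_sides f a b c d) as [F1 [F2 [F3 F4]]]; auto.
  unfold Rect, hseg, vseg.
  assert (E1 := CI_bound (fun t => f (t, c)) M a b Hab F1 ltac:(intros; apply HM; onr)).
  assert (E2 := CI_bound (fun t => f (t, d)) M a b Hab F2 ltac:(intros; apply HM; onr)).
  assert (E3 := CI_bound (fun t => f (a, t)) M c d Hcd F3 ltac:(intros; apply HM; onr)).
  assert (E4 := CI_bound (fun t => f (b, t)) M c d Hcd F4 ltac:(intros; apply HM; onr)).
  eapply Rle_trans; [apply Cmod_minus_le|].
  eapply Rle_trans; [apply Rplus_le_compat_r, Cmod_minus_le|].
  eapply Rle_trans; [apply Rplus_le_compat_r, Rplus_le_compat_r, Cmod_triangle|].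
  rewrite !Cmod_mult, Cmod_Ci. lra.
Qed.

Lemma Rect_split_x h a m b c d : a <= m <= b -> c <= d ->
  (forall z, (onR a b c d z \/ onR a m c d z) -> ccont h z) ->
  Rect h a b c d = (Rect h a m c d + Rect h m b c d)%C.
Proof.
  intros Ha Hc H. unfold Rect, hseg.
  rewrite (CI_Chasles (fun t => h (t, c)) a m b); [|lra|intros; apply rcont_h, H; left; onr].
  rewrite (CI_Chasles (fun t => h (t, d)) a m b); [|lra|intros; apply rcont_h, H; left; onr].
  ring.
Qed.

Lemma Rect_split_y h a b c m d : a <= b -> c <= m <= d ->
  (forall z, (onR a b c d z \/ onR a b c m z) -> ccont h z) ->
  Rect h a b c d = (Rect h a b c m + Rect h a b m d)%C.
Proof.
  intros Ha Hc H. unfold Rect, vseg.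
  rewrite (CI_Chasles (fun t => h (a, t)) c m d); [|lra|intros; apply rcont_v, H; left; onr].
  rewrite (CI_Chasles (fun t => h (b, t)) c m d); [|lra|intros; apply rcont_v, H; left; onr].
  ring.
Qed.

(* A polynomial of degree one has a primitive, hence vanishing boundary integral. *)
Lemma Rect_affine p q a b c d : a <= b -> c <= d -> Rect (fun z => p + q * z)%C a b c d = RtoC 0.
Proof.
  intros Hab Hcd.
  set (H := fun z : C => (p * z + q * / RtoC 2 * (z * z))%C).
  assert (HD : forall z, cder H z ((fun z => p + q * z)%C z)).
  { intros z. eapply cder_eq.
    apply cder_plus. apply cder_scal, cder_id. apply cder_scal.
    apply cder_mult; apply cder_id. simpl. field. }
  assert (HC : forall z, ccont (fun z => p + q * z)%C z) by auto with holo.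
  assert (Hh : forall y, hseg (fun z => p + q * z)%C a b y = (H (b, y) - H (a, y))%C).
  { intros y. assert (E := CI_segment H (fun z => p + q * z)%C (0, y) (RtoC 1) a b Hab
      ltac:(auto) ltac:(auto)).
    rewrite Cmult_1_l in E. unfold hseg. rewrite (CI_ext _ (fun t => p + q * ((0,y) + t * RtoC 1))%C); auto.
    - rewrite E. f_equal; f_equal; unfold RtoC, Cplus, Cmult; simpl; f_equal; ring.
    - intros t _. f_equal. f_equal. unfold RtoC, Cplus, Cmult; simpl; f_equal; ring. }
  assert (Hv : forall x, (Ci * vseg (fun z => p + q * z) x c d = (H (x, d) - H (x, c)))%C).
  { intros x. assert (E := CI_segment H (fun z => p + q * z)%C (x, 0) Ci c d Hcd
      ltac:(auto) ltac:(auto)).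
    unfold vseg. rewrite (CI_ext _ (fun t => p + q * ((x,0) + t * Ci))%C); auto.
    - rewrite E. f_equal; f_equal; unfold RtoC, Cplus, Cmult, Ci; simpl; f_equal; ring.
    - intros t _. f_equal. f_equal. unfold RtoC, Cplus, Cmult, Ci; simpl; f_equal; ring. }
  unfold Rect. rewrite !Hh, !Hv. ring.
Qed.

Lemma pow_lt_small W e : 0 < e -> 0 <= W -> exists k, W / 2 ^ k < e.
Proof.
  intros He HW. destruct (Pow_x_infinity 2 ltac:(rewrite Rabs_right; lra) (W / e + 1)) as [N HN].
  exists N. specialize (HN N (Nat.le_refl N)). rewrite Rabs_right in HN by (apply Rle_ge, pow_le; lra).
  assert (0 < 2 ^ N) by (apply pow_lt; lra).
  apply Rmult_lt_reg_r with (2 ^ N); auto. unfold Rdiv. rewrite Rmult_assoc, Rinv_l by lra.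
  rewrite Rmult_1_r. apply Rle_lt_trans with (W / e * e). right; field; lra. nra.
Qed.

(** The point is the supremum of the left ends; by monotonicity every right end is an upper bound
    for them. *)
Lemma nested_point (x : nat -> R) (w : R) : 0 <= w ->
  (forall k, x k <= x (S k) /\ x (S k) + w / 2 ^ (S k) <= x k + w / 2 ^ k) ->
  exists p, forall k, x k <= p <= x k + w / 2 ^ k.
Proof.
  intros Hw H.
  assert (Hp : forall k, 0 <= w / 2 ^ k).
  { intros k. apply Rmult_le_pos; auto. apply Rlt_le, Rinv_0_lt_compat, pow_lt; lra. }
  assert (Hmono : forall j k, x j <= x (j + k)%nat /\ x (j + k)%nat + w / 2 ^ (j + k) <= x j + w / 2 ^ j).
  { intros j k. induction k.
    - rewrite Nat.add_0_r. lra.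
    - rewrite Nat.add_succ_r. specialize (H (j + k)%nat). lra. }
  destruct (completeness (fun y => exists k, y = x k)) as [p [Hub Hlub]].
  - exists (x 0%nat + w / 2 ^ 0). intros y [k ->]. specialize (Hmono 0%nat k). specialize (Hp k).
    simpl (0 + k)%nat in Hmono. lra.
  - exists (x 0%nat). now exists 0%nat.
  - exists p. intros k. split.
    + apply Hub. now exists k.
    + apply Hlub. intros y [j ->]. destruct (Nat.le_ge_cases j k) as [L|L].
      * replace k with (j + (k - j))%nat by lia. specialize (Hmono j (k - j)%nat).
        specialize (Hp (j + (k - j))%nat). lra.
      * replace j with (k + (j - k))%nat by lia. specialize (Hmono k (j - k)%nat).
        specialize (Hp (k + (j - k))%nat). lra.
Qed.

(** The four quarter integrals add up to the whole one, so they cannot all be smaller than M/4. *)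
Lemma Rect_quarter h a b c d M : a <= b -> c <= d -> 0 <= M ->
  (forall z, inR a b c d z -> ccont h z) -> M <= Cmod (Rect h a b c d) ->
  exists x y, (x = a \/ x = a + (b - a) / 2) /\ (y = c \/ y = c + (d - c) / 2) /\
    M / 4 <= Cmod (Rect h x (x + (b - a) / 2) y (y + (d - c) / 2)).
Proof.
  intros Hab Hcd HM H HR.
  set (m := a + (b - a) / 2). set (n := c + (d - c) / 2).
  assert (Hm : a <= m <= b) by (unfold m; lra). assert (Hn : c <= n <= d) by (unfold n; lra).
  assert (E : Rect h a b c d = (Rect h a m c n + Rect h a m n d + (Rect h m b c n + Rect h m b n d))%C).
  { rewrite (Rect_split_x h a m b c d), (Rect_split_y h a m c n d), (Rect_split_y h m b c n d); auto; try lra;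
    intros z Hz; apply H; unfold onR, inR in *; lra. }
  apply NNPP. intros HN.
  assert (Q : forall x y, (x = a \/ x = m) -> (y = c \/ y = n) ->
    Cmod (Rect h x (x + (b - a) / 2) y (y + (d - c) / 2)) < M / 4).
  { intros x y Hx Hy. apply Rnot_le_lt. intros L. apply HN. exists x, y. auto. }
  assert (Q1 := Q a c ltac:(auto) ltac:(auto)). assert (Q2 := Q a n ltac:(auto) ltac:(auto)).
  assert (Q3 := Q m c ltac:(auto) ltac:(auto)). assert (Q4 := Q m n ltac:(auto) ltac:(auto)).
  fold m n in Q1. fold m in Q2. fold n in Q3.
  replace (n + (d - c) / 2) with d in * by (unfold n; field).
  replace (m + (b - a) / 2) with b in * by (unfold m; field).
  fold n m in Q1, Q2, Q3, Q4.
  rewrite E in HR.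
  assert (T1 := Cmod_triangle (Rect h a m c n + Rect h a m n d) (Rect h m b c n + Rect h m b n d)).
  assert (T2 := Cmod_triangle (Rect h a m c n) (Rect h a m n d)).
  assert (T3 := Cmod_triangle (Rect h m b c n) (Rect h m b n d)). lra.
Qed.

(** Repeated quartering closes in on a point p. There h is affine up to eps |z - p|, the affine part
    integrates to zero by [Rect_affine], and the rest is at most 2 eps (W/2^k)^2, which is too small
    for the lower bound M/4^k. *)
Theorem goursat h a b c d : a <= b -> c <= d -> (forall z, inR a b c d z -> hol h z) ->
  Rect h a b c d = RtoC 0.
Proof.
  intros Hab Hcd H.
  destruct (Req_dec (Cmod (Rect h a b c d)) 0) as [E|E]; [now apply Cmod_eq_0|].
  exfalso. set (M := Cmod (Rect h a b c d)) in *.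
  assert (HM : 0 < M) by (assert (0 <= M) by apply Cmod_ge_0; lra).
  set (wx := b - a). set (wy := d - c).
  assert (P2 : forall k, 0 < 2 ^ k) by (intros; apply pow_lt; lra).
  assert (Hwx : forall k, 0 <= wx / 2 ^ k).
  { intros k. apply Rmult_le_pos. unfold wx; lra. apply Rlt_le, Rinv_0_lt_compat; auto. }
  assert (Hwy : forall k, 0 <= wy / 2 ^ k).
  { intros k. apply Rmult_le_pos. unfold wy; lra. apply Rlt_le, Rinv_0_lt_compat; auto. }
  assert (Sx : forall w k, w / 2 ^ S k = w / 2 ^ k / 2).
  { intros w k. simpl. field. apply Rgt_not_eq, P2. }
  set (inv := fun (k : nat) (p : R * R) =>
    a <= fst p /\ fst p + wx / 2 ^ k <= b /\ c <= snd p /\ snd p + wy / 2 ^ k <= d /\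
    M / 4 ^ k <= Cmod (Rect h (fst p) (fst p + wx / 2 ^ k) (snd p) (snd p + wy / 2 ^ k))).
  assert (step : forall k p, inv k p -> exists q, inv (S k) q /\
     fst p <= fst q /\ fst q + wx / 2 ^ (S k) <= fst p + wx / 2 ^ k /\
     snd p <= snd q /\ snd q + wy / 2 ^ (S k) <= snd p + wy / 2 ^ k).
  { intros k [x y] [I1 [I2 [I3 [I4 I5]]]]. simpl in I1, I2, I3, I4, I5.
    assert (HX := Hwx k). assert (HY := Hwy k).
    destruct (Rect_quarter h x (x + wx / 2 ^ k) y (y + wy / 2 ^ k) (M / 4 ^ k)) as [x' [y' [X [Y L]]]]; try lra.
    - apply Rmult_le_pos; [lra|]. apply Rlt_le, Rinv_0_lt_compat, pow_lt; lra.
    - intros z Hz. apply hol_ccont, H. unfold inR in *. lra.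
    - replace (x + wx / 2 ^ k - x) with (wx / 2 ^ k) in * by ring.
      replace (y + wy / 2 ^ k - y) with (wy / 2 ^ k) in * by ring.
      assert (HX' := Sx wx k). assert (HY' := Sx wy k).
      exists (x', y'). unfold inv. simpl fst; simpl snd. rewrite !Sx.
      repeat split; try lra.
      replace (M / 4 ^ S k) with (M / 4 ^ k / 4). exact L.
      simpl. field. apply pow_nonzero; lra. }
  assert (inv0 : inv 0%nat (a, c)).
  { unfold inv. simpl. replace (a + wx / 1) with b by (unfold wx; field).
    replace (c + wy / 1) with d by (unfold wy; field). fold M. lra. }
  (* Dependent choice: every term of the sequence carries its invariant, so that [step] applies to
     it again. *)
  set (stepf := fun k (p : {p | inv k p}) =>
    constructive_indefinite_description _ (step k (proj1_sig p) (proj2_sig p))).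
  set (sq := nat_rect (fun k => {p | inv k p}) (exist _ (a, c) inv0)
    (fun k p => exist _ (proj1_sig (stepf k p)) (proj1 (proj2_sig (stepf k p))))).
  set (u := fun k => proj1_sig (sq k)).
  assert (Hu : forall k, inv k (u k)) by (intros k; exact (proj2_sig (sq k))).
  assert (HuS : forall k, fst (u k) <= fst (u (S k)) /\ fst (u (S k)) + wx / 2 ^ (S k) <= fst (u k) + wx / 2 ^ k /\
     snd (u k) <= snd (u (S k)) /\ snd (u (S k)) + wy / 2 ^ (S k) <= snd (u k) + wy / 2 ^ k).
  { intros k. exact (proj2 (proj2_sig (stepf k (sq k)))). }
  destruct (nested_point (fun k => fst (u k)) wx) as [px Hpx].
  { unfold wx; lra. } { intros k. specialize (HuS k). lra. }
  destruct (nested_point (fun k => snd (u k)) wy) as [py Hpy].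
  { unfold wy; lra. } { intros k. specialize (HuS k). lra. }
  assert (Hp : inR a b c d (px, py)).
  { assert (A1 := Hpx 0%nat). assert (A2 := Hpy 0%nat). destruct (Hu 0%nat) as [I1 [I2 [I3 [I4 _]]]].
    unfold inR; simpl; lra. }
  destruct (H _ Hp) as [l Hl].
  set (W := wx + wy). assert (HW : 0 <= W) by (unfold W, wx, wy; lra).
  (* Chosen so that 2 eps W^2 < M; the summand 1 covers degenerate rectangles with W = 0. *)
  set (eps := M / (4 * W * W + 1)).
  assert (He : 0 < eps) by (apply Rdiv_lt_0_compat; nra).
  destruct (Hl eps He) as [dl [Hdl HH]].
  destruct (pow_lt_small W dl Hdl HW) as [k Hk].
  destruct (Hu k) as [I1 [I2 [I3 [I4 I5]]]].
  set (x := fst (u k)) in *. set (y := snd (u k)) in *.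
  specialize (Hpx k). specialize (Hpy k). fold x in Hpx. fold y in Hpy.

  assert (EW : wx / 2 ^ k + wy / 2 ^ k = W / 2 ^ k).
  { unfold W. field. apply Rgt_not_eq, P2. }
  assert (HC : forall z, onR x (x + wx / 2 ^ k) y (y + wy / 2 ^ k) z -> inR a b c d z /\ Cmod (z - (px, py)) <= W / 2 ^ k).
  { intros z Hz. split. unfold onR, inR in *; lra.
    eapply Rle_trans; [apply Cmod_le_Re_Im|].
    replace (Re (z - (px, py))) with (Re z - px) by reflexivity.
    replace (Im (z - (px, py))) with (Im z - py) by reflexivity.
    unfold onR, inR in Hz. rewrite <- EW. apply Rplus_le_compat; apply Rabs_le; lra. }
  set (p := (px, py) : C) in *.
  set (A := fun z : C => ((h p - p * l) + l * z)%C).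
  assert (HA : forall z, ccont A z) by (unfold A; auto with holo).
  assert (Eq : Rect h x (x + wx / 2 ^ k) y (y + wy / 2 ^ k) =
     Rect (fun z => h z - A z)%C x (x + wx / 2 ^ k) y (y + wy / 2 ^ k)).
  { rewrite Rect_minus; auto; try lra.
    - unfold A. rewrite Rect_affine by lra. ring.
    - intros z Hz. apply hol_ccont, H. now apply HC. }
  assert (B : Cmod (Rect h x (x + wx / 2 ^ k) y (y + wy / 2 ^ k)) <= 2 * (eps * (W / 2 ^ k)) * (W / 2 ^ k)).
  { rewrite Eq. eapply Rle_trans. apply (Rect_bound _ (eps * (W / 2 ^ k))); try lra.
    - intros z Hz. apply ccont_minus; auto. apply hol_ccont, H. now apply HC.
    - intros z Hz. destruct (HC z Hz) as [_ Hz2].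
      specialize (HH z ltac:(lra)). unfold A.
      replace (h z - (h p - p * l + l * z))%C with (h z - h p - (z - p) * l)%C by ring.
      eapply Rle_trans; [exact HH|]. apply Rmult_le_compat_l; lra.
    - right. rewrite <- EW. ring. }
  assert (F := Rle_trans _ _ _ I5 B).
  replace (2 * (eps * (W / 2 ^ k)) * (W / 2 ^ k)) with (2 * eps * (W * W) / 4 ^ k) in F.
  2:{ replace 4 with (2 * 2) by ring. rewrite Rpow_mult_distr. field. apply Rgt_not_eq, P2. }
  assert (P4 : 0 < / 4 ^ k) by (apply Rinv_0_lt_compat, pow_lt; lra).
  apply Rmult_le_reg_r in F; auto.
  unfold eps in F. assert (HD : 0 < 4 * W * W + 1) by nra.
  assert (F2 : M * (4 * W * W + 1) <= 2 * M * (W * W)).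
  { replace (2 * M * (W * W)) with (2 * (M / (4 * W * W + 1)) * (W * W) * (4 * W * W + 1)) by (field; lra).
    apply Rmult_le_compat_r; lra. }
  nra.
Qed.

(** Serves wherever several radius conditions must hold at once: one positive number below all of
    them replaces nested minima and leaves inequalities for [lra]. *)
Lemma small_list (l : list R) : fold_right (fun x P => 0 < x /\ P) True l ->
  exists m, 0 < m /\ fold_right (fun x P => m <= x /\ P) True l.
Proof.
  assert (Mono : forall m m' l, m' <= m -> fold_right (fun x P => m <= x /\ P) True l ->
     fold_right (fun x P => m' <= x /\ P) True l).
  { intros m m' k Hm. induction k; simpl; intuition lra. }
  induction l as [|x l IH]; simpl.
  - intros _. exists 1. split; [lra|auto].
  - intros [Hx Hl]. destruct (IH Hl) as [m [Hm Hml]]. exists (Rmin x m).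
    split; [now apply Rmin_pos|]. split; [apply Rmin_l|].
    apply Mono with m; [apply Rmin_r|exact Hml].
Qed.

(** Four rectangles around a small square centred at [p] contribute nothing. On the square itself h
    is bounded by continuity and the perimeter tends to zero. *)
Lemma goursat_exc h p a b c d : a < Re p < b -> c < Im p < d ->
  (forall z, inR a b c d z -> ccont h z) ->
  (forall z, inR a b c d z -> z <> p -> hol h z) ->
  Rect h a b c d = RtoC 0.
Proof.
  intros Hp Hq HC HH.
  destruct (ccont_near_bound h p (HC p ltac:(unfold inR; lra))) as [d0 [Hd0 HB]].
  set (M := Cmod (h p) + 1) in *.
  assert (HM : 0 < M) by (unfold M; assert (P := Cmod_ge_0 (h p)); lra).
  assert (Small : forall e, 0 < e -> e < d0 / 2 -> e < Re p - a -> e < b - Re p ->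
    e < Im p - c -> e < d - Im p -> Cmod (Rect h a b c d) <= 8 * M * e).
  { intros e He E0 E1 E2 E3 E4.
    set (x1 := Re p - e). set (x2 := Re p + e). set (y1 := Im p - e). set (y2 := Im p + e).
    assert (X : a < x1 /\ x1 < Re p < x2 /\ x2 < b) by (unfold x1, x2; lra).
    assert (Y : c < y1 /\ y1 < Im p < y2 /\ y2 < d) by (unfold y1, y2; lra).
    rewrite (Rect_split_x h a x1 b c d), (Rect_split_x h x1 x2 b c d),
      (Rect_split_y h x1 x2 c y1 d), (Rect_split_y h x1 x2 y1 y2 d);
      try lra; try (intros z Hz; apply HC; unfold onR, inR in *; lra).
    rewrite (goursat h a x1 c d), (goursat h x2 b c d), (goursat h x1 x2 c y1), (goursat h x1 x2 y2 d);
      try lra;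
      try (intros z Hz; apply HH; [unfold inR in *; lra| intros ->; unfold inR in *; lra]).
    replace (0 + (0 + (Rect h x1 x2 y1 y2 + 0) + 0))%C with (Rect h x1 x2 y1 y2) by ring.
    eapply Rle_trans. apply (Rect_bound h M); try lra.
    - intros z Hz. apply HC. unfold onR, inR in *; lra.
    - intros z Hz. apply HB. eapply Rle_lt_trans; [apply Cmod_le_Re_Im|].
      replace (Re (z - p)) with (Re z - Re p) by reflexivity.
      replace (Im (z - p)) with (Im z - Im p) by reflexivity.
      unfold onR, inR in Hz.
      assert (Rabs (Re z - Re p) <= e) by (apply Rabs_le; unfold x1, x2 in *; lra).
      assert (Rabs (Im z - Im p) <= e) by (apply Rabs_le; unfold y1, y2 in *; lra). lra.
    - unfold x1, x2, y1, y2. right. ring. }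
  apply Cmod_eq_0. apply Rle_antisym; [|apply Cmod_ge_0]. apply Rnot_lt_le. intros L.
  assert (Q : 0 < Cmod (Rect h a b c d) / (8 * M)) by (apply Rdiv_lt_0_compat; lra).
  destruct (small_list (d0 / 2 :: Re p - a :: b - Re p :: Im p - c :: d - Im p :: Cmod (Rect h a b c d) / (8 * M) :: nil)) as [m Hm].
  { simpl. lra. }
  simpl in Hm.
  specialize (Small (m / 2) ltac:(lra) ltac:(lra) ltac:(lra) ltac:(lra) ltac:(lra) ltac:(lra)).
  assert (H : 8 * M * (m / 2) <= 8 * M * (Cmod (Rect h a b c d) / (8 * M)) / 2).
  { assert (8 * M * m <= 8 * M * (Cmod (Rect h a b c d) / (8 * M))) by (apply Rmult_le_compat_l; lra). lra. }
  replace (8 * M * (Cmod (Rect h a b c d) / (8 * M)) / 2) with (Cmod (Rect h a b c d) / 2) in H by (field; lra).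
  lra.
Qed.

Lemma CI_pair (f g F G : R -> R) a b : a <= b ->
  (forall t, a <= t <= b -> is_derive F t (f t)) -> (forall t, a <= t <= b -> is_derive G t (g t)) ->
  (forall t, a <= t <= b -> continuous f t) -> (forall t, a <= t <= b -> continuous g t) ->
  CI (fun t => (f t, g t)) a b = (F b - F a, G b - G a).
Proof.
  intros Hab HF HG Hf Hg. apply CI_unique.
  apply (is_RInt_fct_extend_pair (U:=R_NormedModule) (V:=R_NormedModule)); simpl;
  [apply (is_RInt_derive (V:=R_CompleteNormedModule) F f)|apply (is_RInt_derive (V:=R_CompleteNormedModule) G g)];
  intros t Ht; rewrite Rmin_left, Rmax_right in Ht by lra; auto.
Qed.

Lemma Cinv_pair x t : x * x + t * t <> 0 -> (/ (x, t))%C = (x / (x * x + t * t), - t / (x * x + t * t)).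
Proof. intros H. unfold Cinv. simpl. f_equal; field; auto; intros E; apply H; rewrite <- E; ring. Qed.

Lemma is_derive_cont_ex (f : R -> R) t : ex_derive f t -> continuous f t.
Proof. apply (ex_derive_continuous (V := R_NormedModule)). Qed.

(** An explicit primitive replaces the complex logarithm: the argument becomes an [atan] with finite
    argument, since the vertical line misses the point. The formula returns in the principal values
    on Re s = 1. *)
Lemma CI_inv_v X x y c d : X <> x -> c <= d ->
  CI (fun t => / ((X, t) - (x, y)))%C c d =
   (atan ((d - y) / (X - x)) - atan ((c - y) / (X - x)),
    - ln ((X - x) * (X - x) + (d - y) * (d - y)) / 2 - - ln ((X - x) * (X - x) + (c - y) * (c - y)) / 2).
Proof.
  intros HX Hcd. assert (Hp : forall t, 0 < (X - x) * (X - x) + (t - y) * (t - y)).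
  { intros t. apply Rplus_lt_le_0_compat. apply Rsqr_pos_lt; lra. apply Rle_0_sqr. }
  rewrite (CI_ext _ (fun t => ((X - x) / ((X - x) * (X - x) + (t - y) * (t - y)), - (t - y) / ((X - x) * (X - x) + (t - y) * (t - y))))); [|lra|].
  2: { intros t _. rewrite <- Cinv_pair. reflexivity. specialize (Hp t); lra. }
  apply (CI_pair (fun t => (X - x) / ((X - x) * (X - x) + (t - y) * (t - y))) (fun t => - (t - y) / ((X - x) * (X - x) + (t - y) * (t - y)))
    (fun t => atan ((t - y) / (X - x))) (fun t => - ln ((X - x) * (X - x) + (t - y) * (t - y)) / 2)); [lra| | | |]; intros t _; specialize (Hp t).
  - auto_derive; auto. unfold Rsqr. field. repeat split; lra.
  - auto_derive. unfold Rminus in Hp. lra. field. lra.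
  - apply is_derive_cont_ex. auto_derive. unfold Rminus in Hp. lra.
  - apply is_derive_cont_ex. auto_derive. unfold Rminus in Hp. lra.
Qed.

Lemma atan_ratio x y : 0 < x -> 0 < y -> atan (x / y) + atan (y / x) = PI / 2.
Proof.
  intros Hx Hy. replace (x / y) with (/ (y / x)) by (field; lra).
  rewrite atan_inv. ring. apply Rdiv_lt_0_compat; lra.
Qed.

(** The logarithms cancel between adjacent sides, and each corner contributes two arctangents of
    reciprocal arguments, hence pi/2 by [atan_ratio]. *)
Lemma Rect_inv z a b c d : a < Re z < b -> c < Im z < d ->
  Rect (fun s => / (s - z))%C a b c d = (RtoC (2 * PI) * Ci)%C.
Proof.
  intros Hx Hy. destruct z as [x y]. unfold Re, Im in *; simpl in *.
  unfold Rect, hseg, vseg.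
  assert (SH : forall Y, Y <> y -> CI (fun t => / ((t, Y) - (x, y)))%C a b =
    (ln ((b - x) * (b - x) + (Y - y) * (Y - y)) / 2 - ln ((a - x) * (a - x) + (Y - y) * (Y - y)) / 2,
     - atan ((b - x) / (Y - y)) - - atan ((a - x) / (Y - y)))).
  { intros Y HY. assert (Hp : forall t, 0 < (t - x) * (t - x) + (Y - y) * (Y - y)) by (intros t; apply Rplus_le_lt_0_compat; [apply Rle_0_sqr|apply Rsqr_pos_lt; lra]).
    rewrite (CI_ext _ (fun t => ((t - x) / ((t - x) * (t - x) + (Y - y) * (Y - y)), - (Y - y) / ((t - x) * (t - x) + (Y - y) * (Y - y))))); [|lra|].
    2: { intros t _. rewrite <- Cinv_pair. reflexivity. specialize (Hp t); lra. }
    apply (CI_pair (fun t => (t - x) / ((t - x) * (t - x) + (Y - y) * (Y - y))) (fun t => - (Y - y) / ((t - x) * (t - x) + (Y - y) * (Y - y)))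
    (fun t => ln ((t - x) * (t - x) + (Y - y) * (Y - y)) / 2) (fun t => - atan ((t - x) / (Y - y)))); [lra| | | |]; intros t _; specialize (Hp t).
  - auto_derive. unfold Rminus in Hp. lra. field. lra.
  - auto_derive; auto. unfold Rsqr. field. repeat split; lra.
  - apply is_derive_cont_ex. auto_derive. unfold Rminus in Hp. lra.
  - apply is_derive_cont_ex. auto_derive. unfold Rminus in Hp. lra. }
  rewrite (SH c), (SH d), (CI_inv_v a), (CI_inv_v b) by lra.
  assert (N : forall u v, v <> 0 -> atan (- u / v) = - atan (u / v)).
  { intros u v Hv. rewrite <- atan_opp. f_equal. field. auto. }
  assert (N2 : forall u v, v <> 0 -> atan (u / - v) = - atan (u / v)).
  { intros u v Hv. rewrite <- atan_opp. f_equal. field. auto. }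
  replace (c - y) with (- (y - c)) by ring. replace (a - x) with (- (x - a)) by ring.
  rewrite !N, !N2 by lra.
  assert (A1 := atan_ratio (b - x) (y - c) ltac:(lra) ltac:(lra)).
  assert (A2 := atan_ratio (b - x) (d - y) ltac:(lra) ltac:(lra)).
  assert (A3 := atan_ratio (x - a) (y - c) ltac:(lra) ltac:(lra)).
  assert (A4 := atan_ratio (x - a) (d - y) ltac:(lra) ltac:(lra)).
  apply injective_projections; simpl; lra.
Qed.

(** * Cauchy's formula and division by z - p *)

Lemma slope_ccont_off h z l s : s <> z -> ccont h s -> ccont (slope h z l) s.
Proof.
  intros Hs H. apply ccont_ext_near with (fun y => (h y - h z) / (y - z))%C.
  - generalize (near_neq _ _ Hs). apply near_mono. intros y Hy. unfold slope.
    destruct (Ceq_dec y z); [contradiction|reflexivity].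
  - apply ccont_div; auto with holo. now apply Csub_neq0.
Qed.

Lemma slope_hol_off h z l s : s <> z -> hol h s -> hol (slope h z l) s.
Proof.
  intros Hs H. apply hol_ext_near with (fun y => (h y - h z) / (y - z))%C.
  - generalize (near_neq _ _ Hs). apply near_mono. intros y Hy. unfold slope.
    destruct (Ceq_dec y z); [contradiction|reflexivity].
  - apply hol_div; auto with holo. now apply Csub_neq0.
Qed.

Definition twopii : C := (RtoC (2 * PI) * Ci)%C.

Lemma twopii_neq0 : twopii <> RtoC 0.
Proof. assert (H := PI_RGT_0). intros E. injection E. intros. lra. Qed.

Lemma Cmod_twopii : Cmod twopii = 2 * PI.
Proof.
  assert (H := PI_RGT_0). unfold twopii. rewrite Cmod_mult, Cmod_Ci, Cmod_R, Rabs_right; lra.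
Qed.

Lemma onR_neq z a b c d s : a < Re z < b -> c < Im z < d -> onR a b c d s -> s <> z.
Proof. intros H1 H2 H3 ->. unfold onR, inR in H3. lra. Qed.

(** The difference quotient of h at z is continuous at z and holomorphic elsewhere, so [goursat_exc]
    applies to it; the constant part is [Rect_inv]. *)
Theorem cauchy_formula h z a b c d : a < Re z < b -> c < Im z < d ->
  (forall s, inR a b c d s -> hol h s) ->
  Rect (fun s => h s / (s - z))%C a b c d = (twopii * h z)%C.
Proof.
  intros Hx Hy H.
  assert (Hz : hol h z) by (apply H; unfold inR; lra). destruct Hz as [l Hl].
  assert (E := goursat_exc (slope h z l) z a b c d Hx Hy).
  assert (HB : forall s, onR a b c d s -> s <> z) by (intros s; now apply onR_neq).
  assert (HI : forall s, onR a b c d s -> ccont (fun s => / (s - z))%C s).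
  { intros s Hs. apply ccont_inv; auto with holo. now apply Csub_neq0, HB. }
  assert (HC : forall s, onR a b c d s -> ccont (fun s => h s / (s - z))%C s).
  { intros s Hs. apply ccont_mult; auto. apply hol_ccont, H, Hs. }
  rewrite (Rect_ext _ (fun s => h s / (s - z) - h z * / (s - z))%C) in E; try lra.
  - rewrite Rect_minus, Rect_scal, (Rect_inv z) in E; try lra; auto.
    + fold twopii in E.
      assert (E2 : (Rect (fun s => h s / (s - z)) a b c d - h z * twopii)%C = RtoC 0).
      { apply E.
        - intros s Hs. destruct (Ceq_dec s z) as [->|N]; [now apply cder_slope|].
          apply slope_ccont_off; auto. now apply hol_ccont, H.
        - intros s Hs N. apply slope_hol_off; auto. }
      replace (Rect (fun s => h s / (s - z))%C a b c d) with
       ((Rect (fun s => h s / (s - z)) a b c d - h z * twopii) + h z * twopii)%C by ring.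
      rewrite E2. ring.
    + intros s Hs. apply ccont_mult; auto with holo.
  - intros s Hs. unfold slope. destruct (Ceq_dec s z) as [F|_]; [now apply HB in F|].
    field. now apply Csub_neq0, HB.
Qed.

Lemma rcont_bounded k a b : a <= b -> (forall t, a <= t <= b -> rcont k t) ->
  exists M, forall t, a <= t <= b -> Cmod (k t) <= M.
Proof.
  intros Hab H.
  destruct (continuity_ab_maj (fun t => Cmod (k t)) a b Hab) as [m [Hm _]].
  - intros t Ht. intros e He. destruct (H t Ht e He) as [d [Hd HH]]. exists d. split; [exact Hd|].
    intros u [_ Hu]. unfold dist in *; simpl in *. unfold R_dist in *.
    specialize (HH u Hu). apply Rabs_def1.
    + assert (R := Cmod_rev (k u) (k t)). lra.
    + assert (R := Cmod_rev (k t) (k u)). rewrite Cmod_minus_sym in R. lra.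
  - exists (Cmod (k m)). auto.
Qed.

Lemma onR_bounded k a b c d : a <= b -> c <= d -> (forall z, onR a b c d z -> ccont k z) ->
  exists M, 0 < M /\ forall z, onR a b c d z -> Cmod (k z) <= M.
Proof.
  intros Hab Hcd H. destruct (Rect_sides k a b c d Hab Hcd H) as [F1 [F2 [F3 F4]]].
  destruct (rcont_bounded _ _ _ Hab F1) as [M1 B1]. destruct (rcont_bounded _ _ _ Hab F2) as [M2 B2].
  destruct (rcont_bounded _ _ _ Hcd F3) as [M3 B3]. destruct (rcont_bounded _ _ _ Hcd F4) as [M4 B4].
  exists (Rabs M1 + Rabs M2 + Rabs M3 + Rabs M4 + 1).
  assert (A1 := Rle_abs M1). assert (A2 := Rle_abs M2). assert (A3 := Rle_abs M3). assert (A4 := Rle_abs M4).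
  assert (C1 := Rabs_pos M1). assert (C2 := Rabs_pos M2). assert (C3 := Rabs_pos M3). assert (C4 := Rabs_pos M4).
  split; [lra|]. intros [x y] [[Hx Hy] [E|[E|[E|E]]]]; unfold Re, Im in *; simpl in *; subst.
  - specialize (B3 _ Hy). lra.
  - specialize (B4 _ Hy). lra.
  - specialize (B1 _ Hx). lra.
  - specialize (B2 _ Hx). lra.
Qed.

Lemma onR_dist z a b c d r s : onR a b c d s -> r <= Re z - a -> r <= b - Re z ->
  r <= Im z - c -> r <= d - Im z -> r <= Cmod (s - z).
Proof.
  intros [_ Hs] R1 R2 R3 R4.
  assert (A := Re_le_Cmod (s - z)). assert (B := Im_le_Cmod (s - z)).
  replace (Re (s - z)) with (Re s - Re z) in A by reflexivity.
  replace (Im (s - z)) with (Im s - Im z) in B by reflexivity.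
  apply Rabs_le_between in A. apply Rabs_le_between in B. lra.
Qed.

(** Differentiation under the integral, in the form where a quadratic remainder uniform in [s] is
    available. *)
Lemma Rect_param (K : C -> C -> C) (D : C -> C) z a b c d A r : a <= b -> c <= d -> 0 < r -> 0 < A ->
  (forall y, Cmod (y - z) < r -> forall s, onR a b c d s -> ccont (fun s => K s y) s) ->
  (forall s, onR a b c d s -> ccont D s) ->
  (forall y, Cmod (y - z) < r -> forall s, onR a b c d s ->
     Cmod (K s y - K s z - (y - z) * D s) <= A * (Cmod (y - z) * Cmod (y - z))) ->
  cder (fun y => Rect (fun s => K s y) a b c d) z (Rect D a b c d).
Proof.
  intros Hab Hcd Hr HA HK HD HE e He.
  set (L := 2 * A * ((b - a) + (d - c)) + 1).
  assert (HL : 0 < L) by (unfold L; nra).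
  exists (Rmin r (e / L)). split. apply Rmin_pos; auto. apply Rdiv_lt_0_compat; lra.
  intros y Hy. assert (M1 := Rmin_l r (e / L)). assert (M2 := Rmin_r r (e / L)).
  assert (Hyr : Cmod (y - z) < r) by lra.
  assert (Hzr : Cmod (z - z) < r) by (rewrite Cmod_self; lra).
  assert (E : (Rect (fun s => K s y) a b c d - Rect (fun s => K s z) a b c d - (y - z) * Rect D a b c d)%C
    = Rect (fun s => K s y - K s z - (y - z) * D s)%C a b c d).
  { rewrite Rect_minus, Rect_minus, Rect_scal; auto with holo. }
  rewrite E. eapply Rle_trans. apply (Rect_bound _ (A * (Cmod (y - z) * Cmod (y - z)))); auto.
  - intros s Hs. apply ccont_minus; auto with holo.
  - assert (P := Cmod_ge_0 (y - z)).
    apply Rle_trans with (L * Cmod (y - z) * Cmod (y - z)).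
    + unfold L. nra.
    + apply Rmult_le_compat_r; [exact P|]. apply Rle_trans with (L * (e / L)).
      apply Rmult_le_compat_l; lra. right; field; lra.
Qed.

Lemma rect_gap z a b c d : a < Re z < b -> c < Im z < d ->
  exists r, 0 < r /\ (forall s y, onR a b c d s -> Cmod (y - z) < r -> r <= Cmod (s - y)) /\
    (forall y, Cmod (y - z) < r -> a < Re y < b /\ c < Im y < d).
Proof.
  intros Hx Hy. destruct (small_list (Re z - a :: b - Re z :: Im z - c :: d - Im z :: nil)) as [m Hm].
  { simpl; lra. } simpl in Hm.
  exists (m / 2). split; [lra|]. split.
  - intros s y Hs Hyz.
    assert (D := onR_dist z a b c d m s Hs ltac:(lra) ltac:(lra) ltac:(lra) ltac:(lra)).
    assert (T := Cmod_triangle (s - y) (y - z)). replace (s - y + (y - z))%C with (s - z)%C in T by ring. lra.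
  - intros y Hyz.
    assert (A := Re_le_Cmod (y - z)). assert (B := Im_le_Cmod (y - z)).
    replace (Re (y - z)) with (Re y - Re z) in A by reflexivity.
    replace (Im (y - z)) with (Im y - Im z) in B by reflexivity.
    apply Rabs_le_between in A. apply Rabs_le_between in B. lra.
Qed.

Lemma Rinv_le_gap r x : 0 < r -> r <= x -> / x <= / r.
Proof. intros. apply Rinv_le_contravar; lra. Qed.

Lemma Cinv_gap (r : R) (w : C) : 0 < r -> r <= Cmod w -> w <> RtoC 0 /\ Cmod (/ w) <= / r.
Proof.
  intros Hr H. assert (w <> RtoC 0) by (apply Cmod_neq0; lra). split; auto.
  rewrite Cmod_inv by auto. now apply Rinv_le_gap.
Qed.

Lemma prod_le_compat4 a b c d A B Cc D : 0 <= a -> 0 <= b -> 0 <= c -> 0 <= d ->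
  a <= A -> b <= B -> c <= Cc -> d <= D -> a * b * c * d <= A * B * Cc * D.
Proof. intros. repeat apply Rmult_le_compat; try assumption; repeat apply Rmult_le_pos; assumption. Qed.

Lemma cauchy_type_cder k z a b c d : a < Re z < b -> c < Im z < d ->
  (forall s, onR a b c d s -> ccont k s) ->
  cder (fun y => Rect (fun s => k s / (s - y))%C a b c d) z (Rect (fun s => k s / ((s - z) * (s - z)))%C a b c d).
Proof.
  intros Hx Hy Hk. destruct (rect_gap z a b c d Hx Hy) as [r [Hr [G1 G2]]].
  destruct (onR_bounded k a b c d ltac:(lra) ltac:(lra) Hk) as [M [HM B]].
  assert (Ir : 0 < / r) by now apply Rinv_0_lt_compat.
  assert (Hz : Cmod (z - z) < r) by (rewrite Cmod_self; lra).
  assert (G : forall s y, onR a b c d s -> Cmod (y - z) < r -> (s - y)%C <> RtoC 0 /\ Cmod (/ (s - y)) <= / r).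
  { intros s y Hs Hyz. apply Cinv_gap; auto. }
  apply (Rect_param (fun s y => k s / (s - y))%C _ z a b c d (M * / r * / r * / r) r); try lra.
  - repeat apply Rmult_lt_0_compat; auto.
  - intros y Hyz s Hs. apply ccont_div; auto with holo. now apply G.
  - intros s Hs. apply ccont_div; auto with holo. apply Cmult_neq_0; now apply G.
  - intros y Hyz s Hs. destruct (G s y Hs Hyz) as [N1 L1]. destruct (G s z Hs Hz) as [N2 L2].
    replace (k s / (s - y) - k s / (s - z) - (y - z) * (k s / ((s - z) * (s - z))))%C with
      (((y - z) * (y - z)) * (k s * / (s - y) * / (s - z) * / (s - z)))%C by (field; auto).
    rewrite Cmod_mult, (Cmod_mult (y - z)). rewrite Rmult_comm.
    apply Rmult_le_compat_r. apply Rmult_le_pos; apply Cmod_ge_0.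
    rewrite !Cmod_mult. apply prod_le_compat4; auto using Cmod_ge_0.
Qed.

(** This kernel is the derivative of the Cauchy kernel, so the lemma says that derivatives of Cauchy
    integrals are again differentiable. *)
Lemma cauchy_type2_hol k z a b c d : a < Re z < b -> c < Im z < d ->
  (forall s, onR a b c d s -> ccont k s) ->
  hol (fun y => Rect (fun s => k s / ((s - y) * (s - y)))%C a b c d) z.
Proof.
  intros Hx Hy Hk. destruct (rect_gap z a b c d Hx Hy) as [r [Hr [G1 G2]]].
  destruct (onR_bounded k a b c d ltac:(lra) ltac:(lra) Hk) as [M [HM B]].
  assert (Ir : 0 < / r) by now apply Rinv_0_lt_compat.
  assert (Hz : Cmod (z - z) < r) by (rewrite Cmod_self; lra).
  assert (G : forall s y, onR a b c d s -> Cmod (y - z) < r -> (s - y)%C <> RtoC 0 /\ Cmod (/ (s - y)) <= / r).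
  { intros s y Hs Hyz. apply Cinv_gap; auto. }
  eexists.
  apply (Rect_param (fun s y => k s / ((s - y) * (s - y)))%C
    (fun s => RtoC 2 * k s / ((s - z) * (s - z) * (s - z)))%C z a b c d (M * / r * / r * (3 * / r * / r)) r); try lra.
  - repeat apply Rmult_lt_0_compat; auto. lra.
  - intros y Hyz s Hs. apply ccont_div; auto with holo. apply Cmult_neq_0; now apply G.
  - intros s Hs. apply ccont_div; auto with holo. repeat apply Cmult_neq_0; now apply G.
  - intros y Hyz s Hs. destruct (G s y Hs Hyz) as [N1 L1]. destruct (G s z Hs Hz) as [N2 L2].
    replace (k s / ((s - y) * (s - y)) - k s / ((s - z) * (s - z)) - (y - z) * (2 * k s / ((s - z) * (s - z) * (s - z))))%C with
      (((y - z) * (y - z)) * (k s * / (s - y) * / (s - z) * (/ (s - z) * / (s - y) + RtoC 2 * / (s - z) * / (s - z))))%C by (field; auto).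
    rewrite Cmod_mult, (Cmod_mult (y - z)). rewrite Rmult_comm.
    apply Rmult_le_compat_r. apply Rmult_le_pos; apply Cmod_ge_0.
    rewrite !Cmod_mult. apply prod_le_compat4; auto using Cmod_ge_0.
    eapply Rle_trans; [apply Cmod_triangle|]. rewrite !Cmod_mult, Cmod_R, Rabs_right by lra.
    assert (P1 := Cmod_ge_0 (/ (s - y))). assert (P2 := Cmod_ge_0 (/ (s - z))).
    assert (Cmod (/ (s - z)) * Cmod (/ (s - y)) <= / r * / r) by (apply Rmult_le_compat; auto).

    nra.
Qed.

Lemma disc_square c r : 0 < r -> forall s, inR (Re c - r) (Re c + r) (Im c - r) (Im c + r) s -> Cmod (s - c) <= 2 * r.
Proof.
  intros Hr s Hs. eapply Rle_trans; [apply Cmod_le_Re_Im|].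
  replace (Re (s - c)) with (Re s - Re c) by reflexivity.
  replace (Im (s - c)) with (Im s - Im c) by reflexivity.
  unfold inR in Hs.
  assert (Rabs (Re s - Re c) <= r) by (apply Rabs_le; lra).
  assert (Rabs (Im s - Im c) <= r) by (apply Rabs_le; lra). lra.
Qed.

Lemma near_square z (P : C -> Prop) : near z P -> exists r, 0 < r /\
  forall s, inR (Re z - r) (Re z + r) (Im z - r) (Im z + r) s -> P s.
Proof.
  intros [d [Hd H]]. exists (d / 4). split; [lra|]. intros s Hs. apply H.
  assert (D := disc_square z (d / 4) ltac:(lra) s Hs). lra.
Qed.

Lemma near_hol_cauchy h z : near z (hol h) -> exists r, 0 < r /\
  (forall s, inR (Re z - r) (Re z + r) (Im z - r) (Im z + r) s -> hol h s) /\
  near z (fun y => h y = (/ twopii * Rect (fun s => h s / (s - y)) (Re z - r) (Re z + r) (Im z - r) (Im z + r))%C) /\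
  near z (fun y => C_derive h y = (/ twopii * Rect (fun s => h s / ((s - y) * (s - y))) (Re z - r) (Re z + r) (Im z - r) (Im z + r))%C).
Proof.
  intros H. destruct (near_square z _ H) as [r [Hr HS]]. exists r.
  assert (HF : forall y, Cmod (y - z) < r -> h y = (/ twopii * Rect (fun s => h s / (s - y)) (Re z - r) (Re z + r) (Im z - r) (Im z + r))%C).
  { intros y Hy.
    assert (A := Re_le_Cmod (y - z)). assert (B := Im_le_Cmod (y - z)).
    replace (Re (y - z)) with (Re y - Re z) in A by reflexivity.
    replace (Im (y - z)) with (Im y - Im z) in B by reflexivity.
    apply Rabs_le_between in A. apply Rabs_le_between in B.
    rewrite (cauchy_formula h y); try lra; auto. rewrite Cmult_assoc, Cinv_l, Cmult_1_l; auto.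
    apply twopii_neq0. }
  split; [exact Hr|]. split; [exact HS|]. split; [exists r; split; auto|].
  exists r. split; auto. intros y Hy.
  assert (A := Re_le_Cmod (y - z)). assert (B := Im_le_Cmod (y - z)).
  replace (Re (y - z)) with (Re y - Re z) in A by reflexivity.
  replace (Im (y - z)) with (Im y - Im z) in B by reflexivity.
  apply Rabs_le_between in A. apply Rabs_le_between in B.
  apply cder_C_derive.
  apply cder_ext_near with (fun y => / twopii * Rect (fun s => h s / (s - y)) (Re z - r) (Re z + r) (Im z - r) (Im z + r))%C.
  - generalize (near_ball y z r Hy). apply near_mono. intros x Hx. symmetry. auto.
  - apply cder_scal. apply cauchy_type_cder; try lra. intros s Hs. apply hol_ccont, HS, Hs.
Qed.

Theorem hol_C_derive h z : near z (hol h) -> hol (C_derive h) z.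
Proof.
  intros H. destruct (near_hol_cauchy h z H) as [r [Hr [HS [_ H2]]]].
  apply hol_ext_near with (fun y => / twopii * Rect (fun s => h s / ((s - y) * (s - y))) (Re z - r) (Re z + r) (Im z - r) (Im z + r))%C.
  - revert H2. apply near_mono. auto.
  - apply hol_scal. apply cauchy_type2_hol; try lra. intros s Hs. apply hol_ccont, HS, Hs.
Qed.

(** Division of h - h(p) by z - p. It takes over the role of power series: Taylor remainders,
    removable singularities and Schwarz-type estimates all go through it. *)
Definition dquot (h : C -> C) (p : C) : C -> C := slope h p (C_derive h p).

Lemma dquot_eq h p z : (h z = h p + (z - p) * dquot h p z)%C.
Proof. apply slope_eq. Qed.

(** Near p the quotient is itself a Cauchy integral, with density h(s)/(s - p); at p the same
    integral gives the derivative. So the singularity is removable. *)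
Theorem dquot_hol h p z : near z (hol h) -> near p (hol h) -> hol (dquot h p) z.
Proof.
  intros Hz H. destruct (Ceq_dec z p) as [->|N].
  2: { apply slope_hol_off; auto. now apply near_self in Hz. }
  destruct (near_hol_cauchy h p H) as [r [Hr [HS [H1 H2]]]].
  set (a := Re p - r) in *. set (b := Re p + r) in *. set (c := Im p - r) in *. set (d := Im p + r) in *.
  assert (Hp1 : a < Re p < b) by (unfold a, b; lra). assert (Hp2 : c < Im p < d) by (unfold c, d; lra).
  destruct (rect_gap p a b c d Hp1 Hp2) as [g [Hg [G1 G2]]].
  assert (Hpp : Cmod (p - p) < g) by (rewrite Cmod_self; lra).
  assert (G : forall s y, onR a b c d s -> Cmod (y - p) < g -> (s - y)%C <> RtoC 0).
  { intros s y Hs Hyz. eapply Cinv_gap; eauto. }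
  assert (HC : forall s, onR a b c d s -> ccont h s) by (intros s Hs; apply hol_ccont, HS, Hs).
  apply hol_ext_near with (fun y => / twopii * Rect (fun s => (h s / (s - p)) / (s - y)) a b c d)%C.
  - assert (NG : near p (fun y => Cmod (y - p) < g)) by (exists g; auto).
    generalize (near_and _ _ _ NG H1). apply near_mono. intros y [Hy1 Hy2].
    unfold dquot, slope. destruct (Ceq_dec y p) as [->|N].
    + apply near_self in H2. rewrite H2. f_equal. apply Rect_ext; try lra.
      intros s Hs. field. now apply G.
    + apply near_self in H1. rewrite Hy2, H1 at 1.
      replace ((/ twopii * Rect (fun s => h s / (s - y)) a b c d - / twopii * Rect (fun s => h s / (s - p)) a b c d) / (y - p))%C
       with (/ twopii * (/ (y - p) * (Rect (fun s => h s / (s - y)) a b c d - Rect (fun s => h s / (s - p)) a b c d)))%C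
       by (field; split; [apply twopii_neq0|now apply Csub_neq0]).
      f_equal. rewrite <- Rect_minus, <- Rect_scal; try lra.
      * apply Rect_ext; try lra. intros s Hs. field. repeat split; try now apply G. now apply Csub_neq0.
      * intros s Hs. apply ccont_minus; apply ccont_div; auto with holo; now apply G.
      * intros s Hs. apply ccont_div; auto with holo; now apply G.
      * intros s Hs. apply ccont_div; auto with holo; now apply G.
  - apply hol_scal. eexists. apply cauchy_type_cder; auto. intros s Hs.
    apply ccont_div; auto with holo.
Qed.

Lemma dquot_near_hol h p z : near z (hol h) -> near p (hol h) -> near z (hol (dquot h p)).
Proof.
  intros Hz Hp. generalize (near_near _ _ Hz). apply near_mono. intros y Hy. now apply dquot_hol.
Qed.

(** Cauchy's formula on a square of perimeter 8r with the kernel at most 1/rho; division by 2 pi > 4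
    leaves the factor 2r/rho. *)
Lemma interior_bound h c r z M rho : 0 < rho -> 0 <= M ->
  (forall s, inR (Re c - r) (Re c + r) (Im c - r) (Im c + r) s -> hol h s) ->
  (forall s, onR (Re c - r) (Re c + r) (Im c - r) (Im c + r) s -> Cmod (h s) <= M) ->
  Cmod (z - c) <= r - rho -> Cmod (h z) <= 2 * r / rho * M.
Proof.
  intros Hrho HM HS HB Hz.

  assert (A := Re_le_Cmod (z - c)). assert (B := Im_le_Cmod (z - c)).
  replace (Re (z - c)) with (Re z - Re c) in A by reflexivity.
  replace (Im (z - c)) with (Im z - Im c) in B by reflexivity.
  apply Rabs_le_between in A. apply Rabs_le_between in B.
  assert (E := cauchy_formula h z (Re c - r) (Re c + r) (Im c - r) (Im c + r) ltac:(lra) ltac:(lra) HS).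
  set (a := Re c - r) in *. set (b := Re c + r) in *. set (cc := Im c - r) in *. set (d := Im c + r) in *.
  assert (G : forall s, onR a b cc d s -> (s - z)%C <> RtoC 0 /\ Cmod (/ (s - z)) <= / rho).
  { intros s Hs. apply Cinv_gap; auto. apply (onR_dist z a b cc d); auto; unfold a, b, cc, d; lra. }
  assert (L : Cmod (Rect (fun s => h s / (s - z)) a b cc d)%C <= 2 * (M * / rho) * ((b - a) + (d - cc))).
  { apply Rect_bound; try (unfold a, b, cc, d; lra).
    - intros s Hs. apply ccont_div; auto with holo. now apply G. apply hol_ccont, HS, Hs.
    - intros s Hs. unfold Cdiv. rewrite Cmod_mult. apply Rmult_le_compat; auto using Cmod_ge_0. now apply G. }
  rewrite E, Cmod_mult, Cmod_twopii in L.
  replace (2 * (M * / rho) * ((b - a) + (d - cc))) with (4 * (2 * r / rho * M)) in L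
    by (unfold a, b, cc, d; field; lra).
  assert (Q : 0 <= 2 * r / rho * M).
  { repeat apply Rmult_le_pos; try lra. apply Rlt_le, Rinv_0_lt_compat; lra. }
  assert (PI2 := PI2_1). nra.
Qed.

(** A substitute for the maximum principle: the boundary of the square of half-side r lies in the
    annulus, so control there suffices for the bound inside. *)
Lemma interior_bound_half h c r M z : 0 < r -> 0 <= M ->
  (forall s, Cmod (s - c) <= 2 * r -> hol h s) ->
  (forall s, r <= Cmod (s - c) <= 2 * r -> Cmod (h s) <= M) ->
  Cmod (z - c) <= r / 2 -> Cmod (h z) <= 4 * M.
Proof.
  intros Hr HM HS HB Hz.
  replace (4 * M) with (2 * r / (r / 2) * M) by (field; lra).
  apply (interior_bound h c r z M (r / 2)); auto; try lra.
  - intros s Hs. apply HS. now apply disc_square.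
  - intros s Hs. apply HB. split.
    + apply (onR_dist c _ _ _ _ _ _ Hs); lra.
    + apply disc_square, Hs. lra.
Qed.

(** Subtracting the Cauchy formulas for y and z leaves the factor (y - z)/((s - y)(s - z)) under the
    integral. *)
Lemma cauchy_lipschitz h c r M y z : 0 < r -> 0 <= M ->
  (forall s, Cmod (s - c) <= 2 * r -> hol h s) ->
  (forall s, Cmod (s - c) <= 2 * r -> Cmod (h s) <= M) ->
  Cmod (y - c) <= r / 2 -> Cmod (z - c) <= r / 2 -> Cmod (h y - h z) <= 8 * M / r * Cmod (y - z).
Proof.
  intros Hr HM HS HB Hy Hz.
  assert (HSq : forall s, inR (Re c - r) (Re c + r) (Im c - r) (Im c + r) s -> hol h s).
  { intros s Hs. apply HS. now apply disc_square. }
  assert (IN : forall y, Cmod (y - c) <= r / 2 -> Re c - r / 2 <= Re y <= Re c + r / 2 /\ Im c - r / 2 <= Im y <= Im c + r / 2).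
  { intros x Hx. assert (A := Re_le_Cmod (x - c)). assert (B := Im_le_Cmod (x - c)).
    replace (Re (x - c)) with (Re x - Re c) in A by reflexivity.
    replace (Im (x - c)) with (Im x - Im c) in B by reflexivity.
    apply Rabs_le_between in A. apply Rabs_le_between in B. lra. }
  destruct (IN y Hy) as [Y1 Y2]. destruct (IN z Hz) as [Z1 Z2].
  assert (Ey := cauchy_formula h y (Re c - r) (Re c + r) (Im c - r) (Im c + r) ltac:(lra) ltac:(lra) HSq).
  assert (Ez := cauchy_formula h z (Re c - r) (Re c + r) (Im c - r) (Im c + r) ltac:(lra) ltac:(lra) HSq).
  set (a := Re c - r) in *. set (b := Re c + r) in *. set (cc := Im c - r) in *. set (d := Im c + r) in *.
  assert (Hr2 : 0 < r / 2) by lra.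
  assert (G : forall x s, Cmod (x - c) <= r / 2 -> onR a b cc d s -> (s - x)%C <> RtoC 0 /\ Cmod (/ (s - x)) <= / (r / 2)).
  { intros x s Hx Hs. destruct (IN x Hx). apply Cinv_gap; auto. apply (onR_dist x a b cc d); auto; unfold a, b, cc, d; lra. }
  assert (HC : forall x, Cmod (x - c) <= r / 2 -> forall s, onR a b cc d s -> ccont (fun s => h s / (s - x))%C s).
  { intros x Hx s Hs. apply ccont_div; auto with holo. now apply G. apply hol_ccont, HSq, Hs. }
  assert (E : (twopii * (h y - h z))%C = Rect (fun s => h s / (s - y) - h s / (s - z))%C a b cc d).
  { rewrite Rect_minus; auto; try (unfold a, b, cc, d; lra). rewrite Ey, Ez. ring. }
  assert (L : Cmod (twopii * (h y - h z)) <= 2 * (M * Cmod (y - z) * / (r / 2) * / (r / 2)) * ((b - a) + (d - cc))).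
  { rewrite E. apply Rect_bound; try (unfold a, b, cc, d; lra).
    - intros s Hs. apply ccont_minus; auto.
    - intros s Hs. destruct (G y s Hy Hs) as [N1 L1]. destruct (G z s Hz Hs) as [N2 L2].
      replace (h s / (s - y) - h s / (s - z))%C with (h s * (y - z) * / (s - y) * / (s - z))%C by (field; auto).
      rewrite !Cmod_mult. apply prod_le_compat4; auto using Cmod_ge_0; try lra.
      apply HB. apply disc_square, Hs; lra. }
  rewrite Cmod_mult, Cmod_twopii in L.
  replace (2 * (M * Cmod (y - z) * / (r / 2) * / (r / 2)) * ((b - a) + (d - cc))) with (4 * (8 * M / r * Cmod (y - z))) in L
    by (unfold a, b, cc, d; field; lra).
  assert (Q : 0 <= 8 * M / r * Cmod (y - z)).
  { repeat apply Rmult_le_pos; try lra; auto using Cmod_ge_0. apply Rlt_le, Rinv_0_lt_compat; lra. }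
  assert (PI2 := PI2_1). nra.
Qed.

(** * Taylor polynomials and the identity theorem *)

(** Iterated division by z - p. The value of [dq h p k] at p is the k-th Taylor coefficient, and
    [dq h p k] is the k-th Taylor remainder divided by (z - p)^k. *)
Definition dq (h : C -> C) (p : C) (k : nat) : C -> C := Nat.iter k (fun g => dquot g p) h.

Lemma dq_S h p k : dq h p (S k) = dquot (dq h p k) p.
Proof. reflexivity. Qed.

Lemma dq_near_hol h p z k : near z (hol h) -> near p (hol h) -> near z (hol (dq h p k)).
Proof.
  intros Hz Hp. enough (near z (hol (dq h p k)) /\ near p (hol (dq h p k))) by tauto.
  induction k; [auto|]. rewrite dq_S. destruct IHk. split; now apply dquot_near_hol.
Qed.

Lemma dquot_zero h p : near p (fun y => h y = RtoC 0) -> near p (fun y => dquot h p y = RtoC 0).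
Proof.
  intros H. assert (D : C_derive h p = RtoC 0).
  { apply cder_C_derive. apply cder_ext_near with (fun _ => RtoC 0); [|apply cder_const].
    revert H. apply near_mono. auto. }
  assert (H0 := near_self _ _ H). revert H. apply near_mono. intros y Hy.
  unfold dquot, slope. destruct (Ceq_dec y p); [exact D|]. rewrite Hy, H0.
  unfold Cdiv. ring.
Qed.

Lemma dq_zero h p k : near p (fun y => h y = RtoC 0) -> near p (fun y => dq h p k y = RtoC 0) /\
  forall z, (h z = Cpow (z - p) k * dq h p k z)%C.
Proof.
  intros H. induction k.
  - split; [exact H|]. intros z. simpl. unfold dq; simpl. ring.
  - destruct IHk as [I1 I2]. rewrite dq_S. split; [now apply dquot_zero|].
    intros z. rewrite I2, (dquot_eq (dq h p k) p z). rewrite (near_self _ _ I1). simpl. ring.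
Qed.

Lemma pow_to_0 q e : 0 <= q < 1 -> 0 < e -> exists k, q ^ k < e.
Proof.
  intros Hq He. destruct (pow_lt_1_zero q ltac:(rewrite Rabs_right; lra) e He) as [N HN].
  exists N. specialize (HN N (Nat.le_refl N)). rewrite Rabs_right in HN; auto.
  apply Rle_ge, pow_le; lra.
Qed.

(** If h vanishes near p, then h = (z - p)^k [dq h p k] for every k. The quotient is at most M/r^k
    on the boundary of the square, so |h(z)| is at most a constant times (|z - p|/r)^k. *)
Theorem identity_square h p r z :
  (forall s, inR (Re p - r) (Re p + r) (Im p - r) (Im p + r) s -> near s (hol h)) ->
  near p (fun y => h y = RtoC 0) -> Cmod (z - p) < r -> h z = RtoC 0.
Proof.
  intros HS H0 Hz. assert (Hr : 0 < r) by (assert (P := Cmod_ge_0 (z - p)); lra).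
  set (q := Cmod (z - p) / r).
  assert (Hq : 0 <= q < 1).
  { unfold q. split. apply Rmult_le_pos; [apply Cmod_ge_0|]. apply Rlt_le, Rinv_0_lt_compat; lra.
    apply Rmult_lt_reg_r with r; auto. unfold Rdiv. rewrite Rmult_assoc, Rinv_l; lra. }
  assert (HC : forall s, onR (Re p - r) (Re p + r) (Im p - r) (Im p + r) s -> ccont h s).
  { intros s [Hs _]. now apply hol_ccont, near_self, HS. }
  destruct (onR_bounded h (Re p - r) (Re p + r) (Im p - r) (Im p + r) ltac:(lra) ltac:(lra) HC) as [M [HM B]].
  set (rho := r - Cmod (z - p)). assert (Hrho : 0 < rho) by (unfold rho; lra).
  assert (Hp : near p (hol h)) by (apply HS; unfold inR; lra).
  assert (K : forall k, Cmod (h z) <= 2 * r / rho * M * q ^ k).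
  { intros k. destruct (dq_zero h p k H0) as [_ E]. rewrite E, Cmod_mult, Cmod_pow.
    assert (Pr : 0 < r ^ k) by now apply pow_lt.
    assert (Bk := interior_bound (dq h p k) p r z (M * / r ^ k) rho Hrho).
    assert (Q : Cmod (dq h p k z) <= 2 * r / rho * (M * / r ^ k)).
    { apply Bk.
      - apply Rmult_le_pos; [lra|]. apply Rlt_le, Rinv_0_lt_compat; lra.
      - intros s Hs. apply near_self. apply dq_near_hol; auto.
      - intros s Hs. specialize (B s Hs). rewrite E, Cmod_mult, Cmod_pow in B.
        assert (G : r <= Cmod (s - p)) by (apply (onR_dist p _ _ _ _ r s Hs); lra).
        assert (G2 : r ^ k <= Cmod (s - p) ^ k) by (apply pow_incr; lra).

        apply Rmult_le_reg_r with (r ^ k); auto. rewrite Rmult_assoc, Rinv_l by lra. nra.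
      - unfold rho; lra. }
    apply Rle_trans with (Cmod (z - p) ^ k * (2 * r / rho * (M * / r ^ k))).
    - apply Rmult_le_compat_l; [|exact Q]. apply pow_le, Cmod_ge_0.
    - right. unfold q, Rdiv. rewrite Rpow_mult_distr, pow_inv. ring. }
  apply Cmod_eq_0. apply Rle_antisym; [|apply Cmod_ge_0]. apply Rnot_lt_le. intros L.
  set (A := 2 * r / rho * M) in *.
  assert (HA : 0 < A).
  { unfold A. repeat apply Rmult_lt_0_compat; try lra. now apply Rinv_0_lt_compat. }
  destruct (pow_to_0 q (Cmod (h z) / A) Hq) as [k Hk]. apply Rdiv_lt_0_compat; lra.
  specialize (K k). assert (A * q ^ k < A * (Cmod (h z) / A)) by (apply Rmult_lt_compat_l; lra).
  replace (A * (Cmod (h z) / A)) with (Cmod (h z)) in H by (field; lra). lra.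
Qed.

Lemma entire_near h z : (forall y, hol h y) -> near z (hol h).
Proof. intros H. apply near_true. exact H. Qed.

Lemma entire_zero h p : (forall z, hol h z) -> near p (fun y => h y = RtoC 0) -> forall z, h z = RtoC 0.
Proof.
  intros H H0 z. apply (identity_square h p (Cmod (z - p) + 1)); auto; [|lra].
  intros s _. now apply entire_near.
Qed.

Lemma Cmult_integral (a b : C) : (a * b)%C = RtoC 0 -> a <> RtoC 0 -> b = RtoC 0.
Proof.
  intros H Ha. destruct (Ceq_dec b 0) as [E|E]; auto. now destruct (Cmult_neq_0 a b Ha E).
Qed.

(** Near [p] the factor [f] has no zero, so [g] vanishes there and the identity theorem does the
    rest. *)
Lemma entire_domain f g p : (forall z, hol f z) -> (forall z, hol g z) ->
  (forall z, (f z * g z)%C = RtoC 0) -> f p <> RtoC 0 -> forall z, g z = RtoC 0.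
Proof.
  intros Hf Hg H Hp. apply (entire_zero g p Hg).
  generalize (ccont_near_neq f p _ (hol_ccont _ _ (Hf p)) Hp). apply near_mono.
  intros y Hy. now apply (Cmult_integral (f y)).
Qed.

Lemma RtoC_neq0 x : x <> 0 -> RtoC x <> RtoC 0.
Proof. intros H E. injection E. auto. Qed.

Lemma dq_hol h k : (forall z, hol h z) -> forall z, hol (dq h 0 k) z.
Proof. intros H z. apply near_self, dq_near_hol; now apply entire_near. Qed.

Lemma C_derive_n_hol h k : (forall z, hol h z) -> forall z, hol (C_derive_n h k) z.
Proof.
  intros H. induction k; [exact H|]. intros z. change (hol (C_derive (C_derive_n h k)) z).
  apply hol_C_derive. now apply entire_near.
Qed.

(** Leibniz's rule for h = h(0) + z [dquot h 0]; only the first derivative of the factor z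
    survives. *)
Lemma C_derive_n_dquot h k z : (forall z, hol h z) ->
  (C_derive_n h (S k) z = z * C_derive_n (dquot h 0) (S k) z + RtoC (INR (S k)) * C_derive_n (dquot h 0) k z)%C.
Proof.
  intros H. assert (Hg : forall z, hol (dquot h 0) z) by (apply (dq_hol h 1 H)).
  revert z. induction k; intros z.
  - change (C_derive_n h 1 z) with (C_derive h z). apply cder_C_derive.
    apply cder_ext with (fun y => h (RtoC 0) + y * dquot h 0 y)%C.
    + intros y. etransitivity; [|symmetry; apply (dquot_eq h 0 y)]. ring.
    + eapply cder_eq. apply cder_plus; [apply cder_const|]. apply cder_mult; [apply cder_id|].
      apply hol_cder, Hg. simpl. unfold C_derive_n; simpl. ring.
  - change (C_derive_n h (S (S k)) z) with (C_derive (C_derive_n h (S k)) z). apply cder_C_derive.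
    apply cder_ext with (fun z => z * C_derive_n (dquot h 0) (S k) z + RtoC (INR (S k)) * C_derive_n (dquot h 0) k z)%C.
    + intros y. now rewrite IHk.
    + eapply cder_eq. apply cder_plus.
      apply cder_mult; [apply cder_id|]. apply hol_cder. now apply C_derive_n_hol.
      apply cder_scal. apply hol_cder. now apply C_derive_n_hol.
      change (C_derive (C_derive_n (dquot h 0) (S k)) z) with (C_derive_n (dquot h 0) (S (S k)) z).
      change (C_derive (C_derive_n (dquot h 0) k) z) with (C_derive_n (dquot h 0) (S k) z).
      rewrite (S_INR (S k)), RtoC_plus. ring.
Qed.

(** At 0 the previous lemma lowers the order by one and produces the factor k + 1 of the
    factorial. *)
Lemma C_derive_n_coef k : forall h, (forall z, hol h z) ->
  (C_derive_n h k 0 / RtoC (INR (fact k)))%C = dq h 0 k 0.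
Proof.
  induction k; intros h H.
  - unfold C_derive_n, dq; simpl. field.
  - rewrite C_derive_n_dquot by auto.
    replace (dq h 0 (S k)) with (dq (dquot h 0) 0 k).
    + rewrite <- IHk by (apply (dq_hol h 1 H)).
      replace (fact (S k)) with (S k * fact k)%nat by reflexivity. rewrite mult_INR, RtoC_mult.
      field. split; apply RtoC_neq0; [apply INR_fact_neq_0|now apply not_0_INR].
    + unfold dq. symmetry. apply Nat.iter_succ_r.
Qed.

Theorem taylor_remainder h m z : (forall z, hol h z) ->
  (h z = taylor_poly h m z + Cpow z (S m) * dq h 0 (S m) z)%C.
Proof.
  intros H. induction m.
  - unfold taylor_poly. rewrite sum_O, C_derive_n_coef by auto. rewrite (dquot_eq h 0 z) at 1.
    simpl. unfold dq; simpl. ring.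
  - rewrite IHm at 1. unfold taylor_poly. rewrite sum_Sn. change plus with Cplus.
    rewrite C_derive_n_coef by auto. rewrite (dq_S h 0 (S m)).
    rewrite (dquot_eq (dq h 0 (S m)) 0 z) at 1. simpl. ring.
Qed.

Lemma odd_zero g : ccont g 0 -> (forall z, z <> RtoC 0 -> g (- z)%C = (- g z)%C) -> g (RtoC 0) = RtoC 0.
Proof.
  intros Hc Ho. apply NNPP. intros N.
  destruct (Hc (Cmod (g (RtoC 0))) ltac:(now apply Cmod_gt_0)) as [d [Hd H]].
  set (u := RtoC (d / 2)).
  assert (Hu : u <> RtoC 0) by (intros E; injection E; lra).
  assert (U : Cmod u = d / 2) by (unfold u; rewrite Cmod_R, Rabs_right; lra).
  assert (H1 := H u ltac:(replace (u - 0)%C with u by ring; lra)).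
  assert (H2 := H (- u)%C ltac:(replace (- u - 0)%C with (- u)%C by ring; rewrite Cmod_opp; lra)).
  rewrite Ho in H2 by auto.
  assert (T := Cmod_triangle (g u - g (RtoC 0)) (- g u - g (RtoC 0))).
  replace (g u - g (RtoC 0) + (- g u - g (RtoC 0)))%C with (- (RtoC 2 * g (RtoC 0)))%C in T by ring.
  rewrite Cmod_opp, Cmod_mult, Cmod_R, Rabs_right in T; lra.
Qed.

Lemma Copp_neq0 (z : C) : z <> RtoC 0 -> (- z)%C <> RtoC 0.
Proof. intros H E. apply H. replace z with (- - z)%C by ring. rewrite E. ring. Qed.

Lemma dquot_off h p z : z <> p -> dquot h p z = ((h z - h p) / (z - p))%C.
Proof. intros H. unfold dquot, slope. destruct (Ceq_dec z p); congruence. Qed.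

Lemma dquot_even_odd h : (forall z, hol h z) -> (forall z, h (- z)%C = h z) ->
  dquot h 0 0 = RtoC 0 /\ forall z, dquot h 0 (- z)%C = (- dquot h 0 z)%C.
Proof.
  intros H He.
  assert (A : forall z, z <> RtoC 0 -> dquot h 0 (- z)%C = (- dquot h 0 z)%C).
  { intros z Hz. rewrite !dquot_off; auto using Copp_neq0. rewrite He. field. auto. }
  assert (Z : dquot h 0 0 = RtoC 0).
  { apply odd_zero; auto. apply hol_ccont, (dq_hol h 1 H). }
  split; [exact Z|]. intros z. destruct (Ceq_dec z 0) as [->|N]; auto.
  replace (- 0)%C with (RtoC 0) by ring. rewrite Z. ring.
Qed.

Lemma dquot_odd_even h : (forall z, h (- z)%C = (- h z)%C) -> h (RtoC 0) = RtoC 0 ->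
  forall z, dquot h 0 (- z)%C = dquot h 0 z.
Proof.
  intros Ho H0 z. destruct (Ceq_dec z 0) as [->|N].
  - f_equal. ring.
  - rewrite !dquot_off; auto using Copp_neq0. rewrite Ho, H0. field. auto.
Qed.

(** Division by z alternates between even and odd functions, and an odd continuous function vanishes
    at 0. *)
Lemma dq_even h j : (forall z, hol h z) -> (forall z, h (- z)%C = h z) ->
  (forall z, dq h 0 (2 * j) (- z)%C = dq h 0 (2 * j) z) /\ dq h 0 (S (2 * j)) 0 = RtoC 0.
Proof.
  intros H He. assert (E : forall z, dq h 0 (2 * j) (- z)%C = dq h 0 (2 * j) z).
  { induction j; [exact He|]. replace (2 * S j)%nat with (S (S (2 * j))) by lia.
    rewrite !dq_S. destruct (dquot_even_odd (dq h 0 (2 * j))) as [A B]; auto. now apply dq_hol.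
    now apply dquot_odd_even. }
  split; [exact E|]. rewrite dq_S. apply dquot_even_odd; auto. now apply dq_hol.
Qed.

Lemma taylor_even_eq h n z : (1 <= n)%nat -> (forall z, hol h z) -> (forall z, h (- z)%C = h z) ->
  taylor_poly h (2 * n - 2) z = taylor_poly h (2 * n - 1) z.
Proof.
  intros Hn H He. destruct n as [|n]; [lia|].
  replace (2 * S n - 2)%nat with (2 * n)%nat by lia.
  replace (2 * S n - 1)%nat with (S (2 * n)) by lia.
  unfold taylor_poly. rewrite sum_Sn. rewrite C_derive_n_coef by auto.
  destruct (dq_even h n H He) as [_ ->].
  match goal with |- ?a = plus ?a ?b => change (a = Cplus a b) end. symmetry.
  rewrite Cmult_0_l. apply Cplus_0_r.
Qed.

(** * The complex exponential *)

Lemma Cexp_plus a b : Cexp (a + b) = (Cexp a * Cexp b)%C.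
Proof.
  unfold Cexp. destruct a as [x y], b as [u v]. unfold Re, Im; simpl.
  rewrite exp_plus, cos_plus, sin_plus. unfold Cmult; simpl. f_equal; ring.
Qed.

Lemma Cexp_0 : Cexp 0 = RtoC 1.
Proof. unfold Cexp, RtoC; simpl. rewrite exp_0, cos_0, sin_0. f_equal; ring. Qed.

Lemma Cmod_Cexp z : Cmod (Cexp z) = exp (Re z).
Proof.
  unfold Cexp, Cmod; simpl fst; simpl snd. set (x := Re z). set (y := Im z).
  replace ((exp x * cos y) ^ 2 + (exp x * sin y) ^ 2) with ((exp x)² * ((sin y)² + (cos y)²)) by (unfold Rsqr; ring).
  rewrite sin2_cos2, Rmult_1_r. apply sqrt_Rsqr, Rlt_le, exp_pos.
Qed.

Lemma Cexp_neq0 z : Cexp z <> RtoC 0.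
Proof. apply Cmod_neq0. rewrite Cmod_Cexp. apply exp_pos. Qed.

Lemma Cexp_RtoC x : Cexp (RtoC x) = RtoC (exp x).
Proof. unfold Cexp, RtoC; simpl. rewrite cos_0, sin_0. f_equal; ring. Qed.

Lemma Cexp_opp z : Cexp (- z) = (/ Cexp z)%C.
Proof.
  assert (H : (Cexp z * Cexp (- z))%C = RtoC 1).
  { rewrite <- Cexp_plus. replace (z + - z)%C with (RtoC 0) by ring. apply Cexp_0. }
  replace (Cexp (- z)) with (/ Cexp z * (Cexp z * Cexp (- z)))%C by (field; apply Cexp_neq0).
  rewrite H. ring.
Qed.

Lemma Cexp_INR n z : Cexp (RtoC (INR n) * z) = Cpow (Cexp z) n.
Proof.
  induction n.
  - simpl. rewrite Cmult_0_l. apply Cexp_0.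
  - rewrite S_INR, RtoC_plus. replace ((INR n + 1) * z)%C with (z + INR n * z)%C by ring.
    rewrite Cexp_plus, IHn. reflexivity.
Qed.

Lemma Re_le_exp z : exp (Re z) <= exp (Cmod z).
Proof.
  assert (A := Re_le_Cmod z). apply Rabs_le_between in A.
  destruct (Rle_lt_or_eq_dec (Re z) (Cmod z)) as [L|E]; [lra| |rewrite E; lra].
  apply Rlt_le, exp_increasing, L.
Qed.

Lemma Rabs_Re_scal t z : 0 <= t <= 1 -> exp (Re (RtoC t * z)) <= exp (Cmod z).
Proof.
  intros Ht. eapply Rle_trans; [apply Re_le_exp|].
  rewrite Cmod_RtoC_mult, Rabs_right by lra. assert (P := Cmod_ge_0 z).
  assert (Q : t * Cmod z <= Cmod z) by nra.
  destruct (Rle_lt_or_eq_dec _ _ Q) as [L|E]; [|rewrite E; lra]. apply Rlt_le, exp_increasing, L.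
Qed.

(** The exponential as the integral of its derivative along a segment; bounding the integrand gives
    the remainder estimates [Cexp_bound1] and [Cexp_bound2]. *)
Lemma Cexp_path z a b : a <= b ->
  CI (fun t => z * Cexp (RtoC t * z))%C a b = (Cexp (RtoC b * z) - Cexp (RtoC a * z))%C.
Proof.
  intros Hab. destruct z as [x y].
  rewrite (CI_ext _ (fun t => (x * (exp (t * x) * cos (t * y)) - y * (exp (t * x) * sin (t * y)),
     x * (exp (t * x) * sin (t * y)) + y * (exp (t * x) * cos (t * y))))); auto.
  - rewrite (CI_pair _ _ (fun t => exp (t * x) * cos (t * y)) (fun t => exp (t * x) * sin (t * y))); auto.
    + unfold Cexp, RtoC, Cminus, Cplus, Copp; simpl. rewrite !Rmult_0_l, !Rminus_0_r, !Rplus_0_r. reflexivity.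
    + intros t _. auto_derive; auto. ring.
    + intros t _. auto_derive; auto. ring.
    + intros t _. apply is_derive_cont_ex. auto_derive. auto.
    + intros t _. apply is_derive_cont_ex. auto_derive. auto.
  - intros t _. unfold Cexp, RtoC, Cmult; simpl. rewrite !Rmult_0_l, !Rminus_0_r, !Rplus_0_r. reflexivity.
Qed.

Lemma rcont_pair (f g : R -> R) t : continuous f t -> continuous g t -> rcont (fun u => (f u, g u)) t.
Proof.
  intros Hf Hg e He.
  assert (E : forall k, continuous k t -> exists d, 0 < d /\ forall u, Rabs (u - t) < d -> Rabs (k u - k t) < e / 2).
  { intros k Hk. assert (He2 : 0 < e / 2) by lra.
    destruct (Hk (ball (k t) (mkposreal _ He2)) (locally_ball _ _)) as [d Hd].
    exists d. split; [apply cond_pos|]. intros u Hu. exact (Hd u Hu). }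
  destruct (E f Hf) as [d1 [P1 H1]]. destruct (E g Hg) as [d2 [P2 H2]].
  exists (Rmin d1 d2). split; [now apply Rmin_pos|]. intros u Hu.
  assert (M1 := Rmin_l d1 d2). assert (M2 := Rmin_r d1 d2).
  specialize (H1 u ltac:(lra)). specialize (H2 u ltac:(lra)).
  eapply Rle_lt_trans; [apply Cmod_le_Re_Im|]. unfold Re, Im; simpl.
  fold (f u - f t) (g u - g t). lra.
Qed.

Lemma rcont_Cexp_path z t : rcont (fun t => Cexp (RtoC t * z)) t.
Proof.
  destruct z as [x y].
  apply rcont_ext with (fun t => (exp (t * x) * cos (t * y), exp (t * x) * sin (t * y))).
  - intros u. unfold Cexp, RtoC, Cmult; simpl. rewrite !Rmult_0_l, !Rminus_0_r, !Rplus_0_r. reflexivity.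
  - apply rcont_pair; apply is_derive_cont_ex; auto_derive; auto.
Qed.

Lemma Cexp_bound1 z : Cmod (Cexp z - 1) <= Cmod z * exp (Cmod z).
Proof.
  assert (E := Cexp_path z 0 1 ltac:(lra)).
  rewrite Cmult_1_l, Cmult_0_l, Cexp_0 in E. rewrite <- E.
  eapply Rle_trans. apply (CI_bound _ (Cmod z * exp (Cmod z))); [lra| | ].
  - intros t _. apply rcont_scal, rcont_Cexp_path.
  - intros t Ht. rewrite Cmod_mult, Cmod_Cexp. apply Rmult_le_compat_l; [apply Cmod_ge_0|].
    now apply Rabs_Re_scal.
  - lra.
Qed.

Lemma Cexp_bound2 z : Cmod (Cexp z - 1 - z) <= Cmod z * Cmod z * exp (Cmod z).
Proof.
  assert (E := Cexp_path z 0 1 ltac:(lra)).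
  rewrite Cmult_1_l, Cmult_0_l, Cexp_0 in E.
  assert (E2 : (Cexp z - 1 - z)%C = CI (fun t => z * Cexp (RtoC t * z) - z)%C 0 1).
  { rewrite CI_minus; try lra.
    - rewrite E, CI_const. rewrite Rminus_0_r. ring.
    - intros t _. apply rcont_scal, rcont_Cexp_path.
    - intros t _. apply rcont_const. }
  rewrite E2. eapply Rle_trans. apply (CI_bound _ (Cmod z * Cmod z * exp (Cmod z))); [lra| | ].
  - intros t _. apply rcont_ext with (fun t => z * Cexp (RtoC t * z) + (- z))%C. intros; ring.
    apply rcont_plus; [|apply rcont_const]. apply rcont_scal, rcont_Cexp_path.
  - intros t Ht. replace (z * Cexp (t * z) - z)%C with (z * (Cexp (t * z) - 1))%C by ring.
    rewrite Cmod_mult, Rmult_assoc. apply Rmult_le_compat_l; [apply Cmod_ge_0|].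
    eapply Rle_trans; [apply Cexp_bound1|]. rewrite Cmod_RtoC_mult, Rabs_right by lra.
    assert (P := Cmod_ge_0 z). assert (Q : t * Cmod z <= Cmod z) by nra.
    apply Rmult_le_compat; auto. apply Rmult_le_pos; lra. apply Rlt_le, exp_pos.
    destruct (Rle_lt_or_eq_dec _ _ Q) as [L|E0]; [|rewrite E0; lra]. apply Rlt_le, exp_increasing, L.
  - lra.
Qed.

Lemma cder_Cexp z : cder Cexp z (Cexp z).
Proof.
  intros e He. assert (P := exp_pos (Re z)). assert (P1 := exp_pos 1).
  set (d := e / (exp (Re z) * exp 1)).
  assert (Hd : 0 < d) by (apply Rdiv_lt_0_compat; [lra|apply Rmult_lt_0_compat; lra]).
  exists (Rmin 1 d). split; [apply Rmin_pos; lra|]. intros y Hy.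
  assert (M1 := Rmin_l 1 d). assert (M2 := Rmin_r 1 d).
  set (w := (y - z)%C) in *. replace (Cexp y) with (Cexp z * Cexp w)%C.
  2: { rewrite <- Cexp_plus. f_equal. unfold w. ring. }
  replace (Cexp z * Cexp w - Cexp z - w * Cexp z)%C with (Cexp z * (Cexp w - 1 - w))%C by ring.
  rewrite Cmod_mult, Cmod_Cexp. assert (B := Cexp_bound2 w). assert (W := Cmod_ge_0 w).
  assert (exp (Cmod w) <= exp 1) by (apply Rlt_le, exp_increasing; lra).
  apply Rle_trans with (exp (Re z) * (Cmod w * Cmod w * exp 1)).
  - apply Rmult_le_compat_l; [lra|]. eapply Rle_trans; [exact B|]. apply Rmult_le_compat_l; nra.
  - replace (exp (Re z) * (Cmod w * Cmod w * exp 1)) with ((exp (Re z) * exp 1) * Cmod w * Cmod w) by ring.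
    apply Rmult_le_compat_r; auto.
    replace e with ((exp (Re z) * exp 1) * d) by (unfold d; field; split; apply Rgt_not_eq; apply exp_pos).
    apply Rmult_le_compat_l; [|lra]. apply Rmult_le_pos; lra.
Qed.

Lemma hol_Cexp h z : hol h z -> hol (fun y => Cexp (h y)) z.
Proof. intros [l H]. eexists. apply (cder_comp Cexp h); eauto. apply cder_Cexp. Qed.

Lemma ccont_Cexp h z : ccont h z -> ccont (fun y => Cexp (h y)) z.
Proof. intros H. apply (ccont_comp Cexp h); auto. eapply cder_ccont, cder_Cexp. Qed.

#[export] Hint Resolve hol_Cexp ccont_Cexp : holo.

Lemma RCpow_Cmod x s : 0 < x -> Cmod (RCpow x s) = Rpower x (Re s).
Proof.
  intros Hx. unfold RCpow. rewrite Cmod_Cexp. unfold Rpower. f_equal.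
  destruct s; unfold Re, RtoC; simpl. ring.
Qed.

Lemma RCpow_real x s : RCpow x (RtoC s) = RtoC (Rpower x s).
Proof. unfold RCpow, Rpower. rewrite <- RtoC_mult. apply Cexp_RtoC. Qed.

Lemma RCpow_neq0 x s : RCpow x s <> RtoC 0.
Proof. apply Cexp_neq0. Qed.

Lemma hol_RCpow x h z : hol h z -> hol (fun y => RCpow x (h y)) z.
Proof. intros H. unfold RCpow. apply hol_Cexp. auto with holo. Qed.
#[export] Hint Resolve hol_RCpow : holo.

Lemma exp_le x y : x <= y -> exp x <= exp y.
Proof. intros H. destruct (Rle_lt_or_eq_dec _ _ H) as [L|E]; [apply Rlt_le, exp_increasing, L|rewrite E; lra]. Qed.

Lemma ln_le x y : 0 < x -> x <= y -> ln x <= ln y.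
Proof. intros Hx H. destruct (Rle_lt_or_eq_dec _ _ H) as [L|E]; [apply Rlt_le, ln_increasing; auto|rewrite E; lra]. Qed.

Lemma rcont_mult f g t : rcont f t -> rcont g t -> rcont (fun t => f t * g t)%C t.
Proof.
  intros Hf Hg e He.
  set (m := Cmod (g t) + 1). assert (Hm : 0 < m) by (unfold m; assert (P := Cmod_ge_0 (g t)); lra).
  destruct (Hg 1 Rlt_0_1) as [d1 [P1 H1]]. destruct (Hf (e / (2 * m)) ltac:(apply Rdiv_lt_0_compat; lra)) as [d2 [P2 H2]].
  destruct (rcont_scal (f t) g t Hg (e / 2) ltac:(lra)) as [d3 [P3 H3]].
  destruct (small_list (d1 :: d2 :: d3 :: nil)) as [d Hd]; [simpl; lra|]. simpl in Hd.
  exists d. split; [lra|]. intros u Hu. specialize (H1 u ltac:(lra)). specialize (H2 u ltac:(lra)). specialize (H3 u ltac:(lra)).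
  replace (f u * g u - f t * g t)%C with ((f u - f t) * g u + (f t * g u - f t * g t))%C by ring.
  eapply Rle_lt_trans; [apply Cmod_triangle|]. rewrite Cmod_mult.
  assert (Hg2 : Cmod (g u) <= m) by (unfold m; assert (R := Cmod_rev (g u) (g t)); lra).
  assert (B : Cmod (f u - f t) * Cmod (g u) <= e / (2 * m) * m) by (apply Rmult_le_compat; auto using Cmod_ge_0; lra).
  replace (e / (2 * m) * m) with (e / 2) in B by (field; lra). lra.
Qed.

(** * Gamma *)

Lemma CI_RtoC g a b : a <= b -> (forall t, a <= t <= b -> continuous g t) ->
  CI (fun t => RtoC (g t)) a b = RtoC (RInt g a b).
Proof.
  intros Hab H. apply CI_unique.
  apply (is_RInt_fct_extend_pair (U:=R_NormedModule) (V:=R_NormedModule)); simpl.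
  - apply (RInt_correct (V:=R_CompleteNormedModule)).
    apply (ex_RInt_continuous (V:=R_CompleteNormedModule)).
    intros t Ht. rewrite Rmin_left, Rmax_right in Ht by lra. auto.
  - assert (E := is_RInt_const (V:=R_NormedModule) a b 0).
    replace (scal (b - a) (0 : R_NormedModule)) with 0 in E by (unfold scal; simpl; unfold mult; simpl; ring).
    exact E.
Qed.

Lemma ex_RInt_cont (g : R -> R) a b : a <= b -> (forall t, a <= t <= b -> continuous g t) -> ex_RInt g a b.
Proof.
  intros Hab H. apply (ex_RInt_continuous (V:=R_CompleteNormedModule)).
  intros t Ht. rewrite Rmin_left, Rmax_right in Ht by lra. auto.
Qed.

(** Both ends of the improper integral are exhausted at once by [1/(k+1), k+1], which turns the
    filter in [is_Gamma] into a sequence. *)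
Definition ga (k : nat) : R := / (INR k + 1).
Definition gb (k : nat) : R := INR k + 1.

Lemma gab k : 0 < ga k /\ ga k <= 1 /\ 1 <= gb k.
Proof.
  assert (H := pos_INR k). unfold ga, gb. split; [apply Rinv_0_lt_compat; lra|]. split; [|lra].
  rewrite <- Rinv_1. apply Rinv_le_contravar; lra.
Qed.

Definition gker (x t : R) : R := Rpower t (x - 1) * exp (- t).

Lemma gker_cont x t : 0 < t -> continuous (gker x) t.
Proof.
  intros Ht. apply is_derive_cont_ex. unfold gker, Rpower. auto_derive. auto.
Qed.

Lemma gker_pos x t : 0 < gker x t.
Proof. unfold gker, Rpower. apply Rmult_lt_0_compat; apply exp_pos. Qed.

Lemma RCpow_path_cont s t : 0 < t -> rcont (fun t => RCpow t (s - 1) * RtoC (exp (- t)))%C t.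
Proof.
  intros Ht. destruct s as [x y].
  apply rcont_ext with (fun t => (exp ((x - 1) * ln t) * cos (y * ln t) * exp (- t),
     exp ((x - 1) * ln t) * sin (y * ln t) * exp (- t))).
  - intros u. unfold RCpow, Cexp, RtoC, Cmult; simpl.
    replace ((x - 1) * ln u - (y + - 0) * 0) with ((x - 1) * ln u) by ring.
    replace ((x + - (1)) * 0 + (y + - 0) * ln u) with (y * ln u) by ring.
    replace ((x + - (1)) * ln u - (y + -0) * 0) with ((x - 1) * ln u) by ring.
    f_equal; ring.
  - apply rcont_pair; apply is_derive_cont_ex; auto_derive; auto.
Qed.

Definition gI (k : nat) (x : R) : R := RInt (gker x) (ga k) (gb k).

Section GammaFacts.
Variable G : C -> C.
Hypothesis HG : is_Gamma G.

Definition Gr (x : R) : R := Re (G (RtoC x)).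

Lemma Gamma_seq s : 0 < Re s -> forall e, 0 < e -> exists N, forall k, (N <= k)%nat ->
  Cmod (CI (fun t => RCpow t (s - 1) * RtoC (exp (- t)))%C (ga k) (gb k) - G s) < e.
Proof.
  intros Hs e He. assert (H := proj2 HG s Hs).
  assert (HP : locally (G s) (fun y => Cmod (y - G s) < e)).
  { apply (proj2 (locally_near _ _)). exists e. auto. }
  specialize (H _ HP). destruct H as [P Q HP' HQ HPQ].
  destruct HP' as [d Hd]. destruct HQ as [M HM].
  destruct (archimed_cor1 d (cond_pos d)) as [N1 [HN1 HN1']].
  destruct (INR_unbounded M) as [N2 HN2].
  exists (max N1 N2). intros k Hk.
  assert (K1 : INR N1 <= INR k) by (apply le_INR; lia).
  assert (K2 : INR N2 <= INR k) by (apply le_INR; lia).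
  assert (K0 : 0 < INR N1) by (apply lt_0_INR; lia).
  assert (Pk := gab k).
  destruct (HPQ (ga k) (gb k)) as [y [Hy1 Hy2]].
  - apply Hd; [|lra]. unfold ball; simpl. unfold AbsRing_ball, abs, minus, plus, opp; simpl.
    rewrite Ropp_0, Rplus_0_r, Rabs_right by lra.
    apply Rle_lt_trans with (/ INR N1); auto. apply Rinv_le_contravar; lra.
  - apply HM. unfold gb. lra.
  - simpl in Hy1. rewrite (CI_unique _ _ _ _ Hy1). exact Hy2.
Qed.

Lemma gker_RC x t : (RCpow t (RtoC x - 1) * RtoC (exp (- t)))%C = RtoC (gker x t).
Proof.
  rewrite <- RtoC_minus, RCpow_real, <- RtoC_mult. reflexivity.
Qed.

Lemma CI_gker x k : CI (fun t => RCpow t (RtoC x - 1) * RtoC (exp (- t)))%C (ga k) (gb k) = RtoC (gI k x).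
Proof.
  assert (P := gab k). unfold gI. rewrite <- CI_RtoC; try lra.
  - apply CI_ext; [lra|]. intros t _. apply gker_RC.
  - intros t Ht. apply gker_cont. lra.
Qed.

Lemma Gr_lim x : 0 < x -> is_lim_seq (fun k => gI k x) (Gr x).
Proof.
  intros Hx. apply is_lim_seq_spec. intros [e He]. simpl.
  destruct (Gamma_seq (RtoC x) Hx e He) as [N HN]. exists N. intros k Hk. specialize (HN k Hk).
  rewrite CI_gker in HN. assert (A := Re_le_Cmod (RtoC (gI k x) - G (RtoC x))). unfold Gr.
  eapply Rle_lt_trans; [|exact HN]. exact A.
Qed.

Lemma Gamma_real x : 0 < x -> G (RtoC x) = RtoC (Gr x).
Proof.
  intros Hx. apply injective_projections; [reflexivity|]. simpl.
  change (snd (G (RtoC x))) with (Im (G (RtoC x))).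
  apply NNPP. intros N.
  destruct (Gamma_seq (RtoC x) Hx (Rabs (Im (G (RtoC x)))) (Rabs_pos_lt _ N)) as [K HK].
  specialize (HK K (Nat.le_refl K)). rewrite CI_gker in HK.
  assert (A := Im_le_Cmod (RtoC (gI K x) - G (RtoC x))).
  replace (Im (RtoC (gI K x) - G (RtoC x))) with (- Im (G (RtoC x))) in A by (unfold Im; simpl; ring).
  rewrite Rabs_Ropp in A. lra.
Qed.

Lemma Gamma_abs s : 0 < Re s -> Cmod (G s) <= Gr (Re s).
Proof.
  intros Hs. apply Rnot_lt_le. intros L.
  set (e := (Cmod (G s) - Gr (Re s)) / 2). assert (He : 0 < e) by (unfold e; lra).
  destruct (Gamma_seq s Hs e He) as [N1 H1].
  assert (LL := Gr_lim (Re s) Hs). apply is_lim_seq_spec in LL.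
  destruct (LL (mkposreal e He)) as [N2 H2]. simpl in H2.
  set (k := max N1 N2). specialize (H1 k ltac:(unfold k; lia)). specialize (H2 k ltac:(unfold k; lia)).
  assert (P := gab k).
  assert (B : Cmod (CI (fun t => RCpow t (s - 1) * RtoC (exp (- t)))%C (ga k) (gb k)) <= gI k (Re s)).
  { apply CI_norm; try lra.
    - intros t Ht. apply RCpow_path_cont. lra.
    - apply ex_RInt_cont; [lra|]. intros t Ht. apply gker_cont. lra.
    - intros t Ht. rewrite Cmod_mult, RCpow_Cmod, Cmod_R, Rabs_right by (try lra; apply Rle_ge, Rlt_le, exp_pos).
      unfold gker. right. reflexivity. }
  apply Rabs_def2 in H2. assert (T := Cmod_rev (G s) (CI (fun t => RCpow t (s - 1) * RtoC (exp (- t)))%C (ga k) (gb k))).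
  rewrite Cmod_minus_sym in T. unfold e in *. lra.
Qed.

Lemma gI_incr x k : gI k x <= gI (S k) x.
Proof.
  assert (P := gab k). assert (P' := gab (S k)).
  assert (A : ga (S k) <= ga k) by (unfold ga; rewrite S_INR; assert (H := pos_INR k); apply Rinv_le_contravar; lra).
  assert (B : gb k <= gb (S k)) by (unfold gb; rewrite S_INR; lra).
  assert (EX : forall a b, 0 < a -> a <= b -> ex_RInt (gker x) a b).
  { intros a b Ha Hab. apply ex_RInt_cont; auto. intros t Ht. apply gker_cont; lra. }
  unfold gI. rewrite <- (RInt_Chasles (gker x) (ga (S k)) (ga k) (gb (S k))) by (apply EX; lra).
  rewrite <- (RInt_Chasles (gker x) (ga k) (gb k) (gb (S k))) by (apply EX; lra).
  change plus with Rplus.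
  assert (0 <= RInt (gker x) (ga (S k)) (ga k)).
  { apply RInt_ge_0; auto. apply EX; lra. intros. apply Rlt_le, gker_pos. }
  assert (0 <= RInt (gker x) (gb k) (gb (S k))).
  { apply RInt_ge_0; auto. apply EX; lra. intros. apply Rlt_le, gker_pos. }
  lra.
Qed.

(** The truncated integrals increase in k, so already the one with k = 1 is a positive lower
    bound. *)
Lemma Gr_pos x : 0 < x -> 0 < Gr x.
Proof.
  intros Hx. apply Rlt_le_trans with (gI 1 x).
  - apply RInt_gt_0.
    + assert (H := gab 1). unfold ga, gb; simpl. lra.
    + intros. apply gker_pos.
    + intros t Ht. apply gker_cont. assert (H := gab 1). lra.
  - apply (is_lim_seq_incr_compare (fun k => gI k x)); [now apply Gr_lim|]. intros k. apply gI_incr.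
Qed.

(** The tangent line at the weighted mean [m] lies below the graph; averaging its values at u and v
    gives the claim. *)
Lemma exp_convex th u v : 0 <= th <= 1 -> exp (th * u + (1 - th) * v) <= th * exp u + (1 - th) * exp v.
Proof.
  intros Ht. set (m := th * u + (1 - th) * v).
  assert (A : forall w, exp m * (1 + (w - m)) <= exp w).
  { intros w. replace (exp w) with (exp m * exp (w - m)) by (rewrite <- exp_plus; f_equal; ring).
    apply Rmult_le_compat_l; [apply Rlt_le, exp_pos|]. apply exp_ineq1_le. }
  assert (A1 := A u). assert (A2 := A v). assert (P := exp_pos m).
  apply Rle_trans with (th * (exp m * (1 + (u - m))) + (1 - th) * (exp m * (1 + (v - m)))).
  - right. unfold m at 1 3 5. unfold m. ring_simplify. ring.
  - assert (th * (exp m * (1 + (u - m))) <= th * exp u) by (apply Rmult_le_compat_l; lra).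
    assert ((1 - th) * (exp m * (1 + (v - m))) <= (1 - th) * exp v) by (apply Rmult_le_compat_l; lra). lra.
Qed.

(** Hoelder's inequality. [D] is the geometric mean aimed at; dividing the two integrands by [Gr a]
    and [Gr b] normalises them, so that pointwise convexity of exp integrates to [Gr c <= D]. *)
Lemma Gr_logconvex a b th : 0 < a -> 0 < b -> 0 <= th <= 1 ->
  ln (Gr (th * a + (1 - th) * b)) <= th * ln (Gr a) + (1 - th) * ln (Gr b).
Proof.
  intros Ha Hb Ht. set (c := th * a + (1 - th) * b).
  assert (Hc : 0 < c) by (unfold c; destruct (Req_dec th 0); [subst; lra|]; assert (0 < th * a) by (apply Rmult_lt_0_compat; lra); nra).
  assert (PA := Gr_pos a Ha). assert (PB := Gr_pos b Hb). assert (PC := Gr_pos c Hc).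
  set (D := exp (th * ln (Gr a) + (1 - th) * ln (Gr b))).
  assert (HD : 0 < D) by apply exp_pos.
  assert (Hk : forall k, gI k c <= th * (D / Gr a) * gI k a + (1 - th) * (D / Gr b) * gI k b).
  { intros k. assert (P := gab k). unfold gI.
    assert (EX : forall x, ex_RInt (gker x) (ga k) (gb k)).
    { intros x. apply ex_RInt_cont; [lra|]. intros t Htt. apply gker_cont; lra. }
    rewrite <- !(RInt_scal (V:=R_CompleteNormedModule)) by auto.
    rewrite <- (RInt_plus (V:=R_CompleteNormedModule)) by (apply (ex_RInt_scal (V:=R_NormedModule)); auto).
    apply RInt_le; try lra; auto.
    - apply (ex_RInt_plus (V:=R_NormedModule)); apply (ex_RInt_scal (V:=R_NormedModule)); auto.
    - intros t Htt. unfold plus, scal; simpl. unfold mult; simpl.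
      unfold gker, Rpower. 
      assert (Q := exp_convex th ((a - 1) * ln t - ln (Gr a)) ((b - 1) * ln t - ln (Gr b)) Ht).
      assert (E : exp ((c - 1) * ln t) = D * exp (th * ((a - 1) * ln t - ln (Gr a)) + (1 - th) * ((b - 1) * ln t - ln (Gr b)))).
      { unfold D. rewrite <- exp_plus. f_equal. unfold c. ring. }
      rewrite E. unfold Rminus at 3 6 in Q. 
      assert (EA : forall u x, 0 < x -> exp (u - ln x) = exp u / x).
      { intros u x Hx. unfold Rminus. rewrite exp_plus, exp_Ropp, exp_ln; auto. }
      fold (Rminus ((a - 1) * ln t) (ln (Gr a))) (Rminus ((b - 1) * ln t) (ln (Gr b))) in Q.
      rewrite (EA _ (Gr a)), (EA _ (Gr b)) in Q by auto.
      assert (Pt := exp_pos (- t)).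
      apply Rle_trans with (D * (th * (exp ((a - 1) * ln t) / Gr a) + (1 - th) * (exp ((b - 1) * ln t) / Gr b)) * exp (- t)).
      + apply Rmult_le_compat_r; [lra|]. apply Rmult_le_compat_l; [lra|]. exact Q.
      + right. field. lra. }
  assert (L : Gr c <= th * (D / Gr a) * Gr a + (1 - th) * (D / Gr b) * Gr b).
  { apply (is_lim_seq_le (fun k => gI k c) (fun k => th * (D / Gr a) * gI k a + (1 - th) * (D / Gr b) * gI k b) (Gr c)
      (th * (D / Gr a) * Gr a + (1 - th) * (D / Gr b) * Gr b) Hk).
    - now apply Gr_lim.
    - apply (is_lim_seq_plus' (fun k => th * (D / Gr a) * gI k a) (fun k => (1 - th) * (D / Gr b) * gI k b)).
      + apply (is_lim_seq_scal_l (fun k => gI k a) _ (Gr a)). now apply Gr_lim.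
      + apply (is_lim_seq_scal_l (fun k => gI k b) _ (Gr b)). now apply Gr_lim. }
  replace (th * (D / Gr a) * Gr a + (1 - th) * (D / Gr b) * Gr b) with D in L by (field; lra).
  replace (th * ln (Gr a) + (1 - th) * ln (Gr b)) with (ln D) by (unfold D; now rewrite ln_exp).
  destruct (Rle_lt_or_eq_dec _ _ L) as [L'|E]; [|rewrite E; lra]. apply Rlt_le, ln_increasing; auto.
Qed.

(** Integration by parts on the truncated interval; the boundary terms are kept and disposed of in
    [Gr_succ]. *)
Lemma gI_parts x k : 0 < x -> gI k (x + 1) = x * gI k x + (- (Rpower (gb k) x * exp (- gb k)) + Rpower (ga k) x * exp (- ga k)).
Proof.
  intros Hx. assert (P := gab k). unfold gI.
  assert (EX : forall x, ex_RInt (gker x) (ga k) (gb k)).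
  { intros y. apply ex_RInt_cont; [lra|]. intros t Htt. apply gker_cont; lra. }
  assert (H : is_RInt (fun t => gker (x + 1) t - x * gker x t) (ga k) (gb k)
    (minus (- (Rpower (gb k) x * exp (- gb k))) (- (Rpower (ga k) x * exp (- ga k))))).
  { apply (is_RInt_derive (V:=R_CompleteNormedModule) (fun t => - (Rpower t x * exp (- t)))); intros t Ht;
    rewrite Rmin_left, Rmax_right in Ht by lra.
    - unfold gker, Rpower. auto_derive; [lra|].
      replace ((x + 1 - 1) * ln t) with (x * ln t) by ring.
      replace (exp ((x - 1) * ln t)) with (exp (x * ln t) * / t).
      2: { replace ((x - 1) * ln t) with (x * ln t + - ln t) by ring. rewrite exp_plus, exp_Ropp, exp_ln; auto; lra. }
      field. lra.
    - apply is_derive_cont_ex. unfold gker, Rpower. auto_derive. lra. }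
  apply (is_RInt_unique (V:=R_CompleteNormedModule)) in H.
  rewrite (RInt_minus (V:=R_CompleteNormedModule) (gker (x + 1)) (fun t => x * gker x t)) in H; auto.
  2: { apply (ex_RInt_scal (V:=R_NormedModule)); auto. }
  rewrite (RInt_scal (V:=R_CompleteNormedModule) (gker x)) in H by auto.
  unfold minus, plus, opp, scal in H; simpl in H. unfold mult in H; simpl in H. lra.
Qed.

Lemma Gr_succ x : 0 < x -> Gr (x + 1) = x * Gr x.
Proof.
  intros Hx.
  assert (L1 := Gr_lim (x + 1) ltac:(lra)).
  assert (La : is_lim_seq (fun k => / (INR k + 1)) 0).
  { apply (is_lim_seq_inv (fun k => INR k + 1) p_infty).
    - apply (is_lim_seq_plus _ _ p_infty 1 p_infty). apply is_lim_seq_INR. apply is_lim_seq_const. reflexivity.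
    - discriminate. }
  assert (LA : is_lim_seq (fun k => Rpower (ga k) x * exp (- ga k)) 0).
  { apply is_lim_seq_le_le with (fun _ => 0) (fun k => Rpower (ga k) x).
    - intros k. assert (P := gab k). unfold Rpower. assert (E1 := exp_pos (x * ln (ga k))). assert (E2 := exp_pos (- ga k)).
      assert (exp (- ga k) <= 1) by (rewrite <- exp_0; apply Rlt_le, exp_increasing; lra). nra.
    - apply is_lim_seq_const.
    - apply is_lim_seq_spec. intros [e He]. simpl.
      assert (La2 := La). apply is_lim_seq_spec in La2.
      destruct (La2 (mkposreal (Rpower e (/ x)) (exp_pos _))) as [N HN]. simpl in HN.
      exists N. intros k Hk. specialize (HN k Hk). assert (P := gab k). fold (ga k) in HN.
      rewrite Rminus_0_r, Rabs_right in * by (try lra; apply Rle_ge, Rlt_le, exp_pos).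
      apply Rlt_le_trans with (Rpower (Rpower e (/ x)) x).
      + unfold Rpower at 1 2. apply exp_increasing. apply Rmult_lt_compat_l; auto. apply ln_increasing; lra.
      + rewrite Rpower_mult, Rinv_l, Rpower_1 by lra. lra. }
  (* Eventually x ln t <= t/2, so the boundary term is at most exp(-t/2), which is at most 2/t. *)
  assert (LB : is_lim_seq (fun k => Rpower (gb k) x * exp (- gb k)) 0).
  { assert (LD := is_lim_div_ln_p). apply is_lim_spec in LD.
    destruct (LD (mkposreal (/ (2 * x)) ltac:(apply Rinv_0_lt_compat; lra))) as [M HM].
    simpl in HM. destruct (INR_unbounded M) as [N HN].
    apply is_lim_seq_le_le_loc with (fun _ => 0) (fun k => 2 * / (INR k + 1)).
    - exists N. intros k Hk. assert (P := gab k).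
      assert (K : INR N <= INR k) by now apply le_INR.
      specialize (HM (gb k) ltac:(unfold gb; lra)). rewrite Rminus_0_r in HM. apply Rabs_def2 in HM.
      split. apply Rlt_le, Rmult_lt_0_compat; apply exp_pos.
      unfold Rpower. rewrite <- exp_plus.
      assert (X : x * ln (gb k) + - gb k <= - (gb k / 2)).
      { destruct HM as [HM _]. apply Rmult_lt_compat_r with (r := gb k) in HM; [|lra].
        replace (ln (gb k) / gb k * gb k) with (ln (gb k)) in HM by (field; lra).
        apply Rmult_lt_compat_l with (r := x) in HM; auto.
        replace (x * (/ (2 * x) * gb k)) with (gb k / 2) in HM by (field; lra). lra. }
      apply Rle_trans with (exp (- (gb k / 2))).
      { destruct (Rle_lt_or_eq_dec _ _ X) as [L|E0]; [|rewrite E0; lra]. apply Rlt_le, exp_increasing, L. }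
      rewrite exp_Ropp. fold (gb k).
      replace (2 * / gb k) with (/ (gb k / 2)) by (field; lra).
      apply Rinv_le_contravar; [lra|]. assert (E := exp_ineq1_le (gb k / 2)). lra.
    - apply is_lim_seq_const.
    - replace (Finite 0) with (Rbar_mult 2 0) by (simpl; f_equal; ring). apply is_lim_seq_scal_l, La. }
  assert (L2 : is_lim_seq (fun k => gI k (x + 1)) (x * Gr x + (- 0 + 0))).
  { apply is_lim_seq_ext with (fun k => x * gI k x + (- (Rpower (gb k) x * exp (- gb k)) + Rpower (ga k) x * exp (- ga k))).
    - intros k. symmetry. now apply gI_parts.
    - apply (is_lim_seq_plus' (fun k => x * gI k x)).
      + apply (is_lim_seq_scal_l (fun k => gI k x) x (Gr x)). now apply Gr_lim.
      + apply (is_lim_seq_plus' (fun k => - (Rpower (gb k) x * exp (- gb k)))); auto.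
        apply (is_lim_seq_opp _ 0). auto. }
  apply is_lim_seq_unique in L1, L2. rewrite L1 in L2. injection L2. lra.
Qed.
End GammaFacts.

(** * Zeta *)

Fixpoint csum (a : nat -> C) (N : nat) : C :=
  match N with O => a O | S n => (csum a n + a (S n))%C end.

Lemma csum_S a N : csum a (S N) = (csum a N + a (S N))%C.
Proof. reflexivity. Qed.

Lemma csum_sum_n a N : sum_n (G := C_AbelianMonoid) a N = csum a N.
Proof. induction N; [now rewrite sum_O|]. rewrite sum_Sn, IHN. reflexivity. Qed.

Lemma csum_hol (a : nat -> C -> C) N z : (forall k, hol (a k) z) -> hol (fun y => csum (fun k => a k y) N) z.
Proof. intros H. induction N; simpl; [apply H|]. now apply hol_plus. Qed.

Lemma csum_diff_le a (b : nat -> R) N M : (forall k, Cmod (a k) <= b k) -> (N <= M)%nat ->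
  Cmod (csum a M - csum a N) <= sum_f_R0 b M - sum_f_R0 b N.
Proof.
  intros H L. induction L; simpl.
  - rewrite Cmod_self. lra.
  - replace (csum a m + a (S m) - csum a N)%C with ((csum a m - csum a N) + a (S m))%C by ring.
    eapply Rle_trans; [apply Cmod_triangle|]. specialize (H (S m)). lra.
Qed.

Lemma csum_le a (b : nat -> R) N : (forall k, Cmod (a k) <= b k) -> Cmod (csum a N) <= sum_f_R0 b N.
Proof.
  intros H. induction N; simpl; [apply H|]. eapply Rle_trans; [apply Cmod_triangle|].
  specialize (H (S N)). lra.
Qed.

(** The limit is continuous, and Cauchy's formula for the approximants passes to the limit; W is
    therefore a Cauchy integral near c. *)
Theorem weierstrass (S : nat -> C -> C) W c r : 0 < r ->
  (forall N s, Cmod (s - c) <= 2 * r -> hol (S N) s) ->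
  (forall e, 0 < e -> exists N, forall s, Cmod (s - c) <= 2 * r -> Cmod (S N s - W s) <= e) ->
  hol W c.
Proof.
  intros Hr HS HU.
  assert (HW : forall s, Cmod (s - c) < 2 * r -> ccont W s).
  { intros s Hs e He. destruct (HU (e / 4) ltac:(lra)) as [N HN].
    destruct (near_and _ _ _ (hol_ccont _ _ (HS N s ltac:(lra)) (e / 4) ltac:(lra)) (near_ball s c (2 * r) Hs)) as [d [Hd HH]].
    exists d. split; [exact Hd|]. intros y Hy. destruct (HH y Hy) as [H1 H2].
    assert (A := HN y ltac:(lra)). assert (B := HN s ltac:(lra)).
    replace (W y - W s)%C with (- (S N y - W y) + ((S N y - S N s) + (S N s - W s)))%C by ring.
    eapply Rle_lt_trans; [apply Cmod_triangle|]. rewrite Cmod_opp.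
    assert (T := Cmod_triangle (S N y - S N s) (S N s - W s)). lra. }
  set (q := r / 2).
  set (x1 := Re c - q) in *. set (x2 := Re c + q) in *. set (y1 := Im c - q) in *. set (y2 := Im c + q) in *.
  assert (SQ : forall s, inR x1 x2 y1 y2 s -> Cmod (s - c) <= r).
  { intros s Hs. assert (D := disc_square c q ltac:(unfold q; lra) s Hs). unfold q in D. lra. }
  assert (X : x1 < Re c < x2) by (unfold x1, x2, q; lra).
  assert (Y : y1 < Im c < y2) by (unfold y1, y2, q; lra).
  destruct (rect_gap c x1 x2 y1 y2 X Y) as [g [Hg [G1 G2]]].
  apply hol_ext_near with (fun y => / twopii * Rect (fun s => W s / (s - y)) x1 x2 y1 y2)%C.
  2: { apply hol_scal. eexists. apply cauchy_type_cder; auto. intros s [Hs _]. apply HW. specialize (SQ s Hs). lra. }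
  exists g. split; [exact Hg|]. intros y Hy. destruct (G2 y Hy) as [Y1 Y2].
  assert (GG : forall s, onR x1 x2 y1 y2 s -> (s - y)%C <> RtoC 0 /\ Cmod (/ (s - y)) <= / g).
  { intros s Hs. apply Cinv_gap; auto. }
  assert (E : (Rect (fun s => W s / (s - y)) x1 x2 y1 y2 - twopii * W y)%C = RtoC 0).
  2: { assert (E2 : Rect (fun s => W s / (s - y))%C x1 x2 y1 y2 = (twopii * W y)%C).
       { replace (Rect (fun s => W s / (s - y))%C x1 x2 y1 y2) with ((Rect (fun s => W s / (s - y)) x1 x2 y1 y2 - twopii * W y) + twopii * W y)%C by ring.
         rewrite E. ring. }
       rewrite E2. field. apply twopii_neq0. }
  apply Cmod_eq_0. apply Rle_antisym; [|apply Cmod_ge_0]. apply Rnot_lt_le. intros L.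
  set (m := Cmod (Rect (fun s => W s / (s - y))%C x1 x2 y1 y2 - twopii * W y)) in *.
  set (A := 2 * / g * ((x2 - x1) + (y2 - y1)) + 2 * PI + 1).
  assert (Ig : 0 < / g) by now apply Rinv_0_lt_compat. assert (PP := PI_RGT_0).
  assert (HA : 0 < A) by (unfold A; nra).
  destruct (HU (m / (2 * A)) ltac:(apply Rdiv_lt_0_compat; lra)) as [N HN].
  set (e := m / (2 * A)) in *.
  assert (He : 0 < e) by (apply Rdiv_lt_0_compat; lra).
  assert (CF := cauchy_formula (S N) y x1 x2 y1 y2 Y1 Y2 ltac:(intros s Hs; apply HS; specialize (SQ s Hs); lra)).
  assert (C1 : forall s, onR x1 x2 y1 y2 s -> ccont (fun s => W s / (s - y))%C s).
  { intros s Hs. apply ccont_div; auto with holo. now apply GG. apply HW. specialize (SQ s (proj1 Hs)). lra. }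
  assert (C2 : forall s, onR x1 x2 y1 y2 s -> ccont (fun s => S N s / (s - y))%C s).
  { intros s Hs. apply ccont_div; auto with holo. now apply GG. apply hol_ccont, HS. specialize (SQ s (proj1 Hs)). lra. }
  assert (B : m <= 2 * (e * / g) * ((x2 - x1) + (y2 - y1)) + 2 * PI * e).
  { unfold m. replace (Rect (fun s => W s / (s - y)) x1 x2 y1 y2 - twopii * W y)%C with
      (- Rect (fun s => S N s / (s - y) - W s / (s - y)) x1 x2 y1 y2 + twopii * (S N y - W y))%C.
    2: { rewrite Rect_minus; auto; try lra. rewrite CF. ring. }
    eapply Rle_trans; [apply Cmod_triangle|]. rewrite Cmod_opp, Cmod_mult, Cmod_twopii.
    apply Rplus_le_compat.
    - apply Rect_bound; try lra.
      + intros s Hs. apply ccont_minus; auto.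
      + intros s Hs. replace (S N s / (s - y) - W s / (s - y))%C with ((S N s - W s) * / (s - y))%C by (unfold Cdiv; ring).
        rewrite Cmod_mult. apply Rmult_le_compat; auto using Cmod_ge_0. apply HN. specialize (SQ s (proj1 Hs)). lra.
        now apply GG.
    - apply Rmult_le_compat_l; [lra|]. apply HN.
      assert (inR x1 x2 y1 y2 y) by (unfold inR; lra). specialize (SQ y H). lra. }
  assert (m <= A * e) by (unfold A; nra).
  unfold e in H. replace (A * (m / (2 * A))) with (m / 2) in H by (field; lra). lra.
Qed.

Section ZetaFacts.
Variable Z : C -> C.
Hypothesis HZ : is_zeta Z.

Definition zterm (x : R) (k : nat) : R := Rpower (INR (S k)) (- x).
Definition zsum (x : R) (N : nat) : R := sum_f_R0 (zterm x) N.
Definition zr (x : R) : R := Re (Z (RtoC x)).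

Lemma INR_S_pos k : 1 <= INR (S k).
Proof. rewrite S_INR. assert (H := pos_INR k). lra. Qed.

Lemma zterm_pos x k : 0 < zterm x k.
Proof. apply exp_pos. Qed.

Lemma zeta_seq s : 1 < Re s -> forall e, 0 < e -> exists N, forall k, (N <= k)%nat ->
  Cmod (csum (fun k => RCpow (INR (S k)) (- s)) k - Z s) < e.
Proof.
  intros Hs e He. assert (H := proj2 HZ s Hs).
  assert (HP : locally (Z s) (fun y => Cmod (y - Z s) < e)).
  { apply (proj2 (locally_near _ _)). exists e. auto. }
  destruct (H _ HP) as [N HN]. exists N. intros k Hk. specialize (HN k Hk).
  rewrite <- csum_sum_n. exact HN.
Qed.

Lemma csum_real x N : csum (fun k => RCpow (INR (S k)) (- RtoC x)) N = RtoC (zsum x N).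
Proof.
  induction N.
  - change (RCpow (INR 1) (- RtoC x) = RtoC (zterm x 0)). rewrite <- RtoC_opp, RCpow_real. reflexivity.
  - rewrite csum_S, IHN. change (zsum x (S N)) with (zsum x N + zterm x (S N)). rewrite RtoC_plus. f_equal.
    rewrite <- RtoC_opp, RCpow_real. reflexivity.
Qed.

Lemma zr_lim x : 1 < x -> is_lim_seq (zsum x) (zr x).
Proof.
  intros Hx. apply is_lim_seq_spec. intros [e He]. simpl.
  destruct (zeta_seq (RtoC x) Hx e He) as [N HN]. exists N. intros k Hk. specialize (HN k Hk).
  rewrite csum_real in HN. eapply Rle_lt_trans; [|exact HN].
  exact (Re_le_Cmod (RtoC (zsum x k) - Z (RtoC x))).
Qed.

Lemma zeta_real x : 1 < x -> Z (RtoC x) = RtoC (zr x).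
Proof.
  intros Hx. apply injective_projections; [reflexivity|]. simpl.
  change (snd (Z (RtoC x))) with (Im (Z (RtoC x))).
  apply NNPP. intros N.
  destruct (zeta_seq (RtoC x) Hx (Rabs (Im (Z (RtoC x)))) (Rabs_pos_lt _ N)) as [K HK].
  specialize (HK K (Nat.le_refl K)). rewrite csum_real in HK.
  assert (A := Im_le_Cmod (RtoC (zsum x K) - Z (RtoC x))).
  replace (Im (RtoC (zsum x K) - Z (RtoC x))) with (- Im (Z (RtoC x))) in A by (unfold Im; simpl; ring).
  rewrite Rabs_Ropp in A. lra.
Qed.

Lemma zsum_incr x N M : (N <= M)%nat -> zsum x N <= zsum x M.
Proof.
  intros L. induction L; [lra|]. change (zsum x (S m)) with (zsum x m + zterm x (S m)). assert (H := zterm_pos x (S m)). lra.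
Qed.

Lemma zsum_le x N : 1 < x -> zsum x N <= zr x.
Proof.
  intros Hx. apply (is_lim_seq_incr_compare (zsum x)); [now apply zr_lim|].
  intros k. apply zsum_incr. lia.
Qed.

Lemma zterm_0 x : zterm x 0 = 1.
Proof. unfold zterm, Rpower. simpl. rewrite ln_1, Rmult_0_r. apply exp_0. Qed.

Lemma zsum_0 x : zsum x 0 = 1.
Proof. apply zterm_0. Qed.

Lemma zr_ge1 x : 1 < x -> 1 <= zr x.
Proof.
  intros Hx. apply Rle_trans with (zsum x 0); [|now apply zsum_le].
  rewrite zsum_0. lra.
Qed.

Lemma zr_decr x y : 1 < x -> x <= y -> zr y <= zr x.
Proof.
  intros Hx Hy. apply (is_lim_seq_le (zsum y) (zsum x) (zr y) (zr x)); try apply zr_lim; try lra.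
  intros n. apply sum_Rle. intros k _. unfold zterm, Rpower.
  assert (H := INR_S_pos k). assert (0 <= ln (INR (S k))).
  { rewrite <- ln_1. destruct (Rle_lt_or_eq_dec _ _ H) as [L|E]; [|rewrite <- E; lra].
    apply Rlt_le, ln_increasing; lra. }
  assert (Q : - y * ln (INR (S k)) <= - x * ln (INR (S k))) by nra.
  destruct (Rle_lt_or_eq_dec _ _ Q) as [L|E]; [|rewrite E; lra]. apply Rlt_le, exp_increasing, L.
Qed.

(** Telescoping: 1/(a+1)^2 is at most 1/a - 1/(a+1). *)
Lemma zr_le2 x : 2 <= x -> zr x <= 2.
Proof.
  intros Hx. apply Rle_trans with (zr 2); [apply zr_decr; lra|].
  apply (is_lim_seq_le (zsum 2) (fun _ => 2) (zr 2) 2).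
  - intros n. apply Rle_trans with (2 - / INR (S n)).
    2: { assert (0 < / INR (S n)) by (apply Rinv_0_lt_compat; assert (H := INR_S_pos n); lra). lra. }
    induction n.
    + rewrite zsum_0. simpl. lra.
    + change (zsum 2 (S n)) with (zsum 2 n + zterm 2 (S n)). eapply Rle_trans; [apply Rplus_le_compat_r, IHn|].
      assert (H := INR_S_pos n). set (a := INR (S n)) in *.
      unfold zterm. rewrite (S_INR (S n)). fold a.
      replace (Rpower (a + 1) (- (2))) with (/ ((a + 1) * (a + 1))).
      2: { rewrite Rpower_Ropp. replace 2 with (INR 2) by (simpl; lra). rewrite Rpower_pow by lra. f_equal. ring. }
      apply Rminus_le. replace (2 - / a + / ((a + 1) * (a + 1)) - (2 - / (a + 1))) with (- / (a * ((a + 1) * (a + 1)))) by (field; lra).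
      assert (0 < / (a * ((a + 1) * (a + 1)))) by (apply Rinv_0_lt_compat; nra). lra.
  - apply zr_lim; lra.
  - apply is_lim_seq_const.
Qed.

(** The normalised Hoelder argument of [Gr_logconvex], now on partial sums. *)
Lemma zr_logconvex a b th : 1 < a -> 1 < b -> 0 <= th <= 1 ->
  ln (zr (th * a + (1 - th) * b)) <= th * ln (zr a) + (1 - th) * ln (zr b).
Proof.
  intros Ha Hb Ht. set (c := th * a + (1 - th) * b).
  assert (Hc : 1 < c).
  { unfold c. destruct (Req_dec th 0) as [->|N]; [lra|].
    assert (0 < th * (a - 1)) by (apply Rmult_lt_0_compat; lra).
    assert (0 <= (1 - th) * (b - 1)) by (apply Rmult_le_pos; lra). lra. }
  assert (PA := zr_ge1 a Ha). assert (PB := zr_ge1 b Hb). assert (PC := zr_ge1 c Hc).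
  set (D := exp (th * ln (zr a) + (1 - th) * ln (zr b))).
  assert (HD : 0 < D) by apply exp_pos.
  assert (EA : forall u x, 0 < x -> exp (u - ln x) = exp u / x).
  { intros u x Hx. unfold Rminus. rewrite exp_plus, exp_Ropp, exp_ln; auto. }
  assert (Hk : forall N, zsum c N <= th * (D / zr a) * zsum a N + (1 - th) * (D / zr b) * zsum b N).
  { intros N. unfold zsum. rewrite (scal_sum _ _ (th * (D / zr a))), (scal_sum _ _ ((1 - th) * (D / zr b))).
    rewrite <- sum_plus. apply sum_Rle. intros k _. unfold zterm, Rpower. set (l := ln (INR (S k))).
    assert (Q := exp_convex th (- a * l - ln (zr a)) (- b * l - ln (zr b)) Ht).
    replace (exp (- c * l)) with (D * exp (th * (- a * l - ln (zr a)) + (1 - th) * (- b * l - ln (zr b)))).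
    2: { unfold D. rewrite <- exp_plus. f_equal. unfold c. ring. }
    rewrite !EA in Q by lra.
    apply Rle_trans with (D * (th * (exp (- a * l) / zr a) + (1 - th) * (exp (- b * l) / zr b))).
    - apply Rmult_le_compat_l; lra.
    - right. field. lra. }
  assert (L : zr c <= th * (D / zr a) * zr a + (1 - th) * (D / zr b) * zr b).
  { apply (is_lim_seq_le (zsum c) (fun k => th * (D / zr a) * zsum a k + (1 - th) * (D / zr b) * zsum b k) (zr c)
      (th * (D / zr a) * zr a + (1 - th) * (D / zr b) * zr b) Hk).
    - now apply zr_lim.
    - apply (is_lim_seq_plus' (fun k => th * (D / zr a) * zsum a k) (fun k => (1 - th) * (D / zr b) * zsum b k)).
      + apply (is_lim_seq_scal_l (zsum a) _ (zr a)). now apply zr_lim.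
      + apply (is_lim_seq_scal_l (zsum b) _ (zr b)). now apply zr_lim. }
  replace (th * (D / zr a) * zr a + (1 - th) * (D / zr b) * zr b) with D in L by (field; lra).
  replace (th * ln (zr a) + (1 - th) * ln (zr b)) with (ln D) by (unfold D; now rewrite ln_exp).
  destruct (Rle_lt_or_eq_dec _ _ L) as [L'|E]; [|rewrite E; lra]. apply Rlt_le, ln_increasing; lra.
Qed.

Lemma zterm_Cmod s k : Cmod (RCpow (INR (S k)) (- s)) = zterm (Re s) k.
Proof. rewrite RCpow_Cmod; [reflexivity|]. assert (H := INR_S_pos k). lra. Qed.

Lemma zeta_abs s : 1 < Re s -> Cmod (Z s) <= zr (Re s).
Proof.
  intros Hs. apply Rnot_lt_le. intros L.
  destruct (zeta_seq s Hs (Cmod (Z s) - zr (Re s)) ltac:(lra)) as [N HN]. specialize (HN N (Nat.le_refl N)).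
  assert (B := csum_le (fun k => RCpow (INR (S k)) (- s)) (zterm (Re s)) N (fun k => Req_le _ _ (zterm_Cmod s k))).
  assert (B2 := zsum_le (Re s) N Hs). unfold zsum in B2.
  assert (T := Cmod_rev (Z s) (csum (fun k => RCpow (INR (S k)) (- s)) N)).
  rewrite Cmod_minus_sym in T. lra.
Qed.
End ZetaFacts.

(** * Continuation of zeta to the left of Re s = 1 *)

Lemma RCpow_int c a b : 0 < a -> a <= b ->
  CI (fun x => c * RCpow x (c - 1))%C a b = (RCpow b c - RCpow a c)%C.
Proof.
  intros Ha Hab. destruct c as [p q].
  rewrite (CI_ext _ (fun x => (exp (p * ln x) * (p * cos (q * ln x) - q * sin (q * ln x)) / x,
     exp (p * ln x) * (p * sin (q * ln x) + q * cos (q * ln x)) / x))); auto.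
  - rewrite (CI_pair _ _ (fun x => exp (p * ln x) * cos (q * ln x)) (fun x => exp (p * ln x) * sin (q * ln x))); auto.
    + unfold RCpow, Cexp, RtoC, Cminus, Cplus, Copp, Cmult; simpl.
      rewrite !Rmult_0_r, !Rminus_0_r, !Rplus_0_l. reflexivity.
    + intros t Ht. auto_derive. lra. field. lra.
    + intros t Ht. auto_derive. lra. field. lra.
    + intros t Ht. apply is_derive_cont_ex. auto_derive. lra.
    + intros t Ht. apply is_derive_cont_ex. auto_derive. lra.
  - intros t Ht. unfold RCpow, Cexp, RtoC, Cminus, Cplus, Copp, Cmult; simpl.
    rewrite !Rmult_0_r, !Rminus_0_r, !Rplus_0_l.
    replace ((p + - (1)) * ln t) with (p * ln t + - ln t) by ring.
    replace ((q + - 0) * ln t) with (q * ln t) by ring.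
    rewrite exp_plus, exp_Ropp, exp_ln by lra. f_equal; field; lra.
Qed.

Lemma RCpow_rcont c t : 0 < t -> rcont (fun x => RCpow x c) t.
Proof.
  intros Ht. destruct c as [p q].
  apply rcont_ext with (fun x => (exp (p * ln x) * cos (q * ln x), exp (p * ln x) * sin (q * ln x))).
  - intros u. unfold RCpow, Cexp, RtoC, Cmult; simpl.
    rewrite !Rmult_0_r, !Rminus_0_r, !Rplus_0_l. reflexivity.
  - apply rcont_pair; apply is_derive_cont_ex; auto_derive; auto.
Qed.

Lemma Rpower_decr x y c : 0 < x -> x <= y -> c <= 0 -> Rpower y c <= Rpower x c.
Proof.
  intros Hx Hy Hc. unfold Rpower.
  assert (ln x <= ln y) by (destruct (Rle_lt_or_eq_dec _ _ Hy) as [L|E]; [apply Rlt_le, ln_increasing; auto|rewrite E; lra]).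
  assert (Q : c * ln y <= c * ln x) by nra.
  destruct (Rle_lt_or_eq_dec _ _ Q) as [L|E]; [|rewrite E; lra]. apply Rlt_le, exp_increasing, L.
Qed.

Lemma RCpow_diff s a x : 0 < a -> a <= x -> 0 < Re s ->
  Cmod (RCpow x (- s) - RCpow a (- s)) <= Cmod s * Rpower a (- (Re s + 1)) * (x - a).
Proof.
  intros Ha Hx Hs. rewrite <- RCpow_int by auto.
  apply CI_bound; auto.
  - intros t Ht. apply rcont_scal, RCpow_rcont. lra.
  - intros t Ht. rewrite Cmod_mult, Cmod_opp, RCpow_Cmod by lra.
    apply Rmult_le_compat_l; [apply Cmod_ge_0|].
    replace (Re (- s - 1)) with (- (Re s + 1)) by (unfold Re; simpl; ring).
    apply Rpower_decr; lra.
Qed.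

(* The k-th term of zeta minus the integral of x^(-s) over the unit interval that follows. *)
Definition Dk (s : C) (k : nat) : C :=
  (RCpow (INR (S k)) (- s) - (RCpow (INR (S (S k))) (1 - s) - RCpow (INR (S k)) (1 - s)) / (1 - s))%C.

(** The term is the integral of a^(-s) - x^(-s) over a unit interval starting at a. The mean value
    estimate gains one power of a, so the series over k converges as soon as Re s > 0. *)
Lemma Dk_bound s k : 0 < Re s -> s <> RtoC 1 -> Cmod (Dk s k) <= Cmod s * zterm (Re s + 1) k.
Proof.
  intros Hs H1. assert (Ha := INR_S_pos k). set (a := INR (S k)) in *.
  assert (Hb : INR (S (S k)) = a + 1) by (unfold a; apply S_INR).
  assert (N : (1 - s)%C <> RtoC 0) by (apply Csub_neq0; auto).
  assert (E : Dk s k = CI (fun x => RCpow a (- s) - RCpow x (- s))%C a (a + 1)).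
  { unfold Dk. fold a. rewrite Hb. rewrite <- RCpow_int by lra.
    rewrite CI_minus; try lra.
    - rewrite CI_const. replace (a + 1 - a) with 1 by ring.
      rewrite (CI_ext _ (fun x => (1 - s) * RCpow x (- s))%C); [|lra|].
      + rewrite CI_scal; [|lra|]. field. auto. intros t Ht. apply RCpow_rcont; lra.
      + intros t _. do 2 f_equal. ring.
    - intros t _. apply rcont_const.
    - intros t Ht. apply RCpow_rcont; lra. }
  rewrite E. replace (Cmod s * zterm (Re s + 1) k) with (Cmod s * zterm (Re s + 1) k * (a + 1 - a)) by ring.
  apply CI_bound; try lra.
  - intros t Ht. apply rcont_ext with (fun x => RCpow a (- s) + RtoC (-1) * RCpow x (- s))%C. intros; ring.
    apply rcont_plus; [apply rcont_const|]. apply rcont_scal, RCpow_rcont. lra.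
  - intros t Ht. rewrite Cmod_minus_sym. eapply Rle_trans. apply RCpow_diff; lra.
    unfold zterm. fold a. rewrite <- (Rmult_1_r (Cmod s * Rpower a (- (Re s + 1)))) at 2.
    apply Rmult_le_compat_l; [|lra]. apply Rmult_le_pos; [apply Cmod_ge_0|]. apply Rlt_le, exp_pos.
Qed.

(** The subtracted integrals telescope to the integral of x^(-s) from 1. *)
Lemma Dk_sum s N : s <> RtoC 1 ->
  csum (Dk s) N = (csum (fun k => RCpow (INR (S k)) (- s)) N - (RCpow (INR (S (S N))) (1 - s) - 1) / (1 - s))%C.
Proof.
  intros H1. assert (Hn : (1 - s)%C <> RtoC 0) by (apply Csub_neq0; auto).
  induction N.
  - change (csum (Dk s) 0) with (Dk s 0). change (csum (fun k => RCpow (INR (S k)) (- s)) 0) with (RCpow (INR 1) (- s)).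
    unfold Dk. replace (RCpow (INR 1) (1 - s)) with (RtoC 1). reflexivity.
    unfold RCpow. simpl INR. rewrite ln_1, Cmult_0_r. symmetry. apply Cexp_0.
  - rewrite !csum_S, IHN. unfold Dk at 1. field. auto.
Qed.

Lemma zterm_decr x y k : x <= y -> zterm y k <= zterm x k.
Proof.
  intros Hy. unfold zterm, Rpower.
  assert (H := INR_S_pos k). assert (0 <= ln (INR (S k))).
  { rewrite <- ln_1. destruct (Rle_lt_or_eq_dec _ _ H) as [L|E]; [|rewrite <- E; lra].
    apply Rlt_le, ln_increasing; lra. }
  assert (Q : - y * ln (INR (S k)) <= - x * ln (INR (S k))) by nra.
  destruct (Rle_lt_or_eq_dec _ _ Q) as [L|E]; [|rewrite E; lra]. apply Rlt_le, exp_increasing, L.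
Qed.

Lemma Rpower_small e c : 0 < e -> c < 0 -> exists N, forall k, (N <= k)%nat -> Rpower (INR (S (S k))) c < e.
Proof.
  intros He Hc. destruct (INR_unbounded (Rpower e (/ c))) as [N HN]. exists N. intros k Hk.
  assert (INR N <= INR k) by now apply le_INR.
  assert (INR k <= INR (S (S k))) by (apply le_INR; lia).
  replace e with (Rpower (Rpower e (/ c)) c) by (rewrite Rpower_mult, Rinv_l, Rpower_1; lra).
  assert (P : 0 < Rpower e (/ c)) by apply exp_pos.
  unfold Rpower at 1 2. apply exp_increasing.
  assert (ln (Rpower e (/ c)) < ln (INR (S (S k)))) by (apply ln_increasing; lra). nra.
Qed.

Section ZetaContinuation.
Variable Z : C -> C.
Hypothesis HZ : is_zeta Z.

Lemma Dk_zeta s : 1 < Re s -> forall e, 0 < e -> exists N, forall k, (N <= k)%nat ->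
  Cmod (csum (Dk s) k - (Z s - / (s - 1))) < e.
Proof.
  intros Hs e He. assert (H1 : s <> RtoC 1) by (intros ->; simpl in Hs; lra).
  assert (Hn : (1 - s)%C <> RtoC 0) by (apply Csub_neq0; auto).
  assert (Hn2 : (s - 1)%C <> RtoC 0) by (apply Csub_neq0; auto).
  assert (Hp : 0 < Cmod (1 - s)) by now apply Cmod_gt_0.
  destruct (zeta_seq Z HZ s Hs (e / 2) ltac:(lra)) as [N1 B1].
  destruct (Rpower_small (e / 2 * Cmod (1 - s)) (1 - Re s)) as [N2 B2]; [nra|lra|].
  exists (max N1 N2). intros k Hk. specialize (B1 k ltac:(lia)). specialize (B2 k ltac:(lia)).
  rewrite Dk_sum by auto.
  set (A := csum (fun k => RCpow (INR (S k)) (- s)) k) in *.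
  replace (A - (RCpow (INR (S (S k))) (1 - s) - 1) / (1 - s) - (Z s - / (s - 1)))%C with
    ((A - Z s) - RCpow (INR (S (S k))) (1 - s) / (1 - s))%C by (field; auto).
  eapply Rle_lt_trans; [apply Cmod_minus_le|].
  rewrite Cmod_div, RCpow_Cmod by (auto; assert (Q := INR_S_pos (S k)); lra).
  replace (Re (1 - s)) with (1 - Re s) by reflexivity.
  assert (Rpower (INR (S (S k))) (1 - Re s) / Cmod (1 - s) < e / 2).
  { apply Rmult_lt_reg_r with (Cmod (1 - s)); auto. unfold Rdiv at 1. rewrite Rmult_assoc, Rinv_l by lra. lra. }
  lra.
Qed.

Lemma Dk_abs s N : 0 < Re s -> s <> RtoC 1 -> Cmod (csum (Dk s) N) <= Cmod s * zr Z (Re s + 1).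
Proof.
  intros Hs H1. eapply Rle_trans; [apply (csum_le _ (fun k => zterm (Re s + 1) k * Cmod s))|].
  - intros k. rewrite Rmult_comm. now apply Dk_bound.
  - rewrite <- scal_sum. apply Rmult_le_compat_l; [apply Cmod_ge_0|]. apply (zsum_le Z HZ); lra.
Qed.

(** Quantifies the simple pole with residue 1. Its use is that (s - 1) zeta(s) tends to 1, which
    makes xi(1) non-zero. *)
Lemma zeta_pole s : 1 < Re s -> Cmod (Z s - / (s - 1)) <= 2 * Cmod s.
Proof.
  intros Hs. apply Rnot_lt_le. intros L.
  destruct (Dk_zeta s Hs (Cmod (Z s - / (s - 1)) - 2 * Cmod s) ltac:(lra)) as [N HN].
  specialize (HN N (Nat.le_refl N)).
  assert (B := Dk_abs s N ltac:(lra) ltac:(intros ->; simpl in Hs; lra)).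
  assert (B2 := zr_le2 Z HZ (Re s + 1) ltac:(lra)). assert (P := Cmod_ge_0 s).
  assert (T := Cmod_rev (Z s - / (s - 1)) (csum (Dk s) N)).
  rewrite (Cmod_minus_sym _ (csum (Dk s) N)) in T.
  assert (Cmod s * zr Z (Re s + 1) <= Cmod s * 2) by (apply Rmult_le_compat_l; lra). lra.
Qed.

(** Sum of the series of [Dk]. It continues zeta(s) - 1/(s - 1) beyond Re s > 1; taking limits
    coordinatewise with [Lim_seq] makes it a total function. *)
Definition zW (s : C) : C :=
  (real (Lim_seq (fun N => Re (csum (Dk s) N))), real (Lim_seq (fun N => Im (csum (Dk s) N)))).

(** A sequence whose increments are dominated by those of a convergent one converges, and the tail
    of the dominating sequence bounds the distance to the limit. *)
Lemma cauchy_lim (u b : nat -> R) (l : R) : is_lim_seq b l ->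
  (forall N M, (N <= M)%nat -> Rabs (u M - u N) <= b M - b N) ->
  forall N, Rabs (u N - real (Lim_seq u)) <= l - b N.
Proof.
  intros Hb H.
  assert (E : ex_finite_lim_seq u).
  { apply ex_lim_seq_cauchy_corr. intros e.
    assert (Hb' : ex_finite_lim_seq b) by (exists l; exact Hb).
    apply ex_lim_seq_cauchy_corr in Hb'. destruct (Hb' e) as [N HN]. exists N. intros n m Hn Hm.
    assert (HNm := HN n m Hn Hm). apply Rabs_def2 in HNm.
    destruct (Nat.le_ge_cases n m) as [L|L].
    - rewrite Rabs_minus_sym. specialize (H n m L). lra.
    - specialize (H m n L). lra. }
  destruct E as [x Hx]. rewrite (is_lim_seq_unique _ _ Hx). simpl. intros N.
  apply (is_lim_seq_le_loc (fun M => Rabs (u N - u M)) (fun M => b M - b N) (Rabs (u N - x)) (l - b N)).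
  - exists N. intros M HM. rewrite Rabs_minus_sym. auto.
  - apply (is_lim_seq_abs (fun M => u N - u M) (u N - x)). apply is_lim_seq_minus'; [apply is_lim_seq_const|exact Hx].
  - apply is_lim_seq_minus'; [exact Hb|apply is_lim_seq_const].
Qed.

(** For Re s >= 1/8 the terms are dominated by |s| (k+1)^(-9/8), so the tail of zeta(9/8) gives a
    rate uniform in s; the factor 2 comes from treating the two coordinates separately. *)
Lemma zW_unif s N : 1 / 8 <= Re s -> s <> RtoC 1 ->
  Cmod (csum (Dk s) N - zW s) <= 2 * Cmod s * (zr Z (9 / 8) - zsum (9 / 8) N).
Proof.
  intros Hs H1.
  assert (Lb : is_lim_seq (fun N => Cmod s * zsum (9 / 8) N) (Cmod s * zr Z (9 / 8))).
  { apply (is_lim_seq_scal_l (zsum (9 / 8)) (Cmod s) (zr Z (9 / 8))). apply (zr_lim Z HZ). lra. }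
  assert (D : forall N M, (N <= M)%nat -> Cmod (csum (Dk s) M - csum (Dk s) N) <= Cmod s * zsum (9 / 8) M - Cmod s * zsum (9 / 8) N).
  { intros n m L. rewrite <- Rmult_minus_distr_l, Rmult_comm, Rmult_minus_distr_r.
    rewrite !(Rmult_comm _ (Cmod s)). unfold zsum. rewrite !scal_sum.
    apply csum_diff_le; auto. intros k. eapply Rle_trans; [apply Dk_bound; auto; lra|].
    rewrite Rmult_comm. apply Rmult_le_compat_r; [apply Cmod_ge_0|]. apply zterm_decr. lra. }
  assert (A1 := cauchy_lim (fun N => Re (csum (Dk s) N)) _ _ Lb).
  assert (A2 := cauchy_lim (fun N => Im (csum (Dk s) N)) _ _ Lb).
  eapply Rle_trans; [apply Cmod_le_Re_Im|].
  replace (2 * Cmod s * (zr Z (9 / 8) - zsum (9 / 8) N)) with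
    ((Cmod s * zr Z (9 / 8) - Cmod s * zsum (9 / 8) N) + (Cmod s * zr Z (9 / 8) - Cmod s * zsum (9 / 8) N)) by ring.
  apply Rplus_le_compat.
  - apply A1. intros n m L. eapply Rle_trans; [|apply D, L]. apply (Re_le_Cmod (csum (Dk s) m - csum (Dk s) n)).
  - apply A2. intros n m L. eapply Rle_trans; [|apply D, L]. apply (Im_le_Cmod (csum (Dk s) m - csum (Dk s) n)).
Qed.

Lemma zsum_tail e : 0 < e -> exists N, forall k, (N <= k)%nat -> 0 <= zr Z (9 / 8) - zsum (9 / 8) k < e.
Proof.
  intros He. assert (L := zr_lim Z HZ (9 / 8) ltac:(lra)). apply is_lim_seq_spec in L.
  destruct (L (mkposreal e He)) as [N HN]. exists N. intros k Hk. specialize (HN k Hk). simpl in HN.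
  apply Rabs_def2 in HN. assert (Q := zsum_le Z HZ (9 / 8) k ltac:(lra)). lra.
Qed.

Lemma zW_eq s : 1 < Re s -> zW s = (Z s - / (s - 1))%C.
Proof.
  intros Hs. assert (H1 : s <> RtoC 1) by (intros ->; simpl in Hs; lra).
  apply NNPP. intros N. assert (P := Cmod_sub_gt0 _ _ N). set (m := Cmod (zW s - (Z s - / (s - 1)))) in *.
  destruct (Dk_zeta s Hs (m / 2) ltac:(lra)) as [N1 B1].
  assert (Q := Cmod_ge_0 s).
  destruct (zsum_tail (m / (4 * (Cmod s + 1)))) as [N2 B2]; [apply Rdiv_lt_0_compat; lra|].
  set (k := max N1 N2). specialize (B1 k ltac:(unfold k; lia)). specialize (B2 k ltac:(unfold k; lia)).
  assert (U := zW_unif s k ltac:(lra) H1).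
  assert (T := Cmod_triangle (zW s - csum (Dk s) k) (csum (Dk s) k - (Z s - / (s - 1)))).
  replace (zW s - csum (Dk s) k + (csum (Dk s) k - (Z s - / (s - 1))))%C with (zW s - (Z s - / (s - 1)))%C in T by ring.
  fold m in T. rewrite (Cmod_minus_sym (zW s)) in T.
  assert (2 * Cmod s * (zr Z (9 / 8) - zsum (9 / 8) k) <= m / 2).
  { apply Rle_trans with (2 * (Cmod s + 1) * (m / (4 * (Cmod s + 1)))).
    - apply Rmult_le_compat; lra.
    - right. field. lra. }
  lra.
Qed.

Lemma Dk_hol s k : s <> RtoC 1 -> hol (fun s => Dk s k) s.
Proof.
  intros H. unfold Dk. apply hol_minus; [auto with holo|]. apply hol_div; auto 6 with holo. apply Csub_neq0; auto.
Qed.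

Lemma zW_hol s : 3 / 16 < Re s -> s <> RtoC 1 -> hol zW s.
Proof.
  intros Hs H1. assert (P := Cmod_sub_gt0 _ _ H1).
  destruct (small_list (Cmod (s - 1) / 3 :: (1 / 40) :: nil)) as [r Hr]; [simpl; lra|]. simpl in Hr.
  assert (IN : forall y, Cmod (y - s) <= 2 * r -> 1 / 8 <= Re y /\ y <> RtoC 1).
  { intros y Hy. split.
    - assert (A := Re_le_Cmod (y - s)). replace (Re (y - s)) with (Re y - Re s) in A by reflexivity.
      apply Rabs_le_between in A. lra.
    - intros ->. rewrite Cmod_minus_sym in Hy. lra. }
  apply (weierstrass (fun N s => csum (Dk s) N) zW s r); [lra| |].
  - intros N y Hy. apply (csum_hol (fun k s => Dk s k)). intros k. apply Dk_hol. now apply IN.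
  - intros e He. assert (Q := Cmod_ge_0 s).
    destruct (zsum_tail (e / (2 * (Cmod s + 1)))) as [N HN]; [apply Rdiv_lt_0_compat; lra|].
    exists N. intros y Hy. destruct (IN y Hy) as [Y1 Y2].
    specialize (HN N (Nat.le_refl N)).
    eapply Rle_trans; [now apply zW_unif|].
    assert (T := Cmod_triangle (y - s) s). replace (y - s + s)%C with y in T by ring.
    assert (Py := Cmod_ge_0 y).
    apply Rle_trans with (2 * (Cmod s + 1) * (e / (2 * (Cmod s + 1)))).
    + apply Rmult_le_compat; lra.
    + right. field. lra.
Qed.

Lemma zW_abs s : 1 / 8 <= Re s -> s <> RtoC 1 -> Cmod (zW s) <= 3 * Cmod s * zr Z (9 / 8).
Proof.
  intros Hs H1. assert (U := zW_unif s 0 Hs H1). rewrite zsum_0 in U. assert (B := Dk_abs s 0 ltac:(lra) H1).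
  assert (Q := Cmod_ge_0 s).
  assert (D := zr_decr Z HZ (9 / 8) (Re s + 1) ltac:(lra) ltac:(lra)).
  assert (T := Cmod_rev (zW s) (csum (Dk s) 0)). rewrite Cmod_minus_sym in T.
  assert (Cmod s * zr Z (Re s + 1) <= Cmod s * zr Z (9 / 8)) by (apply Rmult_le_compat_l; lra). lra.
Qed.

(** The square of half-side 7/4 around 2 + i Im s covers 1/4 < Re < 15/4. The condition |Im s| >= 4
    keeps it away from the pole at 1, and its centre lies where [zW_eq] holds. *)
Lemma zeta_continued s : 1 / 4 < Re s < 15 / 4 -> 4 <= Rabs (Im s) -> Z s = (zW s + / (s - 1))%C.
Proof.
  intros Hs Ht. set (p := (2, Im s) : C).
  assert (E : (zW s - (Z s - / (s - 1)))%C = RtoC 0).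
  { apply (identity_square (fun s => zW s - (Z s - / (s - 1)))%C p (7 / 4)).
    - intros y Hy. unfold inR, p in Hy; simpl in Hy.
      assert (HI : 1 <= Rabs (Im y)).
      { revert Ht. unfold Rabs. do 2 destruct Rcase_abs; lra. }
      exists (1 / 32). split; [lra|]. intros x Hx.
      assert (A := Re_le_Cmod (x - y)). assert (B := Im_le_Cmod (x - y)).
      replace (Re (x - y)) with (Re x - Re y) in A by reflexivity.
      replace (Im (x - y)) with (Im x - Im y) in B by reflexivity.
      assert (N1 : x <> RtoC 1).
      { intros ->. replace (Im (RtoC 1) - Im y) with (- Im y) in B by (unfold Im; simpl; ring). rewrite Rabs_Ropp in B. lra. }
      apply Rabs_le_between in A.
      apply hol_minus; [apply zW_hol; auto; lra|]. apply hol_minus.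
      + apply hol_ex_derive. apply (proj1 HZ). exact N1.
      + apply hol_inv; auto with holo. now apply Csub_neq0.
    - generalize (near_Re_gt p 1 ltac:(unfold p; simpl; lra)). apply near_mono. intros y Hy. rewrite zW_eq by auto. ring.
    - eapply Rle_lt_trans; [apply Cmod_le_Re_Im|]. replace (Re (s - p)) with (Re s - 2) by reflexivity.
      replace (Im (s - p)) with (Im s - Im s) by reflexivity. rewrite Rminus_eq_0, Rabs_R0, Rplus_0_r.
      apply Rabs_def1; lra. }
  replace (zW s) with ((zW s - (Z s - / (s - 1))) + (Z s - / (s - 1)))%C by ring. rewrite E. ring.
Qed.

(** For Re s < 2 the bound of [zW_abs] is linear in |s| and the pole term is at most 1; for Re s >=
    2 zeta is bounded by 2. *)
Theorem zeta_growth : exists K, 0 < K /\ forall s, 1 / 2 <= Re s -> 4 <= Rabs (Im s) -> Cmod (Z s) <= K * Cmod s.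
Proof.
  assert (Q := zr_ge1 Z HZ (9 / 8) ltac:(lra)).
  exists (3 * zr Z (9 / 8) + 2). split; [lra|]. intros s Hs Ht.
  assert (H4 : 4 <= Cmod s) by (eapply Rle_trans; [exact Ht|apply Im_le_Cmod]).
  destruct (Rle_lt_dec 2 (Re s)) as [L|L].
  - eapply Rle_trans; [apply (zeta_abs Z HZ); lra|]. assert (B := zr_le2 Z HZ (Re s) L). nra.
  - assert (N1 : s <> RtoC 1).
    { intros ->. unfold Im in Ht; simpl in Ht. rewrite Rabs_R0 in Ht. lra. }
    rewrite zeta_continued by (auto; lra). eapply Rle_trans; [apply Cmod_triangle|].
    assert (B := zW_abs s ltac:(lra) N1).
    assert (B2 : Cmod (/ (s - 1)) <= 1).
    { assert (G := Im_le_Cmod (s - 1)). replace (Im (s - 1)) with (Im s) in G by (unfold Im; simpl; ring).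
      destruct (Cinv_gap 1 (s - 1) ltac:(lra) ltac:(lra)) as [_ B2]. lra. }
    nra.
Qed.
End ZetaContinuation.

(** * The xi function and the size of lambda *)

Section XiFacts.
Variables G Z xi : C -> C.
Hypothesis HG : is_Gamma G.
Hypothesis HZ : is_zeta Z.
Hypothesis Hxi : is_xi G Z xi.

Lemma xi_hol z : hol xi z.
Proof. apply hol_ex_derive. exact (proj1 Hxi z I). Qed.

Lemma Re_half s : Re (s / 2) = Re s / 2.
Proof. unfold Re, Cdiv, Cmult, Cinv; simpl. field. Qed.

Lemma xi_eq s : 0 < Re s -> s <> RtoC 1 ->
  xi s = (RtoC (1 / 2) * RCpow PI (- s / 2) * G (s / 2) * s * (s - 1) * Z s)%C.
Proof.
  intros Hs H1. apply (proj2 Hxi); auto. intros [k Hk].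
  assert (E : Re (s / 2) = - INR k) by (rewrite Hk; reflexivity).
  rewrite Re_half in E. assert (P := pos_INR k). lra.
Qed.

(** The completed zeta function on the real axis: xi(x) = x(x-1)/2 times [Lam x]. Each of its
    factors is log-convex, in contrast to xi itself, whose polynomial factor is split off for this
    reason. *)
Definition Lam (x : R) : R := Rpower PI (- x / 2) * Gr G (x / 2) * zr Z x.

Lemma Lam_pos x : 1 < x -> 0 < Lam x.
Proof.
  intros Hx. unfold Lam. repeat apply Rmult_lt_0_compat. apply exp_pos.
  apply (Gr_pos G HG); lra. assert (H := zr_ge1 Z HZ x Hx). lra.
Qed.

Definition Xr (x : R) : R := / 2 * x * (x - 1) * Lam x.

Lemma xi_real x : 1 < x -> xi (RtoC x) = RtoC (Xr x).
Proof.
  intros Hx. rewrite xi_eq.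
  - replace (RtoC x / 2)%C with (RtoC (x / 2)) by (rewrite RtoC_div; [reflexivity|lra]).
    rewrite (Gamma_real G HG) by lra. rewrite (zeta_real Z HZ) by auto.
    replace (- RtoC x / 2)%C with (RtoC (- x / 2)) by (rewrite RtoC_div, RtoC_opp; [reflexivity|lra]).
    rewrite RCpow_real. unfold Xr, Lam. rewrite !RtoC_mult, RtoC_minus.
    replace (1 / 2) with (/ 2) by field. ring.
  - exact (Rlt_trans _ _ _ Rlt_0_1 Hx).
  - intros E. injection E. lra.
Qed.

Lemma xi_abs s : 1 < Re s -> Cmod (xi s) <= / 2 * Cmod s * Cmod (s - 1) * Lam (Re s).
Proof.
  intros Hs. rewrite xi_eq; [|lra|intros ->; simpl in Hs; lra].
  rewrite !Cmod_mult, Cmod_R, Rabs_right, RCpow_Cmod by (try apply PI_RGT_0; lra).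
  replace (Re (- s / 2)) with (- Re s / 2) by (unfold Re, Cdiv, Cmult, Cinv; simpl; field).
  assert (A := Gamma_abs G HG (s / 2) ltac:(rewrite Re_half; lra)). rewrite Re_half in A.
  assert (B := zeta_abs Z HZ s Hs).
  set (p := Rpower PI (- Re s / 2)). assert (Hp : 0 < p) by apply exp_pos.
  unfold Lam. fold p.
  replace (1 / 2 * p * Cmod (G (s / 2)) * Cmod s * Cmod (s - 1) * Cmod (Z s)) with
    ((/ 2 * Cmod s * Cmod (s - 1)) * (p * Cmod (G (s / 2)) * Cmod (Z s))) by field.
  apply Rmult_le_compat_l.
  - apply Rmult_le_pos; [|apply Cmod_ge_0]. apply Rmult_le_pos; [lra|apply Cmod_ge_0].
  - apply Rmult_le_compat; auto using Cmod_ge_0.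
    + apply Rmult_le_pos; [lra|apply Cmod_ge_0].
    + apply Rmult_le_compat_l; lra.
Qed.

Lemma Gr_bounded A : exists K, 0 < K /\ forall x, 1 / 4 <= x <= A -> Gr G x <= K.
Proof.
  destruct (Rle_lt_dec (1 / 4) A) as [L|L].
  - destruct (rcont_bounded (fun t => G (RtoC t)) (1 / 4) A L) as [M HM].
    + intros t Ht. apply (rcont_comp G RtoC).
      * apply hol_ccont, hol_ex_derive. apply (proj1 HG). intros [k Hk].
        injection Hk. assert (P := pos_INR k). lra.
      * apply rcont_ext with (fun u => RtoC 0 + RtoC u * RtoC 1)%C. intros; ring. apply rcont_line.
    + exists (Rabs M + 1). split. assert (P := Rabs_pos M). lra.
      intros x Hx. specialize (HM x Hx). assert (P := Rle_abs M). unfold Gr.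
      assert (Q := Re_le_Cmod (G (RtoC x))). assert (Q2 := Rle_abs (Re (G (RtoC x)))). lra.
  - exists 1. split; [lra|]. intros; lra.
Qed.

(** One power of |s| comes from each of s, s - 1 and zeta. Gamma and the power of pi stay bounded
    because the real part is confined. *)
Lemma xi_growth A : exists K, 0 < K /\ forall s, 1 / 2 <= Re s <= A -> 4 <= Rabs (Im s) ->
  Cmod (xi s) <= K * Cmod s ^ 3.
Proof.
  destruct (Gr_bounded (A / 2)) as [M [HM BM]]. destruct (zeta_growth Z HZ) as [Kz [HKz Bz]].
  exists (M * Kz). split; [nra|]. intros s Hs Ht.
  assert (H4 : 4 <= Cmod s) by (eapply Rle_trans; [exact Ht|apply Im_le_Cmod]).
  rewrite xi_eq; [|lra|].
  2: { intros ->. unfold Im in Ht; simpl in Ht. rewrite Rabs_R0 in Ht. lra. }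
  rewrite !Cmod_mult, Cmod_R, Rabs_right, RCpow_Cmod by (try apply PI_RGT_0; lra).
  replace (Re (- s / 2)) with (- Re s / 2) by (unfold Re, Cdiv, Cmult, Cinv; simpl; field).
  assert (HA := Gamma_abs G HG (s / 2) ltac:(rewrite Re_half; lra)). rewrite Re_half in HA.
  specialize (BM (Re s / 2) ltac:(lra)). specialize (Bz s ltac:(lra) Ht).
  assert (HP : Rpower PI (- Re s / 2) <= 1).
  { rewrite <- (Rpower_O PI) by apply PI_RGT_0. apply Rle_Rpower; [|lra]. assert (P := PI2_1). lra. }
  assert (HP0 : 0 < Rpower PI (- Re s / 2)) by apply exp_pos.
  assert (H1 : Cmod (s - 1) <= 2 * Cmod s).
  { eapply Rle_trans; [apply Cmod_minus_le|]. rewrite Cmod_1. lra. }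
  set (p := Rpower PI (- Re s / 2)) in *.
  apply Rle_trans with (1 / 2 * 1 * M * Cmod s * (2 * Cmod s) * (Kz * Cmod s)).
  - assert (Q1 := Cmod_ge_0 (G (s / 2))). assert (Q2 := Cmod_ge_0 (s - 1)). assert (Q3 := Cmod_ge_0 (Z s)).
    repeat (apply Rmult_le_compat; try lra; try (repeat apply Rmult_le_pos; lra)).
  - right. simpl. field.
Qed.

(** At 1 xi is known only by continuity. Along s = 1 + h the factor [P] stays near its non-zero
    value and h zeta(1 + h) stays at least 1/2. The point matters because f(1/2) = xi(1) is the end
    of the interval in [lam_large]. *)
Lemma xi_1_neq0 : xi 1 <> RtoC 0.
Proof.
  set (P := fun s : C => (RtoC (1 / 2) * RCpow PI (- s / 2) * G (s / 2) * s)%C).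
  assert (HP1 : P 1 <> RtoC 0).
  { unfold P. repeat apply Cmult_neq_0; try (apply RtoC_neq0; lra).
    - apply RCpow_neq0.
    - replace (1 / 2)%C with (RtoC (1 / 2)) by (rewrite RtoC_div; [reflexivity|lra]).
      rewrite (Gamma_real G HG) by lra. apply RtoC_neq0. assert (Q := Gr_pos G HG (1 / 2) ltac:(lra)). lra. }
  assert (HPc : ccont P 1).
  { unfold P. apply hol_ccont. apply hol_mult; auto with holo. apply hol_mult.
    - apply hol_scal. apply hol_RCpow. unfold Cdiv. auto with holo.
    - apply (hol_comp G (fun s => s / 2)%C).
      + apply hol_ex_derive. apply (proj1 HG). intros [k Hk].
        assert (E : Re (1 / 2) = - INR k) by (rewrite Hk; reflexivity).
        rewrite Re_half in E. simpl in E. assert (Q := pos_INR k). lra.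
      + unfold Cdiv. auto with holo. }
  assert (Q := ccont_near_lower P 1 HPc HP1). assert (Hm : 0 < Cmod (P 1)) by now apply Cmod_gt_0.
  intros E. destruct (hol_ccont _ _ (xi_hol 1) (Cmod (P 1) / 4) ltac:(lra)) as [d [Hd HC]].
  destruct Q as [d2 [Hd2 Q]].
  destruct (small_list (d / 2 :: d2 / 2 :: (1 / 8) :: nil)) as [h Hh]; [simpl; lra|]. simpl in Hh.
  set (s := RtoC (1 + h)).
  assert (Es : (s - 1)%C = RtoC h) by (unfold s; rewrite RtoC_plus; ring).
  specialize (HC s). specialize (Q s). rewrite Es, Cmod_R, Rabs_right in HC, Q by lra.
  specialize (HC ltac:(lra)). specialize (Q ltac:(lra)).
  rewrite E in HC. replace (xi s - 0)%C with (xi s) in HC by ring.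
  rewrite xi_eq in HC; [|unfold s; simpl; lra|unfold s; intros F; injection F; lra].
  fold (P s) in HC. rewrite Es in HC.
  assert (ZP := zeta_pole Z HZ s ltac:(unfold s; simpl; lra)). rewrite Es in ZP.
  assert (HZ1 : 1 / 2 <= Cmod (RtoC h * Z s)).
  { assert (T := Cmod_rev (RtoC 1) (RtoC 1 - RtoC h * Z s)).
    replace (RtoC 1 - (RtoC 1 - RtoC h * Z s))%C with (RtoC h * Z s)%C in T by ring.
    replace (RtoC 1 - RtoC h * Z s)%C with (- (RtoC h * (Z s - / RtoC h)))%C in T by (field; apply RtoC_neq0; lra).
    rewrite Cmod_1, Cmod_opp, Cmod_RtoC_mult, Rabs_right in T by lra.
    assert (Cmod s = 1 + h) by (unfold s; rewrite Cmod_R, Rabs_right; lra).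
    assert (h * Cmod (Z s - / RtoC h) <= 1 / 8 * 3) by (apply Rmult_le_compat; try lra; apply Cmod_ge_0). lra. }
  replace (P s * RtoC h * Z s)%C with (P s * (RtoC h * Z s))%C in HC by ring.
  rewrite Cmod_mult in HC.
  assert (Cmod (P 1) / 2 * (1 / 2) <= Cmod (P s) * Cmod (RtoC h * Z s)) by (apply Rmult_le_compat; lra). lra.
Qed.

Definition ell (x : R) : R := ln (Lam x).

Lemma ell_eq x : 1 < x -> ell x = - x / 2 * ln PI + ln (Gr G (x / 2)) + ln (zr Z x).
Proof.
  intros Hx. unfold ell, Lam. assert (P1 := Gr_pos G HG (x / 2) ltac:(lra)). assert (P2 := zr_ge1 Z HZ x Hx).
  assert (P3 : 0 < Rpower PI (- x / 2)) by apply exp_pos.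
  rewrite !ln_mult; try lra. 2: now apply Rmult_lt_0_compat. f_equal. f_equal. unfold Rpower. apply ln_exp.
Qed.

Lemma ell_convex a b th : 1 < a -> 1 < b -> 0 <= th <= 1 ->
  ell (th * a + (1 - th) * b) <= th * ell a + (1 - th) * ell b.
Proof.
  intros Ha Hb Ht.
  assert (Hc : 1 < th * a + (1 - th) * b).
  { destruct (Req_dec th 0) as [->|N]; [lra|].
    assert (0 < th * (a - 1)) by (apply Rmult_lt_0_compat; lra).
    assert (0 <= (1 - th) * (b - 1)) by (apply Rmult_le_pos; lra). lra. }
  rewrite !ell_eq by auto.
  assert (A := Gr_logconvex G HG (a / 2) (b / 2) th ltac:(lra) ltac:(lra) Ht).
  replace (th * (a / 2) + (1 - th) * (b / 2)) with ((th * a + (1 - th) * b) / 2) in A by field.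
  assert (B := zr_logconvex Z HZ a b th Ha Hb Ht).
  replace (- (th * a + (1 - th) * b) / 2 * ln PI) with (th * (- a / 2 * ln PI) + (1 - th) * (- b / 2 * ln PI)) by field.
  lra.
Qed.

(** The three-chord inequality for the convex function [ell], with denominators cleared. *)
Lemma ell_slope a b c : 1 < a -> a < b -> b < c ->
  (ell b - ell a) * (c - b) <= (ell c - ell b) * (b - a).
Proof.
  intros Ha Hb Hc. set (th := (c - b) / (c - a)).
  assert (Ht : 0 <= th <= 1).
  { unfold th. split. apply Rmult_le_pos; [lra|]. apply Rlt_le, Rinv_0_lt_compat; lra.
    apply Rmult_le_reg_r with (c - a); [lra|]. unfold Rdiv. rewrite Rmult_assoc, Rinv_l; lra. }
  assert (A := ell_convex a c th Ha ltac:(lra) Ht).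
  replace (th * a + (1 - th) * c) with b in A by (unfold th; field; lra).
  apply Rmult_le_compat_r with (r := c - a) in A; [|lra].
  replace ((th * ell a + (1 - th) * ell c) * (c - a)) with ((c - b) * ell a + (b - a) * ell c) in A by (unfold th; field; lra).
  lra.
Qed.

(** The recursion Gamma(x/2 + 1) = (x/2) Gamma(x/2) makes the increment over a step of 2 explicit;
    the zeta factors change it by at most ln 2, whence the 4 pi against the 2 pi. *)
Lemma ell_step x : 2 <= x -> ln (x / (4 * PI)) <= ell (x + 2) - ell x <= ln (x / (2 * PI)).
Proof.
  intros Hx. assert (PP := PI_RGT_0). rewrite !ell_eq by lra.
  replace ((x + 2) / 2) with (x / 2 + 1) by field. rewrite (Gr_succ G HG) by lra.
  assert (P1 := Gr_pos G HG (x / 2) ltac:(lra)).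
  rewrite ln_mult by lra.
  assert (Z1 := zr_ge1 Z HZ (x + 2) ltac:(lra)). assert (Z2 := zr_le2 Z HZ x Hx).
  assert (Z3 := zr_decr Z HZ x (x + 2) ltac:(lra) ltac:(lra)).
  assert (L1 : ln (zr Z (x + 2)) <= ln (zr Z x)).
  { destruct (Rle_lt_or_eq_dec _ _ Z3) as [L|E]; [|rewrite E; lra]. apply Rlt_le, ln_increasing; lra. }
  assert (L2 : ln (zr Z x) <= ln 2).
  { destruct (Rle_lt_or_eq_dec _ _ Z2) as [L|E]; [|rewrite E; lra]. apply Rlt_le, ln_increasing; lra. }
  assert (L3 : 0 <= ln (zr Z (x + 2))).
  { rewrite <- ln_1. destruct (Rle_lt_or_eq_dec _ _ Z1) as [L|E]; [|rewrite <- E; lra]. apply Rlt_le, ln_increasing; lra. }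
  replace (ln (x / (4 * PI))) with (ln (x / 2) - ln PI - ln 2).
  2: { rewrite <- !ln_div by (try lra; try apply Rdiv_lt_0_compat; lra). f_equal. field. lra. }
  replace (ln (x / (2 * PI))) with (ln (x / 2) - ln PI).
  2: { rewrite <- !ln_div by (try lra; try apply Rdiv_lt_0_compat; lra). f_equal. field. lra. }
  lra.
Qed.
End XiFacts.

(** * Size of f on the real axis and of lambda *)

Section Scaling.
Variables G Z xi : C -> C.
Hypothesis HG : is_Gamma G.
Hypothesis HZ : is_zeta Z.
Hypothesis Hxi : is_xi G Z xi.

Definition fx (z : C) : C := xi (RtoC (1 / 2) + z)%C.
Definition fr (x : R) : R := Xr G Z (1 / 2 + x).

Lemma fx_hol z : hol fx z.
Proof. unfold fx. apply (hol_comp xi). apply (xi_hol G Z xi Hxi). auto with holo. Qed.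

Lemma fx_real x : 1 / 2 < x -> fx (RtoC x) = RtoC (fr x).
Proof.
  intros Hx. unfold fx, fr. rewrite <- RtoC_plus. apply (xi_real G Z xi HG HZ Hxi). lra.
Qed.

Lemma fr_pos x : 1 / 2 < x -> 0 < fr x.
Proof.
  intros Hx. unfold fr, Xr. assert (P := Lam_pos G Z HG HZ (1 / 2 + x) ltac:(lra)).
  apply Rmult_lt_0_compat; [|exact P]. repeat apply Rmult_lt_0_compat; lra.
Qed.

Lemma fx_neq0 x : 1 / 2 <= x -> fx (RtoC x) <> RtoC 0.
Proof.
  intros [Hx|<-].
  - rewrite fx_real by auto. apply RtoC_neq0. assert (P := fr_pos x Hx). lra.
  - unfold fx. rewrite <- RtoC_plus. replace (1 / 2 + 1 / 2) with 1 by field.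
    apply (xi_1_neq0 G Z xi HG HZ Hxi).
Qed.

Lemma Cmod_sqrt_bound a t s : 0 < a -> Re s = a -> Im s = t ->
  Cmod s * Cmod s = a * a * (1 + (t / a) * (t / a)).
Proof.
  intros Ha H1 H2. replace (Cmod s * Cmod s) with (Cmod s ^ 2) by ring.
  replace (Cmod s ^ 2) with (a ^ 2 + t ^ 2).
  - field. lra.
  - unfold Cmod. rewrite pow2_sqrt. unfold Re, Im in *. now rewrite H1, H2.
    apply Rplus_le_le_0_compat; apply pow2_ge_0.
Qed.

(** The [Lam] factor only decreases off the axis. In s(s-1) each factor grows relative to its real
    part c by the square root of 1 + (lam y/c)^2, and c >= lam x/2 >= lam/4 gives the 16. *)
Lemma fx_abs lam x y : 2 <= lam -> 1 / 2 <= x ->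
  Cmod (fx (RtoC lam * (x, y))) <= fr (lam * x) * (1 + 16 * (y * y)).
Proof.
  intros Hl Hx. set (s := (RtoC (1 / 2) + RtoC lam * (x, y))%C).
  assert (R1 : Re s = 1 / 2 + lam * x) by (unfold s, Re; simpl; ring).
  assert (R2 : Im s = lam * y) by (unfold s, Im; simpl; ring).
  assert (Hs : 1 < Re s) by (rewrite R1; nra).
  assert (A := xi_abs G Z xi HG HZ Hxi s Hs). unfold fx. fold s.
  set (a := Re s) in *. set (b := a - 1).
  assert (Hb : lam * x / 2 <= b) by (unfold b; nra).
  assert (E1 := Cmod_sqrt_bound a (lam * y) s ltac:(lra) eq_refl R2).
  assert (E2 := Cmod_sqrt_bound b (lam * y) (s - 1)%C ltac:(lra) ltac:(unfold b, a; unfold Re; simpl; ring)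
     ltac:(rewrite <- R2; unfold Im; simpl; ring)).
  assert (Q : forall c, lam * x / 2 <= c -> (lam * y / c) * (lam * y / c) <= 16 * (y * y)).
  { intros c Hc. assert (Hc0 : 0 < c) by lra.
    replace (lam * y / c * (lam * y / c)) with ((lam / c) * (lam / c) * (y * y)) by (field; lra).
    assert (L : lam / c <= 4).
    { apply Rmult_le_reg_r with c; auto. unfold Rdiv. rewrite Rmult_assoc, Rinv_l by lra. nra. }
    assert (L0 : 0 <= lam / c) by (apply Rmult_le_pos; [lra|apply Rlt_le, Rinv_0_lt_compat; lra]).
    apply Rmult_le_compat_r; [nra|]. nra. }
  assert (Q1 := Q a ltac:(rewrite R1; lra)). assert (Q2 := Q b Hb).
  assert (P : Cmod s * Cmod (s - 1) <= a * b * (1 + 16 * (y * y))).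
  { assert (P1 := Cmod_ge_0 s). assert (P2 := Cmod_ge_0 (s - 1)).
    assert (Hy : 0 <= y * y) by nra.
    apply Rsqr_incr_0.
    - unfold Rsqr. replace (Cmod s * Cmod (s - 1) * (Cmod s * Cmod (s - 1))) with ((Cmod s * Cmod s) * (Cmod (s - 1) * Cmod (s - 1))) by ring.
      rewrite E1, E2. set (u := lam * y / a * (lam * y / a)) in *. set (v := lam * y / b * (lam * y / b)) in *.
      replace (a * b * (1 + 16 * (y * y)) * (a * b * (1 + 16 * (y * y)))) with
       ((a * a) * (1 + 16 * (y * y)) * ((b * b) * (1 + 16 * (y * y)))) by ring.
      assert (0 <= u) by (unfold u; apply Rle_0_sqr). assert (0 <= v) by (unfold v; apply Rle_0_sqr).
      apply Rmult_le_compat; try (apply Rmult_le_compat_l; nra); apply Rmult_le_pos; nra.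
    - now apply Rmult_le_pos.
    - repeat apply Rmult_le_pos; lra. }
  eapply Rle_trans; [exact A|]. unfold fr, Xr. rewrite <- R1. fold a.
  assert (PL := Lam_pos G Z HG HZ a Hs).
  replace (/ 2 * a * (a - 1) * Lam G Z a * (1 + 16 * (y * y))) with (/ 2 * (a * b * (1 + 16 * (y * y))) * Lam G Z a) by (unfold b; ring).
  apply Rmult_le_compat_r; [lra|]. lra.
Qed.

Lemma fx_strip_growth A : exists K, 0 < K /\ forall u, 0 <= Re u <= A -> 4 <= Rabs (Im u) ->
  Cmod (fx u) <= K * Cmod u ^ 3.
Proof.
  destruct (xi_growth G Z xi HG HZ Hxi (1 / 2 + A)) as [K [HK B]]. exists (K * 8). split; [lra|].
  intros u Hu Ht. unfold fx.
  assert (R1 : Re (RtoC (1 / 2) + u) = 1 / 2 + Re u) by reflexivity.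
  assert (R2 : Im (RtoC (1 / 2) + u) = Im u) by (unfold Im; simpl; ring).
  specialize (B (RtoC (1 / 2) + u)%C ltac:(rewrite R1; lra) ltac:(rewrite R2; lra)).
  eapply Rle_trans; [exact B|]. rewrite Rmult_assoc. apply Rmult_le_compat_l; [lra|].
  replace (8 * Cmod u ^ 3) with ((2 * Cmod u) ^ 3) by ring. apply pow_incr. split; [apply Cmod_ge_0|].
  eapply Rle_trans; [apply Cmod_triangle|]. rewrite Cmod_R, Rabs_right by lra.
  assert (4 <= Cmod u) by (eapply Rle_trans; [exact Ht|apply Im_le_Cmod]). lra.
Qed.

Lemma scaling_deriv n lam : (1 <= n)%nat -> is_scaling fx n lam ->
  C_derive fx (RtoC lam) = (RtoC (2 * INR n / lam) * fx (RtoC lam))%C.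
Proof.
  intros Hn [Hl E]. assert (N := fx_neq0 lam ltac:(lra)).
  assert (Hn0 : 0 < INR n) by (apply lt_0_INR; lia).
  set (l := C_derive fx (RtoC lam)) in *.
  assert (E2 : (RtoC (lam / INR n) * (l / fx (RtoC lam)))%C = RtoC 2).
  { replace (RtoC 2) with ((RtoC 2 - RtoC (lam / INR n) * (l / fx (RtoC lam))) + RtoC (lam / INR n) * (l / fx (RtoC lam)))%C by ring.
    rewrite E. ring. }
  replace (RtoC (2 * INR n / lam)) with (RtoC 2 * / RtoC (lam / INR n))%C.
  - rewrite <- E2. field. split; [|exact N]. apply RtoC_neq0. apply Rgt_not_eq. apply Rdiv_lt_0_compat; lra.
  - rewrite <- RtoC_inv, <- RtoC_mult. f_equal. field. lra. apply Rgt_not_eq. apply Rdiv_lt_0_compat; lra.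
Qed.

(** The scaling equation makes the logarithmic derivative of f at [lam] equal to 2n/lam, whereas
    this derivative is bounded on [1/2, L']. *)
Lemma lam_large L : exists N, (1 <= N)%nat /\ forall n lam, (N <= n)%nat -> is_scaling fx n lam -> L < lam.
Proof.
  assert (HL : exists L', L <= L' /\ 1 <= L') by (exists (Rmax L 1); split; [apply Rmax_l|apply Rmax_r]).
  destruct HL as [L' [HL1 HL2]].
  destruct (rcont_bounded (fun t => C_derive fx (RtoC t) / fx (RtoC t))%C (1 / 2) L' ltac:(lra)) as [M HM].
  { intros t Ht. apply (rcont_comp (fun z => C_derive fx z / fx z)%C RtoC).
    - apply ccont_div. apply fx_neq0; lra. apply hol_ccont, hol_C_derive, entire_near, fx_hol.
      apply hol_ccont, fx_hol.
    - apply rcont_ext with (fun u => RtoC 0 + RtoC u * RtoC 1)%C. intros; ring. apply rcont_line. }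
  destruct (INR_unbounded (L' * Rabs M)) as [N HN]. exists (S N). split; [lia|].
  intros n lam Hn Hs. apply Rnot_le_lt. intros Hle.
  assert (HnN : INR N <= INR n) by (apply le_INR; lia).
  assert (Hn0 : 0 < INR n) by (apply lt_0_INR; lia).
  assert (D := scaling_deriv n lam ltac:(lia) Hs). destruct Hs as [Hl _].
  specialize (HM lam ltac:(lra)). rewrite D in HM.
  replace (RtoC (2 * INR n / lam) * fx lam / fx lam)%C with (RtoC (2 * INR n / lam)) in HM
    by (field; apply fx_neq0; lra).
  assert (P : 0 < 2 * INR n / lam) by (apply Rdiv_lt_0_compat; lra).
  rewrite Cmod_R, Rabs_right in HM by lra. assert (PM := Rle_abs M).
  assert (2 * INR n <= lam * Rabs M).
  { replace (2 * INR n) with (lam * (2 * INR n / lam)) by (field; lra). apply Rmult_le_compat_l; lra. }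
  assert (lam * Rabs M <= L' * Rabs M) by (apply Rmult_le_compat_r; [apply Rabs_pos|lra]). lra.
Qed.

Lemma fr_exp x : 1 / 2 < x -> fr x = / 2 * (1 / 2 + x) * (x - 1 / 2) * exp (ell G Z (1 / 2 + x)).
Proof.
  intros Hx. unfold fr, Xr, ell. rewrite exp_ln by (apply (Lam_pos G Z HG HZ); lra). field.
Qed.

(** By convexity the slope of [ell] at lam + 1/2 is at least its mean slope over the preceding
    interval of length 2, which [ell_step] bounds below by B/2; the polynomial factor of f
    increases. The scaling equation says that this slope is 2n/lam. The argument works with
    difference quotients of f at step 2 th. *)
Lemma n_lower n lam : (1 <= n)%nat -> is_scaling fx n lam -> 4 <= lam ->
  lam * ln ((lam - 3 / 2) / (4 * PI)) <= 4 * INR n.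
Proof.
  intros Hn Hs Hl. assert (D := scaling_deriv n lam Hn Hs).
  assert (Hn0 : 0 < INR n) by (apply lt_0_INR; lia).
  set (B := ln ((lam - 3 / 2) / (4 * PI))).
  destruct (Rle_lt_dec B 0) as [HB|HB]; [nra|].
  set (F := fr lam). assert (HF : 0 < F) by (apply fr_pos; lra).
  set (l := 2 * INR n / lam * F).
  assert (Hder : cder fx (RtoC lam) (RtoC l)).
  { eapply cder_eq; [apply hol_cder, fx_hol|]. rewrite D, fx_real by lra. unfold l, F. now rewrite RtoC_mult. }
  apply Rnot_lt_le. intros Hc.
  set (g := B * F - 2 * l).
  assert (Hg : 0 < g).
  { unfold g, l. replace (B * F - 2 * (2 * INR n / lam * F)) with ((lam * B - 4 * INR n) * (F / lam)) by (field; lra).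
    apply Rmult_lt_0_compat; [lra|]. apply Rdiv_lt_0_compat; lra. }
  (* The difference quotient will force g <= (B + 2) e, while this choice makes (B + 2) e equal to
     g/2. *)
  set (e := g / (2 * (B + 2))). assert (He : 0 < e) by (apply Rdiv_lt_0_compat; lra).
  destruct (near_and _ _ _ (Hder e He) (hol_ccont _ _ (fx_hol (RtoC lam)) e He)) as [d [Hd HH]].
  destruct (small_list (d / 4 :: 1 / 2 :: nil)) as [th Hth]; [simpl; lra|]. simpl in Hth.
  destruct (HH (RtoC (lam - 2 * th))) as [H1 H2].
  { rewrite <- RtoC_minus, Cmod_R. replace (lam - 2 * th - lam) with (- (2 * th)) by ring. rewrite Rabs_Ropp, Rabs_right; lra. }
  rewrite !fx_real in H1, H2 by lra. rewrite <- !RtoC_minus, <- RtoC_mult, <- RtoC_minus, !Cmod_R in H1. rewrite <- RtoC_minus, Cmod_R in H2.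
  replace (lam - 2 * th - lam) with (- (2 * th)) in H1 by ring. rewrite Rabs_Ropp, (Rabs_right (2 * th)) in H1 by lra.
  fold F in H1, H2. apply Rabs_le_between in H1. apply Rabs_def2 in H2.
  set (Fm := fr (lam - 2 * th)) in *.

  (* Convexity between s0 - 2 and s0: moving left by 2 th lowers [ell] by at least th B. *)
  assert (Low : Fm * (1 + th * B) <= F).
  { set (s0 := 1 / 2 + lam).
    assert (S := ell_step G Z HG HZ (s0 - 2) ltac:(unfold s0; lra)). replace (s0 - 2 + 2) with s0 in S by ring.
    replace ((s0 - 2) / (4 * PI)) with ((lam - 3 / 2) / (4 * PI)) in S by (unfold s0; f_equal; field). fold B in S.
    assert (CV := ell_convex G Z HG HZ (s0 - 2) s0 th ltac:(unfold s0; lra) ltac:(unfold s0; lra) ltac:(lra)).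
    replace (th * (s0 - 2) + (1 - th) * s0) with (1 / 2 + (lam - 2 * th)) in CV by (unfold s0; ring).
    assert (K : ell G Z (1 / 2 + (lam - 2 * th)) + th * B <= ell G Z s0) by nra.
    unfold F, Fm. rewrite !fr_exp by lra. fold s0.
    apply exp_le in K. rewrite exp_plus in K.
    assert (T := exp_ineq1_le (th * B)).
    set (e0 := exp (ell G Z (1 / 2 + (lam - 2 * th)))) in *. assert (P0 : 0 < e0) by apply exp_pos.
    assert (K2 : e0 * (1 + th * B) <= exp (ell G Z s0)) by (eapply Rle_trans; [apply Rmult_le_compat_l; [lra|exact T]|exact K]).
    assert (Q1 : 0 <= e0 * (1 + th * B)) by (apply Rmult_le_pos; nra).
    replace (/ 2 * (1 / 2 + (lam - 2 * th)) * (lam - 2 * th - 1 / 2) * e0 * (1 + th * B)) with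
     (/ 2 * (1 / 2 + (lam - 2 * th)) * (lam - 2 * th - 1 / 2) * (e0 * (1 + th * B))) by ring.
    apply Rmult_le_compat; auto.
    - repeat apply Rmult_le_pos; lra.
    - rewrite !Rmult_assoc. apply Rmult_le_compat_l; [lra|]. unfold s0. apply Rmult_le_compat; lra. }
  assert (F1 : Fm * B <= 2 * l + 2 * e).
  { apply Rmult_le_reg_l with th; [lra|]. nra. }
  assert (F2 : B * (F - e) <= 2 * l + 2 * e) by nra.
  assert (F3 : g <= (B + 2) * e) by (unfold g; lra).
  unfold e in F3. replace ((B + 2) * (g / (2 * (B + 2)))) with (g / 2) in F3 by (field; lra). lra.
Qed.

(** Chord slopes of [ell] bound its change by 2n: for x <= 1 it is increasing, for x > 1 its slope
    is at most (ln lam)/2 and [n_lower] gives lam ln lam <= 8n. The remaining factor exp(2n) >= 4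
    absorbs the polynomial part of f. *)
Lemma fr_ratio n lam x : (1 <= n)%nat -> is_scaling fx n lam -> 400 <= lam -> 1 / 2 <= x <= 3 / 2 ->
  fr (lam * x) <= exp (4 * INR n) * fr lam.
Proof.
  intros Hn Hs Hl Hx. assert (NL := n_lower n lam Hn Hs ltac:(lra)).
  assert (Hn1 : 1 <= INR n) by (change 1 with (INR 1); apply le_INR; lia).
  assert (PP := PI_RGT_0). assert (P4 := PI_4).
  assert (NL2 : lam * ln lam <= 8 * INR n).
  { assert (H : ln lam / 2 <= ln ((lam - 3 / 2) / (4 * PI))).
    { set (q := (lam - 3 / 2) / (4 * PI)).
      assert (Hq : (lam - 3 / 2) / 16 <= q).
      { unfold q, Rdiv. apply Rmult_le_compat_l; [lra|]. apply Rinv_le_contravar; lra. }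
      (* Here lam >= 400 is used: the square of (lam - 3/2)/16 then exceeds lam. *)
      assert (L : lam <= q * q).
      { apply Rle_trans with ((lam - 3 / 2) / 16 * ((lam - 3 / 2) / 16)); [assert (SQ := Rle_0_sqr (lam - 400)); unfold Rsqr in SQ; lra|]. apply Rmult_le_compat; lra. }
      apply ln_le in L; [|lra]. rewrite ln_mult in L by lra. lra. }
    assert (lam * (ln lam / 2) <= lam * ln ((lam - 3 / 2) / (4 * PI))) by (apply Rmult_le_compat_l; lra). lra. }
  assert (Hlx : 200 <= lam * x) by nra.
  set (s0 := 1 / 2 + lam). set (u := 1 / 2 + lam * x).
  assert (L0 : 0 <= ln lam) by (rewrite <- ln_1; apply ln_le; lra).
  assert (EL : ell G Z u - ell G Z s0 <= 2 * INR n).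
  { destruct (Rle_lt_dec x 1) as [X|X].
    - destruct (Req_dec x 1) as [->|N1]; [unfold u, s0; rewrite Rmult_1_r; lra|].
      assert (S := ell_slope G Z HG HZ (u - 2) u s0 ltac:(unfold u; lra) ltac:(lra) ltac:(unfold u, s0; nra)).
      assert (T := ell_step G Z HG HZ (u - 2) ltac:(unfold u; lra)). replace (u - 2 + 2) with u in T by ring.
      assert (0 <= ln ((u - 2) / (4 * PI))).
      { rewrite <- ln_1. apply ln_le; [lra|]. apply Rmult_le_reg_r with (4 * PI); [lra|].
        unfold Rdiv. rewrite Rmult_assoc, Rinv_l; unfold u; lra. }
      assert (0 < s0 - u) by (unfold s0, u; nra).
      assert (0 <= (ell G Z u - ell G Z (u - 2)) * (s0 - u)) by (apply Rmult_le_pos; lra). lra.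
    (* As x <= 3/2, the point u lies to the left of t, so the slope on [s0, u] is at most that on
       [u, t] and hence at most that on [t, t + 2]. *)
    - set (t := s0 + lam).
      assert (S1 := ell_slope G Z HG HZ s0 u t ltac:(unfold s0; lra) ltac:(unfold s0, u; nra) ltac:(unfold s0, u, t, s0; nra)).
      assert (S2 := ell_slope G Z HG HZ u t (t + 2) ltac:(unfold u; lra) ltac:(unfold s0, u, t, s0; nra) ltac:(lra)).
      assert (T := proj2 (ell_step G Z HG HZ t ltac:(unfold t, s0; lra))).
      assert (T2 : ln (t / (2 * PI)) <= ln lam).
      { apply ln_le. apply Rdiv_lt_0_compat; unfold t, s0; lra.
        apply Rmult_le_reg_r with (2 * PI); [lra|]. unfold Rdiv. rewrite Rmult_assoc, Rinv_l by lra.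
        assert (PI2 := PI2_1). unfold t, s0. nra. }
      set (V := ell G Z (t + 2) - ell G Z t) in *.
      assert (Htu : 0 < t - u) by (unfold t, u, s0; nra).
      assert (Hus : 0 < u - s0 <= lam / 2) by (unfold u, s0; nra).
      replace (t + 2 - t) with 2 in S2 by ring.
      assert (K : (ell G Z u - ell G Z s0) * (t - u) <= (ln lam / 2 * (u - s0)) * (t - u)).
      { assert (K1 : (ell G Z t - ell G Z u) * (u - s0) <= (V * (t - u) / 2) * (u - s0)) by (apply Rmult_le_compat_r; lra).
        assert (K2 : V * ((t - u) * (u - s0)) <= ln lam * ((t - u) * (u - s0))).
        { apply Rmult_le_compat_r; [apply Rmult_le_pos; lra|lra]. }
        lra. }
      apply Rmult_le_reg_r in K; [|lra].
      assert (ln lam / 2 * (u - s0) <= ln lam / 2 * (lam / 2)) by (apply Rmult_le_compat_l; lra). lra. }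
  rewrite !fr_exp by lra. fold u s0.
  apply Rle_trans with (/ 2 * u * (lam * x - 1 / 2) * (exp (2 * INR n) * exp (ell G Z s0))).
  - apply Rmult_le_compat_l. unfold u; repeat apply Rmult_le_pos; lra.
    rewrite <- exp_plus. apply exp_le. lra.
  - assert (E4 : 4 <= exp (2 * INR n)).
    { assert (T := exp_ineq1_le 1). apply Rle_trans with (exp 2). replace 2 with (1 + 1) by ring. rewrite exp_plus. nra.
      apply exp_le. lra. }
    replace (4 * INR n) with (2 * INR n + 2 * INR n) by ring. rewrite exp_plus.
    set (E := exp (2 * INR n)) in *. set (E0 := exp (ell G Z s0)). assert (P0 : 0 < E0) by apply exp_pos.
    assert (Q : u * (lam * x - 1 / 2) <= 4 * (s0 * (lam - 1 / 2))).
    { unfold u, s0. replace ((1 / 2 + lam * x) * (lam * x - 1 / 2)) with (lam * lam * (x * x) - 1 / 4) by field.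
      assert (x * x <= 9 / 4) by nra. nra. }
    assert (Q3 : 0 <= s0 * (lam - 1 / 2)) by (unfold s0; apply Rmult_le_pos; lra).
    assert (EE : 0 <= / 2 * (E * E0)) by (repeat apply Rmult_le_pos; lra).
    replace (/ 2 * u * (lam * x - 1 / 2) * (E * E0)) with (u * (lam * x - 1 / 2) * (/ 2 * (E * E0))) by ring.
    replace (E * E * (/ 2 * s0 * (lam - 1 / 2) * E0)) with (E * (s0 * (lam - 1 / 2)) * (/ 2 * (E * E0))) by ring.
    apply Rmult_le_compat_r; [exact EE|]. eapply Rle_trans; [exact Q|]. apply Rmult_le_compat_r; lra.
Qed.
End Scaling.

(** * The phase *)

Section Phase.
Variables (f : C -> C) (n : nat) (lam : R) (phi : C -> C).
Hypothesis Hf : forall z, hol f z.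
Hypothesis Hn : (1 <= n)%nat.
Hypothesis Hlam : 1 / 2 < lam.
Hypothesis Hflam : f (RtoC lam) <> RtoC 0.
Hypothesis Hphase : is_phase f n lam phi.

Lemma INRn_pos : 0 < INR n.
Proof. apply lt_0_INR. lia. Qed.

Lemma lamC : RtoC lam <> RtoC 0.
Proof. apply RtoC_neq0. lra. Qed.

Lemma phase_exp z : z <> RtoC 0 -> f (RtoC lam * z)%C <> RtoC 0 ->
  (f (RtoC lam * z) * Cexp (RtoC (INR n) * phi z))%C = (Cpow z (2 * n) * f (RtoC lam))%C.
Proof.
  intros Hz Hfz. destruct Hphase as [H _]. destruct (H z Hz Hfz) as [a [b [Ha [Hb ->]]]].
  assert (P := INRn_pos).
  replace (RtoC (INR n) * (RtoC 2 * a + RtoC (1 / INR n) * b))%C with (RtoC (INR (2 * n)) * a + b)%C.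
  - rewrite Cexp_plus, Cexp_INR, Ha, Hb. field. exact Hfz.
  - rewrite mult_INR, RtoC_mult. replace (1 / INR n) with (/ INR n) by (unfold Rdiv; ring).
    rewrite RtoC_inv by lra. simpl (INR 2). replace (1 + 1) with 2 by ring. field. apply RtoC_neq0. lra.
Qed.

Lemma f_exp_phase_eq z : f_exp_phase f n lam phi z = (Cpow z (2 * n) * f (RtoC lam))%C.
Proof.
  unfold f_exp_phase. destruct (Ceq_dec z 0) as [E|Nz]; [reflexivity|].
  destruct (Ceq_dec (f (RtoC lam * z)%C) 0) as [E|N]; [reflexivity|]. now apply phase_exp.
Qed.

(** Where neither f(u) nor f(-u) vanishes, the phase relation at v and -v gives f(-u) = f(u),
    because z^(2n) and [phi] are even. So f(u) f(-u) (f(-u) - f(u)) is identically zero, and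
    [entire_domain] cancels the first two factors. *)
Lemma f_even z : f (- z)%C = f z.
Proof.
  set (g := fun u : C => (f (- u) - f u)%C).
  assert (Hfm : forall u, hol (fun u => f (- u)%C) u).
  { intros u. apply (hol_comp f (fun u => - u)%C); auto with holo. }
  assert (Hg : forall u, hol g u) by (intros u; unfold g; auto with holo).
  assert (H0 : forall u, (f u * (f (- u) * g u))%C = RtoC 0).
  { intros u. destruct (Ceq_dec (f u) 0) as [->|N1]; [ring|].
    destruct (Ceq_dec (f (- u)%C) 0) as [E|N2]; [rewrite E; ring|].
    destruct (Ceq_dec u 0) as [->|N3].
    { unfold g. replace (- 0)%C with (RtoC 0) by ring. ring. }
    assert (L := lamC). set (v := (u / RtoC lam)%C).
    assert (Ev : (RtoC lam * v)%C = u) by (unfold v; field; auto).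
    assert (Ev2 : (RtoC lam * - v)%C = (- u)%C) by (unfold v; field; auto).
    assert (Nv : v <> RtoC 0) by (intros E; apply N3; rewrite <- Ev, E; ring).
    assert (E1 := phase_exp v Nv ltac:(rewrite Ev; exact N1)).
    assert (E2 := phase_exp (- v)%C (Copp_neq0 v Nv) ltac:(rewrite Ev2; exact N2)).
    rewrite Ev in E1. rewrite Ev2 in E2. destruct Hphase as [_ [_ [_ Hev]]]. rewrite Hev in E2.
    replace (Cpow (- v) (2 * n)) with (Cpow v (2 * n)) in E2.
    2: { rewrite !Cpow_mult_r. f_equal. simpl. ring. }
    rewrite <- E1 in E2. unfold g.
    assert (E3 : f (- u)%C = f u).
    { assert (X := Cexp_neq0 (RtoC (INR n) * phi v)). set (e := Cexp (RtoC (INR n) * phi v)) in *.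
      replace (f (- u)%C) with (f (- u) * e / e)%C by (field; auto). rewrite E2. field. auto. }
    rewrite E3. ring. }
  assert (H1 := entire_domain f (fun u => f (- u) * g u)%C (RtoC lam) Hf ltac:(intros u; auto with holo) H0 Hflam).
  assert (H2 := entire_domain (fun u => f (- u)%C) g (- RtoC lam)%C Hfm Hg H1
     ltac:(cbv beta; replace (- - RtoC lam)%C with (RtoC lam) by ring; exact Hflam)).
  specialize (H2 z). unfold g in H2. replace (f (- z)%C) with (f (- z) - f z + f z)%C by ring. rewrite H2. ring.
Qed.

Lemma phi_hol z : 1 / (2 * lam) < Re z -> hol phi z.
Proof.
  intros Hz. apply hol_ex_derive. destruct Hphase as [_ [H _]]. apply H.
  rewrite Rabs_right; auto. assert (0 < 1 / (2 * lam)) by (apply Rdiv_lt_0_compat; lra). lra.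
Qed.

Lemma phi_near_hol z : 1 / (2 * lam) < Re z -> near z (hol phi).
Proof. intros H. generalize (near_Re_gt _ _ H). apply near_mono. intros y. apply phi_hol. Qed.

(** Supplies a starting point for the identity theorem in [phase_exp_right]. *)
Lemma f_nowhere_zero_near z r : 0 < r -> exists y, Cmod (y - z) < r /\ f (RtoC lam * y)%C <> RtoC 0.
Proof.
  intros Hr. apply NNPP. intros N. apply Hflam. apply (entire_zero f (RtoC lam * z)%C Hf).
  exists (r * lam). split; [nra|]. intros y Hy. apply NNPP. intros Ny. apply N. exists (y / RtoC lam)%C.
  assert (L := lamC). split.
  - replace (y / RtoC lam - z)%C with ((y - RtoC lam * z) / RtoC lam)%C by (field; auto).
    rewrite Cmod_div, Cmod_R, Rabs_right by (auto; lra).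
    apply Rmult_lt_reg_r with lam; [lra|]. unfold Rdiv. rewrite Rmult_assoc, Rinv_l by lra. lra.
  - replace (RtoC lam * (y / RtoC lam))%C with y by (field; auto). exact Ny.
Qed.

(** [is_phase] gives this relation only where f(lam z) is non-zero; the identity theorem extends it
    to the half-plane. Since its right-hand side does not vanish there, neither does f(lam z). *)
Lemma phase_exp_right z : 1 / (2 * lam) < Re z ->
  (f (RtoC lam * z) * Cexp (RtoC (INR n) * phi z))%C = (Cpow z (2 * n) * f (RtoC lam))%C.
Proof.
  intros Hz. assert (H0 : 0 < 1 / (2 * lam)) by (apply Rdiv_lt_0_compat; lra).
  set (k := fun z : C => (f (RtoC lam * z) * Cexp (RtoC (INR n) * phi z) - Cpow z (2 * n) * f (RtoC lam))%C).
  assert (Hflz : forall y, hol (fun z => f (RtoC lam * z)%C) y).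
  { intros y. apply (hol_comp f (fun z => RtoC lam * z)%C); auto with holo. }
  assert (Hk : forall y, 1 / (2 * lam) < Re y -> hol k y).
  { intros y Hy. unfold k. assert (Q := phi_hol y Hy). auto 8 with holo. }
  set (r := (Re z - 1 / (2 * lam)) / 4). assert (Hr : 0 < r) by (unfold r; lra).
  destruct (f_nowhere_zero_near z r Hr) as [z1 [H1 H2]].
  assert (E : k z = RtoC 0).
  { apply (identity_square k z1 r).
    - intros s Hs. apply disc_square in Hs; auto.
      assert (A := Re_le_Cmod (s - z)). replace (Re (s - z)) with (Re s - Re z) in A by reflexivity.
      apply Rabs_le_between in A.
      assert (T := Cmod_triangle (s - z1) (z1 - z)). replace (s - z1 + (z1 - z))%C with (s - z)%C in T by ring.
      assert (HsR : 1 / (2 * lam) < Re s) by (unfold r in *; lra).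
      generalize (near_Re_gt _ _ HsR). apply near_mono. exact Hk.
    - assert (A := Re_le_Cmod (z1 - z)). replace (Re (z1 - z)) with (Re z1 - Re z) in A by reflexivity.
      apply Rabs_le_between in A. assert (Hz1 : 0 < Re z1) by (unfold r in *; lra).
      generalize (near_and _ _ _ (near_Re_gt _ _ Hz1) (ccont_near_neq (fun z => f (RtoC lam * z)%C) z1 _ (hol_ccont _ _ (Hflz z1)) H2)).
      apply near_mono. intros y [Hy1 Hy2]. unfold k. rewrite phase_exp; auto. ring.
      intros ->. simpl in Hy1. lra.
    - rewrite Cmod_minus_sym. exact H1. }
  unfold k in E.
  replace (f (RtoC lam * z) * Cexp (RtoC (INR n) * phi z))%C with
    (f (RtoC lam * z) * Cexp (RtoC (INR n) * phi z) - Cpow z (2 * n) * f (RtoC lam) + Cpow z (2 * n) * f (RtoC lam))%C by ring.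
  rewrite E. ring.
Qed.

Lemma Cpow_neq0 (z : C) k : z <> RtoC 0 -> Cpow z k <> RtoC 0.
Proof. intros H. induction k; simpl; [apply RtoC_neq0; lra|now apply Cmult_neq_0]. Qed.

(* f(lam s) / (f(lam) s^(2n)), which is exp(-n phi(s)) in the right half-plane. *)
Definition Qf (s : C) : C := (f (RtoC lam * s) / (f (RtoC lam) * Cpow s (2 * n)))%C.

Lemma Re_pos_neq0 s : 0 < Re s -> s <> RtoC 0.
Proof. intros H ->. simpl in H. lra. Qed.

Lemma Qf_exp s : 1 / (2 * lam) < Re s -> Qf s = Cexp (- (RtoC (INR n) * phi s)).
Proof.
  intros Hs. assert (H0 : 0 < 1 / (2 * lam)) by (apply Rdiv_lt_0_compat; lra).
  assert (E := phase_exp_right s Hs). rewrite Cexp_opp. unfold Qf.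
  assert (N := Cexp_neq0 (RtoC (INR n) * phi s)). set (e := Cexp (RtoC (INR n) * phi s)) in *.
  assert (Ns : s <> RtoC 0) by (apply Re_pos_neq0; lra).
  assert (Np : Cpow s (2 * n) <> RtoC 0) by now apply Cpow_neq0.
  replace (f (RtoC lam * s)%C) with (f (RtoC lam * s) * e / e)%C by (field; auto). rewrite E. field. auto.
Qed.

Lemma Qf_hol s : s <> RtoC 0 -> hol Qf s.
Proof.
  intros Hs. unfold Qf. apply hol_div; auto with holo.
  - apply Cmult_neq_0; auto. now apply Cpow_neq0.
  - apply (hol_comp f (fun z => RtoC lam * z)%C); auto with holo.
Qed.

Lemma one_right : 1 / (2 * lam) < 1.
Proof. apply Rmult_lt_reg_r with (2 * lam); [lra|]. unfold Rdiv. rewrite Rmult_assoc, Rinv_l; lra. Qed.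

(** The modulus of the phase relation at 1 gives the real part. Reality is assumed only for x > 1,
    so the imaginary part is reached by continuity. *)
Lemma phi_1 : phi 1 = RtoC 0.
Proof.
  assert (P := INRn_pos). assert (O := one_right).
  assert (E := Qf_exp 1 O).
  assert (Q1 : Qf 1 = RtoC 1).
  { unfold Qf. rewrite Cmult_1_r. replace (Cpow 1 (2 * n)) with (RtoC 1) by (symmetry; apply Cpow_1_l). field. auto. }
  rewrite Q1 in E. assert (M : Cmod (Cexp (- (RtoC (INR n) * phi 1))) = 1) by (rewrite <- E; apply Cmod_1).
  rewrite Cmod_Cexp in M.
  assert (R : Re (phi 1) = 0).
  { replace (Re (- (RtoC (INR n) * phi 1))) with (- (INR n * Re (phi 1))) in M by (unfold Re; simpl; ring).
    assert (M1 : exp (- (INR n * Re (phi 1))) = exp 0) by (rewrite exp_0; exact M). apply exp_inv in M1.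
    assert (M2 : INR n * Re (phi 1) = 0) by lra. destruct (Rmult_integral _ _ M2); lra. }
  assert (I : Im (phi 1) = 0).
  { apply NNPP. intros N. destruct (hol_ccont _ _ (phi_hol 1 O) (Rabs (Im (phi 1))) (Rabs_pos_lt _ N)) as [d [Hd H]].
    specialize (H (RtoC (1 + d / 2))). destruct Hphase as [_ [_ [HI _]]].
    assert (HI2 := HI (1 + d / 2) ltac:(lra)).
    rewrite <- RtoC_minus, Cmod_R, Rabs_right in H by lra. specialize (H ltac:(lra)).
    assert (A := Im_le_Cmod (phi (RtoC (1 + d / 2)) - phi 1)).
    replace (Im (phi (RtoC (1 + d / 2)) - phi 1)) with (Im (phi (RtoC (1 + d / 2))) - Im (phi 1)) in A by reflexivity.
    rewrite HI2, Rminus_0_l, Rabs_Ropp in A. lra. }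
  apply injective_projections; [exact R|exact I].
Qed.

Hypothesis Hsc : is_scaling f n lam.

(** Differentiating [phase_exp_right] at 1 turns phi'(1) into the left-hand side of the scaling
    equation. *)
Lemma dphi_1 : cder phi 1 0.
Proof.
  assert (P := INRn_pos). assert (O := one_right).
  assert (Hd := hol_cder _ _ (phi_hol 1 O)). set (d := C_derive phi 1) in *.
  set (l := C_derive f (RtoC lam)).
  assert (D1 : cder (fun z => f (RtoC lam * z) * Cexp (RtoC (INR n) * phi z))%C 1
     (l * RtoC lam * Cexp (RtoC (INR n) * phi 1) + f (RtoC lam * 1) * (Cexp (RtoC (INR n) * phi 1) * (RtoC (INR n) * d)))%C).
  { apply (cder_mult (fun z => f (RtoC lam * z)%C) (fun z => Cexp (RtoC (INR n) * phi z))).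
    - apply (cder_comp f (fun z => RtoC lam * z)%C).
      + rewrite Cmult_1_r. apply hol_cder, Hf.
      + eapply cder_eq. apply cder_scal, cder_id. ring.
    - apply (cder_comp Cexp (fun z => RtoC (INR n) * phi z)%C). apply cder_Cexp. now apply cder_scal. }
  rewrite phi_1, Cmult_0_r, Cexp_0, Cmult_1_r in D1.
  assert (DP : forall k, cder (fun z => Cpow z k) 1 (RtoC (INR k))).
  { induction k.
    - simpl. apply cder_const.
    - rewrite S_INR, RtoC_plus. simpl. eapply cder_eq. apply cder_mult; [apply cder_id|exact IHk].
      cbv beta. replace (Cpow 1 k) with (RtoC 1) by (symmetry; apply Cpow_1_l). ring. }
  assert (D2 : cder (fun z => Cpow z (2 * n) * f (RtoC lam))%C 1 (RtoC (INR (2 * n)) * f (RtoC lam) + Cpow 1 (2 * n) * 0)%C).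
  { apply (cder_mult (fun z => Cpow z (2 * n)) (fun _ => f (RtoC lam))); [apply DP|apply cder_const]. }
  assert (E : (l * RtoC lam + f (RtoC lam) * (RtoC 1 * (RtoC (INR n) * d)))%C = (RtoC (INR (2 * n)) * f (RtoC lam) + Cpow 1 (2 * n) * 0)%C).
  { replace (l * RtoC lam)%C with (l * RtoC lam * RtoC 1)%C by ring.
    eapply cder_unique; [|exact D2]. revert D1. rewrite !Cmult_1_r. apply cder_ext_near.
    generalize (near_Re_gt 1 _ O). apply near_mono. intros y Hy. now apply phase_exp_right. }
  destruct Hsc as [_ S]. fold l in S.
  rewrite mult_INR, RtoC_mult in E. simpl (INR 2) in E. replace (1 + 1) with 2 in E by ring.
  assert (NC : RtoC (INR n) <> RtoC 0) by (apply RtoC_neq0; lra).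
  assert (E2 : d = (RtoC 2 - RtoC (lam / INR n) * (l / f (RtoC lam)))%C).
  { rewrite RtoC_div by lra.
    replace d with ((l * RtoC lam + f (RtoC lam) * (RtoC 1 * (RtoC (INR n) * d)) - l * RtoC lam) / (f (RtoC lam) * RtoC (INR n)))%C by (field; auto).
    rewrite E. field. auto. }
  rewrite S in E2. now rewrite E2 in Hd.
Qed.
End Phase.

(** * Bounds for divided quotients and the Borel-Caratheodory inequality *)

Lemma dquot_bound h c r M z : 0 < r -> 0 <= M ->
  (forall s, Cmod (s - c) <= 2 * r -> near s (hol h)) ->
  (forall s, Cmod (s - c) <= 2 * r -> Cmod (h s) <= M) ->
  Cmod (z - c) <= 2 * r -> Cmod (dquot h c z) <= 8 * M / r.
Proof.
  intros Hr HM HH HB Hz.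
  assert (Hc : Cmod (c - c) <= 2 * r) by (rewrite Cmod_self; lra).
  assert (Out : forall g s, 0 < g -> g <= Cmod (s - c) -> Cmod (s - c) <= 2 * r -> Cmod (dquot h c s) <= 2 * M / g).
  { intros g s Hg H1 H2. destruct (Cinv_gap g (s - c) Hg H1) as [N B].
    assert (Ns : s <> c) by (intros E; apply N; rewrite E; ring).
    rewrite dquot_off by auto. unfold Cdiv. rewrite Cmod_mult. apply Rmult_le_compat; auto using Cmod_ge_0.
    eapply Rle_trans; [apply Cmod_minus_le|]. assert (B1 := HB s H2). assert (B2 := HB c Hc). lra. }
  assert (Ir : 0 < / r) by now apply Rinv_0_lt_compat.
  destruct (Rle_lt_dec (Cmod (z - c)) (r / 2)) as [L|L].
  - replace (8 * M / r) with (4 * (2 * M / r)) by (field; lra).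
    apply (interior_bound_half (dquot h c) c r); auto.
    + apply Rmult_le_pos; lra.
    + intros s Hs. apply dquot_hol; apply HH; auto.
    + intros s Hs. apply Out; lra.
  - eapply Rle_trans; [apply (Out (r / 2)); lra|].
    replace (2 * M / (r / 2)) with (4 * M / r) by (field; lra).
    unfold Rdiv. apply Rmult_le_compat_r; lra.
Qed.

(** The map h/(2A - h) sends the half-plane Re h <= A into the unit disc and vanishes at c, so a
    Schwarz-type estimate bounds it and inverting the map bounds h. *)
Theorem borel_caratheodory h c r A z : 0 < r -> 0 < A ->
  (forall s, Cmod (s - c) <= 2 * r -> near s (hol h)) -> h c = RtoC 0 ->
  (forall s, Cmod (s - c) <= 2 * r -> Re (h s) <= A) ->
  Cmod (z - c) <= r / 16 -> Cmod (h z) <= 2 * A.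
Proof.
  intros Hr HA HH Hc HB Hz.
  set (g := fun s : C => (h s / (RtoC (2 * A) - h s))%C).
  assert (ND : forall s, Re (h s) <= A -> (RtoC (2 * A) - h s)%C <> RtoC 0).
  { intros s Hs. apply Cmod_neq0. assert (P := Re_le_Cmod (RtoC (2 * A) - h s)).
    replace (Re (RtoC (2 * A) - h s)) with (2 * A - Re (h s)) in P by reflexivity.
    assert (Q := Rle_abs (2 * A - Re (h s))). lra. }
  assert (G1 : forall s, Cmod (s - c) <= 2 * r -> Cmod (g s) <= 1).
  { intros s Hs. specialize (HB s Hs). assert (N := ND s HB). unfold g. rewrite Cmod_div by auto.
    assert (P : 0 < Cmod (RtoC (2 * A) - h s)) by now apply Cmod_gt_0.
    apply Rmult_le_reg_r with (Cmod (RtoC (2 * A) - h s)); auto. unfold Rdiv. rewrite Rmult_assoc, Rinv_l, Rmult_1_l, Rmult_1_r by lra.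
    unfold Cmod. apply sqrt_le_1_alt. unfold Re, RtoC in *; simpl in *. nra. }
  assert (GH : forall s, Cmod (s - c) <= 2 * r -> near s (hol g)).
  { intros s Hs. assert (H1 := HH s Hs).
    assert (N : near s (fun y => (RtoC (2 * A) - h y)%C <> RtoC 0)).
    { apply ccont_near_neq; [|now apply ND, HB]. apply ccont_minus; auto with holo. now apply hol_ccont, near_self. }
    generalize (near_and _ _ _ H1 N). apply near_mono. intros y [Y1 Y2]. unfold g. apply hol_div; auto with holo. }
  assert (Gc : g c = RtoC 0) by (unfold g; rewrite Hc; unfold Cdiv; ring).
  assert (Hzr : Cmod (z - c) <= 2 * r) by lra.
  assert (B := dquot_bound g c r 1 z Hr ltac:(lra) GH G1 Hzr).
  assert (E := dquot_eq g c z). rewrite Gc, Cplus_0_l in E.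
  (* [dquot_bound] is Schwarz's lemma with the constant 8/r; the radius r/16 turns it into 1/2. *)
  assert (Gz : Cmod (g z) <= 1 / 2).
  { rewrite E, Cmod_mult. apply Rle_trans with (r / 16 * (8 * 1 / r)).
    apply Rmult_le_compat; auto using Cmod_ge_0. right; field; lra. }

  assert (Eh : h z = (g z * (RtoC (2 * A) - h z))%C) by (unfold g; field; auto).
  assert (L : Cmod (h z) <= 1 / 2 * (2 * A + Cmod (h z))).
  { rewrite Eh at 1. rewrite Cmod_mult. apply Rmult_le_compat; auto using Cmod_ge_0.
    eapply Rle_trans; [apply Cmod_minus_le|]. rewrite Cmod_R, Rabs_right; lra. }
  lra.
Qed.

Lemma Cmod_sqr (x y : R) : Cmod (x, y) * Cmod (x, y) = x * x + y * y.
Proof.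
  replace (Cmod (x, y) * Cmod (x, y)) with (Cmod (x, y) ^ 2) by ring. unfold Cmod; simpl fst; simpl snd.
  rewrite pow2_sqrt. ring. apply Rplus_le_le_0_compat; apply pow2_ge_0.
Qed.

Lemma Cmod_pow_2n z k : Cmod (Cpow z (2 * k)) = (Cmod z * Cmod z) ^ k.
Proof. rewrite Cmod_pow, pow_mult. f_equal. ring. Qed.

Lemma exp_pow x k : exp x ^ k = exp (INR k * x).
Proof.
  induction k; [simpl; rewrite Rmult_0_l, exp_0; reflexivity|].
  rewrite S_INR. replace ((INR k + 1) * x) with (x + INR k * x) by ring. rewrite exp_plus. simpl. rewrite IHk. ring.
Qed.

(** * Bounds on the phase near 1, uniform in n *)

Section PhaseEstimates.
Variables (f : C -> C) (n : nat) (lam : R) (phi : C -> C) (F : R -> R).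
Hypothesis Hf : forall z, hol f z.
Hypothesis Hn : (32 <= n)%nat.
Hypothesis Hlam : 400 <= lam.
Hypothesis Hphase : is_phase f n lam phi.
Hypothesis Hsc : is_scaling f n lam.
Hypothesis HF : forall x, 1 / 2 < x -> f (RtoC x) = RtoC (F x) /\ 0 < F x.
Hypothesis Habs : forall x y, 1 / 2 <= x -> Cmod (f (RtoC lam * (x, y))) <= F (lam * x) * (1 + 16 * (y * y)).
Hypothesis Hratio : forall x, 1 / 2 <= x <= 3 / 2 -> F (lam * x) <= exp (4 * INR n) * F lam.

Local Notation Q := (Qf f n lam).

Lemma n1 : (1 <= n)%nat. Proof. lia. Qed.
Lemma lam12 : 1 / 2 < lam. Proof. lra. Qed.
Lemma INRn32 : 32 <= INR n. Proof. replace 32 with (INR 32) by (simpl; ring). apply le_INR. exact Hn. Qed.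

Lemma flam_neq0 : f (RtoC lam) <> RtoC 0.
Proof. destruct (HF lam lam12) as [-> P]. apply RtoC_neq0. lra. Qed.

Lemma right_half x : 1 / 400 < x -> 1 / (2 * lam) < x.
Proof.
  intros H. eapply Rle_lt_trans; [|exact H]. unfold Rdiv. rewrite !Rmult_1_l. apply Rinv_le_contravar; lra.
Qed.

Lemma Q_Cmod x y : 1 / 2 <= x ->
  Cmod (Q (x, y)) * (F lam * (x * x + y * y) ^ n) = Cmod (f (RtoC lam * (x, y))).
Proof.
  intros Hx. destruct (HF lam lam12) as [E P]. unfold Qf.
  assert (N : (x, y) <> RtoC 0) by (intros H; injection H; lra).
  rewrite Cmod_div. rewrite Cmod_mult, E, Cmod_R, Rabs_right, Cmod_pow_2n, Cmod_sqr by lra.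
  field. split; [|lra]. apply pow_nonzero. nra.
  apply Cmult_neq_0. apply flam_neq0. now apply Cpow_neq0.
Qed.

(** The power on the left is the growth of |s|^(2n) along the vertical line, relative to its value
    on the axis. *)
Lemma Q_line x y : 1 / 2 <= x ->
  Cmod (Q (x, y)) * (1 + (y / x) * (y / x)) ^ n <= (1 + 16 * (y * y)) * Cmod (Q (RtoC x)).
Proof.
  intros Hx. destruct (HF lam lam12) as [E P]. assert (Hlx : 1 / 2 < lam * x) by nra.
  destruct (HF (lam * x) Hlx) as [Ex Px].
  assert (E1 := Q_Cmod x y Hx). assert (E0 := Q_Cmod x 0 Hx). fold (RtoC x) in E0.
  rewrite <- RtoC_mult, Ex, Cmod_R, Rabs_right in E0 by lra.
  replace (x * x + 0 * 0) with (x * x) in E0 by ring.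
  assert (A := Habs x y Hx). rewrite <- E1, <- E0 in A.
  replace (x * x + y * y) with (x * x * (1 + y / x * (y / x))) in A by (field; lra).
  rewrite Rpow_mult_distr in A.
  assert (K : 0 < F lam * (x * x) ^ n) by (apply Rmult_lt_0_compat; [lra|apply pow_lt; nra]).
  apply Rmult_le_reg_r with (F lam * (x * x) ^ n); auto. lra.
Qed.

Lemma phi_near z : 1 / 400 < Re z -> near z (hol phi).
Proof. intros H. apply (phi_near_hol f n lam phi lam12 Hphase). now apply right_half. Qed.

Lemma Q_exp z : 1 / 400 < Re z -> Q z = Cexp (- (RtoC (INR n) * phi z)).
Proof. intros H. apply (Qf_exp f n lam phi Hf n1 lam12 flam_neq0 Hphase). now apply right_half. Qed.

Lemma Q_Cmod_exp z : 1 / 400 < Re z -> Cmod (Q z) = exp (- INR n * Re (phi z)).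
Proof.
  intros H. rewrite Q_exp, Cmod_Cexp by auto. f_equal. unfold Re; simpl. ring.
Qed.

Lemma disc_Re z c r : Cmod (z - c) <= r -> Re c - r <= Re z <= Re c + r /\ Im c - r <= Im z <= Im c + r.
Proof.
  intros H. assert (A := Re_le_Cmod (z - c)). assert (B := Im_le_Cmod (z - c)).
  replace (Re (z - c)) with (Re z - Re c) in A by reflexivity.
  replace (Im (z - c)) with (Im z - Im c) in B by reflexivity.
  apply Rabs_le_between in A. apply Rabs_le_between in B. lra.
Qed.

(** The 9 is 4 + 3 + 2: exp(4n) from [Hratio], exp(3n) >= 5 for the factor 1 + 16 y^2 with |y| <=
    1/2, and exp(2n) >= 4^n because |z|^2 >= 1/4. *)
Lemma phi_Re_lower z : Cmod (z - 1) <= 1 / 2 -> - Re (phi z) <= 9.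
Proof.
  intros Hz. destruct z as [x y]. destruct (disc_Re _ _ _ Hz) as [R1 R2]. unfold Re, Im in R1, R2. simpl in R1, R2.
  assert (Hx : 1 / 2 <= x <= 3 / 2) by lra.
  assert (E := Q_Cmod x y ltac:(lra)). assert (A := Habs x y ltac:(lra)). assert (B := Hratio x Hx).
  destruct (HF lam lam12) as [_ P].
  assert (N := INRn32).
  assert (E3 : 5 <= exp (3 * INR n)) by (assert (T := exp_ineq1_le (3 * INR n)); lra).
  assert (Hy : 0 <= y * y <= 1 / 4) by nra.
  assert (QB : Cmod (Q (x, y)) * (1 / 4) ^ n <= exp (7 * INR n)).
  { assert (L : (1 / 4) ^ n <= (x * x + y * y) ^ n) by (apply pow_incr; nra).
    assert (PQ := Cmod_ge_0 (Q (x, y))).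
    apply Rmult_le_reg_r with (F lam); auto.
    apply Rle_trans with (Cmod (Q (x, y)) * (F lam * (x * x + y * y) ^ n)).
    - replace (Cmod (Q (x, y)) * (1 / 4) ^ n * F lam) with (Cmod (Q (x, y)) * (F lam * (1 / 4) ^ n)) by ring.
      apply Rmult_le_compat_l; auto. apply Rmult_le_compat_l; lra.
    - rewrite E. eapply Rle_trans; [exact A|].
      replace (7 * INR n) with (4 * INR n + 3 * INR n) by ring. rewrite exp_plus.
      assert (PE := exp_pos (4 * INR n)). destruct (HF (lam * x) ltac:(nra)) as [_ Px].
      apply Rle_trans with (exp (4 * INR n) * F lam * 5).
      + apply Rmult_le_compat; lra.
      + replace (exp (4 * INR n) * exp (3 * INR n) * F lam) with (exp (4 * INR n) * F lam * exp (3 * INR n)) by ring.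
        apply Rmult_le_compat_l; [apply Rmult_le_pos; lra|lra]. }
  assert (E4 : 1 <= (1 / 4) ^ n * exp (2 * INR n)).
  { rewrite (Rmult_comm 2), <- exp_pow, <- Rpow_mult_distr. rewrite <- (pow1 n) at 1. apply pow_incr.
    assert (T := exp_ineq1_le 1). split; [lra|]. replace 2 with (1 + 1) by ring. rewrite exp_plus. nra. }
  rewrite Q_Cmod_exp in QB by (unfold Re; simpl; lra).
  assert (QB2 : exp (- INR n * Re (phi (x, y))) <= exp (9 * INR n)).
  { replace (9 * INR n) with (7 * INR n + 2 * INR n) by ring. rewrite exp_plus.
    set (e := exp (- INR n * Re (phi (x, y)))) in *. assert (Pe : 0 < e) by apply exp_pos.
    assert (P2 := exp_pos (2 * INR n)).
    apply Rle_trans with (e * ((1 / 4) ^ n * exp (2 * INR n))).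
    - rewrite <- (Rmult_1_r e) at 1. apply Rmult_le_compat_l; lra.
    - rewrite <- Rmult_assoc. apply Rmult_le_compat_r; lra. }
  assert (QB3 : - INR n * Re (phi (x, y)) <= 9 * INR n).
  { apply Rnot_lt_le. intros L. apply exp_increasing in L. lra. }
  apply Rmult_le_reg_r with (INR n); lra.
Qed.

(** Borel-Caratheodory for -phi with A = 9 and r = 1/4, which explains both 18 and 1/64. *)
Lemma phi_bound z : Cmod (z - 1) <= 1 / 64 -> Cmod (phi z) <= 18.
Proof.
  intros Hz. rewrite <- Cmod_opp. replace 18 with (2 * 9) by ring.
  apply (borel_caratheodory (fun z => - phi z)%C 1 (1 / 4) 9); try lra.
  - intros s Hs. destruct (disc_Re _ _ _ Hs) as [R1 _]. simpl in R1.
    assert (Hs' : 1 / 400 < Re s) by lra. generalize (phi_near s Hs'). apply near_mono. intros y Hy. now apply hol_opp.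
  - rewrite (phi_1 f n lam phi Hf n1 lam12 flam_neq0 Hphase). ring.
  - intros s Hs. replace (Re (- phi s)) with (- Re (phi s)) by reflexivity. apply phi_Re_lower. lra.
Qed.

(** The bound 18 for [phi], times 1024 = 8/(1/128) for each of four divisions by z - 1. *)
Definition Cphi : R := 18 * (1024 * (1024 * (1024 * 1024))).

Lemma dq_phi_near k z : Cmod (z - 1) <= 1 / 2 -> near z (hol (dq phi 1 k)).
Proof.
  intros Hz. destruct (disc_Re _ _ _ Hz) as [R1 _]. simpl in R1.
  apply dq_near_hol; apply phi_near; simpl; lra.
Qed.

Lemma dq_phi_bound k z : (k <= 4)%nat -> Cmod (z - 1) <= 1 / 64 -> Cmod (dq phi 1 k z) <= Cphi.
Proof.
  assert (B : forall k, forall z, Cmod (z - 1) <= 1 / 64 -> Cmod (dq phi 1 k z) <= 18 * 1024 ^ k).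
  { induction k0; intros y Hy.
    - unfold dq; simpl. rewrite Rmult_1_r. now apply phi_bound.
    - rewrite dq_S. replace (18 * 1024 ^ S k0) with (8 * (18 * 1024 ^ k0) / (1 / 128)) by (simpl; field).
      assert (P : 0 < 1024 ^ k0) by (apply pow_lt; lra).
      apply dquot_bound; try lra.
      + intros s Hs. apply dq_phi_near. lra.
      + intros s Hs. apply IHk0. lra. }
  intros Hk Hz. eapply Rle_trans; [now apply B|]. unfold Cphi. apply Rmult_le_compat_l; [lra|].
  replace (1024 * (1024 * (1024 * 1024))) with (1024 ^ 4) by ring. apply Rle_pow; [lra|exact Hk].
Qed.

Lemma phi_dq2 z : phi z = ((z - 1) * (z - 1) * dq phi 1 2 z)%C.
Proof.
  assert (E0 := phi_1 f n lam phi Hf n1 lam12 flam_neq0 Hphase).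
  assert (E1 : dq phi 1 1 1 = RtoC 0).
  { unfold dq; simpl. unfold dquot. rewrite slope_self. apply cder_C_derive.
    apply (dphi_1 f n lam phi Hf n1 lam12 flam_neq0 Hphase Hsc). }
  rewrite (dquot_eq phi 1 z), E0. change (dquot phi 1 z) with (dq phi 1 1 z).
  rewrite (dquot_eq (dq phi 1 1) 1 z), E1. rewrite <- dq_S. ring.
Qed.

Lemma phi_taylor z : phi z = ((z - 1) * (z - 1) * (dq phi 1 2 1 + (z - 1) * (dq phi 1 3 1 + (z - 1) * dq phi 1 4 z)))%C.
Proof.
  rewrite phi_dq2. f_equal. rewrite (dquot_eq (dq phi 1 2) 1 z). rewrite <- dq_S.
  now rewrite (dquot_eq (dq phi 1 3) 1 z).
Qed.

Lemma ddphi_eq : ddphi1 phi = (RtoC 2 * dq phi 1 2 1)%C.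
Proof.
  unfold ddphi1. change (C_derive_n phi 2 1) with (C_derive (C_derive phi) 1).
  apply cder_C_derive. set (p2 := dq phi 1 2).
  assert (H2 : near 1 (hol p2)) by (apply dq_phi_near; rewrite Cmod_self; lra).
  assert (D : near 1 (fun z => C_derive phi z = (RtoC 2 * (z - 1) * p2 z + (z - 1) * ((z - 1) * C_derive p2 z))%C)).
  { revert H2. apply near_mono. intros y Hy. apply cder_C_derive.
    apply cder_ext with (fun z => (z - 1) * (z - 1) * p2 z)%C. intros; symmetry; apply phi_dq2.
    eapply cder_eq. apply cder_mult; [|now apply hol_cder].
    apply cder_mult; apply cder_minus; [apply cder_id|apply cder_const|apply cder_id|apply cder_const].
    cbv beta. ring. }
  apply cder_ext_near with (fun z => RtoC 2 * (z - 1) * p2 z + (z - 1) * ((z - 1) * C_derive p2 z))%C.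
  revert D. apply near_mono. auto.
  assert (Hp := near_self _ _ H2). assert (Hd := hol_C_derive _ _ H2).
  destruct Hp as [a Ha]. destruct Hd as [b Hb].
  eapply cder_eq.
  - apply cder_plus.
    + apply cder_mult; [|exact Ha]. apply cder_scal. apply cder_minus; [apply cder_id|apply cder_const].
    + apply cder_mult. apply cder_minus; [apply cder_id|apply cder_const].
      apply cder_mult; [|exact Hb]. apply cder_minus; [apply cder_id|apply cder_const].
  - cbv beta. ring.
Qed.

(** Equal to -phi''(1), by [ddphi_a]. *)
Definition aphi : R := - 2 * Re (dq phi 1 2 1).

(** For real x > 1 both [phi] and (x-1)^2 are real, hence so is the quotient; its value at 1 is the
    limit. *)
Lemma dq2_real : dq phi 1 2 1 = RtoC (- aphi / 2).
Proof.
  apply injective_projections; [unfold aphi, Re; simpl; field|]. simpl.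
  change (snd (dq phi 1 2 1)) with (Im (dq phi 1 2 1)).
  apply NNPP. intros N.
  assert (HC : ccont (dq phi 1 2) 1).
  { apply hol_ccont, near_self, dq_phi_near. rewrite Cmod_self; lra. }
  destruct (HC (Rabs (Im (dq phi 1 2 1))) (Rabs_pos_lt _ N)) as [d [Hd H]].
  specialize (H (RtoC (1 + d / 2))). rewrite <- RtoC_minus, Cmod_R, Rabs_right in H by lra. specialize (H ltac:(lra)).
  destruct Hphase as [_ [_ [HI _]]]. assert (HI2 := HI (1 + d / 2) ltac:(lra)).
  rewrite phi_dq2 in HI2. rewrite <- !RtoC_minus, <- RtoC_mult in HI2.
  assert (Z : Im (dq phi 1 2 (RtoC (1 + d / 2))) = 0).
  { unfold Im, Cmult, RtoC in HI2 |- *; simpl in HI2 |- *. rewrite Rmult_0_l, Rplus_0_r in HI2.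
    apply Rmult_integral in HI2. destruct HI2 as [HI2|]; auto. nra. }
  assert (A := Im_le_Cmod (dq phi 1 2 (RtoC (1 + d / 2)) - dq phi 1 2 1)).
  replace (Im (dq phi 1 2 (RtoC (1 + d / 2)) - dq phi 1 2 1)) with (Im (dq phi 1 2 (RtoC (1 + d / 2))) - Im (dq phi 1 2 1)) in A by reflexivity.
  rewrite Z, Rminus_0_l, Rabs_Ropp in A. lra.
Qed.

Lemma ddphi_a : ddphi1 phi = RtoC (- aphi).
Proof. rewrite ddphi_eq, dq2_real, <- RtoC_mult. f_equal. field. Qed.

Lemma ln_lower x : 0 <= x -> x - x * x <= ln (1 + x).
Proof.
  intros Hx. assert (T := exp_ineq1_le (- ln (1 + x))). rewrite exp_Ropp, exp_ln in T by lra.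
  assert (x / (1 + x) <= ln (1 + x)) by (replace (x / (1 + x)) with (1 - / (1 + x)) by (field; lra); lra).
  assert (x - x * x <= x / (1 + x)).
  { apply Rmult_le_reg_r with (1 + x); [lra|]. unfold Rdiv. rewrite Rmult_assoc, Rinv_l by lra. nra. }
  lra.
Qed.

(** On the vertical line through 1, [Q_line] reads (1 + t^2)^n exp(-n Re phi) <= 1 + 16 t^2. Taking
    logarithms and dividing by n t^2 gives 1 - a/2 <= 16/n + O(t), and n >= 32 makes 16/n at most
    1/2. *)
Lemma aphi_ge1 : 1 <= aphi.
Proof.
  apply Rnot_lt_le. intros L.
  assert (CP : 0 < Cphi) by (unfold Cphi; lra).
  set (g := (1 - aphi) / 2). assert (Hg : 0 < g) by (unfold g; lra).
  destruct (small_list (g / (2 * (1 + Cphi)) :: (1 / 64) :: nil)) as [t Ht].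
  { simpl. split; [|lra]. apply Rdiv_lt_0_compat; lra. } simpl in Ht.
  assert (N := INRn32).
  set (z := (1, t) : C).
  assert (Ez : (z - 1)%C = (RtoC t * Ci)%C) by (unfold z, RtoC, Ci, Cminus, Cplus, Copp, Cmult; simpl; f_equal; ring).
  assert (Hz : Cmod (z - 1) = t) by (rewrite Ez, Cmod_mult, Cmod_Ci, Cmod_R, Rabs_right; lra).
  assert (QL := Q_line 1 t ltac:(lra)). fold z in QL.
  replace (t / 1 * (t / 1)) with (t * t) in QL by field.
  assert (Q1 : Cmod (Q (RtoC 1)) = 1).
  { rewrite Q_Cmod_exp by (simpl; lra). rewrite (phi_1 f n lam phi Hf n1 lam12 flam_neq0 Hphase).
    simpl. rewrite Rmult_0_r. apply exp_0. }
  rewrite Q1, Rmult_1_r, Q_Cmod_exp in QL by (unfold z; simpl; lra).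
  assert (L1 : INR n * ln (1 + t * t) - INR n * Re (phi z) <= 16 * (t * t)).
  { assert (E1 : (1 + t * t) ^ n = exp (INR n * ln (1 + t * t))).
    { rewrite <- exp_pow, exp_ln; auto. nra. }
    rewrite E1, <- exp_plus in QL.
    assert (T := exp_ineq1_le (16 * (t * t))).
    assert (exp (- INR n * Re (phi z) + INR n * ln (1 + t * t)) <= exp (16 * (t * t))) by lra.
    apply Rnot_lt_le. intros LL.
    assert (exp (16 * (t * t)) < exp (- INR n * Re (phi z) + INR n * ln (1 + t * t))) by (apply exp_increasing; lra). lra. }
  assert (L2 := ln_lower (t * t) ltac:(nra)).
  assert (L3 : Re (phi z) <= aphi / 2 * (t * t) + t * t * (t * Cphi)).
  { rewrite phi_dq2, Ez. rewrite (dquot_eq (dq phi 1 2) 1 z), <- dq_S, dq2_real, Ez.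
    set (v := dq phi 1 3 z).
    replace (RtoC t * Ci * (RtoC t * Ci) * (RtoC (- aphi / 2) + RtoC t * Ci * v))%C with
      (RtoC (aphi / 2 * (t * t)) + (- (RtoC (t * t) * (RtoC t * (Ci * v)))))%C.
    2: { rewrite !RtoC_mult. replace (- aphi / 2) with (- (aphi / 2)) by field. rewrite RtoC_opp.
         unfold RtoC, Ci, Cminus, Cplus, Copp, Cmult; simpl. f_equal; ring. }
    assert (Bv : Cmod v <= Cphi) by (apply dq_phi_bound; [lia|lra]).
    set (rr := (- (RtoC (t * t) * (RtoC t * (Ci * v))))%C).
    assert (Br : Cmod rr <= t * t * (t * Cphi)).
    { unfold rr. rewrite Cmod_opp, !Cmod_mult, Cmod_Ci, !Cmod_R, !Rabs_right by nra.
      apply Rmult_le_compat_l; [nra|]. apply Rmult_le_compat_l; lra. }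
    assert (P := Re_le_Cmod rr). assert (P2 := Rle_abs (Re rr)).
    replace (Re (RtoC (aphi / 2 * (t * t)) + rr)) with (aphi / 2 * (t * t) + Re rr) by (unfold Re; simpl; ring). lra. }
  assert (L4 : t * t - t * t * (t * t) - Re (phi z) <= t * t / 2).
  { apply Rmult_le_reg_l with (INR n); [lra|].
    assert (INR n * (t * t - t * t * (t * t)) <= INR n * ln (1 + t * t)) by (apply Rmult_le_compat_l; lra).
    (* This is the use of n >= 32. *)
    assert (16 * (t * t) <= INR n * (t * t / 2)) by (assert (0 <= t * t) by nra; nra). lra. }
  assert (Tt : 0 < t * t) by nra.
  assert (L5 : 1 - t * t - 1 / 2 <= aphi / 2 + t * Cphi).
  { apply Rmult_le_reg_l with (t * t); auto. lra. }
  assert (t * (1 + Cphi) <= g / 2).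
  { apply Rle_trans with (g / (2 * (1 + Cphi)) * (1 + Cphi)). apply Rmult_le_compat_r; lra. right; field; lra. }
  unfold g in *. nra.
Qed.
End PhaseEstimates.

(** * The error function *)

Lemma CI_param (K : R -> C -> C) (D : R -> C) z a b A r : a <= b -> 0 < r -> 0 < A ->
  (forall y, Cmod (y - z) < r -> forall t, a <= t <= b -> rcont (fun t => K t y) t) ->
  (forall t, a <= t <= b -> rcont D t) ->
  (forall y, Cmod (y - z) < r -> forall t, a <= t <= b ->
     Cmod (K t y - K t z - (y - z) * D t) <= A * (Cmod (y - z) * Cmod (y - z))) ->
  cder (fun y => CI (fun t => K t y) a b) z (CI D a b).
Proof.
  intros Hab Hr HA HK HD HE e He.
  set (L := A * (b - a) + 1). assert (HL : 0 < L) by (unfold L; nra).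
  exists (Rmin r (e / L)). split. apply Rmin_pos; auto. apply Rdiv_lt_0_compat; lra.
  intros y Hy. assert (M1 := Rmin_l r (e / L)). assert (M2 := Rmin_r r (e / L)).
  assert (Hyr : Cmod (y - z) < r) by lra.
  assert (Hzr : Cmod (z - z) < r) by (rewrite Cmod_self; lra).
  assert (C2 : forall t, a <= t <= b -> rcont (fun t => (y - z) * D t)%C t) by (intros; apply rcont_scal; auto).
  assert (C1 : forall t, a <= t <= b -> rcont (fun t => K t y - K t z)%C t).
  { intros t Ht. apply rcont_ext with (fun t => K t y + RtoC (-1) * K t z)%C. intros; ring.
    apply rcont_plus; [|apply rcont_scal]; auto. }
  assert (E : (CI (fun t => K t y) a b - CI (fun t => K t z) a b - (y - z) * CI D a b)%C
    = CI (fun t => K t y - K t z - (y - z) * D t)%C a b).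
  { rewrite (CI_minus (fun t => K t y - K t z)%C), CI_minus, CI_scal; auto. }
  rewrite E. eapply Rle_trans. apply (CI_bound _ (A * (Cmod (y - z) * Cmod (y - z)))); auto.
  - intros t Ht. apply rcont_ext with (fun t => (K t y - K t z) + RtoC (-1) * ((y - z) * D t))%C. intros; ring.
    apply rcont_plus; [|apply rcont_scal]; auto.
  - assert (P := Cmod_ge_0 (y - z)).
    apply Rle_trans with (L * Cmod (y - z) * Cmod (y - z)).
    + unfold L. nra.
    + apply Rmult_le_compat_r; [exact P|]. apply Rle_trans with (L * (e / L)).
      apply Rmult_le_compat_l; lra. right; field; lra.
Qed.

Definition gauss (c : R) (z : C) : C := Cexp (- (RtoC c * (z * z))).

(** One constant A for all c in [0, 2], as [CI_param] requires when c runs over t^2 or 1 + t^2. *)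
Lemma gauss_quad z : exists A, 0 < A /\ forall c y, 0 <= c <= 2 -> Cmod (y - z) < 1 ->
  Cmod (gauss c y - gauss c z - (y - z) * (- (RtoC (2 * c) * z) * gauss c z)) <= A * (Cmod (y - z) * Cmod (y - z)).
Proof.
  set (m := Cmod z). assert (Hm : 0 <= m) by apply Cmod_ge_0.
  set (w0 := 2 * (2 * m + 1)).
  exists (exp (2 * (m * m)) * (w0 * w0 * exp w0 + 2)). split.
  { assert (P1 := exp_pos (2 * (m * m))). assert (P2 := exp_pos w0). apply Rmult_lt_0_compat; [lra|].
    assert (0 <= w0 * w0 * exp w0) by (apply Rmult_le_pos; [apply Rle_0_sqr|lra]). lra. }
  intros c y Hc Hy. set (h := (y - z)%C) in *. assert (Hh := Cmod_ge_0 h).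
  set (w := (- (RtoC c * (h * (h + RtoC 2 * z))))%C).
  assert (E : gauss c y = (gauss c z * Cexp w)%C).
  { unfold gauss. rewrite <- Cexp_plus. f_equal. unfold w, h. ring. }
  rewrite E. replace (gauss c z * Cexp w - gauss c z - h * (- (RtoC (2 * c) * z) * gauss c z))%C with
    (gauss c z * ((Cexp w - 1 - w) + - (RtoC c * (h * h))))%C.
  2: { unfold w. rewrite RtoC_mult. ring. }
  assert (Bw : Cmod w <= w0 * Cmod h).
  { unfold w. rewrite Cmod_opp, !Cmod_mult, Cmod_R, Rabs_right by lra.
    assert (T : Cmod (h + RtoC 2 * z) <= 2 * m + 1).
    { eapply Rle_trans; [apply Cmod_triangle|]. rewrite Cmod_RtoC_mult, Rabs_right by lra. fold m. lra. }
    replace (w0 * Cmod h) with (2 * (Cmod h * (2 * m + 1))) by (unfold w0; ring).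
    apply Rmult_le_compat; try lra. apply Rmult_le_pos; auto using Cmod_ge_0.
    apply Rmult_le_compat_l; auto. }
  assert (Hw0 : 0 <= w0) by (unfold w0; lra).
  assert (Bw2 : Cmod w <= w0) by nra.
  rewrite Cmod_mult.
  replace (exp (2 * (m * m)) * (w0 * w0 * exp w0 + 2) * (Cmod h * Cmod h)) with
   (exp (2 * (m * m)) * ((w0 * Cmod h) * (w0 * Cmod h) * exp w0 + 2 * (Cmod h * Cmod h))) by ring.
  apply Rmult_le_compat; auto using Cmod_ge_0.
  - unfold gauss. rewrite Cmod_Cexp. apply exp_le. eapply Rle_trans; [apply Rle_abs|].
    eapply Rle_trans; [apply Re_le_Cmod|]. rewrite Cmod_opp, !Cmod_mult, Cmod_R, Rabs_right by lra. fold m.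
    apply Rmult_le_compat_r; [nra|lra].
  - eapply Rle_trans; [apply Cmod_triangle|]. apply Rplus_le_compat.
    + eapply Rle_trans; [apply Cexp_bound2|]. assert (Pw := Cmod_ge_0 w).
      apply Rmult_le_compat; try apply Rmult_le_compat; auto; try (apply Rmult_le_pos; auto).
      apply Rlt_le, exp_pos. now apply exp_le.
    + rewrite Cmod_opp, !Cmod_mult, Cmod_R, Rabs_right by lra. apply Rmult_le_compat_r; [nra|lra].
Qed.

Lemma rcont_R g t : continuous g t -> rcont (fun t => RtoC (g t)) t.
Proof. intros H. apply (rcont_pair g (fun _ => 0)); auto. apply continuous_const. Qed.

Lemma rcont_gauss (c : R -> R) z t : continuous c t -> rcont (fun t => gauss (c t) z) t.
Proof.
  intros H. unfold gauss. apply (rcont_comp (fun u => Cexp (- (u * (z * z)))) (fun t => RtoC (c t))).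
  auto 6 with holo. now apply rcont_R.
Qed.

(* E0 z is the integral of exp(-u^2) along the segment from 0 to z. *)
Definition E0 (z : C) : C := (z * CI (fun t => gauss (t * t) z) 0 1)%C.

Lemma cont_sq t : continuous (fun t => t * t) t.
Proof. apply is_derive_cont_ex. auto_derive. auto. Qed.

(** Stated for general c and d so as to cover both [E0] (c = t^2, d = 1) and [Bg] (c = 1 + t^2, d =
    1/(1 + t^2)). *)
Lemma CI_gauss_cder (c : R -> R) (d : R -> R) z : (forall t, 0 <= t <= 1 -> 0 <= c t <= 2) ->
  (forall t, 0 <= t <= 1 -> Rabs (d t) <= 1) ->
  (forall t, 0 <= t <= 1 -> continuous c t) -> (forall t, 0 <= t <= 1 -> continuous d t) ->
  cder (fun z => CI (fun t => RtoC (d t) * gauss (c t) z)%C 0 1) z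
    (CI (fun t => RtoC (d t) * (- (RtoC (2 * c t) * z) * gauss (c t) z))%C 0 1).
Proof.
  intros Hc Hd Cc Cd. destruct (gauss_quad z) as [A [HA B]].
  apply (CI_param (fun t y => RtoC (d t) * gauss (c t) y)%C _ z 0 1 A 1); try lra.
  - intros y Hy t Ht. apply rcont_mult. apply rcont_R; auto. apply rcont_gauss; auto.
  - intros t Ht. apply rcont_mult. apply rcont_R; auto. apply rcont_mult; [|apply rcont_gauss; auto].
    apply rcont_ext with (fun t => (- (RtoC 2 * z)) * RtoC (c t))%C. intros; rewrite RtoC_mult; ring.
    apply rcont_scal, rcont_R; auto.
  - intros y Hy t Ht. specialize (B (c t) y (Hc t Ht) Hy). specialize (Hd t Ht).
    replace (RtoC (d t) * gauss (c t) y - RtoC (d t) * gauss (c t) z - (y - z) * (RtoC (d t) * (- (RtoC (2 * c t) * z) * gauss (c t) z)))%C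
      with (RtoC (d t) * (gauss (c t) y - gauss (c t) z - (y - z) * (- (RtoC (2 * c t) * z) * gauss (c t) z)))%C by ring.
    rewrite Cmod_RtoC_mult. assert (P := Rabs_pos (d t)).
    rewrite <- (Rmult_1_l (A * _)). apply Rmult_le_compat; auto using Cmod_ge_0.
Qed.

Lemma cder_gauss c z : cder (gauss c) z (- (RtoC (2 * c) * z) * gauss c z)%C.
Proof.
  unfold gauss. eapply cder_eq.
  - apply (cder_comp Cexp (fun z => - (RtoC c * (z * z)))%C). apply cder_Cexp.
    apply cder_opp, cder_scal. apply cder_mult; apply cder_id.
  - cbv beta. rewrite RtoC_mult. ring.
Qed.

Lemma ccont_gauss c z : ccont (gauss c) z.
Proof. eapply cder_ccont, cder_gauss. Qed.

Lemma E0_cder z : cder E0 z (gauss 1 z).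
Proof.
  assert (D := CI_gauss_cder (fun t => t * t) (fun _ => 1) z).
  assert (D' : cder (fun z => CI (fun t => gauss (t * t) z) 0 1) z (CI (fun t => (- (RtoC (2 * (t * t)) * z) * gauss (t * t) z))%C 0 1)).
  { eapply cder_eq.
    - apply cder_ext with (fun z => CI (fun t => RtoC 1 * gauss (t * t) z)%C 0 1).
      + intros y. apply CI_ext; [lra|]. intros; ring.
      + apply D. intros; nra. intros; rewrite Rabs_R1; lra. intros; apply cont_sq. intros; apply continuous_const.
    - apply CI_ext; [lra|]. intros; ring. }
  unfold E0. eapply cder_eq. apply cder_mult; [apply cder_id|exact D']. cbv beta. rewrite Cmult_1_l.
  rewrite <- CI_scal; [|lra|].
  2: { intros t Ht. apply rcont_ext with (fun t => (fun u => (- (RtoC 2 * (u * u) * z)) * Cexp (- (u * u * (z * z))))%C (RtoC t)).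
       - intros u. unfold gauss. rewrite !RtoC_mult. reflexivity.
       - apply (rcont_comp (fun u => (- (RtoC 2 * (u * u) * z)) * Cexp (- (u * u * (z * z))))%C RtoC).
         auto 12 with holo. apply rcont_R, continuous_id. }
  rewrite <- CI_plus; [|lra| |].
  2: { intros; apply rcont_gauss, cont_sq. }
  2: { intros t Ht. apply rcont_ext with (fun t => (fun u => z * ((- (RtoC 2 * (u * u) * z)) * Cexp (- (u * u * (z * z)))))%C (RtoC t)).
       - intros u. unfold gauss. rewrite !RtoC_mult. reflexivity.
       - apply (rcont_comp (fun u => z * ((- (RtoC 2 * (u * u) * z)) * Cexp (- (u * u * (z * z)))))%C RtoC).
         auto 12 with holo. apply rcont_R, continuous_id. }
  (* the integrand is the derivative of t * exp(-t^2 z^2) *)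
  set (dk := fun u : C => (Cexp (- (u * u * (z * z))) + z * (- (RtoC 2 * (u * u) * z) * Cexp (- (u * u * (z * z)))))%C).
  assert (CS := CI_segment (fun u => u * Cexp (- (u * u * (z * z))))%C dk 0 1 0 1 ltac:(lra)).
  rewrite Cmult_1_l in CS. etransitivity; [|etransitivity; [apply CS|]].
  - apply CI_ext; [lra|]. intros t _. unfold dk, gauss. rewrite !RtoC_mult. rewrite Cplus_0_l, Cmult_1_r. reflexivity.
  - intros t _. unfold dk. eapply cder_eq. apply cder_mult; [apply cder_id|].
    apply (cder_comp Cexp (fun u => - (u * u * (z * z)))%C). apply cder_Cexp.
    apply cder_opp. apply cder_mult; [|apply cder_const]. apply cder_mult; apply cder_id. cbv beta. ring.
  - intros t _. unfold dk. auto 12 with holo.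
  - unfold gauss. rewrite !Cplus_0_l, !Cmult_1_r, Cmult_0_l, Cmult_1_l.
    replace (RtoC 1 * (z * z))%C with (z * z)%C by ring. replace (1 * 1 * (z * z))%C with (z * z)%C by ring. ring.
Qed.

Lemma Re_gauss c z : Re (- (RtoC c * (z * z))) = - c * (Re z * Re z - Im z * Im z).
Proof. destruct z; unfold Re, Im; simpl. ring. Qed.

(** Companion integral of the classical evaluation of the Gaussian integral: its derivative is minus
    that of the square of [E0], its value at 0 is pi/4, and on the real axis it decays. *)
Definition Bg (z : C) : C := CI (fun t => RtoC (/ (1 + t * t)) * gauss (1 + t * t) z)%C 0 1.

Lemma inv1sq_cont t : continuous (fun t => / (1 + t * t)) t.
Proof. apply is_derive_cont_ex. auto_derive. nra. Qed.

Lemma inv1sq_bound t : 0 < / (1 + t * t) <= 1.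
Proof.
  split. apply Rinv_0_lt_compat; nra. rewrite <- Rinv_1. apply Rinv_le_contravar; nra.
Qed.

Lemma Bg_cder z : cder Bg z (- (RtoC 2 * (gauss 1 z * E0 z)))%C.
Proof.
  unfold Bg. eapply cder_eq.
  - apply (CI_gauss_cder (fun t => 1 + t * t) (fun t => / (1 + t * t))).
    + intros; nra.
    + intros t _. assert (P := inv1sq_bound t). rewrite Rabs_right; lra.
    + intros t _. apply is_derive_cont_ex. auto_derive. auto.
    + intros t _. apply inv1sq_cont.
  - unfold E0. transitivity (CI (fun t => (- (RtoC 2 * z * gauss 1 z)) * gauss (t * t) z)%C 0 1).
    + apply CI_ext; [lra|]. intros t _.
      assert (N : RtoC (1 + t * t) <> RtoC 0) by (apply RtoC_neq0; nra).
      replace (gauss (1 + t * t) z) with (gauss 1 z * gauss (t * t) z)%C.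
      2: { unfold gauss. rewrite <- Cexp_plus. f_equal. rewrite !RtoC_plus. ring. }
      rewrite RtoC_mult, RtoC_inv by nra. field. auto.
    + rewrite CI_scal; [ring|lra|]. intros; apply rcont_gauss, cont_sq.
Qed.

Lemma E0_sq z : (E0 z * E0 z + Bg z)%C = RtoC (PI / 4).
Proof.
  set (h := fun z : C => (E0 z * E0 z + Bg z)%C).
  assert (D : forall u, cder h u ((fun _ => RtoC 0) u)).
  { intros u. unfold h. eapply cder_eq. apply cder_plus; [|apply Bg_cder].
    apply cder_mult; apply E0_cder. ring. }
  assert (S := CI_segment h (fun _ => RtoC 0) 0 z 0 1 ltac:(lra) ltac:(intros; apply D) ltac:(intros; apply ccont_const)).
  cbv beta in S. rewrite CI_const in S. replace (0 + 1 * z)%C with z in S by ring. replace (0 + 0 * z)%C with (RtoC 0) in S by ring.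
  change (E0 z * E0 z + Bg z)%C with (h z). replace (h z) with (h z - h 0 + h 0)%C by ring. rewrite <- S.
  unfold h, E0. rewrite !Cmult_0_l.
  assert (E : Bg 0 = RtoC (PI / 4)).
  { unfold Bg. transitivity (CI (fun t => RtoC (/ (1 + t * t))) 0 1).
    - apply CI_ext; [lra|]. intros t _. unfold gauss. replace (- (RtoC (1 + t * t) * (0 * 0)))%C with (RtoC 0) by ring.
      rewrite Cexp_0. ring.
    - rewrite CI_RtoC; [|lra|intros; apply inv1sq_cont]. f_equal.
      apply is_RInt_unique. replace (PI / 4) with (minus (atan 1) (atan 0)).
      2: { rewrite atan_1, atan_0. unfold minus, plus, opp; simpl. ring. }
      apply (is_RInt_derive (V := R_CompleteNormedModule) atan).
      + intros t _. auto_derive; auto. unfold Rsqr. field. nra.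
      + intros t _. apply inv1sq_cont. }
  rewrite E. ring.
Qed.

Lemma E0_real x : 0 <= x -> exists r, 0 <= r /\ E0 (RtoC x) = RtoC r.
Proof.
  intros Hx. exists (x * RInt (fun t => exp (- (t * t * (x * x)))) 0 1).
  assert (C0 : forall t, continuous (fun t => exp (- (t * t * (x * x)))) t).
  { intros t. apply is_derive_cont_ex. auto_derive. auto. }
  split.
  - apply Rmult_le_pos; auto. apply RInt_ge_0; [lra|apply ex_RInt_cont; [lra|auto]|]. intros; apply Rlt_le, exp_pos.
  - unfold E0. rewrite RtoC_mult. f_equal. rewrite <- CI_RtoC; [|lra|auto].
    apply CI_ext; [lra|]. intros t _. unfold gauss. rewrite <- !RtoC_mult, <- RtoC_opp. apply Cexp_RtoC.
Qed.

Lemma Bg_small x : Cmod (Bg (RtoC x)) <= exp (- (x * x)).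
Proof.
  unfold Bg. replace (exp (- (x * x))) with (exp (- (x * x)) * (1 - 0)) by ring. apply CI_bound; [lra| |].
  - intros t _. apply rcont_ext with (fun t => RtoC (/ (1 + t * t) * exp (- ((1 + t * t) * (x * x))))).
    + intros u. unfold gauss. rewrite <- !RtoC_mult, <- RtoC_opp, Cexp_RtoC, <- RtoC_mult. reflexivity.
    + apply rcont_R. apply is_derive_cont_ex. auto_derive. nra.
  - intros t Ht. assert (P := inv1sq_bound t). rewrite Cmod_RtoC_mult, Rabs_right by lra.
    unfold gauss. rewrite Cmod_Cexp, Re_gauss. unfold Re, Im; simpl.
    rewrite <- (Rmult_1_l (exp (- (x * x)))). apply Rmult_le_compat; try lra. apply Rlt_le, exp_pos.
    apply exp_le. nra.
Qed.

Definition hpi : R := sqrt PI / 2.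

Lemma hpi_sq : hpi * hpi = PI / 4.
Proof. unfold hpi. assert (P := PI_RGT_0). replace (sqrt PI / 2 * (sqrt PI / 2)) with ((sqrt PI * sqrt PI) / 4) by field. rewrite sqrt_sqrt; lra. Qed.

Lemma sqrtPI_pos : 0 < sqrt PI.
Proof. apply sqrt_lt_R0, PI_RGT_0. Qed.

Lemma hpi_pos : 0 < hpi.
Proof. unfold hpi. assert (P := sqrtPI_pos). lra. Qed.

(** By [E0_sq] the square of [E0 x] differs from pi/4 by [Bg x]; dividing by r + hpi >= hpi gives
    the distance of the roots. *)
Lemma E0_real_lim x : 0 <= x -> Cmod (E0 (RtoC x) - RtoC hpi) <= exp (- (x * x)) / hpi.
Proof.
  intros Hx. destruct (E0_real x Hx) as [r [Hr E]].
  assert (S := E0_sq (RtoC x)). assert (B := Bg_small x). rewrite E in *.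
  assert (B2 : Rabs (r * r - hpi * hpi) <= exp (- (x * x))).
  { rewrite <- Cmod_R. rewrite hpi_sq. rewrite RtoC_minus, <- S, RtoC_mult.
    replace (r * r - (r * r + Bg x))%C with (- Bg x)%C by ring. now rewrite Cmod_opp. }
  rewrite <- RtoC_minus, Cmod_R. assert (P := hpi_pos).
  apply Rmult_le_reg_r with hpi; auto. unfold Rdiv. rewrite Rmult_assoc, Rinv_l, Rmult_1_r by lra.
  eapply Rle_trans; [|exact B2]. replace (r * r - hpi * hpi) with ((r - hpi) * (r + hpi)) by ring.
  rewrite Rabs_mult, (Rabs_right (r + hpi)) by lra. apply Rmult_le_compat_l; [apply Rabs_pos|lra].
Qed.

(** Integration along the segment from b to s + b, where the integrand is Gaussian-small in b. Hence
    all horizontal rays lead to the same limit. *)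
Lemma E0_shift_lim s b : 0 <= b ->
  Cmod (E0 (s + RtoC b) - E0 (RtoC b)) <= Cmod s * exp (Cmod s * Cmod s + 2 * b * Cmod s - b * b).
Proof.
  intros Hb.
  assert (S := CI_segment E0 (gauss 1) (RtoC b) s 0 1 ltac:(lra) ltac:(intros; apply E0_cder) ltac:(intros; apply ccont_gauss)).
  replace (b + 1 * s)%C with (s + b)%C in S by ring. replace (b + 0 * s)%C with (RtoC b) in S by ring.
  rewrite <- S, Cmod_mult. apply Rmult_le_compat_l; [apply Cmod_ge_0|].
  set (M := exp (Cmod s * Cmod s + 2 * b * Cmod s - b * b)). replace M with (M * (1 - 0)) by ring.
  apply CI_bound; [lra| |].
  - intros t _. apply (rcont_comp (gauss 1)). apply ccont_gauss. apply rcont_line.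
  - intros t Ht. unfold gauss. rewrite Cmod_Cexp, Re_gauss. apply exp_le.
    destruct s as [x y]. set (m := Cmod (x, y)).

    assert (Ax : Rabs x <= m) by apply (Re_le_Cmod (x, y)). assert (Ay : Rabs y <= m) by apply (Im_le_Cmod (x, y)).
    apply Rabs_le_between in Ax, Ay.
    replace (Re (b + t * (x, y))) with (b + t * x) by (unfold Re; simpl; ring).
    replace (Im (b + t * (x, y))) with (t * y) by (unfold Im; simpl; ring).
    assert (t * x <= m /\ - m <= t * x) by nra. assert (t * y <= m /\ - m <= t * y) by nra. nra.
Qed.

Lemma exp_neg_small e : 0 < e -> exists M, 0 <= M /\ forall x, M <= x -> exp (- x) < e.
Proof.
  intros He. exists (/ e). split. apply Rlt_le, Rinv_0_lt_compat; auto. intros x Hx.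
  assert (P : 0 < / e) by now apply Rinv_0_lt_compat.
  rewrite exp_Ropp. rewrite <- (Rinv_inv e). apply Rinv_lt_contravar.
  - apply Rmult_lt_0_compat; [lra|apply exp_pos].
  - assert (T := exp_ineq1_le x). lra.
Qed.

Lemma E0_lim s e : 0 < e -> exists M, 0 <= M /\ forall b, M <= b -> Cmod (E0 (s + RtoC b) - RtoC hpi) < e.
Proof.
  intros He. set (m := Cmod s). assert (Hm : 0 <= m) by apply Cmod_ge_0. assert (Hp := hpi_pos).
  assert (P0 := exp_pos (m * m)).
  set (e1 := Rmin (e / 2 * hpi) (e / (2 * ((m + 1) * exp (m * m))))).
  assert (He1 : 0 < e1). { apply Rmin_pos. nra. apply Rdiv_lt_0_compat; nra. }
  destruct (exp_neg_small e1 He1) as [M [HM HE]].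
  exists (M + 2 * m + 1). split; [lra|]. intros b Hb.
  assert (Q1 := Rmin_l (e / 2 * hpi) (e / (2 * ((m + 1) * exp (m * m))))).
  assert (Q2 := Rmin_r (e / 2 * hpi) (e / (2 * ((m + 1) * exp (m * m))))). fold e1 in Q1, Q2.
  assert (T1 := E0_real_lim b ltac:(lra)). assert (T2 := E0_shift_lim s b ltac:(lra)). fold m in T2.
  replace (E0 (s + b) - hpi)%C with ((E0 (s + b) - E0 b) + (E0 b - hpi))%C by ring.
  eapply Rle_lt_trans; [apply Cmod_triangle|].
  assert (X1 : exp (- (b * b)) / hpi < e / 2).
  { apply Rmult_lt_reg_r with hpi; auto. unfold Rdiv at 1. rewrite Rmult_assoc, Rinv_l by lra.
    specialize (HE (b * b) ltac:(nra)). lra. }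
  assert (X2 : m * exp (m * m + 2 * b * m - b * b) <= e / 2).
  { replace (m * m + 2 * b * m - b * b) with (m * m + - (b * (b - 2 * m))) by ring. rewrite exp_plus.
    specialize (HE (b * (b - 2 * m)) ltac:(nra)).
    assert (P1 := exp_pos (- (b * (b - 2 * m)))).
    apply Rle_trans with (((m + 1) * exp (m * m)) * (e / (2 * ((m + 1) * exp (m * m))))).
    - rewrite <- Rmult_assoc. apply Rmult_le_compat; [apply Rmult_le_pos; lra|lra|apply Rmult_le_compat_r; lra|lra].
    - right. field. split; lra. }
  lra.
Qed.

Lemma E0_horizontal s b : 0 <= b -> CI (fun t => Cexp (- ((s + RtoC t) * (s + RtoC t)))) 0 b = (E0 (s + RtoC b) - E0 s)%C.
Proof.
  intros Hb.
  assert (S := CI_segment E0 (gauss 1) s 1 0 b Hb ltac:(intros; apply E0_cder) ltac:(intros; apply ccont_gauss)).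
  rewrite Cmult_1_l in S. replace (s + 0 * 1)%C with s in S by ring. rewrite Cmult_1_r in S. rewrite <- S.
  apply CI_ext; auto. intros t _. unfold gauss. f_equal. ring.
Qed.

Theorem Cerfc_E0 s : Cerfc s = (RtoC (2 / sqrt PI) * (RtoC hpi - E0 s))%C.
Proof.
  unfold Cerfc. f_equal. apply (is_RInt_gen_unique (V := C_R_CompleteNormedModule)).
  intros P HP. apply (proj1 (locally_near _ _)) in HP. destruct HP as [e [He HP]].
  destruct (E0_lim s e He) as [M [HM HE]].
  apply (Filter_prod _ _ _ (fun a => a = 0) (fun b => M < b)).
  - reflexivity.
  - exists M. auto.
  - intros a b -> Hb. exists (E0 (s + RtoC b) - E0 s)%C. split.
    + simpl. rewrite <- E0_horizontal by lra. apply is_CI; [lra|].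
      intros t _. apply (rcont_comp (fun u => Cexp (- ((s + u) * (s + u)))) RtoC).
      auto 8 with holo. apply rcont_R, continuous_id.
    + apply HP. replace (E0 (s + b) - E0 s - (hpi - E0 s))%C with (E0 (s + b) - hpi)%C by ring. apply HE. lra.
Qed.

Lemma E0_odd z : E0 (- z) = (- E0 z)%C.
Proof.
  unfold E0. rewrite (CI_ext (fun t => gauss (t * t) (- z)) (fun t => gauss (t * t) z)); [ring|lra|].
  intros t _. unfold gauss. f_equal. ring.
Qed.

Lemma Cerfc_opp s : Cerfc (- s) = (RtoC 2 - Cerfc s)%C.
Proof.
  rewrite !Cerfc_E0, E0_odd. assert (P := sqrtPI_pos).
  replace (RtoC 2) with (RtoC (2 / sqrt PI) * (RtoC 2 * RtoC hpi))%C. ring.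
  rewrite <- !RtoC_mult. f_equal. unfold hpi. field. lra.
Qed.

Lemma Cerfc_hol s : hol Cerfc s.
Proof.
  apply hol_ext with (fun s => RtoC (2 / sqrt PI) * (RtoC hpi - E0 s))%C.
  - intros y. symmetry. apply Cerfc_E0.
  - apply hol_scal. apply hol_minus; [apply hol_const|]. eexists. apply E0_cder.
Qed.

(* Two-term asymptotic antiderivative: its derivative is exp(-u^2) (1 - 3/(4 u^4)). *)
Definition Vas (u : C) : C := (gauss 1 u * (/ (RtoC 4 * (u * (u * u))) - / (RtoC 2 * u)))%C.

Lemma Vas_cder u : u <> RtoC 0 ->
  cder Vas u (gauss 1 u * (RtoC 1 - RtoC (3 / 4) * / (u * u * (u * u))))%C.
Proof.
  intros Hu. unfold Vas. eapply cder_eq.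
  - apply cder_mult; [apply cder_gauss|]. apply cder_minus; apply cder_inv.
    + repeat apply Cmult_neq_0; auto. apply RtoC_neq0; lra.
    + apply cder_scal. apply cder_mult; [apply cder_id|]. apply cder_mult; apply cder_id.
    + apply Cmult_neq_0; auto. apply RtoC_neq0; lra.
    + apply cder_scal, cder_id.
  - cbv beta. rewrite RtoC_div by lra. rewrite Rmult_1_r. field. auto.
Qed.

Lemma RInt_inv1sq b : 0 <= b -> ex_RInt (fun t => / (1 + t * t)) 0 b /\ RInt (fun t => / (1 + t * t)) 0 b <= 2.
Proof.
  intros Hb. assert (H : is_RInt (fun t => / (1 + t * t)) 0 b (minus (atan b) (atan 0))).
  { apply (is_RInt_derive (V := R_CompleteNormedModule) atan).
    + intros t _. auto_derive; auto. unfold Rsqr. field. nra.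
    + intros t _. apply inv1sq_cont. }
  split; [now exists (minus (atan b) (atan 0))|].
  rewrite (is_RInt_unique _ _ _ _ H). rewrite atan_0. unfold minus, plus, opp; simpl.
  assert (A := atan_bound b). assert (P := PI_4). lra.
Qed.

Lemma exp_sq_le t : exp (- (t * t)) <= / (1 + t * t).
Proof.
  rewrite exp_Ropp. apply Rinv_le_contravar; [nra|]. apply exp_ineq1_le.
Qed.

Lemma Cmod_shift_ge s t : 0 <= Re s -> 0 <= t -> Cmod s <= Cmod (s + RtoC t).
Proof.
  intros Hs Ht. destruct s as [x y]. unfold Re in Hs; simpl in Hs.
  unfold Cmod. apply sqrt_le_1_alt. simpl. nra.
Qed.

Lemma gauss_Cmod_shift s t : 0 <= Re s -> 0 <= t ->
  Cmod (gauss 1 (s + RtoC t)) <= exp (- Re (s * s)) * exp (- (t * t)).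
Proof.
  intros Hs Ht. unfold gauss. rewrite Cmod_Cexp, Re_gauss, <- exp_plus. apply exp_le.
  destruct s as [x y]. unfold Re in *; simpl in *. unfold Im; simpl. nra.
Qed.

(** The left-hand side is the integral of 3/(4 u^4) exp(-u^2) along the ray from s. There |u| >= |s|
    since Re s >= 0, and exp(-t^2) <= 1/(1 + t^2) has integral at most 2, whence 3/2. *)
Lemma erfc_tail s : 0 <= Re s -> 1 <= Cmod s ->
  Cmod (RtoC hpi - E0 s + Vas s) <= 3 / 2 * / Cmod s ^ 4 * exp (- Re (s * s)).
Proof.
  intros Hs H1. set (m := Cmod s) in *. set (K := 3 / 2 * / m ^ 4 * exp (- Re (s * s))).
  assert (Pe := exp_pos (- Re (s * s))).
  assert (Pm : 0 < m ^ 4) by (apply pow_lt; lra). assert (Pmi : 0 < / m ^ 4) by now apply Rinv_0_lt_compat.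
  apply Rnot_lt_le. intros L. set (e := (Cmod (RtoC hpi - E0 s + Vas s) - K) / 2).
  assert (He : 0 < e) by (unfold e; lra).
  destruct (E0_lim s (e / 2) ltac:(lra)) as [M1 [HM1 B1]].
  destruct (exp_neg_small (e / 2 / exp (- Re (s * s))) ltac:(repeat apply Rdiv_lt_0_compat; lra)) as [M2 [HM2 B2]].
  set (b := M1 + M2 + 1). assert (Hb : 0 <= b) by (unfold b; lra).
  specialize (B1 b ltac:(unfold b; lra)). specialize (B2 (b * b) ltac:(unfold b; nra)).
  assert (NZ : forall t, 0 <= t -> 1 <= Cmod (s + RtoC t) /\ m <= Cmod (s + RtoC t) /\ (s + RtoC t)%C <> RtoC 0).
  { intros t Ht. assert (G := Cmod_shift_ge s t Hs Ht). fold m in G. repeat split; try lra. apply Cmod_neq0. lra. }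
  set (dD := fun u : C => (gauss 1 u * (RtoC (3 / 4) * / (u * u * (u * u))))%C).
  assert (S := CI_segment (fun u => E0 u - Vas u)%C dD s 1 0 b Hb).
  rewrite Cmult_1_l in S. rewrite Cmult_1_r in S. replace (s + 0 * 1)%C with s in S by ring.
  assert (CdD : forall t, 0 <= t <= b -> ccont dD (s + RtoC t * 1)).
  { intros t Ht. rewrite Cmult_1_r. destruct (NZ t ltac:(lra)) as [_ [_ N]]. unfold dD. apply ccont_mult; [apply ccont_gauss|].
    apply ccont_mult; [apply ccont_const|]. apply ccont_inv; auto with holo. repeat apply Cmult_neq_0; auto. }
  assert (S' : CI (fun t => dD (s + RtoC t * 1)%C) 0 b = (E0 (s + RtoC b) - Vas (s + RtoC b) - (E0 s - Vas s))%C).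
  { apply S; auto. intros t Ht. destruct (NZ t ltac:(lra)) as [_ [_ N]]. rewrite Cmult_1_r. eapply cder_eq.
    apply cder_minus; [apply E0_cder|now apply Vas_cder]. unfold dD. ring. }
  clear S.
  assert (BI : Cmod (CI (fun t => dD (s + RtoC t * 1)%C) 0 b) <= K).
  { destruct (RInt_inv1sq b Hb) as [EX IL].
    set (k0 := 3 / 4 * / m ^ 4 * exp (- Re (s * s))).
    assert (Pk0 : 0 < k0) by (unfold k0; repeat apply Rmult_lt_0_compat; lra).
    apply Rle_trans with (RInt (fun t => scal k0 (/ (1 + t * t))) 0 b).
    - apply CI_norm; auto.
      + intros t Ht. apply (rcont_comp dD). auto. apply rcont_line.
      + apply (ex_RInt_scal (V := R_NormedModule)); auto.
      + intros t Ht. rewrite Cmult_1_r. destruct (NZ t ltac:(lra)) as [N1 [N2 N]]. unfold dD.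
        rewrite Cmod_mult, Cmod_RtoC_mult, Rabs_right by lra.
        rewrite Cmod_inv by (repeat apply Cmult_neq_0; auto). rewrite !Cmod_mult.
        assert (G := gauss_Cmod_shift s t Hs ltac:(lra)). assert (X := exp_sq_le t).
        set (c := Cmod (s + t)) in *.
        assert (Ic : / (c * c * (c * c)) <= / m ^ 4).
        { apply Rinv_le_contravar; auto. replace (c * c * (c * c)) with (c ^ 4) by ring. apply pow_incr; lra. }
        assert (Ic0 : 0 < / (c * c * (c * c))) by (apply Rinv_0_lt_compat; repeat apply Rmult_lt_0_compat; lra).
        change (scal k0 (/ (1 + t * t))) with (k0 * / (1 + t * t)).
        replace (k0 * / (1 + t * t)) with
          ((exp (- Re (s * s)) * / (1 + t * t)) * (3 / 4 * / m ^ 4)) by (unfold k0; ring).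
        apply Rmult_le_compat; [apply Cmod_ge_0|lra| |apply Rmult_le_compat_l; [lra|exact Ic]].
        eapply Rle_trans; [exact G|]. apply Rmult_le_compat_l; lra.
    - rewrite (RInt_scal (V := R_CompleteNormedModule)) by auto. unfold scal; simpl; unfold mult; simpl.
      apply Rle_trans with (k0 * 2); [apply Rmult_le_compat_l; lra|]. unfold k0, K. right. simpl. field. lra. }
  assert (BV : Cmod (Vas (s + RtoC b)) < e / 2).
  { destruct (NZ b Hb) as [N1 [N2 N]]. unfold Vas. rewrite Cmod_mult. set (u := (s + b)%C) in *.
    assert (Q : Cmod (/ (RtoC 4 * (u * (u * u))) - / (RtoC 2 * u)) <= 1).
    { eapply Rle_trans; [apply Cmod_minus_le|].
      assert (T4 : RtoC 4 <> RtoC 0) by (apply RtoC_neq0; lra). assert (T2 : RtoC 2 <> RtoC 0) by (apply RtoC_neq0; lra).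
      rewrite !Cmod_inv by (repeat apply Cmult_neq_0; auto). rewrite !Cmod_mult, !Cmod_R, !Rabs_right by lra.
      assert (/ (4 * (Cmod u * (Cmod u * Cmod u))) <= / 4).
      { apply Rinv_le_contravar; [lra|]. assert (1 <= Cmod u * Cmod u) by nra. nra. }
      assert (/ (2 * Cmod u) <= / 2) by (apply Rinv_le_contravar; lra). lra. }
    assert (G := gauss_Cmod_shift s b Hs Hb). fold u in G.
    apply Rle_lt_trans with (exp (- Re (s * s)) * exp (- (b * b))).
    - rewrite <- (Rmult_1_r (exp _ * exp _)). apply Rmult_le_compat; auto using Cmod_ge_0.
    - apply Rmult_lt_reg_r with (/ exp (- Re (s * s))); [now apply Rinv_0_lt_compat|].
      replace (exp (- Re (s * s)) * exp (- (b * b)) * / exp (- Re (s * s))) with (exp (- (b * b))) by (field; lra). exact B2. }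
  assert (T1 := Cmod_triangle (- (E0 (s + RtoC b) - RtoC hpi)) (Vas (s + RtoC b) + CI (fun t => dD (s + RtoC t * 1)%C) 0 b)).
  assert (T2 := Cmod_triangle (Vas (s + RtoC b)) (CI (fun t => dD (s + RtoC t * 1)%C) 0 b)).
  rewrite Cmod_opp in T1.
  replace (- (E0 (s + b) - hpi) + (Vas (s + b) + CI (fun t => dD (s + RtoC t * 1)) 0 b))%C with (hpi - E0 s + Vas s)%C in T1
    by (rewrite S'; ring).
  unfold e in *. lra.
Qed.

(** The second term of [Vas] is moved into the error, which leaves the leading term with an error of
    order |s|^(-3). *)
Theorem Cerfc_asym s : 0 <= Re s -> 1 <= Cmod s ->
  Cmod (Cexp (s * s) * Cerfc s - / (RtoC (sqrt PI) * s)) <= 4 / Cmod s ^ 3.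
Proof.
  intros Hs H1. assert (T := erfc_tail s Hs H1). assert (Ns : s <> RtoC 0) by (apply Cmod_neq0; lra).
  assert (SP := sqrtPI_pos).
  assert (SP1 : 1 <= sqrt PI) by (rewrite <- sqrt_1; apply sqrt_le_1_alt; assert (P := PI2_1); lra).
  rewrite Cerfc_E0.
  assert (NP : RtoC (sqrt PI) <> RtoC 0) by (apply RtoC_neq0; lra).
  assert (EV : (Cexp (s * s) * Vas s)%C = (/ (RtoC 4 * (s * (s * s))) - / (RtoC 2 * s))%C).
  { unfold Vas, gauss. rewrite Cmult_assoc, <- Cexp_plus. replace (s * s + - (RtoC 1 * (s * s)))%C with (RtoC 0) by ring.
    rewrite Cexp_0. ring. }
  replace (Cexp (s * s) * (RtoC (2 / sqrt PI) * (hpi - E0 s)) - / (sqrt PI * s))%C with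
    (RtoC (2 / sqrt PI) * (Cexp (s * s) * (hpi - E0 s + Vas s) - / (RtoC 4 * (s * (s * s)))))%C.
  2: { replace (Cexp (s * s) * (hpi - E0 s + Vas s))%C with (Cexp (s * s) * (hpi - E0 s) + Cexp (s * s) * Vas s)%C by ring.
       rewrite EV, RtoC_div by lra. field. auto. }
  rewrite Cmod_RtoC_mult, Rabs_right by (apply Rle_ge, Rlt_le, Rdiv_lt_0_compat; lra).
  assert (P3 : 0 < Cmod s ^ 3) by (apply pow_lt; lra). assert (I3 : 0 < / Cmod s ^ 3) by now apply Rinv_0_lt_compat.
  assert (B1 : Cmod (Cexp (s * s) * (hpi - E0 s + Vas s)) <= 3 / 2 * / Cmod s ^ 3).
  { rewrite Cmod_mult, Cmod_Cexp. eapply Rle_trans; [apply Rmult_le_compat_l; [apply Rlt_le, exp_pos|exact T]|].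
    replace (exp (Re (s * s)) * (3 / 2 * / Cmod s ^ 4 * exp (- Re (s * s)))) with (3 / 2 * / Cmod s ^ 4).
    2: { rewrite exp_Ropp. field. split; [apply Rgt_not_eq, exp_pos|lra]. }
    apply Rmult_le_compat_l; [lra|]. apply Rinv_le_contravar; auto.
    replace (Cmod s ^ 4) with (Cmod s ^ 3 * Cmod s) by ring. rewrite <- (Rmult_1_r (Cmod s ^ 3)) at 1. apply Rmult_le_compat_l; lra. }
  assert (B2 : Cmod (/ (RtoC 4 * (s * (s * s)))) <= / 4 * / Cmod s ^ 3).
  { rewrite Cmod_inv by (repeat apply Cmult_neq_0; auto; apply RtoC_neq0; lra). rewrite !Cmod_mult, Cmod_R, Rabs_right by lra.
    right. simpl. field. lra. }
  assert (B3 := Cmod_minus_le (Cexp (s * s) * (hpi - E0 s + Vas s)) (/ (RtoC 4 * (s * (s * s))))).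
  apply Rle_trans with (2 * (7 / 4 * / Cmod s ^ 3)).
  - apply Rmult_le_compat; auto using Cmod_ge_0.
    + apply Rlt_le, Rdiv_lt_0_compat; lra.
    + apply Rmult_le_reg_r with (sqrt PI); auto. unfold Rdiv. rewrite Rmult_assoc, Rinv_l by lra. lra.
    + lra.
  - unfold Rdiv. lra.
Qed.

(** * Principal value integrals on Re s = 1 *)

(** Symmetric limits are needed because 1/(s - z) decays only like 1/|s|. Continuity on the line is
    included so that the truncated integrals are linear. *)
Definition PVlim (k : C -> C) (l : C) : Prop :=
  (forall t, ccont k (1, t)) /\
  forall e, 0 < e -> exists Y0, 0 <= Y0 /\ forall Y, Y0 <= Y -> Cmod (CI (fun t => k (1, t)) (- Y) Y - l) < e.

Lemma PV_plus f g a b : PVlim f a -> PVlim g b -> PVlim (fun s => f s + g s)%C (a + b)%C.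
Proof.
  intros [Cf Hf] [Cg Hg]. split; [intros; apply ccont_plus; auto|].
  intros e He. destruct (Hf (e / 2) ltac:(lra)) as [Y1 [P1 H1]]. destruct (Hg (e / 2) ltac:(lra)) as [Y2 [P2 H2]].
  exists (Y1 + Y2). split; [lra|]. intros Y HY. specialize (H1 Y ltac:(lra)). specialize (H2 Y ltac:(lra)).
  rewrite CI_plus; try lra; try (intros; apply rcont_v; auto).
  replace (CI (fun t => f (1%R, t)) (- Y) Y + CI (fun t => g (1%R, t)) (- Y) Y - (a + b))%C with
    ((CI (fun t => f (1%R, t)) (- Y) Y - a) + (CI (fun t => g (1%R, t)) (- Y) Y - b))%C by ring.
  eapply Rle_lt_trans; [apply Cmod_triangle|lra].
Qed.

Lemma PV_scal c f a : PVlim f a -> PVlim (fun s => c * f s)%C (c * a)%C.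
Proof.
  intros [Cf Hf]. split; [intros; apply ccont_mult; auto with holo|].
  intros e He. assert (P := Cmod_ge_0 c). destruct (Hf (e / (Cmod c + 1)) ltac:(apply Rdiv_lt_0_compat; lra)) as [Y1 [P1 H1]].
  exists Y1. split; auto. intros Y HY. specialize (H1 Y HY).
  rewrite CI_scal; try lra; try (intros; apply rcont_v; auto).
  replace (c * CI (fun t => f (1%R, t)) (- Y) Y - c * a)%C with (c * (CI (fun t => f (1%R, t)) (- Y) Y - a))%C by ring.
  rewrite Cmod_mult. assert (Q := Cmod_ge_0 (CI (fun t => f (1, t)) (- Y) Y - a)).
  apply Rle_lt_trans with ((Cmod c + 1) * Cmod (CI (fun t => f (1, t)) (- Y) Y - a)); [nra|].
  replace e with ((Cmod c + 1) * (e / (Cmod c + 1))) at 1 by (field; lra). apply Rmult_lt_compat_l; lra.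
Qed.

Lemma PV_ext f g a : (forall t, ccont g (1, t)) -> (forall t, f (1, t) = g (1, t)) -> PVlim f a -> PVlim g a.
Proof.
  intros Cg E [Cf Hf]. split; auto. intros e He. destruct (Hf e He) as [Y0 [P0 H0]]. exists Y0. split; auto.
  intros Y HY. rewrite (CI_ext _ (fun t => f (1, t))); auto. lra.
Qed.

Lemma PV_minus f g a b : PVlim f a -> PVlim g b -> PVlim (fun s => f s - g s)%C (a - b)%C.
Proof.
  intros Hf Hg. replace (a - b)%C with (a + RtoC (-1) * b)%C by ring.
  assert (H := PV_plus _ _ _ _ Hf (PV_scal (RtoC (-1)) _ _ Hg)). revert H. apply PV_ext.
  - intros t. destruct Hf, Hg. apply ccont_minus; auto.
  - intros t. ring.
Qed.

Lemma PV_eq f a b : PVlim f a -> a = b -> PVlim f b.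
Proof. now intros H <-. Qed.

Lemma atan_large u : 0 < u -> 0 <= PI / 2 - atan u <= / u.
Proof.
  intros Hu. assert (P : 0 < / u) by now apply Rinv_0_lt_compat.
  assert (E := atan_inv u Hu). assert (B := atan_bound u).
  split; [lra|]. replace (PI / 2 - atan u) with (atan (/ u)) by lra.
  destruct (MVT_gen atan 0 (/ u) (fun x => / (1 + x * x))) as [c [Hc Hc2]].
  - intros x _. auto_derive; auto. unfold Rsqr. field. nra.
  - intros x _. apply derivable_continuous_pt, derivable_pt_atan.
  - rewrite atan_0, !Rminus_0_r in Hc2. rewrite Hc2. 
    assert (/ (1 + c * c) <= 1) by (rewrite <- Rinv_1; apply Rinv_le_contravar; nra). nra.
Qed.

Lemma ln_ratio_bound A B : 0 < A -> 0 < B -> Rabs (ln A - ln B) <= Rabs (A - B) / A + Rabs (A - B) / B.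
Proof.
  intros HA HB. assert (L : forall X Y, 0 < X -> 0 < Y -> ln X - ln Y <= Rabs (X - Y) / Y).
  { intros X Y HX HY. rewrite <- ln_div by auto. 
    assert (T := exp_ineq1_le (ln (X / Y))). rewrite exp_ln in T by (apply Rdiv_lt_0_compat; auto).
    apply Rle_trans with ((X - Y) / Y). replace ((X - Y) / Y) with (X / Y - 1) by (field; lra). lra.
    apply Rmult_le_compat_r; [apply Rlt_le, Rinv_0_lt_compat; auto|apply Rle_abs]. }
  assert (L1 := L A B HA HB). assert (L2 := L B A HB HA). rewrite (Rabs_minus_sym B A) in L2.
  assert (P1 : 0 <= Rabs (A - B) / A) by (apply Rmult_le_pos; [apply Rabs_pos|apply Rlt_le, Rinv_0_lt_compat; auto]).
  assert (P2 : 0 <= Rabs (A - B) / B) by (apply Rmult_le_pos; [apply Rabs_pos|apply Rlt_le, Rinv_0_lt_compat; auto]).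
  apply Rabs_le. lra.
Qed.

Lemma PV_conv f g a b : PVlim f a -> (forall t, ccont g (1, t)) -> (forall t, f (1, t) = g (1, t)) ->
  a = b -> PVlim g b.
Proof. intros Hf Cg E <-. now apply (PV_ext f). Qed.

Definition sgnline (z : C) : R := if Rlt_dec (Re z) 1 then PI else - PI.

(** In [CI_inv_v] the two arctangents approach a total of pi up to O(1/Y), with the sign of 1 - Re
    z; the two logarithms cancel to the same order because the limits are symmetric. *)
Lemma PV_inv z : Re z <> 1 -> PVlim (fun s => / (s - z))%C (RtoC (sgnline z)).
Proof.
  intros Hz. destruct z as [x y]. unfold sgnline, Re in *; simpl in *. split.
  - intros t. apply ccont_inv; auto with holo. apply Csub_neq0. intros E. injection E. lra.
  - intros e He. set (c := Rabs (1 - x)). assert (Hc : 0 < c) by (apply Rabs_pos_lt; lra).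
    set (m := Rabs y). assert (Hm : 0 <= m) by apply Rabs_pos.
    exists (2 * m + 1 + (4 * c + 32 * m) / e + 1). split.
    { assert (0 <= (4 * c + 32 * m) / e) by (apply Rmult_le_pos; [lra|apply Rlt_le, Rinv_0_lt_compat; auto]). lra. }
    intros Y HY. assert (Q : 0 <= (4 * c + 32 * m) / e) by (apply Rmult_le_pos; [lra|apply Rlt_le, Rinv_0_lt_compat; auto]).
    assert (Hy : - m <= y <= m) by (apply Rabs_le_between; unfold m; lra).
    rewrite (CI_inv_v 1 x y) by lra.
    assert (G1 : 0 < (Y - y) / c) by (apply Rdiv_lt_0_compat; lra). assert (G2 : 0 < (Y + y) / c) by (apply Rdiv_lt_0_compat; lra).
    assert (A1 := atan_large _ G1). assert (A2 := atan_large _ G2).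
    assert (B : forall u, Y / 2 <= u -> / (u / c) <= 2 * c / Y).
    { intros u Hu. replace (/ (u / c)) with (c * / u) by (field; lra). replace (2 * c / Y) with (c * / (Y / 2)) by (field; lra).
      apply Rmult_le_compat_l; [lra|]. apply Rinv_le_contravar; lra. }
    assert (B1 := B (Y - y) ltac:(lra)). assert (B2 := B (Y + y) ltac:(lra)).
    assert (LB := ln_ratio_bound ((1 - x) * (1 - x) + (Y - y) * (Y - y)) ((1 - x) * (1 - x) + (- Y - y) * (- Y - y)) ltac:(nra) ltac:(nra)).
    assert (D : forall w, Y / 2 <= Rabs w -> Rabs ((1 - x) * (1 - x) + (Y - y) * (Y - y) - ((1 - x) * (1 - x) + (- Y - y) * (- Y - y))) / ((1 - x) * (1 - x) + w * w) <= 16 * m / Y).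
    { intros w Hw. replace ((1 - x) * (1 - x) + (Y - y) * (Y - y) - ((1 - x) * (1 - x) + (- Y - y) * (- Y - y))) with (- (4 * Y) * y) by ring.
      rewrite Rabs_mult, Rabs_left by lra. fold m.
      assert (W2 : Y / 2 * (Y / 2) <= w * w). { rewrite <- (Rabs_right (w * w)) by nra. rewrite Rabs_mult. apply Rmult_le_compat; lra. }
      replace (16 * m / Y) with (4 * Y * m * / (Y / 2 * (Y / 2))) by (field; lra).
      unfold Rdiv at 1. rewrite Ropp_involutive. apply Rmult_le_compat_l; [apply Rmult_le_pos; lra|]. apply Rinv_le_contravar; nra. }
    assert (D1 := D (Y - y) ltac:(rewrite Rabs_right; lra)). assert (D2 := D (- Y - y) ltac:(rewrite Rabs_left; lra)).
    assert (HI : 4 * c / Y + 32 * m / Y < e).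
    { apply Rmult_lt_reg_r with Y; [lra|]. replace ((4 * c / Y + 32 * m / Y) * Y) with ((4 * c + 32 * m) / e * e) by (field; lra).
      rewrite (Rmult_comm e). apply Rmult_lt_compat_r; lra. }
    set (L1 := ln ((1 - x) * (1 - x) + (Y - y) * (Y - y))) in *.
    set (L2 := ln ((1 - x) * (1 - x) + (- Y - y) * (- Y - y))) in *.
    eapply Rle_lt_trans; [apply Cmod_le_Re_Im|]. unfold Re, Im, RtoC; simpl fst; simpl snd.
    assert (I1 : Rabs (- L1 / 2 - - L2 / 2 + - 0) <= 16 * m / Y).
    { replace (- L1 / 2 - - L2 / 2 + - 0) with (- ((L1 - L2) / 2)) by field. rewrite Rabs_Ropp. unfold Rdiv at 1. rewrite Rabs_mult, (Rabs_right (/ 2)) by lra. lra. }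
    assert (I2 : Rabs (atan ((Y - y) / (1 - x)) - atan ((- Y - y) / (1 - x)) + - (if Rlt_dec x 1 then PI else - PI)) <= 4 * c / Y).
    { replace (- Y - y) with (- (Y + y)) by ring.
      assert (N : forall u v, v <> 0 -> atan (- u / v) = - atan (u / v)).
      { intros u v Hv. rewrite <- atan_opp. f_equal. field. auto. }
      rewrite N by lra.
      assert (E4 : 4 * c / Y = 2 * c / Y + 2 * c / Y) by (field; lra). rewrite E4.
      destruct (Rlt_dec x 1) as [L|L].
      - replace (1 - x) with c by (unfold c; rewrite Rabs_right; lra). apply Rabs_le. lra.
      - assert (E : 1 - x = - c) by (unfold c; rewrite Rabs_left; lra).
        assert (N2 : forall u, atan (u / - c) = - atan (u / c)).
        { intros u. rewrite <- atan_opp. f_equal. field. lra. }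
        rewrite E, !N2. apply Rabs_le. lra. }
    unfold Rdiv in HI. unfold Rdiv in I1, I2. 
    assert (16 * m * / Y <= 32 * m * / Y). { apply Rmult_le_compat_r; [apply Rlt_le, Rinv_0_lt_compat; lra|lra]. }
    unfold Rdiv. lra.
Qed.

Lemma line_neq0 t : (1, t) <> RtoC 0.
Proof. intros E. injection E. lra. Qed.

Lemma line_ge1 t : 1 <= Cmod (1, t).
Proof. assert (H := Re_le_Cmod (1, t)). unfold Re in H; simpl in H. rewrite Rabs_R1 in H. exact H. Qed.

Lemma line_ge_abs t : Rabs t <= Cmod (1, t).
Proof. apply (Im_le_Cmod (1, t)). Qed.

Lemma Cpow_cder m z : cder (fun z => Cpow z (S m)) z (RtoC (INR (S m)) * Cpow z m)%C.
Proof.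
  induction m.
  - simpl. eapply cder_eq. apply cder_mult; [apply cder_id|apply cder_const]. simpl. ring.
  - change (fun z : C => Cpow z (S (S m))) with (fun z : C => (z * Cpow z (S m))%C).
    eapply cder_eq. apply (cder_mult (fun z => z) (fun z => Cpow z (S m))); [apply cder_id|exact IHm].
    rewrite (S_INR (S m)), RtoC_plus. simpl. ring.
Qed.

Lemma PV_pow m : PVlim (fun s => / Cpow s (S (S m)))%C 0.
Proof.
  split.
  - intros t. apply ccont_inv; auto with holo. apply Cpow_neq0, line_neq0.
  - set (q := INR (S m)). assert (Hq : 1 <= q) by (unfold q; rewrite S_INR; assert (P := pos_INR m); lra).
    assert (Nq : RtoC q <> RtoC 0) by (apply RtoC_neq0; lra).
    set (H := fun s : C => (- / RtoC q * / Cpow s (S m))%C).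
    assert (HD : forall t, cder H (1, t) (/ Cpow (1%R, t) (S (S m)))%C).
    { intros t. assert (N := line_neq0 t). assert (N1 := Cpow_neq0 _ m N).
      unfold H. eapply cder_eq. apply cder_scal. apply cder_inv; [now apply Cpow_neq0|apply Cpow_cder].
      fold q. simpl. field. auto. }
    intros e He. exists (2 / e + 1). assert (P0 : 0 < 2 / e) by (apply Rdiv_lt_0_compat; lra). split; [lra|].
    intros Y HY.
    assert (SEG := CI_segment H (fun s => / Cpow s (S (S m)))%C 1 Ci (- Y) Y ltac:(lra)).
    assert (LE : forall t, (RtoC 1 + RtoC t * Ci)%C = (1, t)) by (intros t; symmetry; apply pairE).
    assert (S' : (Ci * CI (fun t => / Cpow (1%R, t) (S (S m))) (- Y) Y = H (1%R, Y) - H (1%R, (- Y)%R))%C).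
    { rewrite <- !LE. rewrite <- SEG.
      - f_equal. apply CI_ext; [lra|]. intros t _. now rewrite LE.
      - intros t _. rewrite LE. apply HD.
      - intros t _. rewrite LE. apply ccont_inv; auto with holo. apply Cpow_neq0, line_neq0. }
    replace (CI (fun t => / Cpow (1%R, t) (S (S m))) (- Y) Y - 0)%C with
      (- Ci * (Ci * CI (fun t => / Cpow (1%R, t) (S (S m))) (- Y) Y))%C.
    2: { transitivity (- (Ci * Ci) * CI (fun t => / Cpow (1%R, t) (S (S m))) (- Y) Y)%C. ring.
         replace (- (Ci * Ci))%C with (RtoC 1). ring. unfold Ci, RtoC, Cmult, Copp; simpl; f_equal; ring. }
    rewrite S', Cmod_mult, Cmod_opp, Cmod_Ci, Rmult_1_l.
    assert (B : forall t, Y <= Rabs t -> Cmod (H (1, t)) <= / Y).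
    { intros t Ht. unfold H. rewrite Cmod_mult, Cmod_opp. rewrite !Cmod_inv by (auto; apply Cpow_neq0, line_neq0).
      rewrite Cmod_R, Rabs_right, Cmod_pow by lra. simpl.
      assert (G := line_ge1 t). assert (G2 := line_ge_abs t).
      assert (P1 : 1 <= Cmod (1, t) ^ m) by (apply pow_R1_Rle; auto).
      rewrite <- (Rmult_1_l (/ Y)). apply Rmult_le_compat.
      - apply Rlt_le, Rinv_0_lt_compat; lra.
      - apply Rlt_le, Rinv_0_lt_compat; nra.
      - rewrite <- Rinv_1. apply Rinv_le_contravar; lra.
      - apply Rinv_le_contravar; [lra|]. nra. }
    assert (B1 := B Y ltac:(rewrite Rabs_right; lra)). assert (B2 := B (- Y) ltac:(rewrite Rabs_Ropp, Rabs_right; lra)).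
    eapply Rle_lt_trans; [apply Cmod_minus_le|]. apply Rle_lt_trans with (2 * / Y); [lra|].
    apply Rmult_lt_reg_r with Y; [lra|]. rewrite Rmult_assoc, Rinv_l by lra.
    replace (2 * 1) with (2 / e * e) by (field; lra). rewrite (Rmult_comm e). apply Rmult_lt_compat_r; lra.
Qed.

(** Equal to 2s/(s^2 - z^2): even in z and odd in s. Oddness in s is what makes the two sides of the
    strip contribute equally. *)
Definition Kz (z s : C) : C := (/ (s - z) + / (s + z))%C.

Lemma line_ne (z : C) t : Re z <> 1 -> (1, t) <> z.
Proof. intros H E. apply H. now rewrite <- E. Qed.

Lemma sum_neq0 (s z : C) : s <> (- z)%C -> (s + z)%C <> RtoC 0.
Proof. intros H E. apply H. replace s with ((s + z) + - z)%C by ring. rewrite E. ring. Qed.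

Lemma Kz_hol z s : s <> z -> s <> (- z)%C -> hol (Kz z) s.
Proof.
  intros H1 H2. unfold Kz. apply hol_plus; apply hol_inv; auto with holo. now apply Csub_neq0. now apply sum_neq0.
Qed.

Definition kap (z : C) : R := sgnline z + sgnline (- z).

Lemma Re_opp z : Re (- z) = - Re z.
Proof. reflexivity. Qed.

Lemma PV_K z : Re z <> 1 -> Re z <> - 1 -> PVlim (Kz z) (RtoC (kap z)).
Proof.
  intros H1 H2. assert (H3 : Re (- z) <> 1) by (rewrite Re_opp; lra).
  assert (H := PV_plus _ _ _ _ (PV_inv z H1) (PV_inv (- z)%C H3)).
  unfold kap. rewrite RtoC_plus. revert H. apply PV_ext.
  - intros t. apply hol_ccont, Kz_hol; now apply line_ne.
  - intros t. unfold Kz. do 2 f_equal. ring.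
Qed.

Lemma kap_in z : - 1 < Re z < 1 -> kap z = 2 * PI.
Proof. intros H. unfold kap, sgnline. rewrite Re_opp. destruct Rlt_dec, Rlt_dec; lra. Qed.

Lemma kap_out z : 1 < Re z -> kap z = 0.
Proof. intros H. unfold kap, sgnline. rewrite Re_opp. destruct Rlt_dec, Rlt_dec; lra. Qed.

Lemma PV_inv0 : PVlim (fun s => / s)%C (RtoC PI).
Proof.
  assert (H := PV_inv 0 ltac:(simpl; lra)). unfold sgnline in H. simpl in H. destruct (Rlt_dec 0 1); [|lra].
  revert H. apply PV_ext.
  - intros t. apply ccont_inv; auto with holo. apply line_neq0.
  - intros t. f_equal. ring.
Qed.

(** Recursion on the exponent through [Kz]/s^2 = ([Kz] - 2/s)/z^2. At the start 2/s has principal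
    value 2 pi; afterwards the subtracted powers contribute zero by [PV_pow]. *)
Lemma PV_powK z j : Re z <> 1 -> Re z <> - 1 -> z <> RtoC 0 ->
  PVlim (fun s => / Cpow s (2 * S j) * Kz z s)%C (/ Cpow z (2 * S j) * RtoC (kap z - 2 * PI))%C.
Proof.
  intros H1 H2 Hz. assert (H3 : Re (- z) <> 1) by (rewrite Re_opp; lra).
  assert (CC : forall j t, ccont (fun s => / Cpow s (2 * S j) * Kz z s)%C (1, t)).
  { intros i t. apply ccont_mult. apply ccont_inv; auto with holo. apply Cpow_neq0, line_neq0.
    apply hol_ccont, Kz_hol; now apply line_ne. }
  assert (NN : forall t, ((1, t) - z)%C <> RtoC 0 /\ ((1, t) + z)%C <> RtoC 0 /\ (1, t) <> RtoC 0).
  { intros t. split; [apply Csub_neq0; now apply line_ne|]. split; [apply sum_neq0; now apply line_ne|apply line_neq0]. }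
  induction j.
  - assert (H := PV_scal (/ (z * z))%C _ _ (PV_minus _ _ _ _ (PV_K z H1 H2) (PV_scal (RtoC 2) _ _ PV_inv0))).
    apply (PV_conv _ _ _ _ H); auto.
    + intros t. destruct (NN t) as [N1 [N2 N3]]. unfold Kz. simpl. field. auto.
    + simpl. rewrite RtoC_minus, RtoC_mult. field. auto.
  - assert (E1 : (2 * S (S j))%nat = S (S (S (S (2 * j))))) by lia.
    assert (E2 : (2 * S j)%nat = S (S (2 * j))) by lia.
    assert (H := PV_scal (/ (z * z))%C _ _ (PV_minus _ _ _ _ IHj (PV_scal (RtoC 2) _ _ (PV_pow (S (2 * j)))))).
    apply (PV_conv _ _ _ _ H); auto.
    + intros t. destruct (NN t) as [N1 [N2 N3]]. rewrite E1, E2. unfold Kz.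
      assert (NP := Cpow_neq0 _ (2 * j) N3). simpl. simpl in NP. field. auto.
    + rewrite E1, E2. assert (NP := Cpow_neq0 _ (2 * j) Hz). simpl. simpl in NP. field. auto.
Qed.

Lemma PV_powK_in z j : - 1 < Re z < 1 -> PVlim (fun s => / Cpow s (2 * S j) * Kz z s)%C 0.
Proof.
  intros H. destruct (Ceq_dec z 0) as [->|N].
  - assert (P := PV_scal (RtoC 2) _ _ (PV_pow (S (2 * j)))). rewrite Cmult_0_r in P. revert P. apply PV_ext.
    + intros t. apply ccont_mult. apply ccont_inv; auto with holo. apply Cpow_neq0, line_neq0.
      apply hol_ccont, Kz_hol; apply line_ne; simpl; lra.
    + intros t. replace (2 * S j)%nat with (S (S (2 * j))) by lia. assert (N := line_neq0 t).
      assert (NP := Cpow_neq0 _ (2 * j) N). unfold Kz. simpl. simpl in NP.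
      unfold Cminus. rewrite Copp_0, Cplus_0_r. set (s := (1, t) : C) in *. field. auto.
  - eapply PV_eq. apply PV_powK; auto; lra. rewrite kap_in by auto. rewrite Rminus_eq_0. ring.
Qed.

Lemma PV_powK_out z j : 1 < Re z -> PVlim (fun s => / Cpow s (2 * S j) * Kz z s)%C (/ Cpow z (2 * S j) * RtoC (- (2 * PI)))%C.
Proof.
  intros H. eapply PV_eq. apply PV_powK; try lra. intros ->. simpl in H. lra.
  rewrite kap_out by auto. do 2 f_equal. ring.
Qed.

Lemma CI_reflect_odd k l Y : 0 <= Y -> (forall t, - Y <= t <= Y -> rcont k t) ->
  (forall t, - Y < t < Y -> l t = (- k (- t)%R)%C) -> CI l (- Y) Y = (- CI k (- Y) Y)%C.
Proof.
  intros HY Hk E. rewrite (CI_ext l (fun t => - k (- t)%R)%C) by (auto; lra).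
  apply CI_unique. assert (H := is_CI k (- Y) Y ltac:(lra) Hk).
  apply (is_RInt_swap (V := C_R_NormedModule)) in H. rewrite <- (Ropp_involutive Y) in H at 1.
  apply (is_RInt_comp_opp (V := C_R_NormedModule)) in H. exact H.
Qed.

(** * Residue evaluation in the strip |Re s| < 1 *)

Section Contour.
Variables (f : C -> C) (n : nat) (lam : R).
Hypothesis Hf : forall z, hol f z.
Hypothesis Hev : forall z, f (- z)%C = f z.
Hypothesis Hn : (2 <= n)%nat.
Hypothesis Hlam : 400 <= lam.
Hypothesis Hflam : f (RtoC lam) <> RtoC 0.
Hypothesis Hgr : forall A, exists K, 0 < K /\ forall u, 0 <= Re u <= A -> 4 <= Rabs (Im u) -> Cmod (f u) <= K * Cmod u ^ 3.

Local Notation Q := (Qf f n lam).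
Local Notation D := (f (RtoC lam)).

(** The Taylor polynomial written with its even terms only, as its coefficients of odd degree
    vanish. After division by s^(2n) it is a sum of even negative powers, the shape [PV_powK]
    handles. *)
Fixpoint ep (m : nat) (u : C) : C :=
  match m with O => RtoC 0 | S k => (ep k u + dq f 0 (2 * k) 0 * Cpow u (2 * k))%C end.

Lemma taylor_ep m u : (1 <= m)%nat -> taylor_poly f (2 * m - 1) u = ep m u.
Proof.
  intros Hm. induction m; [lia|]. destruct m.
  - simpl ep. rewrite Cplus_0_l. change (2 * 1 - 1)%nat with 1%nat. unfold taylor_poly. rewrite sum_Sn, sum_O.
    rewrite !C_derive_n_coef by auto. destruct (dq_even f 0 Hf Hev) as [_ E]. change (S (2 * 0)) with 1%nat in E. rewrite E.
    change (dq f 0 0 0 * Cpow u 0 + 0 * Cpow u 1 = dq f 0 0 0 * Cpow u 0)%C. ring.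
  - specialize (IHm ltac:(lia)). change (ep (S (S m)) u) with (ep (S m) u + dq f 0 (2 * S m) 0 * Cpow u (2 * S m))%C.
    rewrite <- IHm. replace (2 * S (S m) - 1)%nat with (S (S (2 * S m - 1))) by lia.
    unfold taylor_poly. rewrite !sum_Sn. rewrite !C_derive_n_coef by auto.
    replace (S (2 * S m - 1)) with (2 * S m)%nat by lia.
    destruct (dq_even f (S m) Hf Hev) as [_ E]. rewrite E.
    match goal with |- plus (plus ?a ?b) (?c * ?d)%C = _ => change (a + b + c * d = a + b)%C end.
    rewrite Cmult_0_l. apply Cplus_0_r.
Qed.

Lemma f_ep u : f u = (ep n u + Cpow u (2 * n) * dq f 0 (2 * n) u)%C.
Proof.
  rewrite <- taylor_ep by lia. assert (E := taylor_remainder f (2 * n - 1) u Hf).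
  replace (S (2 * n - 1)) with (2 * n)%nat in E by lia. exact E.
Qed.

(** The Taylor remainder (f - T)(lam s)/(f(lam) s^(2n)), written through [dq] so that it is visibly
    entire, also at 0. *)
Definition Rm (s : C) : C := (RtoC lam ^ (2 * n) / D * dq f 0 (2 * n) (RtoC lam * s))%C.

Lemma lam_s_pow s k : Cpow (RtoC lam * s) k = (Cpow (RtoC lam) k * Cpow s k)%C.
Proof. apply Cpow_mult_l. Qed.

Lemma Q_split s : s <> RtoC 0 -> Q s = (Rm s + ep n (RtoC lam * s) / (D * Cpow s (2 * n)))%C.
Proof.
  intros Hs. unfold Qf, Rm. rewrite (f_ep (RtoC lam * s)) at 1. rewrite lam_s_pow.
  assert (N := Cpow_neq0 s (2 * n) Hs). field. auto.
Qed.

Lemma Rm_hol s : hol Rm s.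
Proof.
  unfold Rm. apply hol_scal. apply (hol_comp (dq f 0 (2 * n)) (fun s => RtoC lam * s)%C); auto with holo.
  now apply dq_hol.
Qed.

Lemma Rm_even s : Rm (- s)%C = Rm s.
Proof.
  unfold Rm. f_equal. replace (RtoC lam * - s)%C with (- (RtoC lam * s))%C by ring. now apply dq_even.
Qed.

(** [A] prescribes the principal values of the even powers against [Kz]. The two final clauses serve
    z in the strip, where all of them vanish, and z to its right, where they are multiples of
    z^(-2j). *)
Lemma PV_ep z (A : nat -> C) : Re z <> 1 -> Re z <> - 1 ->
  (forall j, PVlim (fun s => / Cpow s (2 * S j) * Kz z s)%C (A (S j))) ->
  forall m, (m <= n)%nat -> exists l, PVlim (fun s => ep m (RtoC lam * s) / (D * Cpow s (2 * n)) * Kz z s)%C l /\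
    ((forall j, A (S j) = RtoC 0) -> l = RtoC 0) /\
    (forall c, z <> RtoC 0 -> (forall j, A (S j) = (/ Cpow z (2 * S j) * c)%C) -> l = (ep m (RtoC lam * z) / (D * Cpow z (2 * n)) * c)%C).
Proof.
  intros H1 H2 HA.
  assert (CK : forall t, ccont (Kz z) (1, t)).
  { intros t. apply hol_ccont, Kz_hol; apply line_ne; auto. rewrite Re_opp. lra. }
  assert (Cep : forall m u, ccont (ep m) u).
  { induction m; intros u; simpl; auto with holo. }
  assert (CC : forall m t, ccont (fun s => ep m (RtoC lam * s) / (D * Cpow s (2 * n)) * Kz z s)%C (1, t)).
  { intros m t. apply ccont_mult; auto. apply ccont_div.
    - apply Cmult_neq_0; auto. apply Cpow_neq0, line_neq0.
    - apply (ccont_comp (ep m) (fun s => RtoC lam * s)%C); auto with holo.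
    - auto with holo. }
  induction m; intros Hm.
  - exists (RtoC 0). split.
    + assert (P := PV_scal 0 _ _ (HA 0%nat)). rewrite Cmult_0_l in P. revert P. apply PV_ext; auto.
      intros t. simpl ep. unfold Cdiv. ring.
    + split; auto. intros c _ _. simpl ep. unfold Cdiv. ring.
  - destruct (IHm ltac:(lia)) as [l [P1 [P2 P3]]].
    assert (Ej : exists j, n = (m + S j)%nat) by (exists (n - m - 1)%nat; lia). destruct Ej as [j Ej].
    set (co := (dq f 0 (2 * m) 0 * Cpow (RtoC lam) (2 * m) / D)%C).
    exists (l + co * A (S j))%C.
    assert (Epow : forall s, s <> RtoC 0 -> (dq f 0 (2 * m) 0 * Cpow (RtoC lam * s) (2 * m) / (D * Cpow s (2 * n)))%C = (co * / Cpow s (2 * S j))%C).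
    { intros s Hs. rewrite lam_s_pow. unfold co. replace (2 * n)%nat with (2 * m + 2 * S j)%nat by lia.
      rewrite Cpow_add_r. assert (N1 := Cpow_neq0 s (2 * m) Hs). assert (N2 := Cpow_neq0 s (2 * S j) Hs). field. auto. }
    split; [|split].
    + assert (P := PV_plus _ _ _ _ P1 (PV_scal co _ _ (HA j))). revert P. apply PV_ext; auto.
      intros t. change (ep (S m) (RtoC lam * (1%R, t))) with (ep m (RtoC lam * (1%R, t)) + dq f 0 (2 * m) 0 * Cpow (RtoC lam * (1%R, t)) (2 * m))%C.
      assert (E := Epow (1, t) (line_neq0 t)).
      replace ((ep m (RtoC lam * (1%R, t)) + dq f 0 (2 * m) 0 * Cpow (RtoC lam * (1%R, t)) (2 * m)) / (D * Cpow (1%R, t) (2 * n)))%C with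
        (ep m (RtoC lam * (1%R, t)) / (D * Cpow (1%R, t) (2 * n)) + dq f 0 (2 * m) 0 * Cpow (RtoC lam * (1%R, t)) (2 * m) / (D * Cpow (1%R, t) (2 * n)))%C by (unfold Cdiv; ring).
      rewrite E. ring.
    + intros H0. rewrite (P2 H0), H0. ring.
    + intros c Hz Hc. rewrite (P3 c Hz Hc), Hc.
      change (ep (S m) (RtoC lam * z)) with (ep m (RtoC lam * z) + dq f 0 (2 * m) 0 * Cpow (RtoC lam * z) (2 * m))%C.
      assert (E := Epow z Hz).
      replace ((ep m (RtoC lam * z) + dq f 0 (2 * m) 0 * Cpow (RtoC lam * z) (2 * m)) / (D * Cpow z (2 * n)))%C with
        (ep m (RtoC lam * z) / (D * Cpow z (2 * n)) + dq f 0 (2 * m) 0 * Cpow (RtoC lam * z) (2 * m) / (D * Cpow z (2 * n)))%C by (unfold Cdiv; ring).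
      rewrite E. ring.
Qed.

(** For Re s >= 0, [Rm] is [Q] minus the polynomial part. The cubic growth of f is absorbed by
    |s|^(2n), since n >= 2; evenness of [Rm] covers Re s < 0. *)
Lemma Rm_bounded : exists M, 0 < M /\ forall s, - 1 <= Re s <= 1 -> 1 <= Rabs (Im s) -> Cmod (Rm s) <= M.
Proof.
  destruct (Hgr lam) as [K [HK B]].
  assert (PD : 0 < Cmod D) by now apply Cmod_gt_0.
  assert (EB : forall m, (m <= n)%nat -> exists M, 0 <= M /\ forall s, 1 <= Cmod s -> Cmod (ep m (RtoC lam * s)) <= M * Cmod s ^ (2 * n)).
  { induction m; intros Hm.
    - exists 0. split; [lra|]. intros s Hs. simpl ep. rewrite Cmod_0. lra.
    - destruct (IHm ltac:(lia)) as [M [HM BM]]. set (co := Cmod (dq f 0 (2 * m) 0) * lam ^ (2 * m)).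
      assert (Hco : 0 <= co) by (apply Rmult_le_pos; [apply Cmod_ge_0|apply pow_le; lra]).
      exists (M + co). split; [lra|]. intros s Hs.
      change (ep (S m) (RtoC lam * s)) with (ep m (RtoC lam * s) + dq f 0 (2 * m) 0 * Cpow (RtoC lam * s) (2 * m))%C.
      eapply Rle_trans; [apply Cmod_triangle|]. rewrite Rmult_plus_distr_r. apply Rplus_le_compat; auto.
      rewrite Cmod_mult, lam_s_pow, Cmod_mult, !Cmod_pow, Cmod_R, Rabs_right by lra. unfold co.
      rewrite <- Rmult_assoc. apply Rmult_le_compat_l; auto. apply Rle_pow; auto. lia. }
  destruct (EB n (Nat.le_refl n)) as [M [HM BM]].
  set (iD := / Cmod D). assert (HiD : 0 < iD) by now apply Rinv_0_lt_compat.
  exists (K * lam ^ 3 * iD + M * iD + 1). split.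
  { assert (0 < lam ^ 3) by (apply pow_lt; lra). assert (0 <= M * iD) by (apply Rmult_le_pos; lra).
    assert (0 < K * lam ^ 3 * iD) by (apply Rmult_lt_0_compat; auto; apply Rmult_lt_0_compat; auto). lra. }
  assert (Main : forall s, 0 <= Re s <= 1 -> 1 <= Rabs (Im s) -> Cmod (Rm s) <= K * lam ^ 3 * iD + M * iD + 1).
  { intros s Hs Ht. assert (H1 : 1 <= Cmod s) by (eapply Rle_trans; [exact Ht|apply Im_le_Cmod]).
    assert (Ns : s <> RtoC 0) by (apply Cmod_neq0; lra).
    assert (E := Q_split s Ns). assert (E2 : Rm s = (Q s - ep n (RtoC lam * s) / (D * Cpow s (2 * n)))%C) by (rewrite E; ring).
    rewrite E2. eapply Rle_trans; [apply Cmod_minus_le|].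
    assert (PN := Cpow_neq0 s (2 * n) Ns). assert (ND : (D * Cpow s (2 * n))%C <> RtoC 0) by now apply Cmult_neq_0.
    unfold Qf. rewrite !Cmod_div by auto. rewrite !Cmod_mult, Cmod_pow.
    set (p := Cmod s ^ (2 * n)). assert (Pp : 0 < p) by (apply pow_lt; lra).
    assert (B1 : Cmod (f (RtoC lam * s)) <= K * lam ^ 3 * p).
    { assert (R1 : Re (RtoC lam * s) = lam * Re s) by (destruct s; unfold Re; simpl; ring).
      assert (I1 : Im (RtoC lam * s) = lam * Im s) by (destruct s; unfold Im; simpl; ring).
      eapply Rle_trans; [apply B|].
      - rewrite R1. nra.
      - rewrite I1, Rabs_mult, Rabs_right by lra. nra.
      - rewrite Cmod_RtoC_mult, Rabs_right, Rpow_mult_distr by lra. rewrite <- Rmult_assoc.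
        apply Rmult_le_compat_l. apply Rmult_le_pos; [lra|apply pow_le; lra]. apply Rle_pow; auto. lia. }
    assert (B2 := BM s H1). fold p in B2.
    assert (X1 : Cmod (f (RtoC lam * s)) / (Cmod D * p) <= K * lam ^ 3 * iD).
    { apply Rmult_le_reg_r with (Cmod D * p); [now apply Rmult_lt_0_compat|]. unfold Rdiv. rewrite Rmult_assoc, Rinv_l, Rmult_1_r.
      replace (K * lam ^ 3 * iD * (Cmod D * p)) with (K * lam ^ 3 * p) by (unfold iD; field; lra). exact B1.
      apply Rmult_integral_contrapositive; split; lra. }
    assert (X2 : Cmod (ep n (RtoC lam * s)) / (Cmod D * p) <= M * iD).
    { apply Rmult_le_reg_r with (Cmod D * p); [now apply Rmult_lt_0_compat|]. unfold Rdiv. rewrite Rmult_assoc, Rinv_l, Rmult_1_r.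
      replace (M * iD * (Cmod D * p)) with (M * p) by (unfold iD; field; lra). exact B2.
      apply Rmult_integral_contrapositive; split; lra. }
    lra. }
  intros s Hs Ht. destruct (Rle_lt_dec 0 (Re s)) as [L|L]; [apply Main; auto; lra|].
  rewrite <- Rm_even. apply Main. rewrite Re_opp; lra. replace (Im (- s)) with (- Im s) by reflexivity. now rewrite Rabs_Ropp.
Qed.

Lemma Kz_odd z s : s <> z -> s <> (- z)%C -> Kz z (- s)%C = (- Kz z s)%C.
Proof.
  intros H1 H2. unfold Kz. assert (N1 := Csub_neq0 _ _ H1). assert (N2 := sum_neq0 _ _ H2).

  replace (- s - z)%C with (- (s + z))%C by ring. replace (- s + z)%C with (- (s - z))%C by ring. field. auto.
Qed.

(* An odd integrand without singularities in the strip contributes nothing. *)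
Lemma PV_strip z c : Re z <> 1 -> Re z <> - 1 ->
  (forall Y, 0 < Y -> exists V, (forall s, hol V s \/ ~ inR (-1) 1 (- Y) Y s) /\
     forall s, s <> z -> s <> (- z)%C -> V s = ((Rm s - c) * Kz z s)%C) ->
  PVlim (fun s => (Rm s - c) * Kz z s)%C 0.
Proof.
  intros H1 H2 HV. set (k := fun s : C => ((Rm s - c) * Kz z s)%C).
  assert (CK : forall s, s <> z -> s <> (- z)%C -> ccont k s).
  { intros s N1 N2. unfold k. apply ccont_mult. apply ccont_minus; auto with holo. apply hol_ccont, Rm_hol.
    apply hol_ccont, Kz_hol; auto. }
  assert (H3 : Re (- z) <> 1) by (rewrite Re_opp; lra).
  split; [intros t; apply CK; now apply line_ne|].
  destruct Rm_bounded as [M [HM BM]].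
  intros e He. set (m := Cmod z). assert (Hm : 0 <= m) by apply Cmod_ge_0.
  set (W := (M + Cmod c) * 2). assert (HW : 0 < W) by (unfold W; assert (P := Cmod_ge_0 c); lra).
  exists (m + 1 + 2 * W / e). assert (P0 : 0 < 2 * W / e) by (apply Rdiv_lt_0_compat; lra). split; [lra|].
  intros Y HY.
  assert (Im_z : Rabs (Im z) <= m) by apply Im_le_Cmod.
  assert (NB : forall s, onR (-1) 1 (- Y) Y s -> s <> z /\ s <> (- z)%C).
  { apply Rabs_le_between in Im_z.
    intros s [_ Hs]. split; intros ->; rewrite ?Re_opp in Hs; try replace (Im (- z)) with (- Im z) in Hs by reflexivity;
    destruct Hs as [E|[E|[E|E]]]; lra. }
  destruct (HV Y ltac:(lra)) as [V [HV1 HV2]].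
  assert (R0 : Rect k (-1) 1 (- Y) Y = RtoC 0).
  { rewrite (Rect_ext k V); try lra.
    - apply goursat; try lra. intros s Hs. destruct (HV1 s); [auto|contradiction].
    - intros s Hs. destruct (NB s Hs). symmetry. now apply HV2. }
  assert (KO : forall s, s <> z -> s <> (- z)%C -> k (- s)%C = (- k s)%C).
  { intros s N1 N2. unfold k. rewrite Rm_even, Kz_odd by auto. ring. }
  (* By oddness both vertical sides contribute the same, so the vanishing boundary integral
     expresses the right side through the horizontal sides, which tend to zero. *)
  assert (VS : vseg k (-1) (- Y) Y = (- vseg k 1 (- Y) Y)%C).
  { unfold vseg. apply CI_reflect_odd; [lra| |].
    - intros t Ht. apply rcont_v, CK; now apply line_ne.
    - intros t Ht. rewrite <- KO by (now apply line_ne). f_equal. unfold Copp; simpl. f_equal. ring. }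
  assert (HB : forall Y', Rabs Y' = Y -> Cmod (hseg k (-1) 1 Y') < e).
  { intros Y' HY'.
    assert (HG : forall t, -1 <= t <= 1 -> (Y - m <= Cmod ((t, Y') - z)) /\ (Y - m <= Cmod ((t, Y') + z))).
    { intros t Ht. assert (A : Y <= Cmod (t, Y')) by (rewrite <- HY'; apply (Im_le_Cmod (t, Y'))). split.
      - assert (T := Cmod_rev (t, Y') z). fold m in T. lra.
      - assert (T := Cmod_rev (t, Y') (- z)%C). rewrite Cmod_opp in T. fold m in T.
        replace ((t, Y') - - z)%C with ((t, Y') + z)%C in T by ring. lra. }
    assert (NN : forall t, -1 <= t <= 1 -> (t, Y') <> z /\ (t, Y') <> (- z)%C).
    { intros t Ht. destruct (HG t Ht) as [G1 G2]. split; intros E.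
      - rewrite E, Cmod_self in G1. lra.
      - rewrite E in G2. replace (- z + z)%C with (RtoC 0) in G2 by ring. rewrite Cmod_0 in G2. lra. }
    apply Rle_lt_trans with (W / (Y - m) * (1 - -1)).
    - unfold hseg. apply CI_bound; [lra| |].
      + intros t Ht. destruct (NN t Ht). apply rcont_h. now apply CK.
      + intros t Ht. destruct (HG t Ht) as [G1 G2]. unfold k, Kz. rewrite Cmod_mult.
        replace (W / (Y - m)) with ((M + Cmod c) * (/ (Y - m) + / (Y - m))) by (unfold W; field; lra).
        apply Rmult_le_compat; auto using Cmod_ge_0.
        * eapply Rle_trans; [apply Cmod_minus_le|]. assert (B := BM (t, Y')). unfold Re, Im in B; simpl in B. specialize (B Ht ltac:(lra)). lra.
        * eapply Rle_trans; [apply Cmod_triangle|]. apply Rplus_le_compat; apply Cinv_gap; auto; lra.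
    - apply Rmult_lt_reg_r with (Y - m); [lra|]. replace (W / (Y - m) * (1 - -1) * (Y - m)) with (2 * W / e * e) by (field; lra).
      rewrite (Rmult_comm e). apply Rmult_lt_compat_r; lra. }
  unfold Rect in R0. rewrite VS in R0.
  assert (E : (Ci * vseg k 1 (- Y) Y)%C = (RtoC (/ 2) * (hseg k (-1) 1 Y - hseg k (-1) 1 (- Y)))%C).
  {
    replace (Ci * vseg k 1 (- Y) Y)%C with (RtoC (/ 2) * ((hseg k (-1) 1 (- Y) + Ci * vseg k 1 (- Y) Y - hseg k (-1) 1 Y - Ci * - vseg k 1 (- Y) Y) + hseg k (-1) 1 Y - hseg k (-1) 1 (- Y)))%C.
    - rewrite R0. ring.
    - rewrite RtoC_inv by lra. field. }
  fold (vseg k 1 (- Y) Y). replace (vseg k 1 (- Y) Y - 0)%C with (vseg k 1 (- Y) Y) by ring.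
  assert (EC : Cmod (vseg k 1 (- Y) Y) = Cmod (Ci * vseg k 1 (- Y) Y)) by (rewrite Cmod_mult, Cmod_Ci, Rmult_1_l; reflexivity).
  rewrite EC, E, Cmod_RtoC_mult, Rabs_right by lra.
  assert (B1 := HB Y ltac:(rewrite Rabs_right; lra)). assert (B2 := HB (- Y) ltac:(rewrite Rabs_Ropp, Rabs_right; lra)).
  assert (T := Cmod_minus_le (hseg k (-1) 1 Y) (hseg k (-1) 1 (- Y))). lra.
Qed.

(** Subtracting [Rm z] makes the integrand holomorphic in the strip, so only the constant [Rm z]
    times the principal value of [Kz] remains; the polynomial part contributes zero. *)
Theorem PV_Q_in z : - 1 < Re z < 1 -> PVlim (fun s => Q s * Kz z s)%C (RtoC (2 * PI) * Rm z)%C.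
Proof.
  intros Hz.
  assert (Hzo : (- z)%C <> z \/ z = RtoC 0).
  { destruct (Ceq_dec z 0); auto. left. intros E. apply n0.
    replace z with (RtoC (/ 2) * (z - - z))%C. rewrite E. ring. rewrite RtoC_inv by lra. field. }
  assert (HR : forall s, hol Rm s) by apply Rm_hol.
  assert (P1 : PVlim (fun s => (Rm s - Rm z) * Kz z s)%C 0).
  { apply PV_strip; try lra. intros Y _.
    (* Two divisions remove both poles of the kernel. Evenness of [Rm] gives the zero at -z, and for
       z = 0 it gives a vanishing derivative. *)
    set (U := dquot (dquot Rm z) (- z)%C).
    assert (HU : forall s, hol U s).
    { assert (H1 : forall s, hol (dquot Rm z) s) by (intros s; apply dquot_hol; now apply entire_near).
      intros s. apply dquot_hol; now apply entire_near. }
    assert (Z0 : dquot Rm z (- z)%C = RtoC 0).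
    { destruct Hzo as [N| ->].
      - rewrite dquot_off by auto. rewrite Rm_even. unfold Cdiv. ring.
      - replace (- 0)%C with (RtoC 0) by ring. destruct (dquot_even_odd Rm HR Rm_even) as [E _]. exact E. }
    exists (fun s => RtoC 2 * s * U s)%C. split.
    - intros s. left. auto with holo.
    - intros s N1 N2. rewrite (dquot_eq Rm z s). rewrite (dquot_eq (dquot Rm z) (- z)%C s), Z0. fold U.
      unfold Kz. assert (M1 := Csub_neq0 _ _ N1). assert (M2 := sum_neq0 _ _ N2).
      field. auto. }
  assert (P2 := PV_scal (Rm z) _ _ (PV_K z ltac:(lra) ltac:(lra))). rewrite kap_in in P2 by auto.
  destruct (PV_ep z (fun _ => RtoC 0) ltac:(lra) ltac:(lra) (fun j => PV_powK_in z j Hz) n (Nat.le_refl n)) as [l [P3 [P4 _]]].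
  rewrite (P4 (fun _ => eq_refl)) in P3.
  assert (P := PV_plus _ _ _ _ (PV_plus _ _ _ _ P1 P2) P3).
  apply (PV_conv _ _ _ _ P).
  - intros t. apply ccont_mult.
    + apply hol_ccont, Qf_hol; auto. apply line_neq0.
    + apply hol_ccont, Kz_hol; apply line_ne; rewrite ?Re_opp; lra.
  - intros t. rewrite Q_split by apply line_neq0. ring.
  - ring.
Qed.

(** Now z and -z lie outside the strip, so the remainder part contributes zero and the polynomial
    part carries the whole value. *)
Theorem PV_Q_out z : 1 < Re z ->
  PVlim (fun s => Q s * Kz z s)%C (RtoC (- (2 * PI)) * (ep n (RtoC lam * z) / (D * Cpow z (2 * n))))%C.
Proof.
  intros Hz. assert (Nz : z <> RtoC 0) by (intros ->; simpl in Hz; lra).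
  assert (P1 : PVlim (fun s => (Rm s - 0) * Kz z s)%C 0).
  { apply PV_strip; try lra. intros Y _. exists (fun s => (Rm s - 0) * Kz z s)%C. split; [|auto].
    intros s. destruct (classic (inR (-1) 1 (- Y) Y s)) as [I|I]; [left|right; exact I].
    apply hol_mult; [apply hol_minus; auto with holo; apply Rm_hol|].
    apply Kz_hol; intros ->; unfold inR in I; rewrite ?Re_opp in I; lra. }
  destruct (PV_ep z (fun j => / Cpow z (2 * j) * RtoC (- (2 * PI)))%C ltac:(lra) ltac:(lra) (fun j => PV_powK_out z j Hz) n (Nat.le_refl n)) as [l [P3 [_ P4]]].
  rewrite (P4 (RtoC (- (2 * PI))) Nz (fun _ => eq_refl)) in P3.
  assert (P := PV_plus _ _ _ _ P1 P3).
  apply (PV_conv _ _ _ _ P).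
  - intros t. apply ccont_mult.
    + apply hol_ccont, Qf_hol; auto. apply line_neq0.
    + apply hol_ccont, Kz_hol; apply line_ne; rewrite ?Re_opp; lra.
  - intros t. rewrite Q_split by apply line_neq0. ring.
  - ring.
Qed.
End Contour.

(** * Laplace's method *)

Lemma exp_quartic x : 0 <= x -> (1 + x) ^ 4 * exp (- (x / 4)) <= 65536.
Proof.
  intros Hx. rewrite exp_Ropp. assert (P := exp_pos (x / 4)).
  apply Rmult_le_reg_r with (exp (x / 4)); auto. rewrite Rmult_assoc, Rinv_l, Rmult_1_r by lra.
  replace (exp (x / 4)) with (exp (x / 16) ^ 4).
  2: { rewrite exp_pow. f_equal. simpl. field. }
  replace 65536 with (16 ^ 4) by ring. rewrite <- Rpow_mult_distr. apply pow_incr.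
  assert (T := exp_ineq1_le (x / 16)). lra.
Qed.

(* With x = n t^2, the weighted Gaussian is dominated by (1/n) / (1 + n t^2). *)
Lemma gauss_moment N t j : 0 < N -> (1 <= j <= 3)%nat ->
  (N * (t * t)) ^ j * exp (- (N * (t * t) / 4)) <= 65536 / (1 + N * (t * t)).
Proof.
  intros HN Hj. set (x := N * (t * t)). assert (Hx : 0 <= x) by (unfold x; assert (0 <= t * t) by nra; nra).
  assert (P := exp_pos (- (x / 4))).
  apply Rmult_le_reg_r with (1 + x); [lra|]. replace (65536 / (1 + x) * (1 + x)) with 65536 by (field; lra).
  eapply Rle_trans; [|apply (exp_quartic x Hx)].
  replace (x ^ j * exp (- (x / 4)) * (1 + x)) with (x ^ j * (1 + x) * exp (- (x / 4))) by ring.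
  apply Rmult_le_compat_r; [lra|].
  apply Rle_trans with ((1 + x) ^ j * (1 + x)).
  - apply Rmult_le_compat_r; [lra|]. apply pow_incr; lra.
  - replace ((1 + x) ^ j * (1 + x)) with ((1 + x) ^ (S j)) by (simpl; ring). apply Rle_pow; [lra|lia].
Qed.

Lemma RInt_lorentz N a b : 0 < N ->
  ex_RInt (fun t => / (1 + N * (t * t))) a b /\ RInt (fun t => / (1 + N * (t * t))) a b <= 4 / sqrt N.
Proof.
  intros HN. assert (Ps : 0 < sqrt N) by now apply sqrt_lt_R0.
  assert (Es : sqrt N * sqrt N = N) by (apply sqrt_sqrt; lra).
  assert (Hd : forall t, 1 + N * (t * t) > 0) by (intros t; assert (0 <= t * t) by nra; nra).
  assert (H : is_RInt (fun t => / (1 + N * (t * t))) a b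
     (minus (atan (sqrt N * b) / sqrt N) (atan (sqrt N * a) / sqrt N))).
  { apply (is_RInt_derive (V := R_CompleteNormedModule) (fun t => atan (sqrt N * t) / sqrt N)).
    + intros t _. specialize (Hd t). set (s := sqrt N) in *. rewrite <- Es in Hd |- *.
      auto_derive; auto. unfold Rsqr. field. split; [lra|]. nra.
    + intros t _. apply is_derive_cont_ex. specialize (Hd t). auto_derive. lra. }
  split; [eexists; exact H|].
  rewrite (is_RInt_unique _ _ _ _ H). unfold minus, plus, opp; simpl.
  assert (A := atan_bound (sqrt N * b)). assert (A' := atan_bound (sqrt N * a)). assert (P := PI_4).
  unfold Rdiv. rewrite <- Ropp_mult_distr_l_reverse, <- Rmult_plus_distr_r.
  apply Rmult_le_compat_r; [apply Rlt_le, Rinv_0_lt_compat; auto|lra].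
Qed.

(** Source of the rate n^(-3/2): integrands bounded by 1/n times this Lorentzian gain a further
    1/sqrt(n) from its integral. *)
Lemma CI_lorentz k B N a b : 0 < N -> 0 <= B -> a <= b -> (forall t, a <= t <= b -> rcont k t) ->
  (forall t, a <= t <= b -> Cmod (k t) <= B * / (1 + N * (t * t))) -> Cmod (CI k a b) <= B * (4 / sqrt N).
Proof.
  intros HN HB Hab Hk Hb. destruct (RInt_lorentz N a b HN) as [EX L].
  apply Rle_trans with (RInt (fun t => scal B (/ (1 + N * (t * t)))) a b).
  - apply CI_norm; auto. apply (ex_RInt_scal (V := R_NormedModule)); auto.
  - rewrite (RInt_scal (V := R_CompleteNormedModule)) by auto. apply Rmult_le_compat_l; auto.
Qed.

Lemma CI_odd_zero k T : 0 <= T -> (forall t, - T <= t <= T -> rcont k t) ->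
  (forall t, k (- t)%R = (- k t)%C) -> CI k (- T) T = RtoC 0.
Proof.
  intros HT Hk Ho. assert (E := CI_reflect_odd k k T HT Hk).
  assert (E2 : CI k (- T) T = (- CI k (- T) T)%C).
  { apply E. intros t _. rewrite Ho. ring. }

  replace (CI k (- T) T) with (RtoC (/ 2) * (CI k (- T) T + CI k (- T) T))%C by (rewrite RtoC_inv by lra; field).
  rewrite E2 at 2. ring.
Qed.

Definition n32 (n : nat) : R := / (INR n * sqrt (INR n)).

Lemma gauss_integral b T : 0 < b -> 0 <= T ->
  Cmod (CI (fun t => RtoC (exp (- (b * (t * t))))) (- T) T - RtoC (sqrt (PI / b))) <= 2 / (hpi * sqrt b) * exp (- (b * (T * T))).
Proof.
  intros Hb HT. assert (Pb : 0 < sqrt b) by now apply sqrt_lt_R0.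
  assert (Es : sqrt b * sqrt b = b) by (apply sqrt_sqrt; lra). assert (Hp := hpi_pos).
  assert (SEG := CI_segment E0 (gauss 1) 0 (RtoC (sqrt b)) (- T) T ltac:(lra) ltac:(intros; apply E0_cder) ltac:(intros; apply ccont_gauss)).
  rewrite !Cplus_0_l in SEG.
  replace (RtoC (- T) * RtoC (sqrt b))%C with (- (RtoC T * RtoC (sqrt b)))%C in SEG by (rewrite RtoC_opp; ring).
  rewrite E0_odd, <- RtoC_mult in SEG.
  assert (EI : CI (fun t => gauss 1 (0 + RtoC t * RtoC (sqrt b))) (- T) T = CI (fun t => RtoC (exp (- (b * (t * t))))) (- T) T).
  { apply CI_ext; [lra|]. intros t _. rewrite Cplus_0_l. unfold gauss. rewrite <- !RtoC_mult, <- RtoC_opp, Cexp_RtoC. f_equal. f_equal. rewrite <- Es at 3. ring. }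
  rewrite EI in SEG. set (I := CI (fun t => RtoC (exp (- (b * (t * t))))) (- T) T) in *.
  assert (L := E0_real_lim (T * sqrt b) ltac:(apply Rmult_le_pos; lra)).
  assert (Nb : RtoC (sqrt b) <> RtoC 0) by (apply RtoC_neq0; lra).
  assert (Eq : (I - RtoC (sqrt (PI / b)))%C = (RtoC (2 / sqrt b) * (E0 (RtoC (T * sqrt b)) - RtoC hpi))%C).
  { replace I with (RtoC (sqrt b) * I / RtoC (sqrt b))%C by (field; auto). rewrite SEG.
    replace (sqrt (PI / b)) with (2 / sqrt b * hpi). rewrite (RtoC_mult (2 / sqrt b)), (RtoC_div 2) by lra. field. auto.
    unfold hpi. rewrite sqrt_div_alt by lra. field. lra. }
  rewrite Eq, Cmod_RtoC_mult, Rabs_right by (apply Rle_ge, Rlt_le, Rdiv_lt_0_compat; lra).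
  replace (2 / (hpi * sqrt b) * exp (- (b * (T * T)))) with (2 / sqrt b * (exp (- (b * (T * T))) / hpi)) by (field; lra).
  apply Rmult_le_compat_l; [apply Rlt_le, Rdiv_lt_0_compat; lra|].
  replace (b * (T * T)) with (T * sqrt b * (T * sqrt b)) by (rewrite <- Es at 3; ring). exact L.
Qed.

(** The interface between the phase and Laplace's method: decay along vertical lines relative to the
    axis, at most quadratic growth of the exponent on the axis, and the expansion of the exponent at
    the saddle. The cubic coefficient [c3] does not depend on t, so that its contribution is exactly
    odd. *)
Definition Qgood (C0 a : R) (n : nat) (Q : C -> C) : Prop :=
  1 <= C0 /\ 1 <= a <= 2 * C0 /\ (32 <= n)%nat /\ (forall s, s <> RtoC 0 -> hol Q s) /\
  (forall x y, 1 / 2 <= x -> Cmod (Q (x, y)) * (1 + (y / x) * (y / x)) ^ n <= (1 + 16 * (y * y)) * Cmod (Q (RtoC x))) /\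
  (forall x, Rabs (x - 1) <= 1 / 64 -> Cmod (Q (RtoC x)) <= exp (INR n * (C0 * ((x - 1) * (x - 1))))) /\
  (exists (c3 : C) (p4 : R -> C), Cmod c3 <= C0 /\ forall t, Rabs t <= 1 / 64 -> Cmod (p4 t) <= C0 /\
     Q (1, t) = Cexp (- (RtoC (INR n) * (RtoC (a / 2 * (t * t)) + c3 * RtoC (t * t * t) + RtoC (t * t * (t * t)) * p4 t)))).

Lemma INR32 n : (32 <= n)%nat -> 32 <= INR n.
Proof. intros H. replace 32 with (INR 32) by (simpl; ring). now apply le_INR. Qed.

(* Local expansion at the saddle: the odd cubic term is kept explicitly, since it integrates to zero. *)
Lemma Q_local C0 a n Q : Qgood C0 a n Q ->
  exists c3, Cmod c3 <= C0 /\ forall t, Rabs t <= / (64 * C0) ->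
    Cmod (Q (1, t)) <= exp (- (INR n * (t * t) / 4)) /\
    Cmod (Q (1, t) - RtoC (exp (- (INR n * a / 2 * (t * t)))) * (RtoC 1 - RtoC (INR n) * c3 * RtoC (t * t * t)))
      <= 65536 * (5 * (C0 * C0)) * (/ INR n * / (1 + INR n * (t * t))).
Proof.
  intros [HC [Ha [Hn [_ [_ [_ [c3 [p4 [H3 H4]]]]]]]]]. exists c3. split; auto.
  assert (N := INR32 n Hn). set (nn := INR n) in *.
  intros t Ht.
  assert (I64 : / (64 * C0) <= 1 / 64).
  { replace (1 / 64) with (/ 64) by field. apply Rinv_le_contravar; lra. }
  destruct (H4 t ltac:(lra)) as [P4 E]. rewrite E. clear E.
  assert (At := Rabs_pos t). set (u := Rabs t) in *.
  assert (T2 : t * t = u * u) by (unfold u; rewrite <- Rabs_mult, Rabs_right; nra).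
  assert (HuC : C0 * u <= 1 / 64).
  { apply Rle_trans with (C0 * / (64 * C0)). apply Rmult_le_compat_l; lra. right; field; lra. }
  set (y := (- (RtoC nn * (c3 * RtoC (t * t * t) + RtoC (t * t * (t * t)) * p4 t)))%C).
  assert (Ey : Cexp (- (RtoC nn * (RtoC (a / 2 * (t * t)) + c3 * RtoC (t * t * t) + RtoC (t * t * (t * t)) * p4 t))) =
     (RtoC (exp (- (nn * a / 2 * (t * t)))) * Cexp y)%C).
  { rewrite <- Cexp_RtoC, <- Cexp_plus. f_equal. unfold y. rewrite RtoC_opp.
    replace (nn * a / 2 * (t * t)) with (nn * (a / 2 * (t * t))) by field. rewrite (RtoC_mult nn). ring. }
  rewrite Ey.
  assert (Au3 : Rabs (t * t * t) = u * u * u) by (unfold u; rewrite !Rabs_mult; ring).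
  assert (Au4 : Rabs (t * t * (t * t)) = u * u * (u * u)) by (unfold u; rewrite !Rabs_mult; ring).
  assert (U2 : 0 <= u * u) by nra. assert (U3 : 0 <= u * u * u) by nra.
  assert (By : Cmod y <= nn * (2 * C0 * (u * u * u))).
  { unfold y. rewrite Cmod_opp, Cmod_RtoC_mult, Rabs_right by lra. apply Rmult_le_compat_l; [lra|].
    eapply Rle_trans; [apply Cmod_triangle|]. rewrite (Cmod_mult c3), Cmod_RtoC_mult, Cmod_R, Au3, Au4.
    assert (u * u * (u * u) * Cmod (p4 t) <= u * u * u * C0).
    { apply Rmult_le_compat; auto using Cmod_ge_0. nra. assert (u <= 1) by lra. nra. }
    assert (Cmod c3 * (u * u * u) <= C0 * (u * u * u)) by (apply Rmult_le_compat_r; auto). lra. }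
  (* For |t| <= 1/(64 C0) the cubic and quartic terms take at most half of the Gaussian exponent,
     since a >= 1. *)
  assert (By2 : Cmod y <= nn * (u * u) / 4).
  { eapply Rle_trans; [exact By|]. replace (nn * (2 * C0 * (u * u * u))) with (nn * (u * u) * (2 * (C0 * u))) by ring.
    unfold Rdiv. apply Rmult_le_compat_l; [|lra]. apply Rmult_le_pos; lra. }
  assert (EX1 : exp (- (nn * a / 2 * (t * t))) * exp (Cmod y) <= exp (- (nn * (t * t) / 4))).
  { rewrite <- exp_plus. apply exp_le. rewrite T2.
    assert (nn * (u * u) * 1 <= nn * (u * u) * a) by (apply Rmult_le_compat_l; [apply Rmult_le_pos; lra|lra]). lra. }
  assert (PE := exp_pos (- (nn * a / 2 * (t * t)))). set (g := exp (- (nn * a / 2 * (t * t)))) in *.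
  assert (PY : 1 <= exp (Cmod y)) by (rewrite <- exp_0; apply exp_le, Cmod_ge_0).
  split.
  - rewrite Cmod_RtoC_mult, Rabs_right, Cmod_Cexp by lra.
    eapply Rle_trans; [|exact EX1]. apply Rmult_le_compat_l; [lra|]. apply Re_le_exp.
  - replace (RtoC g * Cexp y - RtoC g * (RtoC 1 - RtoC nn * c3 * RtoC (t * t * t)))%C with
      (RtoC g * ((Cexp y - 1 - y) + - (RtoC nn * (RtoC (t * t * (t * t)) * p4 t))))%C by (unfold y; ring).
    rewrite Cmod_RtoC_mult, Rabs_right by lra.
    assert (X1 : Cmod ((Cexp y - 1 - y) + - (RtoC nn * (RtoC (t * t * (t * t)) * p4 t))) <=
       (4 * (C0 * C0) * (nn * nn * (u * u * u * (u * u * u))) + C0 * (nn * (u * u * (u * u)))) * exp (Cmod y)).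
    { eapply Rle_trans; [apply Cmod_triangle|]. rewrite Rmult_plus_distr_r. apply Rplus_le_compat.
      - eapply Rle_trans; [apply Cexp_bound2|]. apply Rmult_le_compat_r; [lra|].
        replace (4 * (C0 * C0) * (nn * nn * (u * u * u * (u * u * u)))) with
          ((nn * (2 * C0 * (u * u * u))) * (nn * (2 * C0 * (u * u * u)))) by ring.
        apply Rmult_le_compat; auto using Cmod_ge_0.
      - rewrite Cmod_opp, !Cmod_RtoC_mult, Au4, Rabs_right by lra.
        assert (Z : nn * (u * u * (u * u) * Cmod (p4 t)) <= C0 * (nn * (u * u * (u * u)))).
        { replace (C0 * (nn * (u * u * (u * u)))) with (nn * (u * u * (u * u) * C0)) by ring.
          apply Rmult_le_compat_l; [lra|]. apply Rmult_le_compat_l; [nra|exact P4]. }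
        rewrite <- (Rmult_1_r (nn * (u * u * (u * u) * Cmod (p4 t)))). apply Rmult_le_compat; try lra.
        apply Rmult_le_pos; [lra|]. apply Rmult_le_pos; [nra|apply Cmod_ge_0]. }
    set (W := 4 * (C0 * C0) * (nn * nn * (u * u * u * (u * u * u))) + C0 * (nn * (u * u * (u * u)))) in *.
    assert (HW : 0 <= W).
    { unfold W. assert (0 <= C0 * C0) by nra. assert (0 <= nn * nn) by nra. assert (0 <= u * u * u * (u * u * u)) by nra.
      assert (0 <= u * u * (u * u)) by nra. apply Rplus_le_le_0_compat; repeat apply Rmult_le_pos; lra. }
    apply Rle_trans with (W * exp (- (nn * (t * t) / 4))).
    + apply Rle_trans with (g * (W * exp (Cmod y))); [apply Rmult_le_compat_l; lra|].
      replace (g * (W * exp (Cmod y))) with (W * (g * exp (Cmod y))) by ring. apply Rmult_le_compat_l; auto.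
    + assert (M3 := gauss_moment nn t 3 ltac:(lra) ltac:(lia)). assert (M2 := gauss_moment nn t 2 ltac:(lra) ltac:(lia)).
      rewrite T2 in *. set (G := exp (- (nn * (u * u) / 4))) in *. set (Lz := 65536 / (1 + nn * (u * u))) in *.
      assert (PL : 0 < Lz) by (unfold Lz; apply Rdiv_lt_0_compat; [lra|nra]).
      replace (W * G) with (4 * (C0 * C0) * / nn * ((nn * (u * u)) ^ 3 * G) + C0 * / nn * ((nn * (u * u)) ^ 2 * G)) by (unfold W; field; lra).
      replace (65536 * (5 * (C0 * C0)) * (/ nn * / (1 + nn * (u * u)))) with (4 * (C0 * C0) * / nn * Lz + C0 * C0 * / nn * Lz) by (unfold Lz; field; split; [nra|lra]).
      assert (In : 0 < / nn) by (apply Rinv_0_lt_compat; lra).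
      apply Rplus_le_compat.
      * apply Rmult_le_compat_l; auto. apply Rmult_le_pos; [nra|lra].
      * apply Rle_trans with (C0 * / nn * Lz). apply Rmult_le_compat_l; auto. apply Rmult_le_pos; lra.
        apply Rmult_le_compat_r; [lra|]. apply Rmult_le_compat_r; [lra|]. nra.
Qed.

Lemma n32_pos n : (1 <= n)%nat -> 0 < n32 n.
Proof.
  intros H. assert (P : 0 < INR n) by (apply lt_0_INR; lia). unfold n32. apply Rinv_0_lt_compat, Rmult_lt_0_compat; auto.
  now apply sqrt_lt_R0.
Qed.

Lemma n32_lorentz n B : (1 <= n)%nat -> B * / INR n * (4 / sqrt (INR n)) = 4 * B * n32 n.
Proof.
  intros H. assert (P : 0 < INR n) by (apply lt_0_INR; lia). assert (Q := sqrt_lt_R0 _ P). unfold n32. field. lra.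
Qed.

Lemma inv_sq_n32 n : (1 <= n)%nat -> / (INR n * INR n) <= n32 n.
Proof.
  intros H. assert (P : 1 <= INR n) by (change 1 with (INR 1); apply le_INR; lia).
  assert (Q : 0 < sqrt (INR n)) by (apply sqrt_lt_R0; lra).
  unfold n32. apply Rinv_le_contravar. apply Rmult_lt_0_compat; lra. apply Rmult_le_compat_l; [lra|].
  assert (E : sqrt (INR n) * sqrt (INR n) = INR n) by (apply sqrt_sqrt; lra).
  nra.
Qed.

Lemma exp_decay x : 0 < x -> exp (- x) <= 4 / (x * x).
Proof.
  intros Hx. rewrite exp_Ropp. replace (4 / (x * x)) with (/ (x / 2 * (x / 2))) by (field; lra).
  apply Rinv_le_contravar; [nra|]. replace x with (x / 2 + x / 2) at 3 by field. rewrite exp_plus.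
  assert (T := exp_ineq1_le (x / 2)). apply Rmult_le_compat; lra.
Qed.

(** For |y| >= tau the factor (1 + y^2/x^2)^n is at least exp(nL), while |Q(x)| <= exp(nL/2) when x
    is within eps of 1. The surplus exp(-nL/2) beats every power of n. The band of width eps is what
    allows the path to be pushed off the line later. *)
Lemma Q_decay C0 tau : 1 <= C0 -> 0 < tau <= 1 -> exists eps Kd, 0 < eps <= 1 / 64 /\ 0 < Kd /\
  forall a n Q, Qgood C0 a n Q -> forall x y, Rabs (x - 1) <= eps -> tau <= Rabs y ->
  Cmod (Q (x, y)) * (5 * (1 + y * y)) <= Kd * n32 n * / (1 + 1 / 4 * (y * y)).
Proof.
  intros HC Ht. set (L := ln (1 + tau * tau / 4)).
  assert (HL : 0 < L) by (unfold L; rewrite <- ln_1; apply ln_increasing; nra).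
  destruct (small_list (1 / 64 :: L / (2 * C0) :: nil)) as [eps He].
  { simpl. split; [lra|]. split; [apply Rdiv_lt_0_compat; lra|auto]. } simpl in He.
  (* Three powers of w = 1 + y^2/4 are set aside: 64 w covers 1 + 16 y^2, 20 w covers 5(1 + y^2),
     and the third gives the Lorentzian. This explains exp(3L) and 1280 = 20 * 64; the last factor
     comes from exp(-nL/2). *)
  set (Kd := 1280 * exp (3 * L) * (16 / (L * L))).
  assert (HKd : 0 < Kd).
  { unfold Kd. assert (P := exp_pos (3 * L)). repeat apply Rmult_lt_0_compat; try lra. apply Rinv_0_lt_compat; nra. }
  exists eps, Kd. split; [lra|]. split; auto.
  intros a n Q [_ [_ [Hn [_ [HQ1 [HQ2 _]]]]]] x y Hx Hy.
  assert (N := INR32 n Hn). set (nn := INR n) in *.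
  assert (Hx2 : 1 - eps <= x <= 1 + eps) by (apply Rabs_le_between in Hx; lra).
  specialize (HQ1 x y ltac:(lra)). specialize (HQ2 x ltac:(lra)).
  assert (Y2 : tau * tau <= y * y).
  { assert (Z := Rsqr_abs y). unfold Rsqr in Z. rewrite Z. apply Rmult_le_compat; lra. }
  set (w := 1 + 1 / 4 * (y * y)). assert (Hw : exp L <= w) by (unfold L; rewrite exp_ln by nra; unfold w; lra).
  assert (PL := exp_pos L). assert (Hw0 : 0 < w) by lra.
  assert (B1 : Cmod (Q (RtoC x)) <= exp (nn * (L / 2))).
  { eapply Rle_trans; [exact HQ2|]. apply exp_le. apply Rmult_le_compat_l; [lra|].
    assert (D : (x - 1) * (x - 1) <= eps).
    { assert (Z := Rsqr_abs (x - 1)). unfold Rsqr in Z. rewrite Z. nra. }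
    apply Rle_trans with (C0 * (L / (2 * C0))). apply Rmult_le_compat_l; lra. right; field; lra. }
  assert (B2 : w ^ n <= (1 + y / x * (y / x)) ^ n).
  { apply pow_incr. split; [lra|]. unfold w. apply Rplus_le_compat_l.
    replace (y / x * (y / x)) with (/ (x * x) * (y * y)) by (field; lra).
    apply Rmult_le_compat_r; [nra|]. replace (1 / 4) with (/ 4) by field. apply Rinv_le_contravar; nra. }
  set (q := Cmod (Q (x, y))) in *. assert (Hq : 0 <= q) by apply Cmod_ge_0.
  assert (B3 : q * w ^ n <= (1 + 16 * (y * y)) * exp (nn * (L / 2))).
  { eapply Rle_trans; [apply Rmult_le_compat_l; [exact Hq|exact B2]|]. eapply Rle_trans; [exact HQ1|].
    apply Rmult_le_compat_l; [nra|exact B1]. }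
  assert (B4 : exp (L * (nn - 3)) * w ^ 3 <= w ^ n).
  { replace n with ((n - 3) + 3)%nat at 1 by lia. rewrite pow_add. apply Rmult_le_compat_r; [apply pow_le; lra|].
    replace (L * (nn - 3)) with (INR (n - 3) * L).
    - rewrite <- exp_pow. apply pow_incr; lra.
    - unfold nn. rewrite minus_INR by lia. simpl. ring. }
  assert (B5 : q * (w * w * w) * exp (L * (nn - 3)) <= 64 * w * exp (nn * (L / 2))).
  { apply Rle_trans with (q * w ^ n).
    - replace (q * (w * w * w) * exp (L * (nn - 3))) with (q * (exp (L * (nn - 3)) * w ^ 3)) by ring. now apply Rmult_le_compat_l.
    - eapply Rle_trans; [exact B3|]. apply Rmult_le_compat_r; [apply Rlt_le, exp_pos|]. unfold w. nra. }
  assert (B6 : q * (w * w) <= 64 * (exp (3 * L) * exp (- (nn * (L / 2))))).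
  { assert (PE := exp_pos (L * (nn - 3))).
    apply Rmult_le_reg_r with (w * exp (L * (nn - 3))); [now apply Rmult_lt_0_compat|].
    replace (q * (w * w) * (w * exp (L * (nn - 3)))) with (q * (w * w * w) * exp (L * (nn - 3))) by ring.
    eapply Rle_trans; [exact B5|]. right.
    replace (64 * (exp (3 * L) * exp (- (nn * (L / 2)))) * (w * exp (L * (nn - 3)))) with
      (64 * w * (exp (3 * L) * exp (- (nn * (L / 2))) * exp (L * (nn - 3)))) by ring.
    f_equal. rewrite <- !exp_plus. f_equal. field. }
  assert (B7 : exp (- (nn * (L / 2))) <= 16 / (L * L) * n32 n).
  { eapply Rle_trans; [apply exp_decay; nra|]. assert (IS := inv_sq_n32 n ltac:(lia)). fold nn in IS.
    replace (4 / (nn * (L / 2) * (nn * (L / 2)))) with (16 / (L * L) * / (nn * nn)) by (field; lra).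
    apply Rmult_le_compat_l; auto. apply Rlt_le, Rdiv_lt_0_compat; nra. }
  apply Rmult_le_reg_r with w; auto. rewrite (Rmult_assoc (Kd * n32 n)), Rinv_l, Rmult_1_r by lra.
  apply Rle_trans with (20 * (q * (w * w))).
  - replace (20 * (q * (w * w))) with (q * (20 * w) * w) by ring. apply Rmult_le_compat_r; [lra|].
    apply Rmult_le_compat_l; auto. unfold w. nra.
  - unfold Kd. assert (P3 := exp_pos (3 * L)).
    apply Rle_trans with (20 * (64 * (exp (3 * L) * (16 / (L * L) * n32 n)))).
    + apply Rmult_le_compat_l; [lra|]. eapply Rle_trans; [exact B6|]. apply Rmult_le_compat_l; [lra|].
      apply Rmult_le_compat_l; lra.
    + right. ring.
Qed.

Lemma line_minus1 t : ((1, t) - 1)%C = (RtoC t * Ci)%C.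
Proof. unfold RtoC, Ci, Cminus, Cplus, Copp, Cmult; simpl. f_equal; ring. Qed.

Lemma Cmod_line_minus1 t : Cmod ((1, t) - 1) = Rabs t.
Proof. rewrite line_minus1, Cmod_mult, Cmod_Ci, Cmod_R. ring. Qed.

(** * The integral close to the saddle *)

Section Middle.
Variables (C0 a : R) (n : nat) (Q : C -> C).
Hypothesis HQ : Qgood C0 a n Q.

Lemma Qg_ccont t : ccont Q (1, t).
Proof. destruct HQ as [_ [_ [_ [H _]]]]. apply hol_ccont, H, line_neq0. Qed.

(** The first summand comes from replacing [Q] by the corrected Gaussian, the second from the cubic
    correction in [mid1]. *)
Definition Kmid : R := 4 * (65536 * (5 * (C0 * C0))) + 4 * (65536 * C0).

Lemma Kmid_ge : 4 * 65536 <= Kmid.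
Proof. destruct HQ as [HC _]. unfold Kmid. nra. Qed.

(** The double zero at the saddle contributes t^2, worth 1/n against the Gaussian; no cancellation
    is required. *)
Lemma mid2 tau h H : 0 < tau <= / (64 * C0) -> 0 <= H -> (forall t, - tau <= t <= tau -> ccont h (1, t)) ->
  (forall t, - tau <= t <= tau -> Cmod (h (1, t)) <= H) ->
  Cmod (CI (fun t => Q (1%R, t) * (((1%R, t) - 1) * ((1%R, t) - 1)) * h (1%R, t))%C (- tau) tau) <= Kmid * H * n32 n.
Proof.
  intros Ht HH Ch Bh. destruct (Q_local C0 a n Q HQ) as [c3 [_ QL]].
  assert (Hn : (32 <= n)%nat) by (destruct HQ as [_ [_ [Hn _]]]; exact Hn). assert (N := INR32 n Hn).
  apply Rle_trans with (65536 * H * / INR n * (4 / sqrt (INR n))).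
  - apply CI_lorentz; try lra.
    + repeat apply Rmult_le_pos; try lra. apply Rlt_le, Rinv_0_lt_compat; lra.
    + intros t Htt. apply (rcont_v (fun s => Q s * ((s - 1) * (s - 1)) * h s)%C).
      apply ccont_mult; auto. apply ccont_mult; [apply Qg_ccont|auto with holo].
    + intros t Htt. assert (At : Rabs t <= tau) by (apply Rabs_le; lra).
      destruct (QL t ltac:(lra)) as [B _]. rewrite !Cmod_mult, Cmod_line_minus1.
      assert (M := gauss_moment (INR n) t 1 ltac:(lra) ltac:(lia)). rewrite pow_1 in M.
      assert (T2 : Rabs t * Rabs t = t * t) by (rewrite <- Rabs_mult, Rabs_right; nra). rewrite T2.
      assert (T0 : 0 <= t * t) by nra.
      set (g := exp (- (INR n * (t * t) / 4))) in *.
      replace (65536 * H * / INR n * / (1 + INR n * (t * t))) with ((/ INR n * (65536 / (1 + INR n * (t * t)))) * H) by (field; split; nra).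
      apply Rmult_le_compat; auto using Cmod_ge_0. apply Rmult_le_pos; auto using Cmod_ge_0.
      apply Rle_trans with (g * (t * t)). apply Rmult_le_compat_r; auto.
      replace (g * (t * t)) with (/ INR n * (INR n * (t * t) * g)) by (field; lra).
      apply Rmult_le_compat_l; [apply Rlt_le, Rinv_0_lt_compat; lra|exact M].
  - rewrite n32_lorentz by lia. assert (P := n32_pos n ltac:(lia)). assert (KM := Kmid_ge).
    apply Rmult_le_compat_r; [lra|]. nra.
Qed.

Lemma mid_split tau w A : 0 < tau <= / (64 * C0) -> 0 <= A ->
  (forall t, - tau <= t <= tau -> ccont w (1, t)) -> (forall t, - tau <= t <= tau -> Cmod (w (1, t)) <= A) ->
  exists c3, Cmod c3 <= C0 /\
  Cmod (CI (fun t => Q (1%R, t) * w (1%R, t))%C (- tau) tau -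
    CI (fun t => RtoC (exp (- (INR n * a / 2 * (t * t)))) * (RtoC 1 - RtoC (INR n) * c3 * RtoC (t * t * t)) * w (1%R, t))%C (- tau) tau)
   <= 4 * (65536 * (5 * (C0 * C0))) * A * n32 n.
Proof.
  intros Ht HA Cw Bw. destruct (Q_local C0 a n Q HQ) as [c3 [Bc3 QL]]. exists c3. split; auto.
  assert (Hn : (32 <= n)%nat) by (destruct HQ as [_ [_ [Hn _]]]; exact Hn). assert (N := INR32 n Hn).
  destruct HQ as [HC _].
  assert (Cg : forall t, rcont (fun t => RtoC (exp (- (INR n * a / 2 * (t * t)))) * (RtoC 1 - RtoC (INR n) * c3 * RtoC (t * t * t)))%C t).
  { intros t. apply rcont_mult. apply rcont_R. apply is_derive_cont_ex. auto_derive. auto.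
    apply rcont_ext with (fun t => RtoC 1 + (RtoC (-1) * (RtoC (INR n) * c3)) * RtoC (t * t * t))%C. intros; ring.
    apply rcont_plus; [apply rcont_const|]. apply rcont_scal. apply rcont_R. apply is_derive_cont_ex. auto_derive. auto. }
  assert (Cw2 : forall t, - tau <= t <= tau -> rcont (fun t => w (1, t)) t) by (intros; apply rcont_v; auto).
  assert (CQ2 : forall t, rcont (fun t => Q (1, t)) t) by (intros; apply rcont_v, Qg_ccont).
  rewrite <- CI_minus; try lra; try (intros; apply rcont_mult; auto).
  set (B0 := 65536 * (5 * (C0 * C0))) in *.

  apply Rle_trans with (B0 * A * / INR n * (4 / sqrt (INR n))).
  - apply CI_lorentz; try lra.
    + repeat apply Rmult_le_pos; try lra. apply Rlt_le, Rinv_0_lt_compat; lra.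
    + intros t Htt. apply rcont_ext with (fun t => Q (1%R, t) * w (1%R, t) + RtoC (-1) * (RtoC (exp (- (INR n * a / 2 * (t * t)))) * (RtoC 1 - RtoC (INR n) * c3 * RtoC (t * t * t)) * w (1%R, t)))%C.
      intros; ring. apply rcont_plus; [|apply rcont_scal]; apply rcont_mult; auto.
    + intros t Htt. assert (At : Rabs t <= tau) by (apply Rabs_le; lra).
      destruct (QL t ltac:(lra)) as [_ B].
      replace (Q (1%R, t) * w (1%R, t) - RtoC (exp (- (INR n * a / 2 * (t * t)))) * (RtoC 1 - RtoC (INR n) * c3 * RtoC (t * t * t)) * w (1%R, t))%C with
       ((Q (1%R, t) - RtoC (exp (- (INR n * a / 2 * (t * t)))) * (RtoC 1 - RtoC (INR n) * c3 * RtoC (t * t * t))) * w (1%R, t))%C by ring.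
      rewrite Cmod_mult. replace (B0 * A * / INR n * / (1 + INR n * (t * t))) with ((B0 * (/ INR n * / (1 + INR n * (t * t)))) * A) by ring.
      apply Rmult_le_compat; auto using Cmod_ge_0.
  - rewrite n32_lorentz by lia. right. ring.
Qed.

(** With a simple zero the leading part is odd and integrates to zero. The cubic correction then
    yields n t^4 under the Gaussian, again of order n^(-3/2). *)
Lemma mid1 tau : 0 < tau <= / (64 * C0) ->
  Cmod (CI (fun t => Q (1%R, t) * ((1%R, t) - 1))%C (- tau) tau) <= Kmid * n32 n.
Proof.
  intros Ht. destruct (mid_split tau (fun s => s - 1)%C 1 Ht ltac:(lra)) as [c3 [Bc3 M]].
  { auto with holo. }
  { intros t Htt. rewrite Cmod_line_minus1. apply Rle_trans with (/ (64 * C0)). apply Rabs_le; lra.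
    destruct HQ as [HC _]. rewrite <- Rinv_1. apply Rinv_le_contravar; lra. }
  assert (Hn : (32 <= n)%nat) by (destruct HQ as [_ [_ [Hn _]]]; exact Hn). assert (N := INR32 n Hn).
  destruct HQ as [HC [Ha _]].
  set (g := fun t => RtoC (exp (- (INR n * a / 2 * (t * t))))) in *.
  assert (Cg : forall t, rcont g t).
  { intros t. apply rcont_R. apply is_derive_cont_ex. auto_derive. auto. }
  assert (Ctt : forall t, rcont (fun t => RtoC t) t) by (intros; apply rcont_R, continuous_id).
  set (J := CI (fun t => g t * (RtoC 1 - RtoC (INR n) * c3 * RtoC (t * t * t)) * ((1%R, t) - 1))%C (- tau) tau).
  assert (EJ : J = (Ci * CI (fun t => g t * RtoC t)%C (- tau) tau - Ci * (c3 * CI (fun t => RtoC (INR n) * (g t * RtoC (t * t * (t * t))))%C (- tau) tau))%C).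
  { unfold J. rewrite <- !CI_scal; try lra.
    - rewrite <- CI_minus; try lra.
      + apply CI_ext; [lra|]. intros t _. rewrite line_minus1. rewrite !RtoC_mult. ring.
      + intros t _. apply rcont_scal, rcont_mult; auto.
      + intros t _. apply rcont_scal, rcont_scal, rcont_scal, rcont_mult; auto. apply rcont_R, is_derive_cont_ex. auto_derive. auto.
    - intros t _. apply rcont_scal, rcont_scal, rcont_mult; auto. apply rcont_R, is_derive_cont_ex. auto_derive. auto.
    - intros t _. apply rcont_scal, rcont_mult; auto. apply rcont_R, is_derive_cont_ex. auto_derive. auto.
    - intros t _. apply rcont_mult; auto. }
  rewrite (CI_odd_zero (fun t => g t * RtoC t)%C) in EJ; [|lra| |].
  2: { intros t _. apply rcont_mult; auto. }
  2: { intros t. unfold g. rewrite RtoC_opp. replace (- t * - t) with (t * t) by ring. ring. }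
  assert (BJ : Cmod J <= C0 * (65536 * / INR n * (4 / sqrt (INR n)))).
  { rewrite EJ. replace (Ci * 0 - Ci * (c3 * CI (fun t => RtoC (INR n) * (g t * RtoC (t * t * (t * t))))%C (- tau) tau))%C with
      (- (Ci * (c3 * CI (fun t => RtoC (INR n) * (g t * RtoC (t * t * (t * t))))%C (- tau) tau)))%C by ring.
    rewrite Cmod_opp, Cmod_mult, Cmod_Ci, Rmult_1_l, Cmod_mult. apply Rmult_le_compat; auto using Cmod_ge_0.
    apply CI_lorentz; try lra.
    - apply Rmult_le_pos; [lra|]. apply Rlt_le, Rinv_0_lt_compat; lra.
    - intros t _. apply rcont_scal, rcont_mult; auto. apply rcont_R, is_derive_cont_ex. auto_derive. auto.
    - intros t _. assert (T0 : 0 <= t * t) by nra. rewrite !Cmod_mult. unfold g. rewrite !Cmod_R, !Rabs_right; try lra; try nra.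
      2: apply Rle_ge, Rlt_le, exp_pos.
      assert (M2 := gauss_moment (INR n) t 2 ltac:(lra) ltac:(lia)).
      assert (EG : exp (- (INR n * a / 2 * (t * t))) <= exp (- (INR n * (t * t) / 4))).
      { apply exp_le. assert (0 <= INR n * (t * t)) by (apply Rmult_le_pos; lra). nra. }
      replace (65536 * / INR n * / (1 + INR n * (t * t))) with (/ INR n * (65536 / (1 + INR n * (t * t)))) by (field; split; nra).
      apply Rle_trans with (/ INR n * ((INR n * (t * t)) ^ 2 * exp (- (INR n * (t * t) / 4)))).
      + replace (/ INR n * ((INR n * (t * t)) ^ 2 * exp (- (INR n * (t * t) / 4)))) with (INR n * (exp (- (INR n * (t * t) / 4)) * (t * t * (t * t)))) by (field; lra).
        apply Rmult_le_compat_l; [lra|]. apply Rmult_le_compat_r; [nra|exact EG].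
      + apply Rmult_le_compat_l; [apply Rlt_le, Rinv_0_lt_compat; lra|exact M2]. }
  rewrite n32_lorentz in BJ by lia.
  assert (RV := Cmod_rev (CI (fun t => Q (1%R, t) * ((1%R, t) - 1))%C (- tau) tau) J). cbv beta in M.
  match type of M with Cmod (?x - ?y) <= _ => change y with J in M; set (I1 := x) in * end.
  unfold Kmid. rewrite Rmult_plus_distr_r. lra.
Qed.

(** The cubic correction is odd and drops out; what remains is the full Gaussian integral up to an
    exponentially small tail. *)
Lemma mid0 tau : 0 < tau <= / (64 * C0) ->
  Cmod (CI (fun t => Q (1, t)) (- tau) tau - RtoC (sqrt (PI / (INR n * a / 2)))) <= (Kmid + 32 / (tau * tau)) * n32 n.
Proof.
  intros Ht. destruct (mid_split tau (fun s => RtoC 1) 1 Ht ltac:(lra)) as [c3 [Bc3 M]].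
  { auto with holo. } { intros. rewrite Cmod_1. lra. }
  assert (Hn : (32 <= n)%nat) by (destruct HQ as [_ [_ [Hn _]]]; exact Hn). assert (N := INR32 n Hn).
  destruct HQ as [HC [Ha _]].
  rewrite (CI_ext _ (fun t => Q (1, t))) in M; [|lra|intros; ring].
  set (g := fun t => RtoC (exp (- (INR n * a / 2 * (t * t))))) in *.
  assert (Cg : forall t, rcont g t).
  { intros t. apply rcont_R. apply is_derive_cont_ex. auto_derive. auto. }
  set (J := CI (fun t => g t * (RtoC 1 - RtoC (INR n) * c3 * RtoC (t * t * t)) * RtoC 1)%C (- tau) tau).
  assert (Ct3 : forall t, rcont (fun t => RtoC (t * t * t)) t).
  { intros t. apply rcont_R, is_derive_cont_ex. auto_derive. auto. }
  assert (EJ : J = CI g (- tau) tau).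
  { transitivity (CI g (- tau) tau - RtoC (INR n) * c3 * CI (fun t => g t * RtoC (t * t * t))%C (- tau) tau)%C.
    - unfold J. rewrite <- CI_scal; try lra.
      + rewrite <- CI_minus; try lra; auto.
        * apply CI_ext; [lra|]. intros t _. ring.
        * intros t _. apply rcont_scal, rcont_mult; auto.
      + intros t _. apply rcont_mult; auto.
    - rewrite (CI_odd_zero (fun t => g t * RtoC (t * t * t))%C); [ring|lra| |].
      + intros t _. apply rcont_mult; auto.
      + intros t. unfold g. replace (- t * - t) with (t * t) by ring. replace (t * t * - t) with (- (t * t * t)) by ring. rewrite RtoC_opp. ring. }
  match type of M with Cmod (?x - ?y) <= _ => change y with J in M end. rewrite EJ in M.
  assert (Pb : 0 < INR n * a / 2) by nra.
  assert (GI := gauss_integral (INR n * a / 2) tau Pb ltac:(lra)). change (CI (fun t => RtoC (exp (- (INR n * a / 2 * (t * t))))) (- tau) tau) with (CI g (- tau) tau) in GI.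
  set (b := INR n * a / 2) in *.
  assert (Bg : 2 / (hpi * sqrt b) * exp (- (b * (tau * tau))) <= 32 / (tau * tau) * n32 n).
  { assert (Hb : INR n / 2 <= b) by (unfold b; nra).
    assert (Sn : 0 < sqrt (INR n)) by (apply sqrt_lt_R0; lra).
    assert (Sb : sqrt (INR n) / 2 <= sqrt b).
    { replace (sqrt (INR n) / 2) with (sqrt (INR n / 4)). apply sqrt_le_1_alt; lra.
      rewrite sqrt_div_alt by lra. f_equal. replace 4 with (2 * 2) by ring. apply sqrt_square; lra. }
    assert (Hh : 1 / 2 <= hpi).
    { unfold hpi. assert (1 <= sqrt PI) by (rewrite <- sqrt_1; apply sqrt_le_1_alt; assert (P := PI2_1); lra). lra. }
    assert (X1 : 2 / (hpi * sqrt b) <= 8 / sqrt (INR n)).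
    { replace (8 / sqrt (INR n)) with (2 * / (1 / 2 * (sqrt (INR n) / 2))) by (field; lra). unfold Rdiv at 1.
      apply Rmult_le_compat_l; [lra|]. apply Rinv_le_contravar; [nra|]. apply Rmult_le_compat; lra. }

    assert (X2 : exp (- (b * (tau * tau))) <= 2 / (INR n * (tau * tau))).
    { rewrite exp_Ropp. replace (2 / (INR n * (tau * tau))) with (/ (INR n / 2 * (tau * tau))) by (field; lra).
      apply Rinv_le_contravar; [nra|]. assert (E := exp_ineq1_le (b * (tau * tau))). nra. }
    apply Rle_trans with (8 / sqrt (INR n) * (2 / (INR n * (tau * tau)))).
    - apply Rmult_le_compat; auto; try apply Rlt_le, exp_pos.
      apply Rlt_le, Rdiv_lt_0_compat; [lra|]. apply Rmult_lt_0_compat; [lra|]. lra.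
    - unfold n32. apply Rle_trans with (16 / (tau * tau) * / (INR n * sqrt (INR n))). right; field; lra.
      apply Rmult_le_compat_r. apply Rlt_le, Rinv_0_lt_compat; nra. apply Rmult_le_compat_r. apply Rlt_le, Rinv_0_lt_compat; nra. lra. }
  assert (T := Cmod_triangle (CI (fun t => Q (1, t)) (- tau) tau - CI g (- tau) tau) (CI g (- tau) tau - RtoC (sqrt (PI / b)))).
  replace (CI (fun t => Q (1%R, t)) (- tau) tau - CI g (- tau) tau + (CI g (- tau) tau - sqrt (PI / b)))%C with
   (CI (fun t => Q (1%R, t)) (- tau) tau - sqrt (PI / b))%C in T by ring.
  assert (P := n32_pos n ltac:(lia)).
  assert (4 * (65536 * (5 * (C0 * C0))) * 1 * n32 n <= Kmid * n32 n).
  { apply Rmult_le_compat_r; [lra|]. unfold Kmid. nra. }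
  rewrite Rmult_plus_distr_r. lra.
Qed.
End Middle.

(** Goursat replaces the segment by the other three sides of a rectangle, so that bounds are only
    needed there. *)
Lemma vseg_shift h M x0 x1 c d : c <= d ->
  (forall x y, Rmin x0 x1 <= x <= Rmax x0 x1 -> c <= y <= d -> hol h (x, y)) ->
  (forall x y, Rmin x0 x1 <= x <= Rmax x0 x1 -> c <= y <= d -> x = x1 \/ y = c \/ y = d -> Cmod (h (x, y)) <= M) ->
  Cmod (vseg h x0 c d) <= M * (2 * Rabs (x1 - x0) + (d - c)).
Proof.
  intros Hcd Hh HM. set (a := Rmin x0 x1) in *. set (b := Rmax x0 x1) in *.
  assert (Ba : a <= x0 /\ a <= x1) by (split; [apply Rmin_l|apply Rmin_r]).
  assert (Bb : x0 <= b /\ x1 <= b) by (split; [apply Rmax_l|apply Rmax_r]).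
  assert (G := goursat h a b c d ltac:(lra) Hcd).
  assert (G0 : Rect h a b c d = RtoC 0).
  { apply G. intros [x y] [H1 H2]. simpl in *. auto. }
  assert (S1 : forall y, y = c \/ y = d -> Cmod (hseg h a b y) <= M * (b - a)).
  { intros y Hy. apply CI_bound; [lra| |].
    - intros t Ht. apply rcont_h, hol_ccont, Hh; lra.
    - intros t Ht. apply HM; lra. }
  assert (S2 : Cmod (vseg h x1 c d) <= M * (d - c)).
  { apply CI_bound; [lra| |].
    - intros t Ht. apply rcont_v, hol_ccont, Hh; lra.
    - intros t Ht. apply HM; lra. }
  assert (T1 := S1 c ltac:(auto)). assert (T2 := S1 d ltac:(auto)).
  assert (L : b - a = Rabs (x1 - x0)).
  { unfold a, b, Rmin, Rmax, Rabs. destruct Rle_dec, Rcase_abs; lra. }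
  rewrite <- L. unfold Rect in G0.
  assert (EQ : Cmod (vseg h x0 c d) = Cmod (hseg h a b c - hseg h a b d + (if Rle_dec x0 x1 then Ci * vseg h x1 c d else - (Ci * vseg h x1 c d)))).
  { rewrite <- (Rmult_1_l (Cmod (vseg h x0 c d))), <- Cmod_Ci, <- Cmod_mult.
    unfold a, b, Rmin, Rmax in *. destruct Rle_dec.
    - f_equal. transitivity (Ci * vseg h x0 c d + 0)%C; [ring|]. rewrite <- G0. ring.
    - rewrite <- Cmod_opp. f_equal. transitivity (- (Ci * vseg h x0 c d) + 0)%C; [ring|]. rewrite <- G0. ring. }
  rewrite EQ. eapply Rle_trans; [apply Cmod_triangle|].
  assert (W : Cmod (if Rle_dec x0 x1 then Ci * vseg h x1 c d else - (Ci * vseg h x1 c d))%C = Cmod (vseg h x1 c d)).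
  { destruct Rle_dec; rewrite ?Cmod_opp, Cmod_mult, Cmod_Ci; ring. }
  rewrite W. assert (U := Cmod_minus_le (hseg h a b c) (hseg h a b d)). lra.
Qed.

Lemma Cmod_Re_gap s z r : r <= Rabs (Re s - Re z) -> r <= Cmod (s - z).
Proof. intros H. eapply Rle_trans; [exact H|]. apply (Re_le_Cmod (s - z)). Qed.

Lemma Cmod_Im_gap s z r : r <= Rabs (Im s - Im z) -> r <= Cmod (s - z).
Proof. intros H. eapply Rle_trans; [exact H|]. apply (Im_le_Cmod (s - z)). Qed.

Lemma sqm1_bound x y : Rabs (x - 1) <= 1 / 64 -> Cmod ((x, y) * (x, y) - 1) <= 5 * (1 + y * y).
Proof.
  intros H. apply Rabs_le_between in H. eapply Rle_trans; [apply Cmod_minus_le|].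
  rewrite Cmod_mult, Cmod_1. assert (P := Cmod_sqr x y). nra.
Qed.

(** * The integral away from the saddle *)

Section Tail.
Variables (C0 a : R) (n : nat) (Q : C -> C) (tau eps Kd : R).
Hypothesis HQ : Qgood C0 a n Q.
Hypothesis Ht : 0 < tau <= 1.
Hypothesis He : 0 < eps <= 1 / 64.
Hypothesis HK : 0 < Kd.
Hypothesis HD : forall x y, Rabs (x - 1) <= eps -> tau <= Rabs y ->
  Cmod (Q (x, y)) * (5 * (1 + y * y)) <= Kd * n32 n * / (1 + 1 / 4 * (y * y)).

Lemma Hn32 : 0 < n32 n.
Proof. apply n32_pos. destruct HQ as [_ [_ [H _]]]. lia. Qed.

Lemma tail_direct h A p q : 0 <= A -> p <= q -> (forall t, p <= t <= q -> tau <= Rabs t) ->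
  (forall t, p <= t <= q -> ccont h (1, t)) ->
  (forall t, p <= t <= q -> Cmod (h (1, t)) <= A * (5 * (1 + t * t))) ->
  Cmod (CI (fun t => Q (1%R, t) * h (1%R, t))%C p q) <= 8 * A * Kd * n32 n.
Proof.
  intros HA Hpq Htt Ch Bh. assert (P := Hn32).
  apply Rle_trans with (A * (Kd * n32 n) * (4 / sqrt (1 / 4))).
  - apply CI_lorentz; auto; try lra.
    + apply Rmult_le_pos; auto. apply Rmult_le_pos; lra.
    + intros t T. apply (rcont_v (fun s => Q s * h s)%C). apply ccont_mult; auto. now apply (Qg_ccont C0 a n).
    + intros t T. rewrite Cmod_mult. specialize (HD 1 t ltac:(rewrite Rminus_diag, Rabs_R0; lra) (Htt t T)).
      rewrite Rmult_assoc. eapply Rle_trans; [apply Rmult_le_compat_l; [apply Cmod_ge_0|apply (Bh t T)]|].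
      replace (Cmod (Q (1, t)) * (A * (5 * (1 + t * t)))) with (A * (Cmod (Q (1, t)) * (5 * (1 + t * t)))) by ring.
      now apply Rmult_le_compat_l.
  - replace (sqrt (1 / 4)) with (1 / 2). right; field. symmetry. replace (1 / 4) with (1 / 2 * (1 / 2)) by field. apply sqrt_square; lra.
Qed.

(** One half of the kernel with the factor s^2 - 1, which vanishes at the saddle; the other half is
    the same function at -z. *)
Definition mz (z s : C) : C := ((s * s - 1) / (s - z))%C.

Lemma mz_hol z s : s <> z -> hol (mz z) s.
Proof. intros H. unfold mz. apply hol_div; auto with holo. now apply Csub_neq0. Qed.

Lemma mz_bound z x y : Rabs (x - 1) <= 1 / 64 -> eps <= Cmod ((x, y) - z) -> Cmod (mz z (x, y)) <= / eps * (5 * (1 + y * y)).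
Proof.
  intros H1 H2. unfold mz. rewrite Cmod_div by (apply Cmod_neq0; lra). unfold Rdiv. rewrite Rmult_comm.
  apply Rmult_le_compat; auto using Cmod_ge_0, sqm1_bound. apply Rlt_le, Rinv_0_lt_compat; lra. apply Rinv_le_contravar; lra.
Qed.

Lemma tail_far z p q : Re z <> 1 -> p <= q -> (forall t, p <= t <= q -> tau <= Rabs t) ->
  (forall t, p <= t <= q -> eps <= Cmod ((1, t) - z)) ->
  Cmod (CI (fun t => Q (1%R, t) * mz z (1%R, t))%C p q) <= 8 * / eps * Kd * n32 n.
Proof.
  intros Hz Hpq H1 H2. apply tail_direct; auto.
  - apply Rlt_le, Rinv_0_lt_compat; lra.
  - intros t T. apply hol_ccont, mz_hol. now apply line_ne.
  - intros t T. apply mz_bound; auto. rewrite Rminus_diag, Rabs_R0; lra.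
Qed.

(* If z is close to the line, a short piece of the path is pushed away from z. *)
Lemma tail_near z p q : Re z <> 1 -> (forall t, p <= t <= q -> tau <= Rabs t) ->
  Rabs (Re z - 1) <= eps -> p <= Im z - eps -> Im z + eps <= q ->
  Cmod (CI (fun t => Q (1%R, t) * mz z (1%R, t))%C p q) <= (16 * / eps + 4) * Kd * n32 n.
Proof.
  intros Hz H1 Hx Hp Hq. set (y0 := Im z) in *.
  assert (Cc : forall t, rcont (fun t => Q (1%R, t) * mz z (1%R, t))%C t).
  { intros t. apply (rcont_v (fun s => Q s * mz z s)%C). apply ccont_mult. now apply (Qg_ccont C0 a n).
    apply hol_ccont, mz_hol. now apply line_ne. }
  rewrite (CI_Chasles _ p (y0 - eps) q), (CI_Chasles _ (y0 - eps) (y0 + eps) q) by (auto; lra).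
  assert (F1 := tail_far z p (y0 - eps) Hz ltac:(lra) ltac:(intros; apply H1; lra)
    ltac:(intros t T; apply Cmod_Im_gap; simpl; fold y0; rewrite Rabs_left1; lra)).
  assert (F2 := tail_far z (y0 + eps) q Hz ltac:(lra) ltac:(intros; apply H1; lra)
    ltac:(intros t T; apply Cmod_Im_gap; simpl; fold y0; rewrite Rabs_right; lra)).
  set (x1 := if Rlt_dec (Re z) 1 then 1 + eps else 1 - eps).
  assert (Hx1 : Rabs (x1 - 1) = eps) by (unfold x1; destruct Rlt_dec; [rewrite Rabs_right|rewrite Rabs_left1]; lra).
  assert (Hbox : forall x, Rmin 1 x1 <= x <= Rmax 1 x1 -> x <> Re z /\ Rabs (x - 1) <= eps).
  { intros x. unfold x1, Rmin, Rmax. destruct Rlt_dec; destruct Rle_dec; try lra; intros; (split; [lra|apply Rabs_le; lra]). }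
  assert (P := Hn32).
  assert (F3 : Cmod (CI (fun t => Q (1%R, t) * mz z (1%R, t))%C (y0 - eps) (y0 + eps)) <= / eps * (Kd * n32 n) * (2 * Rabs (x1 - 1) + (y0 + eps - (y0 - eps)))).
  { apply (vseg_shift (fun s => Q s * mz z s)%C); [lra| |].
    - intros x y X Y. destruct (Hbox x X) as [B1 B2]. apply hol_mult.
      + destruct HQ as [_ [_ [_ [HH _]]]]. apply HH. intros E. apply (f_equal Re) in E. simpl in E.
        apply Rabs_le_between in B2. lra.
      + apply mz_hol. intros E. apply B1. now rewrite <- E.
    - intros x y X Y S. destruct (Hbox x X) as [B1 B2]. rewrite Cmod_mult.
      specialize (HD x y B2 (H1 y ltac:(lra))).
      assert (G : eps <= Cmod ((x, y) - z)).
      { destruct S as [->|[->| ->]].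
        - apply Cmod_Re_gap. simpl. unfold x1. destruct Rlt_dec; [rewrite Rabs_right|rewrite Rabs_left1]; lra.
        - apply Cmod_Im_gap. simpl. fold y0. rewrite Rabs_left1; lra.
        - apply Cmod_Im_gap. simpl. fold y0. rewrite Rabs_right; lra. }
      assert (MB := mz_bound z x y ltac:(lra) G).
      apply Rle_trans with (/ eps * (Cmod (Q (x, y)) * (5 * (1 + y * y)))).
      + replace (/ eps * (Cmod (Q (x, y)) * (5 * (1 + y * y)))) with (Cmod (Q (x, y)) * (/ eps * (5 * (1 + y * y)))) by ring.
        apply Rmult_le_compat_l; auto using Cmod_ge_0.
      + apply Rmult_le_compat_l. apply Rlt_le, Rinv_0_lt_compat; lra. eapply Rle_trans; [exact HD|].
        rewrite <- (Rmult_1_r (Kd * n32 n)) at 2. apply Rmult_le_compat_l. apply Rmult_le_pos; lra.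
        rewrite <- Rinv_1. apply Rinv_le_contravar; nra. }
  rewrite Hx1 in F3. replace (/ eps * (Kd * n32 n) * (2 * eps + (y0 + eps - (y0 - eps)))) with (4 * (Kd * n32 n)) in F3 by (field; lra).
  eapply Rle_trans; [apply Cmod_triangle|]. eapply Rle_trans; [apply Rplus_le_compat_l, Cmod_triangle|]. lra.
Qed.

(** If z is within eps of the line horizontally, its distance rho from 1 forces |Im z| >= tau + eps.
    So z is near at most one of the two tails, which is deformed, and is at distance at least eps
    from the other. *)
Lemma tail_cauchy rho z p q : Re z <> 1 -> rho <= Cmod (z - 1) -> tau + 2 * eps <= rho ->
  (p = tau /\ Rabs (Im z) + 1 <= q \/ q = - tau /\ p <= - (Rabs (Im z) + 1)) -> p <= q ->
  Cmod (CI (fun t => Q (1%R, t) * mz z (1%R, t))%C p q) <= (16 * / eps + 4) * Kd * n32 n.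
Proof.
  intros Hz Hr Hte Hpq Hpq'. assert (P := Hn32).
  assert (H1 : forall t, p <= t <= q -> tau <= Rabs t).
  { intros t T. destruct Hpq as [[-> _]|[-> _]]; [rewrite Rabs_right|rewrite Rabs_left1]; lra. }
  assert (Ie : 0 < / eps) by (apply Rinv_0_lt_compat; lra).
  assert (KP : 0 < Kd * n32 n) by (apply Rmult_lt_0_compat; lra).
  assert (FF : 8 * / eps * Kd * n32 n <= (16 * / eps + 4) * Kd * n32 n).
  { replace (8 * / eps * Kd * n32 n) with (8 * / eps * (Kd * n32 n)) by ring.
    replace ((16 * / eps + 4) * Kd * n32 n) with ((16 * / eps + 4) * (Kd * n32 n)) by ring.
    apply Rmult_le_compat_r; [lra|]. set (ie := / eps) in *. lra. }
  assert (IM := Rabs_le_between (Im z) (Rabs (Im z))). destruct IM as [IM _]. specialize (IM (Rle_refl _)).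
  destruct (Rle_dec eps (Rabs (Re z - 1))) as [F|F].
  - eapply Rle_trans; [apply tail_far; auto|exact FF].
    intros t T. apply Cmod_Re_gap. simpl. now rewrite Rabs_minus_sym.
  - assert (IY : tau + eps <= Rabs (Im z)).
    { assert (T := Cmod_le_Re_Im (z - 1)).
      change (Re (z - 1)) with (Re z + - (1)) in T. change (Im (z - 1)) with (Im z + - 0) in T.
      rewrite Ropp_0, Rplus_0_r in T. unfold Rminus in F. lra. }
    destruct (Rle_dec (Im z) 0) as [SG|SG].
    + rewrite Rabs_left1 in IY, Hpq by lra. destruct Hpq as [[-> Hq]|[-> Hp]].
      * eapply Rle_trans; [apply tail_far; auto|exact FF]. intros t T. apply Cmod_Im_gap. simpl. rewrite Rabs_right; lra.
      * apply tail_near; auto; lra.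
    + rewrite Rabs_right in IY, Hpq by lra. destruct Hpq as [[-> Hq]|[-> Hp]].
      * apply tail_near; auto; lra.
      * eapply Rle_trans; [apply tail_far; auto|exact FF]. intros t T. apply Cmod_Im_gap. simpl. rewrite Rabs_left1; lra.
Qed.
End Tail.

(** Splits the kernel at the saddle into a constant times s - 1 and a bounded multiple of (s - 1)^2,
    to which [mid1] and [mid2] apply. *)
Lemma mz_expand z s : s <> z -> z <> RtoC 1 ->
  mz z s = ((2 / (1 - z)) * (s - 1) + ((s - 1) * (s - 1)) * (- (1 + z) / ((s - z) * (1 - z))))%C.
Proof.
  intros H1 H2. unfold mz. field. split; [apply Csub_neq0; congruence|now apply Csub_neq0].
Qed.

(* The factor s^2 - 1 annihilates the saddle, so that the first surviving term is of order n^(-3/2). *)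
Lemma middle_cauchy C0 a n Q rho tau z : Qgood C0 a n Q -> 0 < rho <= 1 -> 0 < tau <= / (64 * C0) -> tau <= rho / 4 ->
  Re z <> 1 -> rho <= Cmod (z - 1) ->
  Cmod (CI (fun t => Q (1%R, t) * mz z (1%R, t))%C (- tau) tau) <= Kmid C0 * (2 / rho + 4 / (rho * rho)) * n32 n.
Proof.
  intros HQ Hr Ht Htr Hz Hzr.
  assert (Hz1 : z <> RtoC 1) by (intros ->; apply Hz; reflexivity).

  set (m2 := fun s => (- (1 + z) / ((s - z) * (1 - z)))%C).
  assert (C2 : forall t, ccont m2 (1, t)).
  { intros t. unfold m2. apply ccont_div; auto with holo.
    apply Cmult_neq_0; apply Csub_neq0; [now apply line_ne|congruence]. }
  assert (D1 : Cmod (1 - z) = Cmod (z - 1)) by apply Cmod_minus_sym. set (r := Cmod (z - 1)) in *.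
  assert (B2 : forall t, - tau <= t <= tau -> Cmod (m2 (1, t)) <= 4 / (rho * rho)).
  { intros t T. unfold m2.
    assert (E2 : 3 / 4 * r <= Cmod ((1, t) - z)).
    { replace ((1, t) - z)%C with ((1 - z) - (1 - (1, t)))%C by ring.
      assert (U := Cmod_rev (1 - z) (1 - (1, t))). rewrite D1, (Cmod_minus_sym 1 (1, t)), Cmod_line_minus1 in U.
      assert (Rabs t <= tau) by (apply Rabs_le; lra). lra. }
    assert (E3 : Cmod (1 + z) <= 2 + r).
    { replace (1 + z)%C with (RtoC 2 + (z - 1))%C by ring. eapply Rle_trans; [apply Cmod_triangle|].
      rewrite Cmod_R, Rabs_right by lra. unfold r; lra. }
    rewrite Cmod_div by (apply Cmult_neq_0; apply Cmod_neq0; lra). rewrite Cmod_opp, Cmod_mult, D1.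
    apply Rmult_le_reg_r with (Cmod ((1, t) - z) * r); [apply Rmult_lt_0_compat; lra|].
    unfold Rdiv at 1. rewrite Rmult_assoc, Rinv_l, Rmult_1_r by (apply Rmult_integral_contrapositive; lra).
    eapply Rle_trans; [exact E3|].
    apply Rle_trans with (4 / (rho * rho) * (3 / 4 * r * r)).
    - replace (4 / (rho * rho) * (3 / 4 * r * r)) with (3 * ((r / rho) * (r / rho))) by (field; lra).
      assert (Z : 1 <= r / rho). { apply Rmult_le_reg_r with rho; [lra|]. unfold Rdiv. rewrite Rmult_assoc, Rinv_l; lra. }
      assert (Z2 : r <= r / rho). { apply Rmult_le_reg_r with rho; [lra|]. unfold Rdiv. rewrite Rmult_assoc, Rinv_l by lra. nra. }
      nra.
    - apply Rmult_le_compat_l. apply Rlt_le, Rdiv_lt_0_compat; nra. apply Rmult_le_compat_r; lra. }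
  assert (B1 : Cmod (2 / (1 - z)) <= 2 / rho).
  { rewrite Cmod_div by (apply Csub_neq0; congruence). rewrite Cmod_R, Rabs_right, D1 by lra. apply Rmult_le_compat_l; [lra|]. apply Rinv_le_contravar; lra. }
  assert (CQ := Qg_ccont C0 a n Q HQ).
  assert (EI : CI (fun t => Q (1%R, t) * mz z (1%R, t))%C (- tau) tau =
    (2 / (1 - z) * CI (fun t => Q (1%R, t) * ((1%R, t) - 1))%C (- tau) tau +
     CI (fun t => Q (1%R, t) * (((1%R, t) - 1) * ((1%R, t) - 1)) * m2 (1%R, t))%C (- tau) tau)%C).
  { assert (R1 : forall t, rcont (fun t => Q (1%R, t) * ((1%R, t) - 1))%C t).
    { intros t. apply (rcont_v (fun s => Q s * (s - 1))%C). apply ccont_mult; auto with holo. }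
    rewrite <- CI_scal, <- CI_plus; try lra; auto.
    - apply CI_ext; [lra|]. intros t _. rewrite mz_expand; auto. 2: now apply line_ne. unfold m2. ring.
    - intros t _. apply rcont_scal. auto.
    - intros t _. apply (rcont_v (fun s => Q s * ((s - 1) * (s - 1)) * m2 s)%C). apply ccont_mult; auto. apply ccont_mult; auto with holo. }
  rewrite EI. eapply Rle_trans; [apply Cmod_triangle|]. rewrite Cmod_mult.
  assert (M1 := mid1 C0 a n Q HQ tau Ht).
  assert (P4 : 0 < 4 / (rho * rho)) by (apply Rdiv_lt_0_compat; nra).
  assert (M2 := mid2 C0 a n Q HQ tau m2 (4 / (rho * rho)) Ht ltac:(lra) ltac:(auto) B2).
  assert (M3 : Cmod (2 / (1 - z)) * Cmod (CI (fun t => Q (1%R, t) * ((1%R, t) - 1))%C (- tau) tau) <= 2 / rho * (Kmid C0 * n32 n)).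
  { apply Rmult_le_compat; auto using Cmod_ge_0. }
  lra.
Qed.

(** The bound is stated for all large truncations, because its use is to be passed to the principal
    value by [PV_le]. The constant does not deteriorate as z approaches the line. *)
Lemma laplace_main C0 rho : 1 <= C0 -> 0 < rho <= 1 -> exists K, 0 < K /\ forall a n Q, Qgood C0 a n Q ->
  forall z, Re z <> 1 -> Re z <> - 1 -> rho <= Cmod (z - 1) -> rho <= Cmod (z + 1) ->
  exists Y0, forall Y, Y0 <= Y ->
   Cmod ((1 - z * z) / 2 * CI (fun t => Q (1%R, t) * Kz z (1%R, t))%C (- Y) Y - RtoC (sqrt (PI / (INR n * a / 2)))) <= K * n32 n.
Proof.
  intros HC Hr. assert (IC : 0 < / (64 * C0)) by (apply Rinv_0_lt_compat; lra).
  destruct (small_list (/ (64 * C0) :: rho / 4 :: 1 :: nil)) as [tau Ht]; [simpl; repeat split; lra|]. simpl in Ht.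
  destruct (Q_decay C0 tau HC ltac:(lra)) as [eps0 [Kd [He0 [HK HD0]]]].
  destruct (small_list (eps0 :: rho / 4 :: nil)) as [eps He]; [simpl; repeat split; lra|]. simpl in He.
  assert (Ie : 0 < / eps) by (apply Rinv_0_lt_compat; lra).
  assert (It : 0 < 32 / (tau * tau)) by (apply Rdiv_lt_0_compat; nra).
  assert (Ir : 0 < 2 / rho + 4 / (rho * rho)) by (apply Rplus_lt_0_compat; apply Rdiv_lt_0_compat; nra).
  assert (KMP : 0 < Kmid C0) by (unfold Kmid; nra).
  set (K1 := Kmid C0 * (2 / rho + 4 / (rho * rho)) + 2 * ((16 * / eps + 4) * Kd)).
  assert (PK1 : 0 < K1).
  { unfold K1. apply Rplus_lt_0_compat; [apply Rmult_lt_0_compat; lra|]. apply Rmult_lt_0_compat; [lra|]. apply Rmult_lt_0_compat; lra. }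
  exists ((Kmid C0 + 32 / (tau * tau) + 16 * Kd) + (Kmid C0 + 16 * Kd) + K1). split; [lra|].
  intros a n Q HQ z Hz1 Hz2 Hr1 Hr2.
  assert (HD : forall x y, Rabs (x - 1) <= eps -> tau <= Rabs y ->
    Cmod (Q (x, y)) * (5 * (1 + y * y)) <= Kd * n32 n * / (1 + 1 / 4 * (y * y))).
  { intros. apply (HD0 a n Q HQ); lra. }

  assert (CQ := Qg_ccont C0 a n Q HQ).
  assert (Main : forall u, Re u <> 1 -> rho <= Cmod (u - 1) -> forall Y, Rabs (Im u) + 2 <= Y ->
    Cmod (CI (fun t => Q (1%R, t) * mz u (1%R, t))%C (- Y) Y) <= K1 * n32 n).
  { intros u Hu1 Hu2 Y HY. assert (IP := Rabs_pos (Im u)).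
    assert (Cc : forall t, rcont (fun t => Q (1%R, t) * mz u (1%R, t))%C t).
    { intros t. apply (rcont_v (fun s => Q s * mz u s)%C). apply ccont_mult; auto.
      apply hol_ccont, mz_hol. now apply line_ne. }
    rewrite (CI_Chasles _ (- Y) (- tau) Y), (CI_Chasles _ (- tau) tau Y) by (auto; lra).
    assert (T1 := tail_cauchy C0 a n Q tau eps Kd HQ ltac:(lra) ltac:(lra) HK HD rho u (- Y) (- tau) Hu1 Hu2 ltac:(lra) ltac:(right; split; lra) ltac:(lra)).
    assert (T2 := tail_cauchy C0 a n Q tau eps Kd HQ ltac:(lra) ltac:(lra) HK HD rho u tau Y Hu1 Hu2 ltac:(lra) ltac:(left; split; lra) ltac:(lra)).
    assert (T3 := middle_cauchy C0 a n Q rho tau u HQ ltac:(lra) ltac:(lra) ltac:(lra) Hu1 Hu2).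
    eapply Rle_trans; [apply Cmod_triangle|]. eapply Rle_trans; [apply Rplus_le_compat_l, Cmod_triangle|].
    unfold K1. lra. }
  assert (TD : forall h, (forall t, ccont h (1, t)) -> (forall t, Cmod (h (1, t)) <= 1 * (5 * (1 + t * t))) -> forall Y, 2 <= Y ->
    Cmod (CI (fun t => Q (1%R, t) * h (1%R, t))%C (- Y) Y - CI (fun t => Q (1%R, t) * h (1%R, t))%C (- tau) tau) <= 16 * Kd * n32 n).
  { intros h Ch Bh Y HY.
    assert (Cc : forall t, rcont (fun t => Q (1%R, t) * h (1%R, t))%C t).
    { intros t. apply (rcont_v (fun s => Q s * h s)%C). apply ccont_mult; auto. }
    rewrite (CI_Chasles _ (- Y) (- tau) Y), (CI_Chasles _ (- tau) tau Y) by (auto; lra).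
    assert (T1 := tail_direct C0 a n Q tau eps Kd HQ ltac:(lra) HK HD h 1 (- Y) (- tau) ltac:(lra) ltac:(lra)
      ltac:(intros; rewrite Rabs_left1; lra) ltac:(auto) ltac:(auto)).
    assert (T2 := tail_direct C0 a n Q tau eps Kd HQ ltac:(lra) HK HD h 1 tau Y ltac:(lra) ltac:(lra)
      ltac:(intros; rewrite Rabs_right; lra) ltac:(auto) ltac:(auto)).
    match goal with |- Cmod (?x + (?y + ?z) - ?y) <= _ => replace (x + (y + z) - y)%C with (x + z)%C by ring end.
    eapply Rle_trans; [apply Cmod_triangle|]. lra. }
  exists (Rabs (Im z) + 2). intros Y HY. assert (IP := Rabs_pos (Im z)).
  assert (M1 := Main z Hz1 Hr1 Y HY).
  assert (Hz2' : Re (- z) <> 1) by (rewrite Re_opp; lra).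
  assert (M2 := Main (- z)%C Hz2' ltac:(rewrite <- Cmod_opp; replace (- (- z - 1))%C with (z + 1)%C by ring; auto) Y
    ltac:(replace (Im (- z)) with (- Im z) by reflexivity; rewrite Rabs_Ropp; lra)).
  assert (A0 := mid0 C0 a n Q HQ tau ltac:(lra)). assert (A1 := mid1 C0 a n Q HQ tau ltac:(lra)).
  assert (T0 := TD (fun _ => RtoC 1) ltac:(auto with holo) ltac:(intros; cbv beta; rewrite Cmod_1; nra) Y ltac:(lra)).
  assert (T1 := TD (fun s => s - 1)%C ltac:(auto with holo) ltac:(intros; cbv beta; rewrite Cmod_line_minus1; assert (0 <= Rabs t) by apply Rabs_pos;
     assert (Z := Rsqr_abs t); unfold Rsqr in Z; nra) Y ltac:(lra)).
  cbv beta in T0, T1.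
  assert (R0 : forall t, rcont (fun t => Q (1, t)) t) by (intros t; now apply rcont_v).
  assert (R1 : forall t, rcont (fun t => Q (1%R, t) * ((1%R, t) - 1))%C t).
  { intros t. apply (rcont_v (fun s => Q s * (s - 1))%C). apply ccont_mult; auto with holo. }
  assert (Rm : forall u, Re u <> 1 -> forall t, rcont (fun t => Q (1%R, t) * mz u (1%R, t))%C t).
  { intros u Hu t. apply (rcont_v (fun s => Q s * mz u s)%C). apply ccont_mult; auto. apply hol_ccont, mz_hol. now apply line_ne. }
  rewrite !(CI_ext (fun t => Q (1%R, t) * RtoC 1)%C (fun t => Q (1, t))) in T0 by (try lra; intros; ring).
  (* Pointwise on the line, s is written as 1 + (s - 1), so that [mid0] gives the main term and
     [mid1] an error. *)
  assert (EQ : ((1 - z * z) / 2 * CI (fun t => Q (1%R, t) * Kz z (1%R, t))%C (- Y) Y)%C =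
    (CI (fun t => Q (1%R, t)) (- Y) Y + CI (fun t => Q (1%R, t) * ((1%R, t) - 1))%C (- Y) Y
     - RtoC (/ 2) * (CI (fun t => Q (1%R, t) * mz z (1%R, t))%C (- Y) Y + CI (fun t => Q (1%R, t) * mz (- z) (1%R, t))%C (- Y) Y))%C).
  { rewrite <- (CI_plus (fun t => Q (1%R, t) * mz z (1%R, t))%C), <- (CI_plus (fun t => Q (1%R, t))), <- !CI_scal, <- CI_minus; try lra; auto.
    - apply CI_ext; [lra|]. intros t _. unfold Kz, mz.
      assert (N1 : ((1, t) - z)%C <> RtoC 0) by (apply Csub_neq0; now apply line_ne).
      assert (N2 : ((1, t) + z)%C <> RtoC 0) by (apply sum_neq0; now apply line_ne).
      replace ((1, t) - - z)%C with ((1, t) + z)%C by ring. rewrite RtoC_inv by lra. field. auto.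
    - intros t _. now apply rcont_plus.
    - intros t _. apply rcont_scal, rcont_plus; auto.
    - intros t _. apply rcont_plus; auto.
    - intros t _. apply (rcont_v (fun s => Q s * Kz z s)%C). apply ccont_mult; auto. apply hol_ccont, Kz_hol; now apply line_ne. }
  rewrite EQ.
  set (I0 := CI (fun t => Q (1%R, t)) (- Y) Y) in *. set (I0' := CI (fun t => Q (1%R, t)) (- tau) tau) in *.
  set (I1 := CI (fun t => Q (1%R, t) * ((1%R, t) - 1))%C (- Y) Y) in *. set (I1' := CI (fun t => Q (1%R, t) * ((1%R, t) - 1))%C (- tau) tau) in *.
  set (J1 := CI (fun t => Q (1%R, t) * mz z (1%R, t))%C (- Y) Y) in *. set (J2 := CI (fun t => Q (1%R, t) * mz (- z) (1%R, t))%C (- Y) Y) in *.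
  set (s0 := sqrt (PI / (INR n * a / 2))) in *.
  replace (I0 + I1 - RtoC (/ 2) * (J1 + J2) - RtoC s0)%C with
    (((I0 - I0') + (I0' - RtoC s0)) + (((I1 - I1') + I1') - RtoC (/ 2) * (J1 + J2)))%C by ring.
  assert (X1 := Cmod_triangle ((I0 - I0') + (I0' - RtoC s0)) (((I1 - I1') + I1') - RtoC (/ 2) * (J1 + J2))).
  assert (X2 := Cmod_triangle (I0 - I0') (I0' - RtoC s0)). assert (X3 := Cmod_minus_le ((I1 - I1') + I1') (RtoC (/ 2) * (J1 + J2))).
  assert (X4 := Cmod_triangle (I1 - I1') I1'). assert (X5 := Cmod_triangle J1 J2).
  rewrite Cmod_RtoC_mult, Rabs_right in X3 by lra. lra.
Qed.

(** * The error away from the saddle points *)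

(** Everything about xi that the asymptotic analysis uses; from here on Gamma and zeta do not appear
    until the final assembly. *)
Record setup (f : C -> C) (n : nat) (lam : R) (phi : C -> C) : Prop := {
  su_hol : forall z, hol f z;
  su_n : (32 <= n)%nat;
  su_lam : 400 <= lam;
  su_phase : is_phase f n lam phi;
  su_scaling : is_scaling f n lam;
  su_real : exists F : R -> R,
    (forall x, 1 / 2 < x -> f (RtoC x) = RtoC (F x) /\ 0 < F x) /\
    (forall x y, 1 / 2 <= x -> Cmod (f (RtoC lam * (x, y))%C) <= F (lam * x) * (1 + 16 * (y * y))) /\
    (forall x, 1 / 2 <= x <= 3 / 2 -> F (lam * x) <= exp (4 * INR n) * F lam);
  su_growth : forall A, exists K, 0 < K /\ forall u, 0 <= Re u <= A -> 4 <= Rabs (Im u) -> Cmod (f u) <= K * Cmod u ^ 3 }.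

(* Leading amplitude: sqrt(n) / (2 c) with h0(z) = 2 c / (1 - z^2). *)
Definition amp (n : nat) (phi : C -> C) : R := sqrt (2 * PI * aphi phi) * sqrt (INR n) / 2.

Section Outer.
Variables (f : C -> C) (n : nat) (lam : R) (phi : C -> C).
Hypothesis S : setup f n lam phi.

Local Notation D := (f (RtoC lam)).
Local Notation Q := (Qf f n lam).

Lemma su_2n : (2 <= n)%nat.
Proof. assert (H := su_n _ _ _ _ S). lia. Qed.

Lemma su_flam : D <> RtoC 0.
Proof. destruct (su_real _ _ _ _ S) as [F [H1 _]]. apply (flam_neq0 f lam F (su_lam _ _ _ _ S) H1). Qed.

Lemma su_even z : f (- z)%C = f z.
Proof.
  assert (Hn := su_n _ _ _ _ S). assert (Hl := su_lam _ _ _ _ S).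
  apply (f_even f n lam phi (su_hol _ _ _ _ S) ltac:(lia) ltac:(lra) su_flam (su_phase _ _ _ _ S)).
Qed.

Ltac su := destruct (su_real _ _ _ _ S) as [F [H1 [H2 H3]]]; destruct S.

Lemma su_Q_exp z : 1 / 400 < Re z -> Q z = Cexp (- (RtoC (INR n) * phi z)).
Proof. su. eapply Q_exp; eauto. Qed.

Lemma su_dq_bound k z : (k <= 4)%nat -> Cmod (z - 1) <= 1 / 64 -> Cmod (dq phi 1 k z) <= Cphi.
Proof. su. eapply dq_phi_bound; eauto. Qed.

Lemma su_dq_near k z : Cmod (z - 1) <= 1 / 2 -> near z (hol (dq phi 1 k)).
Proof. su. eapply dq_phi_near; eauto. Qed.

Lemma su_phi2 z : phi z = ((z - 1) * (z - 1) * dq phi 1 2 z)%C.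
Proof. su. eapply phi_dq2; eauto. Qed.

Lemma su_phi4 z : phi z = ((z - 1) * (z - 1) * (dq phi 1 2 1 + (z - 1) * (dq phi 1 3 1 + (z - 1) * dq phi 1 4 z)))%C.
Proof. su. eapply phi_taylor; eauto. Qed.

Lemma su_dq2 : dq phi 1 2 1 = RtoC (- aphi phi / 2).
Proof. su. eapply dq2_real; eauto. Qed.

Lemma su_ddphi : ddphi1 phi = RtoC (- aphi phi).
Proof. su. eapply ddphi_a; eauto. Qed.

Lemma su_a : 1 <= aphi phi <= 2 * Cphi.
Proof.
  split. su. eapply aphi_ge1; eauto.
  assert (B := su_dq_bound 2 1 ltac:(lia) ltac:(rewrite Cmod_self; lra)). rewrite su_dq2, Cmod_R in B.
  apply Rabs_le_between in B. lra.
Qed.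

Lemma su_good : Qgood Cphi (aphi phi) n Q.
Proof.
  assert (CP : 1 <= Cphi) by (unfold Cphi; lra).
  split; [exact CP|]. split; [apply su_a|]. split; [apply S|].
  split; [intros s Hs; apply Qf_hol; [apply S|apply su_flam|auto]|].
  split; [su; intros; eapply Q_line; eauto|]. split.
  - intros x Hx. assert (Hx' := Hx). apply Rabs_le_between in Hx'.
    destruct (su_real _ _ _ _ S) as [F [H1 [H2 H3]]].
    rewrite (Q_Cmod_exp f n lam phi F (su_hol _ _ _ _ S) (su_n _ _ _ _ S) (su_lam _ _ _ _ S) (su_phase _ _ _ _ S) H1) by (simpl; lra).
    apply exp_le. rewrite Ropp_mult_distr_l_reverse, Ropp_mult_distr_r. apply Rmult_le_compat_l; [apply pos_INR|].
    eapply Rle_trans; [apply Rle_abs|]. rewrite Rabs_Ropp. eapply Rle_trans; [apply Re_le_Cmod|].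
    rewrite su_phi2, !Cmod_mult, <- RtoC_minus, Cmod_R.
    assert (B := su_dq_bound 2 (RtoC x) ltac:(lia) ltac:(rewrite <- RtoC_minus, Cmod_R; lra)).
    assert (Z := Rsqr_abs (x - 1)). unfold Rsqr in Z. rewrite Z.
    rewrite (Rmult_comm Cphi). apply Rmult_le_compat_l; auto. rewrite <- Z. nra.
  - exists (- (Ci * dq phi 1 3 1))%C, (fun t => dq phi 1 4 (1, t)). split.
    + rewrite Cmod_opp, Cmod_mult, Cmod_Ci, Rmult_1_l. apply su_dq_bound. lia. rewrite Cmod_self; lra.
    + intros t Ht. split. apply su_dq_bound. lia. now rewrite Cmod_line_minus1.
      rewrite su_Q_exp by (simpl; lra). do 3 f_equal. rewrite su_phi4, line_minus1, su_dq2.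
      replace (RtoC t * Ci * (RtoC t * Ci) * (RtoC (- aphi phi / 2) + RtoC t * Ci * (dq phi 1 3 1 + RtoC t * Ci * dq phi 1 4 (1, t))))%C with
        (Ci * Ci * (RtoC (- aphi phi / 2) * RtoC (t * t) + Ci * dq phi 1 3 1 * RtoC (t * t * t) + Ci * Ci * RtoC (t * t * (t * t)) * dq phi 1 4 (1, t)))%C
        by (rewrite !RtoC_mult; ring).
      replace (Ci * Ci)%C with (- RtoC 1)%C by (unfold Ci, Cmult, Copp, RtoC; simpl; f_equal; ring).
      replace (aphi phi / 2 * (t * t)) with (- (- aphi phi / 2 * (t * t))) by field. rewrite RtoC_opp, (RtoC_mult (- aphi phi / 2)). ring.
Qed.

Lemma INRn1 : 32 <= INR n.
Proof. apply INR32, S. Qed.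

Lemma amp_pos : 0 < amp n phi.
Proof.
  assert (A := su_a). assert (N := INRn1). assert (P := PI_RGT_0). unfold amp.
  apply Rdiv_lt_0_compat; [|lra]. apply Rmult_lt_0_compat; apply sqrt_lt_R0; nra.
Qed.

Lemma amp_inv : amp n phi * sqrt (PI / (INR n * aphi phi / 2)) = PI.
Proof.
  assert (A := su_a). assert (N := INRn1). assert (P := PI_RGT_0). unfold amp.
  rewrite <- sqrt_mult by nra. unfold Rdiv at 1. rewrite Rmult_assoc, (Rmult_comm (/ 2)), <- Rmult_assoc.
  rewrite <- sqrt_mult.
  - replace (2 * PI * aphi phi * INR n * (PI / (INR n * aphi phi / 2))) with ((2 * PI) * (2 * PI)) by (field; lra).
    rewrite sqrt_square by lra. field.
  - apply Rmult_le_pos; [nra|lra].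
  - apply Rlt_le, Rdiv_lt_0_compat; nra.
Qed.

Lemma amp_le : amp n phi <= sqrt (4 * PI * Cphi) * sqrt (INR n).
Proof.
  assert (A := su_a). assert (P := PI_RGT_0). unfold amp.
  assert (Q1 := sqrt_pos (INR n)). assert (Q2 := sqrt_pos (2 * PI * aphi phi)).
  assert (L : sqrt (2 * PI * aphi phi) <= sqrt (4 * PI * Cphi)) by (apply sqrt_le_1_alt; nra). nra.
Qed.

Definition Pz (z : C) : C := (ep f n (RtoC lam * z) / (D * Cpow z (2 * n)))%C.
(** The formula of the theorem for z outside the discs, solved for the error: inside the strip
    through the remainder [Rm], and in [eout] through the polynomial part [Pz]. *)
Definition ein (z : C) : C := (RtoC (amp n phi) * (1 - z * z) * Rm f n lam z - 1)%C.
Definition eout (z : C) : C := (- (RtoC (amp n phi) * (1 - z * z) * Pz z) - 1)%C.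

(** The two errors differ by the jump of [chi], expressed through [Q]. *)
Lemma ein_eout z : z <> RtoC 0 -> ein z = (eout z + RtoC (amp n phi) * (1 - z * z) * Q z)%C.
Proof.
  intros Hz. rewrite (Q_split f n lam) by (auto; try apply S; try apply su_even; try apply su_2n; apply su_flam). unfold ein, eout, Pz. ring.
Qed.

Lemma ein_hol z : hol ein z.
Proof. unfold ein. apply hol_minus; auto with holo. apply hol_mult; auto with holo. apply Rm_hol, S. Qed.

Lemma eout_hol z : z <> RtoC 0 -> hol eout z.
Proof.
  intros Hz. assert (H : hol (fun z => ein z - RtoC (amp n phi) * (1 - z * z) * Q z)%C z).
  { apply hol_minus; [apply ein_hol|]. apply hol_mult; auto with holo. apply Qf_hol; auto. apply S. apply su_flam. }
  destruct H as [l H]. exists l. revert H. apply cder_ext_near.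
  apply (near_mono z (fun y => y <> RtoC 0)); [|now apply near_neq]. intros y Hy. rewrite ein_eout by auto. ring.
Qed.

Lemma ein_even z : ein (- z)%C = ein z.
Proof.
  unfold ein. rewrite Rm_even by (try apply S; apply su_even). ring.
Qed.

Lemma eout_even z : z <> RtoC 0 -> eout (- z)%C = eout z.
Proof.
  intros Hz. assert (H1 := ein_eout z Hz). assert (Hz' : (- z)%C <> RtoC 0) by now apply Copp_neq0.
  assert (H2 := ein_eout (- z)%C Hz').
  assert (EQ : Q (- z)%C = Q z).
  { unfold Qf. f_equal. replace (RtoC lam * - z)%C with (- (RtoC lam * z))%C by ring. apply su_even.
    f_equal. rewrite !Cpow_mult_r. f_equal. simpl. ring. }
  rewrite ein_even, EQ in H2. replace (- z * - z)%C with (z * z)%C in H2 by ring.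
  transitivity (ein z - RtoC (amp n phi) * (1 - z * z) * Q z)%C; [rewrite H2|rewrite H1]; ring.
Qed.

Lemma taylor_ein z : taylor_poly f (2 * n - 1) (RtoC lam * z) =
  (f (RtoC lam * z) - Cpow z (2 * n) * D * Rm f n lam z)%C.
Proof.
  rewrite (taylor_ep f n (su_hol _ _ _ _ S) su_even su_2n) by (assert (H := su_2n); lia).
  rewrite (f_ep f n (su_hol _ _ _ _ S) su_even su_2n (RtoC lam * z)). unfold Rm. rewrite lam_s_pow. field. apply su_flam.
Qed.

Lemma taylor_eout z : z <> RtoC 0 -> taylor_poly f (2 * n - 1) (RtoC lam * z) = (Cpow z (2 * n) * D * Pz z)%C.
Proof.
  intros Hz. rewrite (taylor_ep f n (su_hol _ _ _ _ S) su_even su_2n) by (assert (H := su_2n); lia).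
  unfold Pz. field. split; [now apply Cpow_neq0|apply su_flam].
Qed.
End Outer.

Lemma PV_le k l c S0 B : PVlim k l ->
  (exists Y0, forall Y, Y0 <= Y -> Cmod (c * CI (fun t => k (1%R, t)) (- Y) Y - S0) <= B) -> Cmod (c * l - S0) <= B.
Proof.
  intros [_ H] [Y0 HY]. apply le_epsilon. intros e He.
  set (e' := e / (Cmod c + 1)). assert (Cp := Cmod_ge_0 c).
  destruct (H e' ltac:(unfold e'; apply Rdiv_lt_0_compat; lra)) as [Y1 [_ H1]].
  specialize (H1 (Rmax Y0 Y1) (Rmax_r _ _)). specialize (HY (Rmax Y0 Y1) (Rmax_l _ _)).
  set (I := CI _ _ _) in *.
  replace (c * l - S0)%C with ((c * I - S0) - c * (I - l))%C by ring.
  eapply Rle_trans; [apply Cmod_minus_le|]. rewrite Cmod_mult. apply Rplus_le_compat; auto.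
  apply Rle_trans with (Cmod c * e'). apply Rmult_le_compat_l; lra.
  unfold e'. apply Rmult_le_reg_r with (Cmod c + 1); [lra|]. field_simplify; [|lra]. nra.
Qed.

(** By [amp_inv] the amplitude turns the main term of [laplace_main] into 1; being of order sqrt(n),
    it turns the error n^(-3/2) into 1/n. *)
Lemma outer_bound rho : 0 < rho <= 1 -> exists K, 0 < K /\ forall f n lam phi, setup f n lam phi ->
  forall z, rho <= Cmod (z - 1) -> rho <= Cmod (z + 1) ->
  (Rabs (Re z) < 1 -> Cmod (ein f n lam phi z) <= K / INR n) /\ (1 <= Rabs (Re z) -> Cmod (eout f n lam phi z) <= K / INR n).
Proof.
  intros Hr. destruct (laplace_main Cphi (rho / 2) ltac:(unfold Cphi; lra) ltac:(lra)) as [K [HK L]].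
  set (Ka := sqrt (4 * PI * Cphi)).
  assert (HKa : 0 < Ka) by (apply sqrt_lt_R0; assert (P := PI_RGT_0); unfold Cphi; nra).
  assert (PP := PI_RGT_0).
  exists (Ka * K / PI). split; [apply Rdiv_lt_0_compat; nra|].
  intros f n lam phi S.
  assert (HQ := su_good _ _ _ _ S). assert (N := INRn1 _ _ _ _ S). specialize (L _ _ _ HQ).
  assert (AP := amp_pos _ _ _ _ S). assert (AI := amp_inv _ _ _ _ S). assert (AL := amp_le _ _ _ _ S). fold Ka in AL.
  set (S0 := sqrt (PI / (INR n * aphi phi / 2))) in *.
  assert (HS : forall X, Cmod (RtoC PI * X - RtoC S0) <= K * n32 n -> Cmod (RtoC (amp n phi) * X - 1) <= Ka * K / PI / INR n).
  { intros X HX. replace (RtoC (amp n phi) * X - 1)%C with (RtoC (amp n phi / PI) * (RtoC PI * X - RtoC S0))%C.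
    - rewrite Cmod_RtoC_mult, Rabs_right by (apply Rle_ge, Rlt_le, Rdiv_lt_0_compat; lra).
      assert (Sn : 0 < sqrt (INR n)) by (apply sqrt_lt_R0; lra).
      apply Rle_trans with (Ka * sqrt (INR n) / PI * (K * n32 n)).
      + apply Rmult_le_compat; auto using Cmod_ge_0. apply Rlt_le, Rdiv_lt_0_compat; lra.
        unfold Rdiv. apply Rmult_le_compat_r; auto. apply Rlt_le, Rinv_0_lt_compat; lra.
      + unfold n32. right. field. lra.
    - transitivity (RtoC (amp n phi / PI * PI) * X - RtoC (amp n phi * S0 / PI))%C.
      + replace (amp n phi * S0 / PI) with (amp n phi / PI * S0) by (field; lra). rewrite !RtoC_mult. ring.
      + rewrite AI. replace (amp n phi / PI * PI) with (amp n phi) by (field; lra). replace (PI / PI) with 1 by (field; lra). reflexivity. }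
  assert (Gin : forall z, rho / 2 <= Cmod (z - 1) -> rho / 2 <= Cmod (z + 1) -> Rabs (Re z) < 1 -> Cmod (ein f n lam phi z) <= Ka * K / PI / INR n).
  { intros z H1 H2 H3. apply Rabs_lt_between in H3.
    assert (PV := PV_Q_in f n lam (su_hol _ _ _ _ S) (su_even _ _ _ _ S) (su_2n _ _ _ _ S) (su_lam _ _ _ _ S) (su_flam _ _ _ _ S) (su_growth _ _ _ _ S) z ltac:(lra)).
    assert (B := PV_le _ _ ((1 - z * z) / 2)%C (RtoC S0) (K * n32 n) PV (L z ltac:(lra) ltac:(lra) H1 H2)).
    unfold ein. replace (RtoC (amp n phi) * (1 - z * z) * Rm f n lam z)%C with (RtoC (amp n phi) * ((1 - z * z) * Rm f n lam z))%C by ring.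
    apply HS. revert B. apply Rle_trans. right. f_equal. rewrite RtoC_mult. field. }
  assert (Gout1 : forall z, rho / 2 <= Cmod (z - 1) -> rho / 2 <= Cmod (z + 1) -> 1 < Re z -> Cmod (eout f n lam phi z) <= Ka * K / PI / INR n).
  { intros z H1 H2 H3.
    assert (PV := PV_Q_out f n lam (su_hol _ _ _ _ S) (su_even _ _ _ _ S) (su_2n _ _ _ _ S) (su_lam _ _ _ _ S) (su_flam _ _ _ _ S) (su_growth _ _ _ _ S) z ltac:(lra)).
    assert (B := PV_le _ _ ((1 - z * z) / 2)%C (RtoC S0) (K * n32 n) PV (L z ltac:(lra) ltac:(lra) H1 H2)).
    unfold eout. replace (- (RtoC (amp n phi) * (1 - z * z) * Pz f n lam z))%C with (RtoC (amp n phi) * (- (1 - z * z) * Pz f n lam z))%C by ring.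
    apply HS. revert B. apply Rle_trans. right. f_equal. unfold Pz. rewrite RtoC_opp, RtoC_mult. field.
    split; [apply Cpow_neq0; intros ->; simpl in H3; lra|apply (su_flam _ _ _ _ S)]. }
  (* [PV_Q_out] needs Re z > 1. Points of the line are reached from the right by continuity of
     [eout]; working with rho/2 leaves room for the shift. *)
  assert (Gout2 : forall z, rho <= Cmod (z - 1) -> rho <= Cmod (z + 1) -> 1 <= Re z -> Cmod (eout f n lam phi z) <= Ka * K / PI / INR n).
  { intros z H1 H2 H3. apply le_epsilon. intros e He.
    assert (Nz : z <> RtoC 0) by (intros ->; simpl in H3; lra).
    destruct (hol_ccont _ _ (eout_hol _ _ _ _ S z Nz) e He) as [d [Hd Cc]].
    set (h := Rmin (d / 2) (rho / 2)). assert (Hh1 := Rmin_l (d / 2) (rho / 2)). assert (Hh2 := Rmin_r (d / 2) (rho / 2)). fold h in Hh1, Hh2.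
    assert (Hh : 0 < h) by (apply Rmin_pos; lra).
    assert (Ah : Cmod (RtoC h) = h) by (rewrite Cmod_R, Rabs_right; lra).
    specialize (Cc (z + RtoC h)%C). replace (z + RtoC h - z)%C with (RtoC h) in Cc by ring. rewrite Ah in Cc.
    specialize (Cc ltac:(lra)).
    assert (G := Gout1 (z + RtoC h)%C).
    assert (U1 := Cmod_rev (z - 1) (- RtoC h)). assert (U2 := Cmod_rev (z + 1) (- RtoC h)). rewrite Cmod_opp, Ah in U1, U2.
    replace (z - 1 - - RtoC h)%C with (z + RtoC h - 1)%C in U1 by ring. replace (z + 1 - - RtoC h)%C with (z + RtoC h + 1)%C in U2 by ring.
    specialize (G ltac:(lra) ltac:(lra)). replace (Re (z + RtoC h)) with (Re z + h) in G by reflexivity. specialize (G ltac:(lra)).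
    assert (U := Cmod_rev (eout f n lam phi z) (eout f n lam phi (z + RtoC h))). rewrite Cmod_minus_sym in U. lra. }
  intros z H1 H2. split.
  - intros H3. apply Gin; lra.
  - intros H3. destruct (Rle_dec 0 (Re z)) as [P|P].
    + rewrite Rabs_right in H3 by lra. apply Gout2; auto.
    + rewrite Rabs_left in H3 by lra. assert (Nz : z <> RtoC 0) by (intros ->; simpl in H3; lra).
      rewrite <- (eout_even _ _ _ _ S z Nz). apply Gout2.
      * rewrite <- Cmod_opp. replace (- (- z - 1))%C with (z + 1)%C by ring. auto.
      * rewrite <- Cmod_opp. replace (- (- z + 1))%C with (z - 1)%C by ring. auto.
      * rewrite Re_opp. lra.
Qed.

(** * The local map *)

(** If a value u close to w(z0) were missed, 1/(w - u) would be holomorphic on a square around z0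
    and larger at the centre than its boundary values allow. Local injectivity keeps w away from
    w(z0) on the boundary. *)
Lemma open_map w z0 e : 0 < e -> near z0 (hol w) -> near z0 (fun z => w z = w z0 -> z = z0) ->
  exists d, 0 < d /\ forall u, Cmod (u - w z0) < d -> exists z, Cmod (z - z0) < e /\ w z = u.
Proof.
  intros He Hw Hi. destruct (near_and _ _ _ Hw Hi) as [d0 [Hd0 H]].
  destruct (small_list (d0 / 4 :: e / 4 :: nil)) as [r Hr]; [simpl; repeat split; lra|]. simpl in Hr.
  set (a := Re z0 - r). set (b := Re z0 + r). set (c := Im z0 - r). set (d := Im z0 + r).
  assert (IN : forall s, inR a b c d s -> hol w s /\ Cmod (s - z0) < e).
  { intros s Hs. assert (B := disc_square z0 r ltac:(lra) s Hs). split; [apply H; lra|lra]. }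
  assert (ON : forall s, onR a b c d s -> w s <> w z0).
  { intros s Hs E. assert (B := disc_square z0 r ltac:(lra) s ltac:(apply Hs)).
    assert (Z : s = z0) by (apply H; [lra|auto]).
    assert (R0 := onR_dist z0 a b c d r s Hs ltac:(unfold a; lra) ltac:(unfold b; lra) ltac:(unfold c; lra) ltac:(unfold d; lra)).
    rewrite Z, Cmod_self in R0. lra. }
  destruct (onR_bounded (fun s => / (w s - w z0))%C a b c d ltac:(unfold a, b; lra) ltac:(unfold c, d; lra)) as [M [HM BM]].
  { intros s Hs. apply ccont_inv; [now apply Csub_neq0, ON|]. apply ccont_minus; auto with holo. apply hol_ccont, IN, Hs. }
  assert (IM : 0 < / M) by now apply Rinv_0_lt_compat.
  exists (/ M / 8). split; [lra|]. intros u Hu. apply NNPP. intros Hno.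
  assert (Nu : forall s, Cmod (s - z0) < e -> (w s - u)%C <> RtoC 0).
  { intros s Hs E. apply Hno. exists s. split; auto. replace (w s) with (w s - u + u)%C by ring. rewrite E. ring. }
  assert (B := interior_bound (fun s => / (w s - u))%C z0 r z0 (2 * M) r ltac:(lra) ltac:(lra)).
  assert (B1 : Cmod (/ (w z0 - u)) <= 2 * r / r * (2 * M)).
  { apply B.
    - intros s Hs. apply hol_inv; [apply Nu, IN, Hs|]. apply hol_minus; auto with holo. apply IN, Hs.
    - intros s Hs. specialize (BM s Hs). rewrite Cmod_inv in BM by (now apply Csub_neq0, ON).
      rewrite Cmod_inv by (apply Nu, IN, Hs).
      assert (P : 0 < Cmod (w s - w z0)) by (apply Cmod_sub_gt0, ON, Hs).
      assert (L1 : / M <= Cmod (w s - w z0)).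
      { rewrite <- (Rinv_inv (Cmod (w s - w z0))). apply Rinv_le_contravar; auto. now apply Rinv_0_lt_compat. }
      assert (U := Cmod_rev (w s - w z0) (u - w z0)).
      replace (w s - w z0 - (u - w z0))%C with (w s - u)%C in U by ring.
      apply Rle_trans with (/ (/ M / 2)). apply Rinv_le_contravar; lra. right; field; lra.
    - rewrite Cmod_self. lra. }
  assert (N0 : (w z0 - u)%C <> RtoC 0) by (apply Nu; rewrite Cmod_self; lra).
  rewrite Cmod_inv in B1 by auto. rewrite Cmod_minus_sym in Hu.
  assert (P : 0 < Cmod (w z0 - u)) by (apply Cmod_gt_0; auto).
  replace (2 * r / r * (2 * M)) with (4 * M) in B1 by (field; lra).
  assert (C : / (/ M / 8) < / Cmod (w z0 - u)) by (apply Rinv_lt_contravar; auto; apply Rmult_lt_0_compat; lra).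
  replace (/ (/ M / 8)) with (8 * M) in C by (field; lra). lra.
Qed.

(* Principal branch on the right half-plane. *)
Definition csqrt (u : C) : C := let p := sqrt ((Cmod u + Re u) / 2) in (p, Im u / (2 * p)).

Lemma csqrt_sqr u : 0 < Re u -> (csqrt u * csqrt u)%C = u.
Proof.
  destruct u as [x y]. simpl Re. intros Hx. unfold csqrt. simpl Re. simpl Im.
  assert (N := Cmod_sqr x y). assert (P := Cmod_ge_0 (x, y)). set (m := Cmod (x, y)) in *.
  assert (Pp : 0 < sqrt ((m + x) / 2)) by (apply sqrt_lt_R0; lra).
  assert (E : sqrt ((m + x) / 2) * sqrt ((m + x) / 2) = (m + x) / 2) by (apply sqrt_sqrt; lra).
  set (p := sqrt ((m + x) / 2)) in *. unfold Cmult; simpl. f_equal; [|field; lra].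
  replace (y / (2 * p) * (y / (2 * p))) with (y * y / (4 * (p * p))) by (field; lra). rewrite E.
  replace (y * y) with ((m + x) * (m - x)) by lra. field. lra.
Qed.

Lemma csqrt_Re u : 1 / 4 <= Re u -> 1 / 2 <= Re (csqrt u).
Proof.
  intros H. unfold csqrt. simpl. replace (1 / 2) with (sqrt (1 / 2 * (1 / 2))) by (apply sqrt_square; lra).
  apply sqrt_le_1_alt. assert (A := Re_le_Cmod u). rewrite Rabs_right in A by lra. lra.
Qed.

(** Both roots have real part at least 1/2, so dividing by their sum does not increase the
    modulus. *)
Lemma csqrt_gap u v : 1 / 4 <= Re u -> 1 / 4 <= Re v -> Cmod (csqrt u - csqrt v) <= Cmod (u - v).
Proof.
  intros Hu Hv. replace (u - v)%C with ((csqrt u - csqrt v) * (csqrt u + csqrt v))%C.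
  - rewrite Cmod_mult. rewrite <- (Rmult_1_r (Cmod (csqrt u - csqrt v))) at 1.
    apply Rmult_le_compat_l; [apply Cmod_ge_0|]. eapply Rle_trans; [|apply Re_le_Cmod]. eapply Rle_trans; [|apply Rle_abs].
    assert (A := csqrt_Re u Hu). assert (B := csqrt_Re v Hv). change (1 <= Re (csqrt u) + Re (csqrt v)). lra.
  - rewrite <- (csqrt_sqr u) at 3 by lra. rewrite <- (csqrt_sqr v) at 3 by lra. ring.
Qed.

(** The difference quotient of the root is that of h divided by the sum of the two roots, a
    continuous function. *)
Lemma csqrt_comp_hol h z : near z (hol h) -> near z (fun y => 1 / 4 <= Re (h y)) -> hol (fun y => csqrt (h y)) z.
Proof.
  intros H1 H2. assert (Hz := near_self _ _ H1). assert (Rz := near_self _ _ H2). simpl in Rz.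
  destruct Hz as [l Hl]. set (q := fun y => (slope h z l y / (csqrt (h y) + csqrt (h z)))%C).
  assert (NN : forall y, 1 / 4 <= Re (h y) -> (csqrt (h y) + csqrt (h z))%C <> RtoC 0).
  { intros y Hy E. apply (f_equal Re) in E. change (Re (csqrt (h y)) + Re (csqrt (h z)) = 0) in E.
    assert (A := csqrt_Re (h y) Hy). assert (B := csqrt_Re (h z) Rz). lra. }
  exists (q z). apply (slope_cder (fun y => csqrt (h y)) z q).
  - unfold q. apply ccont_div; [now apply NN|now apply cder_slope|]. apply ccont_plus; auto with holo.
    intros e He. destruct (near_and _ _ _ (cder_ccont _ _ _ Hl e He) H2) as [d [Hd HH]]. exists d. split; auto.
    intros y Hy. destruct (HH y Hy) as [A B]. eapply Rle_lt_trans; [apply csqrt_gap; auto|exact A].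
  - revert H2. apply near_mono. intros y Hy. unfold q.
    assert (E := slope_eq h z l y).
    replace (csqrt (h z) + (y - z) * (slope h z l y / (csqrt (h y) + csqrt (h z))))%C with
      ((csqrt (h z) * csqrt (h z) + csqrt (h z) * csqrt (h y) + (y - z) * slope h z l y) / (csqrt (h y) + csqrt (h z)))%C by (field; auto).
    rewrite csqrt_sqr by lra. replace (h z + csqrt (h z) * csqrt (h y) + (y - z) * slope h z l y)%C with (csqrt (h z) * csqrt (h y) + h y)%C by (rewrite E at 2; ring).
    rewrite <- (csqrt_sqr (h y)) at 3 by lra. field. auto.
Qed.

Lemma csqrt_R x : 0 < x -> csqrt (RtoC x) = RtoC (sqrt x).
Proof.
  intros Hx. unfold csqrt. simpl. rewrite Cmod_R, Rabs_right by lra. replace ((x + x) / 2) with x by field.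
  unfold RtoC. f_equal. unfold Rdiv. ring.
Qed.

(* Radius around 1 on which the square root of -phi/(z-1)^2 exists and w is bi-Lipschitz. *)
Definition rloc : R := / (8192 * Cphi).

Lemma rloc_pos : 0 < rloc.
Proof. unfold rloc. apply Rinv_0_lt_compat. unfold Cphi. lra. Qed.

Lemma rloc_C : Cphi * rloc = / 8192.
Proof. unfold rloc. field. unfold Cphi. lra. Qed.

Lemma rloc_le : rloc <= / 8192.
Proof. rewrite <- rloc_C. assert (P := rloc_pos). unfold Cphi. lra. Qed.

Section Local.
Variables (f : C -> C) (n : nat) (lam : R) (phi : C -> C).
Hypothesis S : setup f n lam phi.

Definition psi (z : C) : C := (- dq phi 1 2 z)%C.
Definition Sr (z : C) : C := csqrt (psi z).
(** Explicit candidate for w: since phi = -(z - 1)^2 psi, its square is phi. Being built from [phi]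
    alone, it obeys bounds with absolute constants. *)
Definition wt (z : C) : C := (- Ci * (z - 1) * Sr z)%C.

Lemma psi_near z : Cmod (z - 1) <= 1 / 2 -> near z (hol psi).
Proof. intros H. generalize (su_dq_near _ _ _ _ S 2 z H). apply near_mono. intros y Hy. unfold psi. now apply hol_opp. Qed.

Lemma psi_1 : psi 1 = RtoC (aphi phi / 2).
Proof. unfold psi. rewrite (su_dq2 _ _ _ _ S), <- RtoC_opp. f_equal. field. Qed.

Lemma psi_bound z : Cmod (z - 1) <= 1 / 64 -> Cmod (psi z) <= Cphi.
Proof. intros H. unfold psi. rewrite Cmod_opp. apply (su_dq_bound _ _ _ _ S); auto. Qed.

Lemma psi_lip y z : Cmod (y - 1) <= 1 / 256 -> Cmod (z - 1) <= 1 / 256 -> Cmod (psi y - psi z) <= 1024 * Cphi * Cmod (y - z).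
Proof.
  intros Hy Hz. replace (1024 * Cphi) with (8 * Cphi / (1 / 128)) by field.
  apply (cauchy_lipschitz psi 1 (1 / 128)); try lra. unfold Cphi; lra.
  - intros s Hs. apply near_self. apply psi_near; lra.
  - intros s Hs. apply psi_bound; lra.
Qed.

(** psi(1) = a/2 >= 1/2, and the Lipschitz bound over distance 2 rloc moves psi by at most 2048 Cphi
    rloc = 1/4. This is one reason for the 8192 in [rloc]. *)
Lemma psi_Re z : Cmod (z - 1) <= 2 * rloc -> 1 / 4 <= Re (psi z).
Proof.
  intros H. assert (RL := rloc_le). assert (RC := rloc_C).
  assert (L := psi_lip z 1 ltac:(lra) ltac:(rewrite Cmod_self; lra)).
  assert (D : Cmod (psi z - psi 1) <= 1 / 4).
  { eapply Rle_trans; [exact L|]. apply Rle_trans with (1024 * Cphi * (2 * rloc)); [apply Rmult_le_compat_l; [unfold Cphi; lra|auto]|]. lra. }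
  assert (A := su_a _ _ _ _ S). assert (B := Re_le_Cmod (psi z - psi 1)). rewrite psi_1 in *.
  change (Re (psi z - RtoC (aphi phi / 2))) with (Re (psi z) - aphi phi / 2) in B. apply Rabs_le_between in B. lra.
Qed.

Lemma Sr_hol z : Cmod (z - 1) < 2 * rloc -> hol Sr z.
Proof.
  intros H. assert (RL := rloc_le). apply csqrt_comp_hol. apply psi_near; lra.
  generalize (near_ball z 1 (2 * rloc) H). apply near_mono. intros y Hy. apply psi_Re; lra.
Qed.

Lemma Sr_sqr z : Cmod (z - 1) <= 2 * rloc -> (Sr z * Sr z)%C = psi z.
Proof. intros H. apply csqrt_sqr. assert (A := psi_Re z H). lra. Qed.

Lemma Sr_Re z : Cmod (z - 1) <= 2 * rloc -> 1 / 2 <= Re (Sr z).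
Proof. intros H. now apply csqrt_Re, psi_Re. Qed.

Lemma Sr_lower z : Cmod (z - 1) <= 2 * rloc -> 1 / 2 <= Cmod (Sr z).
Proof. intros H. assert (A := Sr_Re z H). assert (B := Re_le_Cmod (Sr z)). rewrite Rabs_right in B; lra. Qed.

Lemma Sr_upper z : Cmod (z - 1) <= 2 * rloc -> Cmod (Sr z) <= Cphi.
Proof.
  intros H. assert (RL := rloc_le). assert (B := psi_bound z ltac:(lra)). rewrite <- Sr_sqr, Cmod_mult in B by auto.
  destruct (Rle_dec (Cmod (Sr z)) 1); [unfold Cphi; lra|nra].
Qed.

Lemma Sr_1 : Sr 1 = RtoC (sqrt (aphi phi / 2)).
Proof. unfold Sr. rewrite psi_1. apply csqrt_R. assert (A := su_a _ _ _ _ S). lra. Qed.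

Lemma Sr_lip y z : Cmod (y - 1) <= 2 * rloc -> Cmod (z - 1) <= 2 * rloc -> Cmod (Sr y - Sr z) <= 1024 * Cphi * Cmod (y - z).
Proof.
  intros Hy Hz. assert (RL := rloc_le). eapply Rle_trans; [apply csqrt_gap; now apply psi_Re|]. apply psi_lip; lra.
Qed.

Lemma wt_sqr z : Cmod (z - 1) <= 2 * rloc -> (wt z * wt z)%C = phi z.
Proof.
  intros H. unfold wt. replace (- Ci * (z - 1) * Sr z * (- Ci * (z - 1) * Sr z))%C with (Ci * Ci * (z - 1) * (z - 1) * (Sr z * Sr z))%C by ring.
  rewrite Sr_sqr by auto. rewrite (su_phi2 _ _ _ _ S z). unfold psi.
  replace (Ci * Ci)%C with (- RtoC 1)%C by (unfold Ci, Cmult, Copp, RtoC; simpl; f_equal; ring). ring.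
Qed.

Lemma wt_hol z : Cmod (z - 1) < 2 * rloc -> hol wt z.
Proof. intros H. unfold wt. apply hol_mult; [auto 6 with holo|now apply Sr_hol]. Qed.

Lemma Cmod_wt z : Cmod (wt z) = Cmod (z - 1) * Cmod (Sr z).
Proof. unfold wt. rewrite !Cmod_mult, Cmod_opp, Cmod_Ci. ring. Qed.

Lemma wt_lower z : Cmod (z - 1) <= 2 * rloc -> Cmod (z - 1) / 2 <= Cmod (wt z).
Proof. intros H. rewrite Cmod_wt. assert (A := Sr_lower z H). assert (B := Cmod_ge_0 (z - 1)). nra. Qed.

Lemma wt_upper z : Cmod (z - 1) <= 2 * rloc -> Cmod (wt z) <= Cphi * Cmod (z - 1).
Proof. intros H. rewrite Cmod_wt, Rmult_comm. apply Rmult_le_compat_r; [apply Cmod_ge_0|now apply Sr_upper]. Qed.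

(** Equality of the values gives (y - z) Sr(y) = -(z - 1)(Sr(y) - Sr(z)). The left side is at least
    |y - z|/2, the right side at most |y - z|/4 by the choice of [rloc]. *)
Lemma wt_inj y z : Cmod (y - 1) <= 2 * rloc -> Cmod (z - 1) <= 2 * rloc -> wt y = wt z -> y = z.
Proof.
  intros Hy Hz E. apply NNPP. intros N. assert (P := Cmod_sub_gt0 _ _ N).
  assert (E2 : ((y - z) * Sr y)%C = (- ((z - 1) * (Sr y - Sr z)))%C).
  { assert (E3 : (Ci * wt y)%C = (Ci * wt z)%C) by now rewrite E. unfold wt in E3.
    assert (CC : (Ci * Ci)%C = (- RtoC 1)%C) by (unfold Ci, Cmult, Copp, RtoC; simpl; f_equal; ring).
    replace (Ci * (- Ci * (y - 1) * Sr y))%C with (- (Ci * Ci) * ((y - 1) * Sr y))%C in E3 by ring.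
    replace (Ci * (- Ci * (z - 1) * Sr z))%C with (- (Ci * Ci) * ((z - 1) * Sr z))%C in E3 by ring. rewrite CC in E3.
    replace ((y - z) * Sr y)%C with (- - RtoC 1 * ((y - 1) * Sr y) - (z - 1) * Sr y)%C by ring. rewrite E3. ring. }
  apply (f_equal Cmod) in E2. rewrite Cmod_opp, !Cmod_mult in E2.
  assert (A := Sr_lower y Hy). assert (L := Sr_lip y z Hy Hz). assert (RC := rloc_C).
  assert (B : Cmod (z - 1) * Cmod (Sr y - Sr z) <= 2 * rloc * (1024 * Cphi * Cmod (y - z))).
  { apply Rmult_le_compat; auto using Cmod_ge_0. }
  replace (2 * rloc * (1024 * Cphi * Cmod (y - z))) with (2048 * (Cphi * rloc) * Cmod (y - z)) in B by ring. rewrite RC in B. nra.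
Qed.
End Local.

Lemma path_ivt (k : R -> C) (m : C -> R) a b : a < b -> (forall x y, Rabs (m x - m y) <= Cmod (x - y)) ->
  (forall t, a <= t <= b -> rcont k t) -> m (k a) < 0 -> 0 < m (k b) -> exists t, a <= t <= b /\ m (k t) = 0.
Proof.
  intros Hab Hm Hk Ha Hb. destruct (IVT_interv (fun t => m (k t)) a b) as [t [T1 T2]]; auto.
  - intros t Ht e He. destruct (Hk t Ht e He) as [d [Hd H]]. exists d. split; auto.
    intros x [_ Hx]. unfold dist in *; simpl in *. unfold R_dist in *. eapply Rle_lt_trans; [apply Hm|]. now apply H.
  - now exists t.
Qed.

(** * Identification of w with the explicit root *)

Section LocalMap.
Variables (f : C -> C) (n : nat) (lam : R) (phi : C -> C) (delta : R) (B1 : C -> Prop) (w : C -> C).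
Hypothesis S : setup f n lam phi.
Hypothesis Hd : 0 < delta < rloc / 4.
Hypothesis HL : is_local_map phi delta B1 w.

Lemma B1_near z : B1 z -> near z B1.
Proof. intros H. apply locally_near. destruct HL as [O _]. now apply O. Qed.

Lemma w_hol z : B1 z -> hol w z.
Proof. intros H. apply hol_ex_derive. destruct HL as [_ [_ [O _]]]. now apply O. Qed.

Lemma w_inv : exists g : C -> C, forall u, Cmod u < delta -> B1 (g u) /\ w (g u) = u.
Proof.
  destruct HL as [_ [_ [_ [_ [_ [_ [_ [H _]]]]]]]].
  exists (fun u => epsilon (inhabits (RtoC 0)) (fun z => B1 z /\ w z = u)).
  intros u Hu. apply epsilon_spec, H, Hu.
Qed.

Lemma w_inj z z' : B1 z -> B1 z' -> w z = w z' -> z = z'.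
Proof. destruct HL as [_ [_ [_ [_ [_ [_ [H _]]]]]]]. apply H. Qed.

Lemma w_lt z : B1 z -> Cmod (w z) < delta.
Proof. destruct HL as [_ [_ [_ [_ [_ [H _]]]]]]. apply H. Qed.

Lemma w_sqr z : B1 z -> (w z * w z)%C = phi z.
Proof. destruct HL as [_ [_ [_ [H _]]]]. apply H. Qed.

Lemma B1_1 : B1 (RtoC 1).
Proof. apply HL. Qed.

Lemma w_1 : w 1 = RtoC 0.
Proof.
  assert (E := w_sqr 1 B1_1). rewrite (su_phi2 _ _ _ _ S 1) in E.
  replace ((1 - 1) * (1 - 1) * dq phi 1 2 1)%C with (RtoC 0) in E by ring.
  destruct (Ceq_dec (w 1) 0) as [Z|Z]; [exact Z|]. now apply (Cmult_integral (w 1)).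
Qed.

Section Inverse.
Variable g : C -> C.
Hypothesis Hg : forall u, Cmod u < delta -> B1 (g u) /\ w (g u) = u.

Lemma g_cont u : Cmod u < delta -> ccont g u.
Proof.
  intros Hu. destruct (Hg u Hu) as [G1 G2]. intros e He.
  destruct (near_and _ _ _ (B1_near _ G1) (near_ball (g u) (g u) e ltac:(rewrite Cmod_self; lra))) as [r0 [Hr0 N0]].
  destruct (open_map w (g u) (Rmin e r0)) as [d [Hd0 H]].
  - apply Rmin_pos; lra.
  - generalize (B1_near _ G1). apply near_mono. apply w_hol.
  - generalize (B1_near _ G1). apply near_mono. intros z Hz E. now apply w_inj.
  - rewrite G2 in H. assert (NU := near_ball u 0 delta). replace (u - 0)%C with u in NU by ring.
    destruct (NU Hu) as [d' [Hd' H']]. exists (Rmin d d'). split; [apply Rmin_pos; lra|]. intros v Hv.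
    assert (M1 := Rmin_l d d'). assert (M2 := Rmin_r d d').
    assert (Hv' : Cmod v < delta). { specialize (H' v ltac:(lra)). now replace (v - 0)%C with v in H' by ring. }
    destruct (H v ltac:(lra)) as [z [Z1 Z2]]. assert (M3 := Rmin_l e r0). assert (M4 := Rmin_r e r0).
    assert (Bz : B1 z) by (apply N0; lra).
    destruct (Hg v Hv') as [G3 G4]. replace (g v) with z; [lra|]. apply w_inj; auto. congruence.
Qed.

Lemma g_0 : g 0 = RtoC 1.
Proof.
  destruct (Hg 0) as [G1 G2]; [rewrite Cmod_0; lra|]. apply w_inj; auto using B1_1. now rewrite G2, w_1.
Qed.

Lemma ray_cont u t : Cmod u < delta -> 0 <= t <= 1 -> rcont (fun t => g (RtoC t * u)%C) t.
Proof.
  intros Hu Ht. apply (rcont_comp g (fun t => RtoC t * u)%C).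
  - apply g_cont. rewrite Cmod_RtoC_mult, Rabs_right by lra. assert (P := Cmod_ge_0 u). nra.
  - apply rcont_ext with (fun t => 0 + RtoC t * u)%C; [intros; ring|apply rcont_line].
Qed.

Lemma ray_lt u t : Cmod u < delta -> 0 <= t <= 1 -> Cmod (RtoC t * u) < delta.
Proof. intros Hu Ht. rewrite Cmod_RtoC_mult, Rabs_right by lra. assert (P := Cmod_ge_0 u). nra. Qed.

(* The image of a ray cannot cross the circle |z - 1| = rloc, where |w| > delta. *)
Lemma g_disc u : Cmod u < delta -> Cmod (g u - 1) < rloc.
Proof.
  intros Hu. apply Rnot_le_lt. intros Hge.
  assert (KEY : forall t, 0 <= t <= 1 -> Cmod (g (RtoC t * u)%C - 1) = rloc -> False).
  { intros t Ht E. assert (TU := ray_lt u t Hu Ht). destruct (Hg _ TU) as [G1 G2].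
    set (z := g (RtoC t * u)%C) in *. assert (A := wt_lower f n lam phi S z ltac:(lra)).
    assert (B := wt_sqr f n lam phi S z ltac:(lra)). rewrite <- w_sqr, G2 in B by auto.
    apply (f_equal Cmod) in B. rewrite (Cmod_mult (wt phi z)), (Cmod_mult (RtoC t * u)) in B. assert (P := Cmod_ge_0 (RtoC t * u)). rewrite E in A.
    assert (X := Rmult_le_0_lt_compat (Cmod (RtoC t * u)) (Cmod (wt phi z)) (Cmod (RtoC t * u)) (Cmod (wt phi z)) P P ltac:(lra) ltac:(lra)). lra. }
  destruct Hge as [Hgt|Heq].
  - destruct (path_ivt (fun t => g (RtoC t * u)%C) (fun z => Cmod (z - 1) - rloc) 0 1) as [t [T1 T2]]; try lra.
    + intros x y. replace (Cmod (x - 1) - rloc - (Cmod (y - 1) - rloc)) with (Cmod (x - 1) - Cmod (y - 1)) by ring.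
      replace (x - y)%C with ((x - 1) - (y - 1))%C by ring. apply Rabs_le. split.
      * assert (A := Cmod_rev (y - 1) (x - 1)). rewrite (Cmod_minus_sym (y - 1)) in A. lra.
      * apply Cmod_rev.
    + intros t Ht. now apply ray_cont.
    + rewrite Cmult_0_l, g_0, Cmod_self. lra.
    + rewrite Cmult_1_l. lra.
    + apply (KEY t); lra.
  - apply (KEY 1); [lra|]. rewrite Cmult_1_l. lra.
Qed.
End Inverse.

Lemma B1_rloc z : B1 z -> Cmod (z - 1) < rloc.
Proof.
  intros H. destruct w_inv as [g Hg]. assert (L := w_lt z H).
  assert (E : g (w z) = z). { destruct (Hg _ L). now apply w_inj. }
  rewrite <- E. now apply g_disc.
Qed.

Lemma w_pm z : B1 z -> w z = wt phi z \/ w z = (- wt phi z)%C.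
Proof.
  intros H. assert (R := B1_rloc z H).
  assert (E := w_sqr z H). rewrite <- (wt_sqr f n lam phi S) in E by lra.
  assert (E2 : ((w z - wt phi z) * (w z + wt phi z))%C = RtoC 0).
  { replace ((w z - wt phi z) * (w z + wt phi z))%C with (w z * w z - wt phi z * wt phi z)%C by ring. rewrite E. ring. }
  destruct (Ceq_dec (w z - wt phi z) 0) as [Z|Z]; [|apply (Cmult_integral _ _ E2) in Z].
  - left. replace (w z) with (w z - wt phi z + wt phi z)%C by ring. rewrite Z. ring.
  - right. replace (w z) with (w z + wt phi z - wt phi z)%C by ring. rewrite Z. ring.
Qed.

(** With the minus sign the prescribed expansion would read Sr(z) + s = -s r. But Re Sr > 0 makes
    the left side larger than s in modulus, while |r| <= 1 near 1. *)
Lemma w_near_1 : exists e, 0 < e /\ forall z, B1 z -> Cmod (z - 1) < e -> w z = wt phi z.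
Proof.
  assert (HL' := HL). destruct HL' as [_ [_ [_ [_ [[K [eps [He H]]] _]]]]].
  exists (Rmin eps (/ (Rabs K + 1))). assert (PK := Rabs_pos K).
  split; [apply Rmin_pos; auto; apply Rinv_0_lt_compat; lra|].
  intros z Hz Hze. assert (M1 := Rmin_l eps (/ (Rabs K + 1))). assert (M2 := Rmin_r eps (/ (Rabs K + 1))).
  destruct (w_pm z Hz) as [E|E]; auto. destruct (H z Hz ltac:(lra)) as [r [R1 R2]].
  destruct (Ceq_dec z 1) as [->|N].
  { rewrite E. unfold wt. ring. }
  exfalso. assert (A := su_a _ _ _ _ S).
  replace (- Re (ddphi1 phi) / 2) with (aphi phi / 2) in R2.
  2: { rewrite (su_ddphi _ _ _ _ S). simpl. field. }
  set (s := sqrt (aphi phi / 2)) in *.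
  assert (Ps : 0 < s) by (apply sqrt_lt_R0; lra).
  assert (SR := Sr_Re f n lam phi S z ltac:(assert (T := B1_rloc z Hz); lra)).
  assert (EQ : (Sr phi z + RtoC s)%C = (- (RtoC s * r))%C).
  { rewrite E in R2. unfold wt in R2.

    replace (Sr phi z) with (- (- Ci * (z - 1) * Sr phi z) / (Ci * (z - 1)))%C by (field; split; [now apply Csub_neq0|apply Cmod_neq0; rewrite Cmod_Ci; lra]).
    rewrite R2. field. split; [now apply Csub_neq0|apply Cmod_neq0; rewrite Cmod_Ci; lra]. }
  assert (L : s < Cmod (Sr phi z + RtoC s)).
  { eapply Rlt_le_trans; [|apply Re_le_Cmod]. eapply Rlt_le_trans; [|apply Rle_abs]. change (s < Re (Sr phi z) + s). lra. }
  rewrite EQ, Cmod_opp, Cmod_RtoC_mult, Rabs_right in L by lra.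
  assert (R3 : Cmod r <= 1).
  { eapply Rle_trans; [exact R1|]. apply Rle_trans with ((Rabs K + 1) * / (Rabs K + 1)); [|right; field; lra].
    assert (T := Rle_abs K). apply Rle_trans with ((Rabs K + 1) * Cmod (z - 1)).
    - apply Rmult_le_compat_r; [apply Cmod_ge_0|lra].
    - apply Rmult_le_compat_l; lra. }
  nra.
Qed.

(* The sign in w = +-wt is constant along rays of the image disc. *)
Lemma w_wt z : B1 z -> w z = wt phi z.
Proof.
  intros Hz. destruct (w_pm z Hz) as [E|E]; auto.
  destruct w_inv as [g Hg]. destruct w_near_1 as [e [He NE]].
  set (u := w z) in *. assert (Hu : Cmod u < delta) by apply (w_lt z Hz).
  assert (Gz : g u = z). { destruct (Hg _ Hu). now apply w_inj. }
  destruct (Ceq_dec u 0) as [Zu|Zu].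
  { rewrite Zu in E |- *. replace (wt phi z) with (- - wt phi z)%C by ring. rewrite <- E. ring. }
  exfalso. assert (Pu : 0 < Cmod u) by now apply Cmod_gt_0.
  destruct (g_cont g Hg 0 ltac:(rewrite Cmod_0; lra) e He) as [d [Hd0 GC]].
  destruct (small_list (1 / 2 :: d / (2 * Cmod u) :: nil)) as [t0 Ht0].
  { simpl. split; [lra|]. split; [apply Rdiv_lt_0_compat; lra|auto]. } simpl in Ht0.
  assert (K1 : forall t, 0 <= t <= 1 -> B1 (g (RtoC t * u)%C) /\ w (g (RtoC t * u)%C) = (RtoC t * u)%C).
  { intros t Ht. apply Hg. now apply ray_lt. }
  (* On the ray Re(wt/u) is t or -t; it equals t0 at the start and -1 at the end, so it would have
     to vanish at some t >= t0. *)
  destruct (path_ivt (fun t => wt phi (g (RtoC t * u)%C) / u)%C (fun v => - Re v) t0 1) as [t [T1 T2]]; try lra.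
  - intros x y. replace (- Re x - - Re y) with (- Re (x - y)) by (unfold Re; simpl; ring). rewrite Rabs_Ropp. apply Re_le_Cmod.
  - intros t Ht. apply rcont_ext with (fun t => / u * wt phi (g (RtoC t * u)))%C; [intros; unfold Cdiv; ring|]. apply rcont_scal.
    apply (rcont_comp (wt phi) (fun t => g (RtoC t * u)%C)); [|apply (ray_cont g Hg); auto; lra].
    apply hol_ccont. apply (wt_hol f n lam phi S). destruct (K1 t ltac:(lra)) as [G1 _]. assert (A := B1_rloc _ G1). lra.
  - destruct (K1 t0 ltac:(lra)) as [G1 G2]. rewrite <- NE; auto.
    + rewrite G2. replace (RtoC t0 * u / u)%C with (RtoC t0) by (field; auto). simpl. lra.
    + rewrite <- (g_0 g Hg). apply GC. replace (RtoC t0 * u - 0)%C with (RtoC t0 * u)%C by ring.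
      rewrite Cmod_RtoC_mult, Rabs_right by lra.
      apply Rle_lt_trans with (d / (2 * Cmod u) * Cmod u); [apply Rmult_le_compat_r; lra|].
      replace (d / (2 * Cmod u) * Cmod u) with (d / 2) by (field; lra). lra.
  - rewrite Cmult_1_l, Gz. replace (wt phi z / u)%C with (- RtoC 1)%C. simpl. lra.
    rewrite E at 1. field. intros Z. apply Zu. rewrite E, Z. ring.
  - destruct (K1 t ltac:(lra)) as [G1 G2].
    assert (Q : Re (wt phi (g (RtoC t * u)) / u)%C = t \/ Re (wt phi (g (RtoC t * u)) / u)%C = - t).
    { destruct (w_pm _ G1) as [E1|E1]; rewrite G2 in E1.
      - left. rewrite <- E1. replace (RtoC t * u / u)%C with (RtoC t) by (field; auto). reflexivity.
      - right. replace (wt phi (g (RtoC t * u)%C)) with (- - wt phi (g (RtoC t * u)%C))%C by ring. rewrite <- E1.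
        replace (- (RtoC t * u) / u)%C with (RtoC (- t)) by (rewrite RtoC_opp; field; auto). reflexivity. }
    lra.
Qed.

Lemma B1_delta z : B1 z -> Cmod (z - 1) <= 2 * delta.
Proof.
  intros H. assert (A := B1_rloc z H). assert (B := w_lt z H). rewrite w_wt in B by auto.
  assert (L := wt_lower f n lam phi S z ltac:(lra)). lra.
Qed.

(** Together with [B1_delta] this encloses [B1] between two discs whose radii do not depend on n. *)
Lemma B1_contains z : Cmod (z - 1) <= rloc -> Cphi * Cmod (z - 1) < delta -> B1 z.
Proof.
  intros H1 H2. destruct w_inv as [g Hg].
  assert (U := wt_upper f n lam phi S z ltac:(lra)). destruct (Hg (wt phi z) ltac:(lra)) as [G1 G2].
  rewrite w_wt in G2 by auto. assert (A := B1_rloc _ G1).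
  rewrite <- (wt_inj f n lam phi S (g (wt phi z)) z ltac:(lra) ltac:(lra) G2). exact G1.
Qed.
End LocalMap.

(** * The error near the saddle points *)

Lemma Ci_sqr : (Ci * Ci)%C = (- RtoC 1)%C.
Proof. unfold Ci, Cmult, Copp, RtoC; simpl; f_equal; ring. Qed.

Lemma Ci_neq0 : Ci <> RtoC 0.
Proof. apply Cmod_neq0. rewrite Cmod_Ci. lra. Qed.

Section Inner.
Variables (f : C -> C) (n : nat) (lam : R) (phi : C -> C).
Hypothesis S : setup f n lam phi.

Local Notation Q := (Qf f n lam).
Local Notation rn := (sqrt (INR n)).
Local Notation Pn := (Pz f n lam).

Definition c0 : R := 1 / sqrt (2 * PI * aphi phi).

Lemma c0_den : 1 <= sqrt (2 * PI * aphi phi).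
Proof.
  assert (A := su_a _ _ _ _ S). assert (P := PI2_1). rewrite <- sqrt_1 at 1. apply sqrt_le_1_alt. nra.
Qed.

Lemma c0_pos : 0 < c0 <= 1.
Proof.
  assert (A := c0_den). unfold c0. split. apply Rdiv_lt_0_compat; lra.
  unfold Rdiv. rewrite Rmult_1_l, <- Rinv_1. apply Rinv_le_contravar; lra.
Qed.

Lemma rn_pos : 0 < rn.
Proof. apply sqrt_lt_R0. assert (N := INRn1 _ _ _ _ S). lra. Qed.

Lemma rn_sqr : rn * rn = INR n.
Proof. apply sqrt_sqrt. apply pos_INR. Qed.

Lemma amp_c0 : amp n phi * (2 * c0) = rn.
Proof. assert (A := c0_den). unfold amp, c0. field. lra. Qed.

Lemma h0_eq z : h0 phi z = (RtoC c0 * (2 / (1 - z * z)))%C.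
Proof.
  unfold h0, c0. rewrite (su_ddphi _ _ _ _ S), Cmod_R, Rabs_left by (assert (A := su_a _ _ _ _ S); lra).
  now rewrite Ropp_involutive.
Qed.

Lemma h0_amp z : (1 - z * z)%C <> RtoC 0 -> (h0 phi z * (RtoC (amp n phi) * (1 - z * z)))%C = RtoC rn.
Proof.
  intros H. rewrite h0_eq, <- amp_c0, !RtoC_mult. field. auto.
Qed.

Lemma h0_eout z : (1 - z * z)%C <> RtoC 0 -> (h0 phi z * (1 + eout f n lam phi z))%C = (- (RtoC rn * Pn z))%C.
Proof. intros H. rewrite <- (h0_amp z H). unfold eout. ring. Qed.

Lemma h0_ein z : (1 - z * z)%C <> RtoC 0 -> (h0 phi z * (1 + ein f n lam phi z))%C = (RtoC rn * Rm f n lam z)%C.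
Proof. intros H. rewrite <- (h0_amp z H). unfold ein. ring. Qed.

Lemma h0_jump z : z <> RtoC 0 -> (1 - z * z)%C <> RtoC 0 ->
  (h0 phi z * eout f n lam phi z)%C = (h0 phi z * ein f n lam phi z - RtoC rn * Q z)%C.
Proof. intros Hz H. rewrite (ein_eout _ _ _ _ S z Hz), <- (h0_amp z H). ring. Qed.

Definition sz (z : C) : C := (Ci * RtoC rn * wt phi z)%C.
(** The formula of the theorem inside the disc around 1, solved for the error, with [wt] in place of
    w. *)
Definition Ein (z : C) : C := (RtoC rn * (Q z * (RtoC (1 / 2) * Cerfc (sz z)) - Pn z))%C.
(** The value predicted for the error inside the disc. *)
Definition bfun (z : C) : C := (h0 phi z + RtoC 1 / (RtoC 2 * Ci * RtoC (sqrt PI) * wt phi z))%C.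

Lemma sz_eq z : sz z = (RtoC rn * ((z - 1) * Sr phi z))%C.
Proof.
  unfold sz, wt. replace (Ci * RtoC rn * (- Ci * (z - 1) * Sr phi z))%C with (- (Ci * Ci) * RtoC rn * (z - 1) * Sr phi z)%C by ring.
  rewrite Ci_sqr. ring.
Qed.

Lemma disc_right z : Cmod (z - 1) <= 2 * rloc -> 1 / 400 < Re z.
Proof. intros H. assert (L := rloc_le). destruct (disc_Re _ _ _ H) as [A _]. simpl in A. lra. Qed.

Lemma Q_sz z : Cmod (z - 1) <= 2 * rloc -> Q z = Cexp (sz z * sz z).
Proof.
  intros H. rewrite (su_Q_exp _ _ _ _ S) by now apply disc_right. f_equal. rewrite <- (wt_sqr f n lam phi S z H), <- rn_sqr, RtoC_mult.
  unfold sz. replace (Ci * RtoC rn * wt phi z * (Ci * RtoC rn * wt phi z))%C with (Ci * Ci * (RtoC rn * RtoC rn * (wt phi z * wt phi z)))%C by ring.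
  rewrite Ci_sqr. ring.
Qed.

Lemma Re_scal r u : Re (RtoC r * u) = r * Re u.
Proof. destruct u as [x y]. simpl. ring. Qed.

Lemma Re_sqr u : Re (u * u) = 2 * (Re u * Re u) - Cmod u * Cmod u.
Proof. destruct u as [x y]. rewrite Cmod_sqr. simpl. ring. Qed.

(* Q is exponentially small between the line Re z = 1 and the curve where erfc switches. *)
Lemma Q_mixed z : Cmod (z - 1) <= 2 * rloc -> (1 <= Re z /\ Re (sz z) < 0) \/ (Re z < 1 /\ 0 <= Re (sz z)) ->
  Cmod (Q z) <= exp (- (INR n * (Cmod (z - 1) * Cmod (z - 1)) / 8)).
Proof.
  intros H HM. assert (RP := rloc_pos). set (X := ((z - 1) * Sr phi z)%C).
  assert (Rn := rn_pos).
  assert (SX : Re (sz z) = rn * Re X) by (rewrite sz_eq; fold X; apply Re_scal).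
  assert (D : Cmod (Sr phi z - Sr phi 1) <= 1 / 4).
  { eapply Rle_trans; [apply (Sr_lip f n lam phi S); auto; rewrite Cmod_self; lra|].
    apply Rle_trans with (1024 * Cphi * (2 * rloc)); [apply Rmult_le_compat_l; [unfold Cphi; lra|auto]|].
    assert (RC := rloc_C). lra. }
  assert (S1 := Sr_Re f n lam phi S 1 ltac:(rewrite Cmod_self; lra)).
  rewrite (Sr_1 f n lam phi S) in D, S1. set (s0 := sqrt (aphi phi / 2)) in *. simpl in S1.
  assert (G : Rabs (Re X - s0 * (Re z - 1)) <= Cmod (z - 1) / 4).
  { replace (Re X - s0 * (Re z - 1)) with (Re ((z - 1) * (Sr phi z - RtoC s0))) by (unfold X; replace ((z - 1) * (Sr phi z - RtoC s0))%C with ((z - 1) * Sr phi z - RtoC s0 * (z - 1))%C by ring;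
      change (Re ((z - 1) * Sr phi z - RtoC s0 * (z - 1))) with (Re ((z - 1) * Sr phi z) - Re (RtoC s0 * (z - 1))); rewrite Re_scal; reflexivity).
    eapply Rle_trans; [apply Re_le_Cmod|]. rewrite Cmod_mult. assert (P := Cmod_ge_0 (z - 1)). nra. }
  apply Rabs_le_between in G.
  assert (XR : Rabs (Re X) <= Cmod (z - 1) / 4).
  { rewrite SX in HM. apply Rabs_le. destruct HM as [[M1 M2]|[M1 M2]].
    - assert (Re X < 0) by (apply Rnot_le_lt; intros Z; assert (0 <= rn * Re X) by (apply Rmult_le_pos; lra); lra).
      assert (0 <= s0 * (Re z - 1)) by (apply Rmult_le_pos; lra). lra.
    - assert (0 <= Re X) by (apply Rnot_lt_le; intros Z; assert (rn * Re X < 0) by nra; lra).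
      assert (s0 * (Re z - 1) <= 0) by nra. lra. }
  rewrite Q_sz, Cmod_Cexp by auto. apply exp_le. rewrite sz_eq. fold X.
  replace (RtoC rn * X * (RtoC rn * X))%C with (RtoC rn * RtoC rn * (X * X))%C by ring. rewrite <- RtoC_mult, rn_sqr.
  rewrite Re_scal, Re_sqr.
  assert (XL : Cmod (z - 1) / 2 <= Cmod X).
  { unfold X. rewrite Cmod_mult. assert (A := Sr_lower f n lam phi S z H). assert (P := Cmod_ge_0 (z - 1)). nra. }
  set (m := Cmod (z - 1)) in *.
  assert (E := Rsqr_abs (Re X)). unfold Rsqr in E. rewrite E. assert (PX := Rabs_pos (Re X)).
  assert (B1 : Rabs (Re X) * Rabs (Re X) <= m / 4 * (m / 4)) by (apply Rmult_le_compat; lra).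
  assert (B2 : m / 2 * (m / 2) <= Cmod X * Cmod X) by (apply Rmult_le_compat; lra).
  replace (- (INR n * (m * m) / 8)) with (INR n * (- (m * m) / 8)) by field. apply Rmult_le_compat_l; [apply pos_INR|]. lra.
Qed.

Lemma one_minus_sqr z : z <> RtoC 1 -> z <> RtoC (-1) -> (1 - z * z)%C <> RtoC 0.
Proof.
  intros H1 H2 E. assert (E2 : ((z - 1) * (z + 1))%C = RtoC 0) by (replace ((z - 1) * (z + 1))%C with (- (1 - z * z))%C by ring; rewrite E; ring).
  apply (Cmult_integral (z - 1) (z + 1)) in E2; [|now apply Csub_neq0]. apply H2.
  replace z with (z + 1 - 1)%C by ring. rewrite E2, <- RtoC_minus. f_equal. ring.
Qed.

Lemma h0_bound r z : 0 < r -> r <= Cmod (z - 1) -> Cmod (z - 1) <= 2 * rloc -> Cmod (h0 phi z) <= 2 / r.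
Proof.
  intros Hr H1 H2. assert (R := disc_right z H2). destruct (disc_Re _ _ _ H2) as [A _]. simpl in A.
  assert (P1 : 1 <= Cmod (1 + z)).
  { eapply Rle_trans; [|apply Re_le_Cmod]. change (Re (1 + z)) with (1 + Re z). rewrite Rabs_right; lra. }
  assert (N : (1 - z * z)%C <> RtoC 0).
  { apply one_minus_sqr. intros ->. rewrite Cmod_self in H1. lra. intros ->. simpl in R. lra. }
  rewrite h0_eq, Cmod_RtoC_mult, Cmod_div by auto. rewrite Cmod_R, !Rabs_right by (assert (C := c0_pos); lra).
  replace (1 - z * z)%C with (- ((z - 1) * (1 + z)))%C by ring. rewrite Cmod_opp, Cmod_mult.
  assert (C := c0_pos). assert (B : r <= Cmod (z - 1) * Cmod (1 + z)) by nra.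
  apply Rle_trans with (1 * (2 / r)); [|lra]. apply Rmult_le_compat; try lra.
  - apply Rlt_le, Rdiv_lt_0_compat; lra.
  - apply Rmult_le_compat_l; [lra|]. apply Rinv_le_contravar; lra.
Qed.

(** The sign of Re(sz) selects the asymptotics of erfc, and the side of Re z = 1 selects [ein] or
    [eout]; when the two choices disagree, [Q_mixed] pays for the jump. The three constants belong
    to the outer error, the erfc remainder and [Q]. The condition on r makes |sz| >= 1. *)
Lemma Ein_annulus r K z : 0 < r -> 2 * r < 2 * rloc -> 2 <= rn * r -> r <= Cmod (z - 1) <= 2 * r ->
  (Rabs (Re z) < 1 -> Cmod (ein f n lam phi z) <= K / INR n) -> (1 <= Rabs (Re z) -> Cmod (eout f n lam phi z) <= K / INR n) ->
  Cmod (Ein z - bfun z) <= (2 / r * K + 16 / (r * r * r) + 256 / (r * r * (r * r))) / INR n.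
Proof.
  intros Hr Hr2 Hn Hz Bi Bo. assert (H2 : Cmod (z - 1) <= 2 * rloc) by lra.
  assert (R := disc_right z H2). rewrite (Rabs_right (Re z)) in Bi, Bo by lra.
  assert (N := INRn1 _ _ _ _ S). assert (Rn := rn_pos). assert (Rs := rn_sqr).
  assert (Nz0 : z <> RtoC 0) by (intros ->; simpl in R; lra).
  assert (Nz : (1 - z * z)%C <> RtoC 0).
  { apply one_minus_sqr. intros ->. rewrite Cmod_self in Hz. lra. intros ->. simpl in R. lra. }
  assert (WL := wt_lower f n lam phi S z H2).
  assert (Nw : wt phi z <> RtoC 0) by (apply Cmod_neq0; lra).
  assert (SP := sqrtPI_pos).
  assert (SM : Cmod (sz z) = rn * Cmod (wt phi z)) by (unfold sz; rewrite !Cmod_mult, Cmod_Ci, Cmod_R, Rabs_right by lra; ring).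
  assert (S1 : 1 <= Cmod (sz z)) by (rewrite SM; nra).
  assert (H0 := h0_bound r z Hr ltac:(lra) H2).
  assert (I1 : 0 < / INR n) by (apply Rinv_0_lt_compat; lra).
  assert (rrr : 0 < r * r * r) by nra.
  assert (RB : rn / 2 * (4 / Cmod (sz z) ^ 3) <= 16 / (r * r * r) * / INR n).
  { rewrite SM. set (m := Cmod (wt phi z)) in *.
    replace (rn / 2 * (4 / (rn * m) ^ 3)) with (2 / (m * m * m) * / (rn * rn)) by (field; lra). rewrite Rs.
    apply Rmult_le_compat_r; [lra|]. replace (16 / (r * r * r)) with (2 * / (r / 2 * (r / 2) * (r / 2))) by (field; lra).
    apply Rmult_le_compat_l; [lra|]. apply Rinv_le_contravar; [nra|]. apply Rmult_le_compat; try nra. }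
  assert (QB : (1 <= Re z /\ Re (sz z) < 0) \/ (Re z < 1 /\ 0 <= Re (sz z)) -> Cmod (RtoC rn * Q z) <= 256 / (r * r * (r * r)) * / INR n).
  { intros M. assert (B := Q_mixed z H2 M). rewrite Cmod_RtoC_mult, Rabs_right by lra.
    assert (B2 : exp (- (INR n * (Cmod (z - 1) * Cmod (z - 1)) / 8)) <= exp (- (INR n * (r * r) / 8))).
    { apply exp_le. assert (r * r <= Cmod (z - 1) * Cmod (z - 1)) by (apply Rmult_le_compat; lra).
      assert (INR n * (r * r) <= INR n * (Cmod (z - 1) * Cmod (z - 1))) by (apply Rmult_le_compat_l; lra). lra. }
    assert (B3 := exp_decay (INR n * (r * r) / 8) ltac:(nra)).
    replace (4 / (INR n * (r * r) / 8 * (INR n * (r * r) / 8))) with (256 / (r * r * (r * r)) * / (INR n * INR n)) in B3 by (field; lra).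
    apply Rle_trans with (INR n * (256 / (r * r * (r * r)) * / (INR n * INR n))).
    - apply Rmult_le_compat; auto using Cmod_ge_0; try lra. assert (1 <= rn) by (rewrite <- sqrt_1; apply sqrt_le_1_alt; lra). nra.
    - right. field. lra. }
  assert (Eeq : Ein z = (RtoC (rn / 2) * (Q z * Cerfc (sz z)) + h0 phi z * (1 + eout f n lam phi z))%C).
  { rewrite h0_eout by auto. unfold Ein. rewrite RtoC_div, RtoC_div by lra. field. }
  assert (Beq : bfun z = (h0 phi z + RtoC (rn / 2) * / (RtoC (sqrt PI) * sz z))%C).
  { unfold bfun, sz. f_equal. rewrite RtoC_div by lra. field. repeat split; auto using Ci_neq0; apply RtoC_neq0; lra. }
  assert (HIn : Re z < 1 -> Cmod (h0 phi z * ein f n lam phi z) <= 2 / r * K * / INR n).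
  { intros M. rewrite Cmod_mult. rewrite Rmult_assoc. apply Rmult_le_compat; auto using Cmod_ge_0. }
  assert (HOut : 1 <= Re z -> Cmod (h0 phi z * eout f n lam phi z) <= 2 / r * K * / INR n).
  { intros M. rewrite Cmod_mult. rewrite Rmult_assoc. apply Rmult_le_compat; auto using Cmod_ge_0. }
  assert (P256 : 0 < 256 / (r * r * (r * r))) by (apply Rdiv_lt_0_compat; nra).
  assert (P0 : 0 <= 256 / (r * r * (r * r)) * / INR n) by (apply Rmult_le_pos; lra).
  unfold Rdiv at 1. rewrite !Rmult_plus_distr_r.
  rewrite Eeq, Beq.
  destruct (Rle_dec 0 (Re (sz z))) as [Ms|Ms].
  - assert (AS := Cerfc_asym (sz z) Ms S1). rewrite <- Q_sz in AS by auto.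
    set (Rr := (Q z * Cerfc (sz z) - / (RtoC (sqrt PI) * sz z))%C) in *.
    assert (AR : Cmod (RtoC (rn / 2) * Rr) <= 16 / (r * r * r) * / INR n).
    { rewrite Cmod_RtoC_mult, Rabs_right by lra. eapply Rle_trans; [|exact RB]. apply Rmult_le_compat_l; lra. }
    replace (RtoC (rn / 2) * (Q z * Cerfc (sz z)) + h0 phi z * (1 + eout f n lam phi z) - (h0 phi z + RtoC (rn / 2) * / (RtoC (sqrt PI) * sz z)))%C
      with (RtoC (rn / 2) * Rr + h0 phi z * eout f n lam phi z)%C by (unfold Rr; ring).
    destruct (Rle_dec 1 (Re z)) as [M|M].
    + eapply Rle_trans; [apply Cmod_triangle|]. specialize (HOut M). lra.
    + rewrite h0_jump by auto. specialize (HIn ltac:(lra)). specialize (QB ltac:(right; lra)).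
      eapply Rle_trans; [apply Cmod_triangle|]. assert (T := Cmod_minus_le (h0 phi z * ein f n lam phi z) (RtoC rn * Q z)). lra.
  (* To the left of its switching curve erfc is handled as 2 minus erfc at the opposite point; the 2
     produces the extra term with [Q]. *)
  - assert (AS := Cerfc_asym (- sz z) ltac:(rewrite Re_opp; lra) ltac:(rewrite Cmod_opp; lra)).
    replace (- sz z * - sz z)%C with (sz z * sz z)%C in AS by ring. rewrite <- Q_sz, Cerfc_opp, Cmod_opp in AS by auto.
    assert (Nsz : sz z <> RtoC 0) by (apply Cmod_neq0; lra).
    set (Rr := (Q z * (RtoC 2 - Cerfc (sz z)) - / (RtoC (sqrt PI) * - sz z))%C) in *.
    assert (AR : Cmod (RtoC (rn / 2) * Rr) <= 16 / (r * r * r) * / INR n).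
    { rewrite Cmod_RtoC_mult, Rabs_right by lra. eapply Rle_trans; [|exact RB]. apply Rmult_le_compat_l; lra. }
    replace (RtoC (rn / 2) * (Q z * Cerfc (sz z)) + h0 phi z * (1 + eout f n lam phi z) - (h0 phi z + RtoC (rn / 2) * / (RtoC (sqrt PI) * sz z)))%C
      with (h0 phi z * eout f n lam phi z + RtoC rn * Q z - RtoC (rn / 2) * Rr)%C.
    2: { unfold Rr. rewrite !RtoC_div by lra. field. split; auto. apply RtoC_neq0; lra. }
    destruct (Rle_dec 1 (Re z)) as [M|M].
    + specialize (HOut M). specialize (QB ltac:(left; lra)).
      eapply Rle_trans; [apply Cmod_minus_le|]. assert (T := Cmod_triangle (h0 phi z * eout f n lam phi z) (RtoC rn * Q z)). lra.
    + rewrite h0_jump by auto. specialize (HIn ltac:(lra)).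
      replace (h0 phi z * ein f n lam phi z - RtoC rn * Q z + RtoC rn * Q z)%C with (h0 phi z * ein f n lam phi z)%C by ring.
      eapply Rle_trans; [apply Cmod_minus_le|]. lra.
Qed.

Lemma Pn_hol z : z <> RtoC 0 -> hol Pn z.
Proof.
  intros Hz. assert (H : hol (fun z => Q z - Rm f n lam z)%C z).
  { apply hol_minus. apply Qf_hol; auto. apply S. apply (su_flam _ _ _ _ S). apply Rm_hol, S. }
  destruct H as [l H]. exists l. revert H. apply cder_ext_near.
  apply (near_mono z (fun y => y <> RtoC 0)); [|now apply near_neq]. intros y Hy.
  rewrite (Q_split f n lam (su_hol _ _ _ _ S) (su_even _ _ _ _ S) (su_2n _ _ _ _ S) (su_flam _ _ _ _ S) y Hy). unfold Pz. ring.
Qed.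

Lemma Ein_hol z : Cmod (z - 1) < 2 * rloc -> hol Ein z.
Proof.
  intros H. assert (R := disc_right z ltac:(lra)). assert (Nz : z <> RtoC 0) by (intros ->; simpl in R; lra).
  unfold Ein. apply hol_scal. apply hol_minus; [|now apply Pn_hol]. apply hol_mult.
  - apply Qf_hol; auto. apply S. apply (su_flam _ _ _ _ S).
  - apply hol_scal. apply (hol_comp Cerfc sz). apply Cerfc_hol. unfold sz. apply hol_scal. now apply (wt_hol f n lam phi S).
Qed.

(* (z - 1) (bfun z), with the pole at 1 cancelled. *)
Definition Bf (z : C) : C := (RtoC (/ (2 * sqrt PI)) * / Sr phi z - RtoC (2 * c0) * / (1 + z))%C.

Lemma Sr_neq0 z : Cmod (z - 1) <= 2 * rloc -> Sr phi z <> RtoC 0.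
Proof. intros H. assert (A := Sr_lower f n lam phi S z H). apply Cmod_neq0. lra. Qed.

Lemma one_plus z : Cmod (z - 1) <= 2 * rloc -> 1 <= Cmod (1 + z).
Proof.
  intros H. assert (L := rloc_le). destruct (disc_Re _ _ _ H) as [A _]. simpl in A.
  eapply Rle_trans; [|apply Re_le_Cmod]. change (Re (1 + z)) with (1 + Re z). rewrite Rabs_right; lra.
Qed.

Lemma Bf_eq z : Cmod (z - 1) <= 2 * rloc -> z <> RtoC 1 -> Bf z = ((z - 1) * bfun z)%C.
Proof.
  intros H Hz. assert (N1 := Sr_neq0 z H). assert (N2 := one_plus z H). assert (SP := sqrtPI_pos).
  assert (N3 : (1 + z)%C <> RtoC 0) by (apply Cmod_neq0; lra). assert (N4 : (z - 1)%C <> RtoC 0) by now apply Csub_neq0.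
  unfold bfun, Bf, wt. rewrite h0_eq, RtoC_inv, !RtoC_mult by lra.
  replace (1 - z * z)%C with (- ((z - 1) * (1 + z)))%C by ring.
  replace (RtoC 2 * Ci * RtoC (sqrt PI) * (- Ci * (z - 1) * Sr phi z))%C with (- (Ci * Ci) * (RtoC 2 * RtoC (sqrt PI) * (z - 1) * Sr phi z))%C by ring.
  rewrite Ci_sqr. field. repeat split; auto. apply RtoC_neq0; lra.
Qed.

(** The residues of [h0] and of 1/(2i sqrt(pi) w) at 1 are opposite, which amounts to sqrt(2 pi a) =
    2 sqrt(pi) sqrt(a/2). *)
Lemma Bf_1 : Bf 1 = RtoC 0.
Proof.
  unfold Bf. rewrite (Sr_1 f n lam phi S). replace (1 + 1)%C with (RtoC 2) by (rewrite <- RtoC_plus; f_equal; ring).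
  assert (A := su_a _ _ _ _ S). assert (SP := sqrtPI_pos).
  assert (P := PI_RGT_0). assert (Pa : 0 < sqrt (aphi phi / 2)) by (apply sqrt_lt_R0; lra).
  rewrite <- !RtoC_inv, <- !RtoC_mult, <- RtoC_minus by lra. f_equal.
  assert (E : sqrt (2 * PI * aphi phi) = 2 * sqrt PI * sqrt (aphi phi / 2)).
  { replace (2 * PI * aphi phi) with (2 * 2 * (PI * (aphi phi / 2))) by field.
    rewrite sqrt_mult by nra. rewrite sqrt_square, sqrt_mult by lra. ring. }
  unfold c0. rewrite E. field. lra.
Qed.

Lemma Bf_hol z : Cmod (z - 1) < 2 * rloc -> hol Bf z.
Proof.
  intros H. assert (N2 := one_plus z ltac:(lra)). unfold Bf. apply hol_minus; apply hol_scal; apply hol_inv; auto with holo.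
  - apply Sr_neq0; lra.
  - now apply (Sr_hol f n lam phi S).
  - apply Cmod_neq0; lra.
Qed.

Lemma Bf_small z : Cmod (z - 1) <= 2 * rloc -> Cmod (Bf z) <= (4096 * Cphi + 1) * Cmod (z - 1).
Proof.
  intros H. assert (RP := rloc_pos). assert (N1 := Sr_lower f n lam phi S z H). assert (N2 := one_plus z H).
  assert (H1 : Cmod (1 - 1) <= 2 * rloc) by (rewrite Cmod_self; lra).
  assert (M1 := Sr_lower f n lam phi S 1 H1). assert (L := Sr_lip f n lam phi S 1 z H1 H).
  rewrite (Cmod_minus_sym 1 z) in L.
  assert (SP1 : 1 <= sqrt PI) by (rewrite <- sqrt_1; apply sqrt_le_1_alt; assert (P := PI2_1); lra).
  assert (C := c0_pos).
  assert (NS := Sr_neq0 z H). assert (NS1 := Sr_neq0 1 H1). assert (NO : (1 + z)%C <> RtoC 0) by (apply Cmod_neq0; lra).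
  replace (Bf z) with (Bf z - Bf 1)%C by (rewrite Bf_1; ring).
  replace (Bf z - Bf 1)%C with (RtoC (/ (2 * sqrt PI)) * ((Sr phi 1 - Sr phi z) / (Sr phi z * Sr phi 1)) + RtoC c0 * ((z - 1) / (1 + z)))%C.
  2: { unfold Bf. rewrite RtoC_mult. field; repeat split; auto; rewrite <- RtoC_plus; apply RtoC_neq0; lra. }
  assert (PZ := Cmod_ge_0 (z - 1)).
  eapply Rle_trans; [apply Cmod_triangle|]. rewrite Rmult_plus_distr_r. apply Rplus_le_compat.
  - rewrite Cmod_RtoC_mult, Cmod_div, Cmod_mult by now apply Cmult_neq_0.
    assert (I2 : 0 < / (2 * sqrt PI) <= 1). { split. apply Rinv_0_lt_compat; lra. rewrite <- Rinv_1. apply Rinv_le_contravar; lra. }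
    rewrite Rabs_right by lra. apply Rle_trans with (1 * (1024 * Cphi * Cmod (z - 1) * 4)); [|lra].
    assert (G : 0 <= Cmod (Sr phi 1 - Sr phi z) / (Cmod (Sr phi z) * Cmod (Sr phi 1))).
    { apply Rmult_le_pos; [apply Cmod_ge_0|]. apply Rlt_le, Rinv_0_lt_compat. nra. }
    apply Rmult_le_compat; try lra. unfold Rdiv. apply Rmult_le_compat; auto using Cmod_ge_0.
    + apply Rlt_le, Rinv_0_lt_compat. nra.
    + replace 4 with (/ (1 / 2 * (1 / 2))) by field. apply Rinv_le_contravar; [lra|]. apply Rmult_le_compat; lra.
  - rewrite Cmod_RtoC_mult, Cmod_div, Rabs_right by (auto; lra). apply Rmult_le_compat; try lra.
    + apply Rmult_le_pos; auto. apply Rlt_le, Rinv_0_lt_compat; lra.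
    + apply Rmult_le_reg_r with (Cmod (1 + z)); [lra|]. unfold Rdiv. rewrite Rmult_assoc, Rinv_l by lra. nra.
Qed.

Lemma bfun_bound z : Cmod (z - 1) <= 2 * rloc -> z <> RtoC 1 -> Cmod (bfun z) <= 4096 * Cphi + 1.
Proof.
  intros H Hz. assert (B := Bf_small z H). rewrite Bf_eq, Cmod_mult in B by auto.
  assert (P := Cmod_sub_gt0 z 1 Hz). apply Rmult_le_reg_l with (Cmod (z - 1)); auto. lra.
Qed.

(** The function (z - 1) [Ein] - [Bf] vanishes at 1, so its quotient by z - 1 is holomorphic across
    1 and coincides with [Ein] - [bfun] elsewhere; [interior_bound_half] carries the annulus bound
    inside. *)
Lemma Ein_inner r M z : 0 < r -> r < rloc -> 0 <= M ->
  (forall s, r <= Cmod (s - 1) <= 2 * r -> Cmod (Ein s - bfun s) <= M) ->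
  Cmod (z - 1) <= r / 2 -> z <> RtoC 1 -> Cmod (Ein z - bfun z) <= 4 * M.
Proof.
  intros Hr Hr2 HM HA Hz Nz. set (V := fun z => ((z - 1) * Ein z - Bf z)%C).
  assert (V1 : V 1 = RtoC 0) by (unfold V; rewrite Bf_1; ring).
  assert (VH : forall s, Cmod (s - 1) < 2 * rloc -> hol V s).
  { intros s Hs. unfold V. apply hol_minus; [|now apply Bf_hol]. apply hol_mult; auto with holo. now apply Ein_hol. }
  assert (VN : forall s, Cmod (s - 1) < 2 * rloc -> near s (hol V)).
  { intros s Hs. generalize (near_ball s 1 (2 * rloc) Hs). apply near_mono. apply VH. }
  assert (VD : forall s, Cmod (s - 1) < 2 * rloc -> s <> RtoC 1 -> dquot V 1 s = (Ein s - bfun s)%C).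
  { intros s Hs Ns. rewrite dquot_off by auto. rewrite V1. unfold V. rewrite Bf_eq by (auto; lra). field. now apply Csub_neq0. }
  rewrite <- VD by (auto; lra). apply (interior_bound_half (dquot V 1) 1 r M z); auto.
  - intros s Hs. apply dquot_hol; apply VN; [lra|rewrite Cmod_self; assert (RP := rloc_pos); lra].
  - intros s Hs. rewrite VD; [auto|lra|]. intros ->. rewrite Cmod_self in Hs. lra.
Qed.
End Inner.

(** The outer estimate is used with rho = r, so that it covers the annulus between r and 2r; near -1
    there is nothing to check, since |1 + z| >= 1 there. *)
Lemma inner_bound r : 0 < r < rloc -> exists K, 0 < K /\ forall f n lam phi, setup f n lam phi ->
  2 <= sqrt (INR n) * r -> forall z, Cmod (z - 1) <= r / 2 -> z <> RtoC 1 ->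
  Cmod (Ein f n lam phi z - bfun phi z) <= K / INR n.
Proof.
  intros Hr. assert (RL := rloc_le). destruct (outer_bound r ltac:(lra)) as [K [HK HO]].
  assert (rr : 0 < r * r) by nra. assert (rrr : 0 < r * r * r) by nra. assert (r4 : 0 < r * r * (r * r)) by nra.
  set (K' := 2 / r * K + 16 / (r * r * r) + 256 / (r * r * (r * r))).
  assert (PK : 0 < K').
  { unfold K'. apply Rplus_lt_0_compat; [apply Rplus_lt_0_compat|].
    apply Rmult_lt_0_compat; [apply Rdiv_lt_0_compat; lra|lra]. apply Rdiv_lt_0_compat; lra. apply Rdiv_lt_0_compat; lra. }
  exists (4 * K'). split; [lra|]. intros f n lam phi S Hn z Hz Nz.
  assert (N := INRn1 _ _ _ _ S).
  replace (4 * K' / INR n) with (4 * (K' / INR n)) by (field; lra).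
  apply (Ein_inner f n lam phi S r); auto; try lra.
  - apply Rlt_le, Rdiv_lt_0_compat; lra.
  - intros s Hs. apply (Ein_annulus f n lam phi S r K s); auto; try lra;
      apply (HO f n lam phi S s); try lra; assert (O := one_plus s ltac:(lra)); replace (s + 1)%C with (1 + s)%C by ring; lra.
Qed.

(** * Assembly *)

Lemma boundary_off A z : ~ boundary A z -> near z A \/ near z (fun y => ~ A y).
Proof.
  intros H. destruct (classic (locally z A)) as [L|L]; [left; now apply locally_near|].
  right. apply locally_near. apply NNPP. intros L2. now apply H.
Qed.

(** Extends bounds to the centre of a disc, where the explicit terms of the estimate have a pole. *)
Lemma ccont_limit_bound h c K : ccont h c -> (exists d, 0 < d /\ forall z, Cmod (z - c) < d -> z <> c -> Cmod (h z) <= K) ->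
  Cmod (h c) <= K.
Proof.
  intros Hh [d [Hd H]]. apply le_epsilon. intros e He. destruct (Hh e He) as [d' [Hd' H']].
  set (t := Rmin d d' / 2). assert (M1 := Rmin_l d d'). assert (M2 := Rmin_r d d').
  assert (Pt : 0 < t) by (unfold t; assert (0 < Rmin d d') by (apply Rmin_pos; auto); lra).
  assert (A : Cmod (c + RtoC t - c) = t) by (replace (c + RtoC t - c)%C with (RtoC t) by ring; rewrite Cmod_R, Rabs_right; lra).
  assert (Lt : t < d /\ t < d') by (unfold t in *; lra).
  specialize (H' (c + RtoC t)%C ltac:(rewrite A; lra)).
  assert (N : (c + RtoC t)%C <> c) by (intros E; rewrite E, Cmod_self in A; lra).
  specialize (H (c + RtoC t)%C ltac:(rewrite A; lra) N).
  assert (U := Cmod_rev (h c) (h (c + RtoC t)%C)). rewrite (Cmod_minus_sym (h c)) in U. lra.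
Qed.

Definition Efun (f : C -> C) (n : nat) (lam : R) (phi : C -> C) (B1 : C -> Prop) (z : C) : C :=
  if excluded_middle_informative (B1 z) then Ein f n lam phi z
  else if excluded_middle_informative (B1 (- z)%C) then Ein f n lam phi (- z)%C
  else if Rlt_dec (Rabs (Re z)) 1 then ein f n lam phi z else eout f n lam phi z.

Section Assembly.
Variables (f : C -> C) (n : nat) (lam : R) (phi : C -> C) (delta : R) (B1 : C -> Prop) (w : C -> C) (K1 K2 : R).
Hypothesis S : setup f n lam phi.
Hypothesis Hd : 0 < delta < rloc / 4.
Hypothesis HL : is_local_map phi delta B1 w.
Hypothesis HK1 : 0 < K1.
Hypothesis HK2 : 0 < K2.
Hypothesis HI : forall z, Cmod (z - 1) <= 2 * delta -> z <> RtoC 1 -> Cmod (Ein f n lam phi z - bfun phi z) <= K1 / INR n.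
Hypothesis HO : forall z, delta / (2 * Cphi) <= Cmod (z - 1) -> delta / (2 * Cphi) <= Cmod (z + 1) ->
  (Rabs (Re z) < 1 -> Cmod (ein f n lam phi z) <= K2 / INR n) /\ (1 <= Rabs (Re z) -> Cmod (eout f n lam phi z) <= K2 / INR n).

Local Notation E := (Efun f n lam phi B1).
Local Notation B := (sym_nbhd B1).
Local Notation T := (taylor_poly f (2 * n - 1)).
Local Notation rn := (sqrt (INR n)).

Lemma B1_dist z : B1 z -> Cmod (z - 1) <= 2 * delta /\ 1 / 400 < Re z.
Proof.
  intros H. assert (A := B1_delta f n lam phi delta B1 w S Hd HL z H). split; auto. apply disc_right. lra.
Qed.

Lemma B1_excl z : B1 z -> B1 (- z)%C -> False.
Proof. intros H1 H2. apply B1_dist in H1, H2. rewrite Re_opp in H2. lra. Qed.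

(** The complement of the discs therefore keeps a fixed distance from 1 and -1, as [outer_bound]
    requires. *)
Lemma B1_in z : Cmod (z - 1) < delta / (2 * Cphi) -> B1 z.
Proof.
  intros H. assert (CP : 1 <= Cphi) by (unfold Cphi; lra).
  assert (H1 : Cphi * Cmod (z - 1) < delta).
  { apply Rle_lt_trans with (Cphi * (delta / (2 * Cphi))). apply Rmult_le_compat_l; lra.
    replace (Cphi * (delta / (2 * Cphi))) with (delta / 2) by (field; lra). lra. }
  apply (B1_contains f n lam phi delta B1 w S Hd HL); auto. nra.
Qed.

Lemma not_B z : ~ B z -> delta / (2 * Cphi) <= Cmod (z - 1) /\ delta / (2 * Cphi) <= Cmod (z + 1).
Proof.
  intros H. split; apply Rnot_lt_le; intros L; apply H; unfold sym_nbhd.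
  - left. now apply B1_in.
  - right. apply B1_in. rewrite <- Cmod_opp. now replace (- (- z - 1))%C with (z + 1)%C by ring.
Qed.

Lemma E_in1 z : B1 z -> E z = Ein f n lam phi z.
Proof. intros H. unfold Efun. destruct excluded_middle_informative; [reflexivity|contradiction]. Qed.

Lemma E_in2 z : B1 (- z)%C -> E z = Ein f n lam phi (- z)%C.
Proof.
  intros H. unfold Efun. destruct excluded_middle_informative as [H1|_]; [now destruct (B1_excl z)|].
  destruct excluded_middle_informative; [reflexivity|contradiction].
Qed.

Lemma E_strip z : ~ B z -> Rabs (Re z) < 1 -> E z = ein f n lam phi z.
Proof.
  intros H H1. unfold Efun, sym_nbhd in *. do 2 (destruct excluded_middle_informative; [tauto|]). destruct Rlt_dec; [reflexivity|lra].
Qed.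

Lemma E_out z : ~ B z -> 1 <= Rabs (Re z) -> E z = eout f n lam phi z.
Proof.
  intros H H1. unfold Efun, sym_nbhd in *. do 2 (destruct excluded_middle_informative; [tauto|]). destruct Rlt_dec; [lra|reflexivity].
Qed.

Lemma out_neq0 z : 1 <= Rabs (Re z) -> z <> RtoC 0.
Proof. intros H ->. simpl in H. rewrite Rabs_R0 in H. lra. Qed.

Lemma not_B_sqr z : ~ B z -> (1 - z * z)%C <> RtoC 0.
Proof.
  intros H. apply one_minus_sqr; intros ->; apply H; unfold sym_nbhd; assert (X := B1_1 phi delta B1 w HL); [now left|right].
  now replace (- RtoC (-1))%C with (RtoC 1) by (rewrite <- RtoC_opp; f_equal; ring).
Qed.

Lemma phase_eq z : f_exp_phase f n lam phi z = (Cpow z (2 * n) * f (RtoC lam))%C.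
Proof. apply f_exp_phase_eq. assert (H := su_n _ _ _ _ S); lia. apply S. Qed.

Lemma rnC : RtoC rn <> RtoC 0.
Proof. apply RtoC_neq0. assert (P := rn_pos f n lam phi S). lra. Qed.

Lemma outside z : ~ B z -> T (RtoC lam * z)%C =
  (f (RtoC lam * z) * chi z - f_exp_phase f n lam phi z / RtoC rn * h0 phi z * (RtoC 1 + E z))%C.
Proof.
  intros H. assert (N := not_B_sqr z H). assert (Rc := rnC). rewrite phase_eq. unfold chi.
  destruct (Rlt_dec (Rabs (Re z)) 1) as [L|L].
  - rewrite E_strip, (taylor_ein f n lam phi S) by auto. rewrite <- (Cmult_assoc _ (h0 phi z)), (h0_ein f n lam phi S z N). field. auto.
  - rewrite E_out by (auto; lra). rewrite (taylor_eout f n lam phi S) by (apply out_neq0; lra).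
    rewrite <- (Cmult_assoc _ (h0 phi z)), (h0_eout f n lam phi S z N). field. auto.
Qed.

Lemma inside1 z : B1 z -> T (RtoC lam * z)%C =
  (f (RtoC lam * z) * (RtoC (1 / 2) * Cerfc (Ci * RtoC rn * wt phi z)) - f_exp_phase f n lam phi z / RtoC rn * Ein f n lam phi z)%C.
Proof.
  intros H. apply B1_dist in H. assert (Nz : z <> RtoC 0) by (intros ->; simpl in H; lra). assert (Rc := rnC).
  rewrite phase_eq, (taylor_eout f n lam phi S z Nz). unfold Ein, sz, Qf. field.
  repeat split; auto using Cpow_neq0. apply (su_flam _ _ _ _ S).
Qed.

Lemma Cpow_even z : Cpow (- z) (2 * n) = Cpow z (2 * n).
Proof. rewrite !Cpow_mult_r. f_equal. simpl. ring. Qed.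

Lemma f_lam_even z : f (RtoC lam * - z)%C = f (RtoC lam * z)%C.
Proof. replace (RtoC lam * - z)%C with (- (RtoC lam * z))%C by ring. apply (su_even _ _ _ _ S). Qed.

Lemma inside z : B z -> T (RtoC lam * z)%C =
  (f (RtoC lam * z) * (RtoC (1 / 2) * Cerfc (Ci * RtoC rn * w z)) - f_exp_phase f n lam phi z / RtoC rn * E z)%C.
Proof.
  intros [H|H].
  - rewrite (w_wt f n lam phi delta B1 w S Hd HL), E_in1 by auto. now apply inside1.
  (* The passage from -z to z goes through the form of T in [taylor_ein], because evenness of [Rm]
     is at hand. *)
  - assert (X := inside1 (- z) H). rewrite phase_eq, (taylor_ein f n lam phi S), Cpow_even, f_lam_even in X.
    rewrite Rm_even in X by (try apply S; apply (su_even _ _ _ _ S)). rewrite <- (taylor_ein f n lam phi S) in X.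
    assert (W : w z = w (- z)%C).
    { destruct HL as [_ [_ [_ [_ [_ [_ [_ [_ Hw]]]]]]]]. rewrite <- (Hw _ H). f_equal. ring. }
    rewrite W, (w_wt f n lam phi delta B1 w S Hd HL), E_in2, phase_eq by auto. exact X.
Qed.

Lemma out_bound z : ~ B z -> Cmod (E z) <= K2 / INR n.
Proof.
  intros H. destruct (not_B z H) as [N1 N2]. destruct (HO z N1 N2) as [O1 O2].
  destruct (Rlt_dec (Rabs (Re z)) 1) as [L|L].
  - rewrite E_strip by auto. auto.
  - rewrite E_out by (auto; lra). apply O2. lra.
Qed.

Lemma h0_even z : h0 phi (- z)%C = h0 phi z.
Proof. unfold h0. now replace (- z * - z)%C with (z * z)%C by ring. Qed.

Lemma in_bound z : B z -> z <> RtoC 1 -> z <> RtoC (-1) ->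
  Cmod (E z - (h0 phi z + RtoC 1 / (RtoC 2 * Ci * RtoC (sqrt PI) * w z)))%C <= K1 / INR n.
Proof.
  intros [H|H] Z1 Z2.
  - rewrite (w_wt f n lam phi delta B1 w S Hd HL), E_in1 by auto. apply HI; auto. now apply B1_dist.
  - assert (W : w z = w (- z)%C).
    { destruct HL as [_ [_ [_ [_ [_ [_ [_ [_ Hw]]]]]]]]. rewrite <- (Hw _ H). f_equal. ring. }
    rewrite W, (w_wt f n lam phi delta B1 w S Hd HL), E_in2, <- h0_even by auto. apply HI. now apply B1_dist.
    intros X. apply Z2. replace z with (- - z)%C by ring. rewrite X, <- RtoC_opp. reflexivity.
Qed.

Lemma Kn K : 0 < K -> K / INR n <= K.
Proof.
  intros HK. assert (N := INRn1 _ _ _ _ S). apply Rmult_le_reg_r with (INR n); [lra|].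
  unfold Rdiv. rewrite Rmult_assoc, Rinv_l by lra. nra.
Qed.

Lemma Ein_bounded z : B1 z -> Cmod (Ein f n lam phi z) <= K1 + (4096 * Cphi + 1).
Proof.
  assert (G : forall y, B1 y -> y <> RtoC 1 -> Cmod (Ein f n lam phi y) <= K1 + (4096 * Cphi + 1)).
  { intros y Hy Ny. destruct (B1_dist y Hy) as [D _]. assert (X := HI y D Ny). assert (KN := Kn K1 HK1).
    assert (Y := bfun_bound f n lam phi S y ltac:(lra) Ny). assert (U := Cmod_rev (Ein f n lam phi y) (bfun phi y)). lra. }
  intros H. destruct (Ceq_dec z 1) as [->|N]; [|now apply G].
  apply ccont_limit_bound.
  - apply hol_ccont, (Ein_hol f n lam phi S). rewrite Cmod_self. lra.
  - destruct (B1_near phi delta B1 w HL 1 H) as [d [Hd0 HH]]. exists d. split; auto.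
Qed.

Lemma E_bounded z : Cmod (E z) <= K1 + (4096 * Cphi + 1) + K2.
Proof.
  assert (CP : 1 <= Cphi) by (unfold Cphi; lra).
  destruct (classic (B z)) as [[H|H]|H].
  - rewrite E_in1 by auto. assert (X := Ein_bounded z H). lra.
  - rewrite E_in2 by auto. assert (X := Ein_bounded _ H). lra.
  - assert (X := out_bound z H). assert (KN := Kn K2 HK2). lra.
Qed.

(** Off the excluded curves a whole neighbourhood of the point falls into a single branch of
    [Efun]. *)
Lemma E_hol z : ~ ((boundary S1 z /\ ~ B z) \/ boundary B z) -> hol E z.
Proof.
  intros HD. destruct (classic (B z)) as [[H|H]|H].
  - destruct (Ein_hol f n lam phi S z) as [l Hl]. { assert (X := B1_dist z H). lra. }
    exists l. revert Hl. apply cder_ext_near. generalize (B1_near phi delta B1 w HL z H). apply near_mono.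
    intros y Hy. symmetry. now apply E_in1.
  - assert (Hl : hol (fun y => Ein f n lam phi (- y)%C) z).
    { apply (hol_comp (Ein f n lam phi) (fun y => - y)%C); auto with holo. apply (Ein_hol f n lam phi S).
      assert (X := B1_dist _ H). lra. }
    destruct Hl as [l Hl]. exists l. revert Hl. apply cder_ext_near.
    destruct (B1_near phi delta B1 w HL _ H) as [d [Hd0 N]]. exists d. split; auto.
    intros y Hy. symmetry. apply E_in2. apply N. replace (- y - - z)%C with (- (y - z))%C by ring. now rewrite Cmod_opp.
  - destruct (boundary_off B z ltac:(tauto)) as [N|N]; [now apply near_self in N|].
    destruct (boundary_off S1 z ltac:(tauto)) as [N1|N1].
    + destruct (ein_hol f n lam phi S z) as [l Hl]. exists l. revert Hl. apply cder_ext_near.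
      generalize (near_and _ _ _ N N1). apply near_mono. intros y [Y1 Y2]. symmetry. now apply E_strip.
    + destruct (eout_hol f n lam phi S z) as [l Hl].
      { apply out_neq0. apply Rnot_lt_le. exact (near_self _ _ N1). }
      exists l. revert Hl. apply cder_ext_near.
      generalize (near_and _ _ _ N N1). apply near_mono. intros y [Y1 Y2]. symmetry. apply E_out; auto. now apply Rnot_lt_le.
Qed.
End Assembly.

Theorem theorem3p1 (Gamma zeta xi : C -> C)
  (HGamma : is_Gamma Gamma) (Hzeta : is_zeta zeta) (Hxi : is_xi Gamma zeta xi) :
  let f : C -> C := fun z => xi (RtoC (1 / 2) + z)%C in
  forall (lam : nat -> R) (phi : nat -> C -> C),
  eventually (fun n => is_scaling f n (lam n)) ->
  eventually (fun n => is_phase f n (lam n) (phi n)) ->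
  exists delta0 : R, (0 < delta0)%R /\
  forall delta : R, (0 < delta < delta0)%R ->
  forall (B1 : nat -> C -> Prop) (w : nat -> C -> C),
  eventually (fun n => is_local_map (phi n) delta (B1 n) (w n)) ->
  exists (E : nat -> C -> C) (M K : R),
  eventually (fun n =>
    let B := sym_nbhd (B1 n) in
    (forall z : C,
       taylor_poly f (2 * n - 2) (RtoC (lam n) * z)%C
       = taylor_poly f (2 * n - 1) (RtoC (lam n) * z)%C) /\
    (forall z : C, ~ B z ->
       taylor_poly f (2 * n - 1) (RtoC (lam n) * z)%C
       = (f (RtoC (lam n) * z) * chi z
          - f_exp_phase f n (lam n) (phi n) z / RtoC (sqrt (INR n))
            * h0 (phi n) z * (RtoC 1 + E n z))%C) /\
    (forall z : C, B z ->
       taylor_poly f (2 * n - 1) (RtoC (lam n) * z)%C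
       = (f (RtoC (lam n) * z)
            * (RtoC (1 / 2) * Cerfc (Ci * RtoC (sqrt (INR n)) * w n z))
          - f_exp_phase f n (lam n) (phi n) z / RtoC (sqrt (INR n)) * E n z)%C) /\
    (let D := fun z : C => ~ ((boundary S1 z /\ ~ B z) \/ boundary B z) in
     (forall z : C, D z -> (Cmod (E n z) <= K)%R) /\ holomorphic_on D (E n)) /\
    (forall z : C, ~ B z -> (Cmod (E n z) <= M / INR n)%R) /\
    (* At z = 1 and z = -1 the poles of the two explicit terms cancel; the
       estimate there is the limit of the one on the punctured set. *)
    (forall z : C, B z -> z <> RtoC 1 -> z <> RtoC (-1) ->
       (Cmod (E n z - (h0 (phi n) z
                       + RtoC 1 / (RtoC 2 * Ci * RtoC (sqrt PI) * w n z))%C)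
        <= M / INR n)%R)).
Proof.
  intros f lam phi [Na Ha] [Nb Hb]. assert (RP := rloc_pos).
  (* The threshold depends on [Cphi] only, hence neither on n nor on the local maps. *)
  exists (rloc / 4). split; [lra|]. intros delta Hd B1 w [Nc Hc].
  (* Half of this radius is 2 delta, and the disc of that radius contains [B1] by [B1_delta]. *)
  destruct (inner_bound (4 * delta) ltac:(lra)) as [K1 [HK1 HI]].
  assert (CP : 1 <= Cphi) by (unfold Cphi; lra). assert (RL := rloc_le).
  assert (Hrho : 0 < delta / (2 * Cphi) <= 1).
  { split; [apply Rdiv_lt_0_compat; lra|]. apply Rmult_le_reg_r with (2 * Cphi); [lra|]. unfold Rdiv. rewrite Rmult_assoc, Rinv_l; lra. }
  destruct (outer_bound (delta / (2 * Cphi)) Hrho) as [K2 [HK2 HO]].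
  destruct (lam_large Gamma zeta xi HGamma Hzeta Hxi 400) as [Nd [Nd1 Hdd]].
  (* Ensures delta sqrt(n) >= 1, from which the size condition of [inner_bound] follows. *)
  destruct (INR_unbounded (/ (delta * delta))) as [Ne He].
  exists (fun n => Efun f n (lam n) (phi n) (B1 n)), (K1 + K2), (K1 + (4096 * Cphi + 1) + K2).
  exists (32 + Na + Nb + Nc + Nd + Ne)%nat. intros n Hn.
  specialize (Ha n ltac:(lia)). specialize (Hb n ltac:(lia)). specialize (Hc n ltac:(lia)).
  assert (Hl : 400 < lam n) by (apply (Hdd n); [lia|exact Ha]).
  assert (S : setup f n (lam n) (phi n)).
  { constructor; auto; try lia; try lra.
    - apply (fx_hol Gamma zeta xi Hxi).
    - exists (fr Gamma zeta). split; [|split].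
      + intros x Hx. split. now apply (fx_real Gamma zeta xi HGamma Hzeta Hxi). now apply (fr_pos Gamma zeta HGamma Hzeta).
      + intros x y Hx. apply (fx_abs Gamma zeta xi HGamma Hzeta Hxi); auto; lra.
      + intros x Hx. apply (fr_ratio Gamma zeta xi HGamma Hzeta Hxi n (lam n) x); auto; lia || lra.
    - apply (fx_strip_growth Gamma zeta xi HGamma Hzeta Hxi). }
  assert (N := INRn1 _ _ _ _ S).
  assert (HI' : forall z, Cmod (z - 1) <= 2 * delta -> z <> RtoC 1 -> Cmod (Ein f n (lam n) (phi n) z - bfun (phi n) z) <= K1 / INR n).
  { intros z Hz Nz. apply HI; auto; [|lra].
    assert (LE : INR Ne <= INR n) by (apply le_INR; lia).
    assert (Q : 1 / delta <= sqrt (INR n)).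
    { rewrite <- (sqrt_square (1 / delta)) by (apply Rlt_le, Rdiv_lt_0_compat; lra). apply sqrt_le_1_alt.
      replace (1 / delta * (1 / delta)) with (/ (delta * delta)) by (field; lra). lra. }
    apply Rle_trans with 4; [lra|].
    replace 4 with (1 / delta * (4 * delta)) at 1 by (field; lra). apply Rmult_le_compat_r; lra. }
  assert (HO' := HO f n (lam n) (phi n) S).
  assert (MN : forall K, 0 < K -> forall K', 0 < K' -> K / INR n <= (K + K') / INR n).
  { intros k Hk k' Hk'. apply Rmult_le_compat_r; [apply Rlt_le, Rinv_0_lt_compat; lra|lra]. }
  cbv zeta. split; [|split; [|split; [|split; [|split]]]].
  - intros z. apply taylor_even_eq; [lia|apply S|apply (su_even _ _ _ _ S)].
  - intros z Hz. now apply (outside f n (lam n) (phi n) delta (B1 n) (w n) S Hd Hc).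
  - intros z Hz. now apply (inside f n (lam n) (phi n) delta (B1 n) (w n) S Hd Hc).
  - split.
    + intros z _. now apply (E_bounded f n (lam n) (phi n) delta (B1 n) (w n)).
    + intros z Hz. apply hol_ex_derive. now apply (E_hol f n (lam n) (phi n) delta (B1 n) (w n)).
  - intros z Hz. eapply Rle_trans; [now apply (out_bound f n (lam n) (phi n) delta (B1 n) (w n) K2 S Hd Hc)|].
    rewrite Rplus_comm. now apply MN.
  - intros z Hz Z1 Z2. eapply Rle_trans; [now apply (in_bound f n (lam n) (phi n) delta (B1 n) (w n) K1 S Hd Hc)|].
    now apply MN.
Qed.
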